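(* Let $d\ge 1$, $T>0$, let $\mathfrak f\in C_c^\infty(\mathbb{R}^d\times\mathbb{R};\mathbb{R}^d)$ and $u_0\in C_c^\infty(\mathbb{R}^d)$. Then the Cauchy problem $$u_t+\operatorname{div}_{\mathbf x}\big(\mathfrak f(\mathbf x,u)\big)=\Delta u+\partial_t\Delta u \quad\text{in } (0,T)\times\mathbb{R}^d,\qquad u|_{t=0}=u_0,$$ has a weak solution $u\in L^2((0,T)\times\mathbb{R}^d)$, this weak solution is unique among weak solutions in $L^2((0,T)\times\mathbb{R}^d)$, and it belongs to $C^\infty((0,T)\times\mathbb{R}^d)$.
   Context: Here $\operatorname{div}_{\mathbf x}(\mathfrak f(\mathbf x,u))$ denotes $\sum_{j=1}^d\partial_{x_j}[f_j(\mathbf x,u(t,\mathbf x))]$. Weak solution: for a given vector field $F\in L^2((0,T)\times\mathbb{R}^d;\mathbb{R}^d)$ and $u_0\in L^2(\mathbb{R}^d)$, a function $u\in L^2((0,T)\times\mathbb{R}^d)$ is a weak solution of $u_t+\operatorname{div}F=\Delta u+\partial_t\Delta u$, $u|_{t=0}=u_0$, if for every $\varphi\in C_c^\infty([0,T)\times\mathbb{R}^d)$ $$\int_0^T\!\!\int_{\mathbb{R}^d}\big(u\,\partial_t\varphi+F\cdot\nabla\varphi+u\,\Delta\varphi-u\,\partial_t\Delta\varphi\big)\,d\mathbf x\,dt+\int_{\mathbb{R}^d}u_0\big(\varphi(0,\cdot)-\Delta\varphi(0,\cdot)\big)\,d\mathbf x=0 .$$ For the nonlinear problem, $F(t,\mathbf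 x)=\mathfrak f(\mathbf x,u(t,\mathbf x))$. *)

(* Defs.v *)
From HB Require Import structures.
From mathcomp Require Import all_boot all_order all_algebra.
From mathcomp Require Import all_classical all_reals all_analysis.
Unset Printing Implicit Defensive.
Import Order.TTheory GRing.Theory Num.Theory.
Import numFieldNormedType.Exports.
Local Open Scope classical_set_scope.
Local Open Scope ring_scope.

Section defs.
Context {R : realType}.

(** Points of R^n for measure theory: n.-tuple R (product sigma-algebra of
    Borel sets, from the library).  Points of R^n for differential calculus:
    row vectors 'rV[R]_n (normed space, from the library).  Conversions: *)
Definition rv n (x : n.-tuple R) : 'rV[R]_n := \row_i tnth x i.
Definition tup n (v : 'rV[R]_n) : n.-tuple R := [tuple v ord0 i | i < n].

Fixpoint lebn (n : nat) : set (n.-tuple R) -> \bar R :=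
  match n with
  | 0%N => fun A => ((\1_A [tuple]) : R)%:E
  | n'.+1 => fun A =>
      ((@lebesgue_measure R) \x (lebn n'))%E
        [set p : R * n'.-tuple R | A [tuple of p.1 :: p.2]]
  end.

Definition mu_st (d : nat) : set (R * d.-tuple R) -> \bar R :=
  ((@lebesgue_measure R) \x (lebn d))%E.

Definition pd n (i : 'I_n) (g : 'rV[R]_n -> R) : 'rV[R]_n -> R :=
  fun v => derive g v (delta_mx 0 i).

Fixpoint iter_pd n (l : seq 'I_n) (g : 'rV[R]_n -> R) : 'rV[R]_n -> R :=
  match l with
  | [::] => g
  | i :: l' => pd n i (iter_pd n l' g)
  end.

Definition smooth_on n (U : set 'rV[R]_n) (g : 'rV[R]_n -> R) : Prop :=
  forall l : seq 'I_n,
    (forall x, U x -> {for x, continuous (iter_pd n l g)}) /\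
    (forall (i : 'I_n) x, U x -> derivable (iter_pd n l g) x (delta_mx 0 i)).

Definition cc_smooth n (g : 'rV[R]_n -> R) : Prop :=
  smooth_on n setT g /\ compact (closure [set v | g v != 0]).

(** Space-time coordinates: index 0 is t, index 1+j is x_j. *)
Definition tidx (d : nat) : 'I_(1 + d) := lshift d ord0.
Definition xidx (d : nat) (j : 'I_d) : 'I_(1 + d) := rshift 1 j.

Definition st d (p : R * d.-tuple R) : 'rV[R]_(1 + d) :=
  row_mx (const_mx p.1) (rv d p.2).
Definition ofST d (w : R * d.-tuple R -> R) : 'rV[R]_(1 + d) -> R :=
  fun v => w (v ord0 (tidx d), tup d (rsubmx v)).

Definition ofXU d (g : d.-tuple R -> R -> R) : 'rV[R]_(d + 1) -> R :=
  fun v => g (tup d (lsubmx v)) (rsubmx v ord0 ord0).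

Definition lapx d (g : 'rV[R]_(1 + d) -> R) : 'rV[R]_(1 + d) -> R :=
  fun v => \sum_(j < d) pd (1 + d) (xidx d j) (pd (1 + d) (xidx d j) g) v.

(** Test functions C_c^infinity([0,T) x R^d): smooth compactly supported
    functions on R x R^d whose (closed) support lies in {t < T}. *)
Definition test_fun d (T : R) (phi : R * d.-tuple R -> R) : Prop :=
  cc_smooth (1 + d) (ofST d phi) /\
  closure [set v | ofST d phi v != 0] `<=` [set v | v ord0 (tidx d) < T].

Definition slab d (T : R) : set (R * d.-tuple R) := `]0, T[ `*` setT.

Definition L2_st d (T : R) (u : R * d.-tuple R -> R) : Prop :=
  measurable_fun (slab d T) u /\
  (\int[mu_st d]_(p in slab d T) ((u p) ^+ 2)%:E < +oo)%E.

Definition weak_identity d (T : R) (F : 'I_d -> R * d.-tuple R -> R)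
    (u0 : d.-tuple R -> R) (u : R * d.-tuple R -> R) : Prop :=
  forall phi, test_fun d T phi ->
    let Phi := ofST d phi in
    ((\int[mu_st d]_(p in slab d T)
        (u p * pd (1 + d) (tidx d) Phi (st d p)
         + \sum_(j < d) F j p * pd (1 + d) (xidx d j) Phi (st d p)
         + u p * lapx d Phi (st d p)
         - u p * pd (1 + d) (tidx d) (lapx d Phi) (st d p))%:E)
     + \int[lebn d]_x (u0 x * (phi (0, x) - lapx d Phi (st d (0, x))))%:E = 0)%E.

Definition weak_solution d (T : R) (F : 'I_d -> R * d.-tuple R -> R)
    (u0 : d.-tuple R -> R) (u : R * d.-tuple R -> R) : Prop :=
  L2_st d T u /\ (forall j, L2_st d T (F j)) /\ weak_identity d T F u0 u.

Definition weak_solution_nl d (T : R) (f : 'I_d -> d.-tuple R -> R -> R)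
    (u0 : d.-tuple R -> R) (u : R * d.-tuple R -> R) : Prop :=
  weak_solution d T (fun j p => f j p.2 (u p)) u0 u.

End defs.

(* Main.v *)
(** Applying [(1 - Delta)^-1] turns the equation into the ordinary differential equation
    [u_t = - u + A u - sum_j B_j (f_j (x, u))] with the bounded operators
    [A = (1 - Delta)^-1] and [B_j = d_j (1 - Delta)^-1]. No Fourier analysis is needed: [A]
    and [B_j] are explicit averages over the maps [x |-> x - r z], with [z] Gaussian and [r]
    distributed with density [r e^(-r^2/2)] on the half-line.

    Existence: Picard iteration for the integrated equation, in a sup norm weighted by
    [e^(lam t)] and by [prod_i 1 / (1 + x_i^2)], which gives a solution in [L^2]. Smoothness: a
    derivative of the solution satisfies the formally differentiated linear equation; one
    solves that equation, and a Gronwall estimate for the quadratic remainder shows that its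
    solution is the derivative, which allows a bootstrap. The weak identity follows by
    writing a test function as [phi = A (phi - Delta phi)] and moving [A] and [B_j] to [u]
    and [F].

    Uniqueness: averaging the weak identity for the difference [w] of two solutions over
    translates of the test function against the kernel of [A] removes the operator
    [1 - Delta] and leaves [w_t = h], with [h] the right-hand side of the differential
    equation. Products of one-variable bumps generate enough test functions for
    [w = int_0^t h] almost everywhere, and Gronwall in a weighted [L^1] norm gives
    [w = 0]. *)
Require Import Defs.
From HB Require Import structures.
From mathcomp Require Import all_boot all_order all_algebra.
From mathcomp Require Import all_classical all_reals all_analysis.
From mathcomp Require Import measurable_realfun ring lra.
Import Order.TTheory GRing.Theory Num.Theory.
Import numFieldNormedType.Exports.
Local Open Scope classical_set_scope.
Local Open Scope ring_scope.

Set Implicit Arguments.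
Unset Strict Implicit.
Unset Printing Implicit Defensive.

(** The convolution kernel of $(1-\Delta)^{-1}$ is singular at the origin in dimension at least two,
    and that of $\partial_j(1-\Delta)^{-1}$ is worse. Averaging over the pair $(r,z)$ instead of
    over $y=rz$ removes the singularity: the factor $1/r$ that integration by parts produces cancels
    the $r$ of the density, so every operator has a bounded density with Gaussian decay in $(r,z)$.

    The weight $\rho=\prod_i 1/(1+x_i^2)$ is integrable, at most 1, and grows under translation by
    $y$ at most by a polynomial factor, which the Gaussian absorbs. Compact support bounds flux and
    datum by a multiple of $\rho$; the mild solution inherits this bound and is square integrable. A
    competing solution is only in $L^2$ of the slab, hence in $L^1(\rho)$, where the operators are
    bounded by duality.

    Derivatives are expressed by remainders $|g(x+he_j)-g(x)-hg'(x)|\le Mh^2$, which can be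
    integrated against a kernel as they stand; translation invariance and $h\to0$ then do the work
    of differentiation. Functions are defined on all of space-time, with time clamped to $[0,T]$ or
    cut by an indicator. *)

Notation intg mu f := (integrable mu setT (EFin \o f)).
Notation mfunT f := (measurable_fun setT f).

(** * Integrals of real-valued functions *)

Section real_integral.
Context d (T : measurableType d) (R : realType).
Variable mu : {measure set T -> \bar R}.
Implicit Types f g h : T -> R.

Lemma intg_measurable f : intg mu f -> mfunT f.
Proof. by move=> /measurable_int /measurable_EFinP. Qed.

Lemma intg_dom f g : mfunT f -> intg mu g -> (forall x, `|f x| <= g x) ->
  intg mu f.
Proof.
move=> mf ig fg; apply: (le_integrable _ _ _ ig) => //.
  exact/measurable_EFinP.
by move=> x _ /=; rewrite lee_fin (le_trans (fg x))// ler_norm.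
Qed.

Lemma intg_eq f g : f =1 g -> intg mu f -> intg mu g.
Proof. by move=> /funext ->. Qed.

Lemma intgD f g : intg mu f -> intg mu g -> intg mu (fun x => f x + g x).
Proof.
by move=> fi gi; have := integrableD measurableT fi gi; exact: eq_integrable.
Qed.

Lemma intgZ k f : intg mu f -> intg mu (fun x => k * f x).
Proof. by move=> fi; have := integrableZl measurableT k fi; exact: eq_integrable. Qed.

Lemma intgN f : intg mu f -> intg mu (fun x => - f x).
Proof. by move=> fi; have := integrableN fi; exact: eq_integrable. Qed.

Lemma intgB f g : intg mu f -> intg mu g -> intg mu (fun x => f x - g x).
Proof. by move=> fi gi; exact: intgD (intgN gi). Qed.

Lemma intg0 : intg mu (fun=> 0).
Proof. exact: integrable0. Qed.

Lemma intg_sum (I : Type) (s : seq I) (F : I -> T -> R) :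
  (forall i, intg mu (F i)) -> intg mu (fun x => \sum_(i <- s) F i x).
Proof.
move=> Fi; elim: s => [|i s ih].
  by apply: intg_eq intg0 => x; rewrite big_nil.
by apply: intg_eq (intgD (Fi i) ih) => x; rewrite big_cons.
Qed.

Lemma intg_norm f : intg mu f -> intg mu (fun x => `|f x|).
Proof. by move=> fi; have := integrable_norm fi; exact: eq_integrable. Qed.

Lemma intgM_bounded h f M : mfunT h -> (forall x, `|h x| <= M) -> intg mu f ->
  intg mu (fun x => h x * f x).
Proof.
move=> mh hM fi; have mf := intg_measurable fi.
apply: (intg_dom _ (intgZ M (intg_norm fi))); first exact: measurable_funM.
by move=> x; rewrite normrM ler_wpM2r.
Qed.

Lemma IntE f : intg mu f -> (\int[mu]_x f x)%:E = (\int[mu]_x (f x)%:E)%E.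
Proof. by move=> fi; rewrite /Rintegral fineK//; exact: integrable_fin_num. Qed.

Lemma IntD f g : intg mu f -> intg mu g ->
  \int[mu]_x (f x + g x) = \int[mu]_x f x + \int[mu]_x g x.
Proof. by move=> fi gi; rewrite -RintegralD. Qed.

Lemma IntB f g : intg mu f -> intg mu g ->
  \int[mu]_x (f x - g x) = \int[mu]_x f x - \int[mu]_x g x.
Proof. by move=> fi gi; rewrite -RintegralB. Qed.

Lemma IntZ k f : intg mu f -> \int[mu]_x (k * f x) = k * \int[mu]_x f x.
Proof. by move=> fi; rewrite RintegralZl. Qed.

Lemma IntZr k f : intg mu f -> \int[mu]_x (f x * k) = (\int[mu]_x f x) * k.
Proof. by move=> fi; rewrite RintegralZr. Qed.

Lemma IntN f : intg mu f -> \int[mu]_x (- f x) = - \int[mu]_x f x.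
Proof.
move=> fi; rewrite -mulN1r -IntZ//; congr Rintegral; apply/funext => x.
by rewrite mulN1r.
Qed.

Lemma Int_eq f g : f =1 g -> \int[mu]_x f x = \int[mu]_x g x.
Proof. by move=> /funext ->. Qed.

Lemma Int0 : \int[mu]_x (0 : R) = 0.
Proof. by rewrite /Rintegral integral0. Qed.

Lemma Int_sum (I : Type) (s : seq I) (F : I -> T -> R) :
  (forall i, intg mu (F i)) ->
  \int[mu]_x (\sum_(i <- s) F i x) = \sum_(i <- s) \int[mu]_x F i x.
Proof.
move=> Fi; elim: s => [|i s ih].
  by rewrite big_nil -[RHS]Int0; apply: Int_eq => x; rewrite big_nil.
rewrite big_cons -ih -IntD//; last exact: intg_sum.
by apply: Int_eq => x; rewrite big_cons.
Qed.

Lemma Int_ge0 f : (forall x, 0 <= f x) -> 0 <= \int[mu]_x f x.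
Proof. by move=> f0; apply: Rintegral_ge0 => x _. Qed.

Lemma Int_le f g : intg mu f -> intg mu g -> (forall x, f x <= g x) ->
  \int[mu]_x f x <= \int[mu]_x g x.
Proof. by move=> fi gi fg; exact: le_Rintegral. Qed.

Lemma Int_norm_le f g : mfunT f -> intg mu g -> (forall x, `|f x| <= g x) ->
  `|\int[mu]_x f x| <= \int[mu]_x g x.
Proof.
move=> mf gi fg; have fi := intg_dom mf gi fg.
apply: (le_trans (le_normr_Rintegral measurableT fi)).
by apply: Int_le => //; exact: intg_norm.
Qed.

Lemma intg_ge0P f : mfunT f -> (forall x, 0 <= f x) ->
  (\int[mu]_x (f x)%:E < +oo)%E -> intg mu f.
Proof.
move=> mf f0 fy; apply/integrableP; split; first exact/measurable_EFinP.
rewrite (eq_integral (fun x => (f x)%:E))// => x _.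
by rewrite /= ger0_norm.
Qed.

End real_integral.

(** * Measure-preserving maps *)

Section measure_preserving.
Context (R : realType).

Definition mpres d (T : measurableType d) (mu : set T -> \bar R) (tau : T -> T) :=
  mfunT tau /\ forall A, measurable A -> mu (tau @^-1` A) = mu A.

Lemma mpres_ge0_integral d (T : measurableType d)
    (mu : {measure set T -> \bar R}) (tau : T -> T) (f : T -> \bar R) :
  mpres mu tau -> mfunT f -> (forall x, (0 <= f x)%E) ->
  (\int[mu]_x f (tau x) = \int[mu]_x f x)%E.
Proof.
move=> [mtau mutau] mf f0.
have := @ge0_integral_pushforward _ _ _ _ _ tau mtau mu setT f measurableT mf
  (fun x _ => f0 x).
rewrite preimage_setT => <-.
by apply: eq_measure_integral => A mA _; exact: mutau.
Qed.

Lemma mpres_intg d (T : measurableType d)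
    (mu : {measure set T -> \bar R}) (tau : T -> T) (f : T -> R) :
  mpres mu tau -> intg mu f -> intg mu (fun x => f (tau x)).
Proof.
move=> tauP fi; have mf := intg_measurable fi.
have mft : mfunT (fun x => f (tau x)) by apply: measurableT_comp => //; exact: tauP.1.
move/integrableP : fi => [_ fy].
apply/integrableP; split; first exact/measurable_EFinP.
move: fy; rewrite /=.
rewrite -(@mpres_ge0_integral _ _ mu tau (fun x => `|(f x)%:E|%E))//.
by apply: measurableT_comp => //; exact/measurable_EFinP.
Qed.

Lemma mpres_Int d (T : measurableType d)
    (mu : {measure set T -> \bar R}) (tau : T -> T) (f : T -> R) :
  mpres mu tau -> intg mu f -> \int[mu]_x f (tau x) = \int[mu]_x f x.
Proof.
move=> tauP fi; have mf := intg_measurable fi.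
rewrite /Rintegral; congr fine; have [mtau mutau] := tauP.
have := @integral_pushforward _ _ _ _ _ tau mtau mu setT (EFin \o f).
rewrite preimage_setT => <-//.
- by apply: eq_measure_integral => A mA _; exact: mutau.
- exact/measurable_EFinP.
- exact: (mpres_intg tauP fi).
Qed.

(** By sections: [tau2] preserves the measure of each section, then [tau1] preserves the integral of
    the section measures. *)
Lemma mpres_prod d1 d2 (T1 : measurableType d1) (T2 : measurableType d2)
    (m1 : {sigma_finite_measure set T1 -> \bar R})
    (m2 : {sigma_finite_measure set T2 -> \bar R}) tau1 tau2 :
  mpres m1 tau1 -> mpres m2 tau2 ->
  mpres (m1 \x m2)%E (fun p => (tau1 p.1, tau2 p.2)).
Proof.
move=> h1 h2; split.
  apply: measurable_fun_pair => /=.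
    by apply: measurableT_comp; [exact: h1.1|exact: measurable_fst].
  by apply: measurableT_comp; [exact: h2.1|exact: measurable_snd].
move=> A mA; rewrite /product_measure1/=.
rewrite -[RHS](mpres_ge0_integral h1); last 2 first.
  exact: measurable_fun_xsection.
  by move=> x; exact: measure_ge0.
apply: eq_integral => x _ /=.
rewrite -(h2.2 (xsection A (tau1 x))); last exact: measurable_xsection.
by congr (m2 _); apply/seteqP; split => y /= /xsectionP h; apply/xsectionP.
Qed.

Lemma mpres_id d (T : measurableType d) (mu : set T -> \bar R) : mpres mu id.
Proof. by split; first exact: measurable_id. Qed.

End measure_preserving.

(** * Fubini for real-valued integrals *)

Section fubini_real.
Context d1 d2 (T1 : measurableType d1) (T2 : measurableType d2) (R : realType).
Variables (m1 : {sigma_finite_measure set T1 -> \bar R})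
          (m2 : {sigma_finite_measure set T2 -> \bar R}).
Implicit Types F : T1 * T2 -> R.

Lemma intg_swap F : intg (m1 \x m2)%E F -> intg (m2 \x m1)%E (fun q => F (q.2, q.1)).
Proof.
move=> Fi; have mF := intg_measurable Fi.
have msw : mfunT (fun q : T2 * T1 => (q.2, q.1)).
  by apply: measurable_fun_pair.
move/integrableP : Fi => [_ Fy]; apply/integrableP; split.
  by apply/measurable_EFinP; exact: measurableT_comp.
move: Fy => /=.
have mnF : mfunT (fun p => `|(F p)%:E|%E).
  by apply: measurableT_comp => //; exact/measurable_EFinP.
rewrite (fubini_tonelli2 _ mnF)// (fubini_tonelli1 (m1:=m2))//.
exact: (@measurableT_comp _ _ _ _ _ _ (fun p => `|(F p)%:E|%E) _ _ mnF msw).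
Qed.

(** Fubini produces extended-real partial integrals that may be infinite on a null set. [fine] sends
    those values to 0, which affects neither integrability nor the integral. *)
Lemma ae_Int (d : measure_display) (T : measurableType d) (mu : {measure set T -> \bar R})
  (G : T -> \bar R) :
  mu.-integrable setT G ->
  intg mu (fun x => fine (G x)) /\ (\int[mu]_x G x = \int[mu]_x (fine (G x))%:E)%E.
Proof.
move=> iG.
have mG := measurable_int mu iG.
have mfG : mfunT (fun x => fine (G x)) by exact: measurableT_comp.
have aeE : ae_eq mu setT G (fun x => (fine (G x))%:E).
  have := integrable_ae measurableT iG.
  by apply: filterS => x /(_ I) Gx _; rewrite fineK.
split.
  apply/integrableP; split; first exact/measurable_EFinP.
  move/integrableP : iG => [_]; apply: le_lt_trans.
  apply: ge0_le_integral => //=.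
  - by apply/measurable_EFinP; exact: measurableT_comp.
  - exact: measurableT_comp.
  - by move=> x _; case: (G x) => //=; rewrite normr0 leey.
apply: ae_eq_integral => //; exact/measurable_EFinP.
Qed.

Lemma intg_fubini1 F : intg (m1 \x m2)%E F ->
  intg m1 (fun x => \int[m2]_y F (x, y)).
Proof. by move=> Fi; have [] := ae_Int (integrable_fubini_F Fi). Qed.

Lemma Int_fubini1 F : intg (m1 \x m2)%E F ->
  \int[(m1 \x m2)%E]_p F p = \int[m1]_x \int[m2]_y F (x, y).
Proof.
move=> Fi; have [_ e] := ae_Int (integrable_fubini_F Fi).
rewrite {1}/Rintegral -(integral12_prod_meas1 Fi) e.
by rewrite {2}/Rintegral.
Qed.

Lemma intg_tensor (h : T1 -> R) (k : T2 -> R) :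
  intg m1 h -> intg m2 k -> intg (m1 \x m2)%E (fun p => h p.1 * k p.2).
Proof.
move=> hi ki.
have mh := intg_measurable hi; have mk := intg_measurable ki.
have mF : mfunT (fun p : T1 * T2 => h p.1 * k p.2).
  by apply: measurable_funM; apply: measurableT_comp.
apply/integrableP; split; first exact/measurable_EFinP.
have mnF : mfunT (fun p : T1 * T2 => `|(h p.1 * k p.2)%:E|%E).
  by apply: measurableT_comp => //; exact/measurable_EFinP.
rewrite (fubini_tonelli1 _ mnF); last by move=> p; exact: abse_ge0.
have [_ hy] := integrableP _ _ _ hi.
have [_ ky] := integrableP _ _ _ ki.
move: ky => /=; set K := (X in (X < +oo)%E -> _) => Ky.
have K0 : (0 <= K)%E by apply: integral_ge0 => x _; rewrite lee_fin.
have E x : fubini_F m2 (fun p : T1 * T2 => `|(h p.1 * k p.2)%:E|%E) x =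
    (`|h x|%:E * K)%E.
  rewrite /fubini_F -ge0_integralZl//=.
  - by apply: eq_integral => y _; rewrite normrM EFinM.
  - by apply/measurable_EFinP; exact: measurableT_comp.
rewrite (eq_integral (fun x => `|h x|%:E * K)%E); last by move=> x _; exact: E.
rewrite ge0_integralZr//=.
- by apply: lte_mul_pinfty => //; [apply: integral_ge0 => x _; rewrite lee_fin|
    rewrite ge0_fin_numE//; apply: integral_ge0 => x _; rewrite lee_fin].
- by apply/measurable_EFinP; exact: measurableT_comp.
Qed.

Lemma intg_shear F (tau : T1 -> T2 -> T2) :
  (forall x, mpres m2 (tau x)) -> mfunT (fun p => F (p.1, tau p.1 p.2)) ->
  intg (m1 \x m2)%E F -> intg (m1 \x m2)%E (fun p => F (p.1, tau p.1 p.2)).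
Proof.
move=> tauP mG Fi; have mF := intg_measurable Fi.
have [_ Fy] := integrableP _ _ _ Fi.
apply/integrableP; split; first exact/measurable_EFinP.
have mnF : mfunT (fun p => `|(F p)%:E|%E).
  by apply: measurableT_comp => //; exact/measurable_EFinP.
have mnG : mfunT (fun p => `|(F (p.1, tau p.1 p.2))%:E|%E).
  by apply: measurableT_comp => //; exact/measurable_EFinP.
move: Fy => /=.
rewrite (fubini_tonelli1 _ mnF); last by move=> p; exact: abse_ge0.
rewrite (fubini_tonelli1 _ mnG); last by move=> p; exact: abse_ge0.
apply: le_lt_trans; rewrite le_eqVlt; apply/orP; left; apply/eqP.
apply: eq_integral => x _; rewrite /fubini_F/=.
apply: (@mpres_ge0_integral _ _ _ m2 (tau x) (fun y => `|(F (x, y))%:E|%E)) => //.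
exact: measurable_fun_pair2 mnF.
Qed.

End fubini_real.

Lemma Int_fubini2 d1 d2 (T1 : measurableType d1) (T2 : measurableType d2)
    (R : realType) (m1 : {sigma_finite_measure set T1 -> \bar R})
    (m2 : {sigma_finite_measure set T2 -> \bar R}) (F : T1 * T2 -> R) :
  intg (m1 \x m2)%E F ->
  \int[(m1 \x m2)%E]_p F p = \int[m2]_y \int[m1]_x F (x, y).
Proof.
move=> Fi; rewrite (Int_fubini1 Fi).
have Si := intg_swap Fi.
rewrite -(Int_fubini1 (F := fun q => F (q.2, q.1)) Si) -(Int_fubini1 Fi).
rewrite /Rintegral; congr fine.
rewrite -(integral12_prod_meas1 Si) -(integral21_prod_meas1 Fi).
exact: eq_integral.
Qed.

Lemma intg_fubini2 d1 d2 (T1 : measurableType d1) (T2 : measurableType d2)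
    (R : realType) (m1 : {sigma_finite_measure set T1 -> \bar R})
    (m2 : {sigma_finite_measure set T2 -> \bar R}) (F : T1 * T2 -> R) :
  intg (m1 \x m2)%E F -> intg m2 (fun y => \int[m1]_x F (x, y)).
Proof. by move=> /intg_swap/intg_fubini1. Qed.

(** * Sigma-finite measures from bare set functions *)

Section pack_measure.
Context d (T : measurableType d) (R : realType).

(** [lebn] is a recursion on bare set functions, so the induction that makes it a measure has to
    turn the hypothesis at [n] into a measure before it can form a product. *)
Definition is_sfmeasure (m : set T -> \bar R) :=
  [/\ m set0 = 0%E, forall A, (0 <= m A)%E, semi_sigma_additive m
    & sigma_finite setT m].

Variable m : set T -> \bar R.
Hypothesis mP : is_sfmeasure m.
(** The vacuous [let] keeps [mP] among the arguments once the section is closed, so that the measure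
    instances can be attached to this constant. *)
Definition sfmeasure := let _ := mP in m.

Let sfmeasure0 : sfmeasure set0 = 0%E. Proof. by case: mP. Qed.
Let sfmeasure_ge0 A : (0 <= sfmeasure A)%E. Proof. by case: mP. Qed.
Let sfmeasure_additive : semi_sigma_additive sfmeasure. Proof. by case: mP. Qed.
HB.instance Definition _ :=
  isMeasure.Build _ _ _ sfmeasure sfmeasure0 sfmeasure_ge0 sfmeasure_additive.
Let sfmeasure_sigma_finite : sigma_finite setT sfmeasure.
Proof. by case: mP. Qed.
HB.instance Definition _ :=
  Measure_isSigmaFinite.Build _ _ _ sfmeasure sfmeasure_sigma_finite.

Definition sfmeasure_pack : {sigma_finite_measure set T -> \bar R} := sfmeasure.

End pack_measure.

(** * Lebesgue measure on the line *)

Section lebesgue_on_reals.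
Context {R : realType}.

(* The library's [lebesgue_measure] lives on [measurableTypeR R], whose display
   differs from that of the canonical measurable structure of [R] used by
   products and tuples; [lebR] is the same set function on the latter. *)
Definition lebR : set R -> \bar R := @lebesgue_measure R.

Let lebR0 : lebR set0 = 0%E. Proof. exact: (measure0 lebesgue_measure). Qed.
Let lebR_ge0 A : (0 <= lebR A)%E. Proof. exact: (measure_ge0 lebesgue_measure). Qed.
Let lebR_additive : semi_sigma_additive lebR.
Proof. exact: (@measure_semi_sigma_additive _ _ _ (@lebesgue_measure R)). Qed.
HB.instance Definition _ := isMeasure.Build _ _ _ lebR lebR0 lebR_ge0 lebR_additive.
Let lebR_sigma_finite : sigma_finite setT lebR.
Proof.
have [F FT Ffin] := sigma_finiteT (@lebesgue_measure R).
by exists F.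
Qed.
HB.instance Definition _ := Measure_isSigmaFinite.Build _ _ _ lebR lebR_sigma_finite.

Lemma ge0_integral_lebR (D : set R) (f : R -> \bar R) : measurable D ->
  measurable_fun D f -> (forall x, D x -> (0 <= f x)%E) ->
  (\int[lebR]_(x in D) f x = \int[lebesgue_measure]_(x in D) f x)%E.
Proof.
move=> mD mf f0.
have mid : measurable_fun [set: measurableTypeR R] (id : measurableTypeR R -> R).
  by [].
have := @ge0_integral_pushforward _ _ (measurableTypeR R) R R id mid
  lebesgue_measure D f mD mf.
by rewrite preimage_id => <-// x /set_mem; exact: f0.
Qed.

Lemma integrable_lebR (D : set R) (f : R -> R) : measurable D ->
  (@lebesgue_measure R).-integrable D (EFin \o f) -> lebR.-integrable D (EFin \o f).
Proof.
move=> mD /integrableP[mf fy]; apply/integrableP; split => //.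
rewrite ge0_integral_lebR//; exact: (measurableT_comp _ mf).
Qed.

Lemma integral_lebR (D : set R) (f : R -> R) : measurable D ->
  (@lebesgue_measure R).-integrable D (EFin \o f) ->
  \int[lebR]_(x in D) f x = \int[lebesgue_measure]_(x in D) f x.
Proof.
move=> mD fi; rewrite /Rintegral; congr fine.
have mf : measurable_fun D (EFin \o f) by exact: measurable_int fi.
rewrite integralE [RHS]integralE; congr (_ - _)%E.
  by apply: ge0_integral_lebR; [|exact: measurable_funepos|by move=> x _; exact: funepos_ge0].
by apply: ge0_integral_lebR; [|exact: measurable_funeneg|by move=> x _; exact: funeneg_ge0].
Qed.

(** The shifted measure gives every half-open interval its length, so it is Lebesgue measure by
    uniqueness. *)
Lemma lebR_shift_mpres (a : R) : mpres lebR (fun x : R => x + a).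
Proof.
have mt : mfunT (fun x : R => x + a) by exact: measurable_funD.
have mt' : measurable_fun [set: measurableTypeR R] (fun x : R => x + a : measurableTypeR R).
  exact: mt.
split=> // A mA.
pose nu := pushforward (@lebesgue_measure R)
  (fun x : measurableTypeR R => (x + a : R) : measurableTypeR R)
  : {measure set (measurableTypeR R) -> \bar R}.
have := @lebesgue_measure_unique R (nu mt') _ A mA.
move=> H; apply/esym/H => X [[b c]] _ <-{X} /=.
rewrite /nu /= /pushforward (_ : _ @^-1` _ = `]b - a, c - a]%classic); last first.
  by apply/seteqP; split => x /=; rewrite !in_itv/=; lra.
rewrite !lebesgue_measure_itv/= !lte_fin ltrD2r.
by case: ifPn => // bc; rewrite -!EFinB; congr EFin; lra.
Qed.

Lemma product_lebRE d (T : measurableType d)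
    (m : {sigma_finite_measure set T -> \bar R}) (A : set (R * T)) :
  measurable A -> (@lebesgue_measure R \x m)%E A = (lebR \x m)%E A.
Proof.
move=> mA; rewrite /product_measure1; apply/esym.
apply: (@ge0_integral_lebR setT) => //; exact: measurable_fun_xsection.
Qed.

End lebesgue_on_reals.

Lemma product_sigma_finite d1 d2 (T1 : measurableType d1) (T2 : measurableType d2)
    (R : realType) (m1 : {sigma_finite_measure set T1 -> \bar R})
    (m2 : {sigma_finite_measure set T2 -> \bar R}) :
  sigma_finite setT (m1 \x m2)%E.
Proof.
have /sigma_finiteP[F [FT ndF Ffin]] := sigma_finiteT m1.
have /sigma_finiteP[G [GT ndG Gfin]] := sigma_finiteT m2.
exists (fun n => F n `*` G n).
  apply/esym/seteqP; split => // -[x y] _.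
  have [i _ Fi] : (\bigcup_n F n) x by rewrite -FT.
  have [j _ Gj] : (\bigcup_n G n) y by rewrite -GT.
  (* Both exhaustions increase, so the larger index catches both coordinates. *)
  exists (maxn i j) => //; split => /=.
    by move: Fi; apply/subsetPset/ndF/leq_maxl.
  by move: Gj; apply/subsetPset/ndG/leq_maxr.
move=> n; have [mF Fy] := Ffin n; have [mG Gy] := Gfin n.
split; first exact: measurableX.
rewrite product_measure1E; [|exact: mF|exact: mG].
by apply: lte_mul_pinfty => //; rewrite ge0_fin_numE.
Qed.

Arguments lebn : simpl never.

(** * Lebesgue measure on tuples and on space-time *)

Section lebn_measure.
Context {R : realType}.

Definition tcons n (p : R * n.-tuple R) : n.+1.-tuple R := [tuple of p.1 :: p.2].

Lemma measurable_tcons n : mfunT (@tcons n).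
Proof. by apply: measurable_cons. Qed.

(** On measurable sets [lebn n.+1] is the image under [tcons] of a product measure, and additivity
    passes through preimages. Nonnegativity is demanded of all sets, measurable or not, and comes
    from the integral in the definition. *)
Lemma lebn_is_sfmeasure n : is_sfmeasure (@lebn R n).
Proof.
elim: n => [|n mP].
  split.
  - by rewrite /lebn indicE in_set0.
  - by move=> A; rewrite /lebn lee_fin.
  - exact: (@measure_semi_sigma_additive _ _ _ (dirac ([tuple] : 0.-tuple R))).
  - exists (fun=> setT); first by rewrite bigcup_const.
    by move=> i; split => //; rewrite /lebn indicE ltry.
pose m := sfmeasure_pack mP.
pose P1 : {measure set _ -> \bar R} := (lebR \x m)%E.
have E A : measurable A -> lebn n.+1 A = P1 (@tcons n @^-1` A).
  move=> mA; apply: (@product_lebRE _ _ _ m).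
  by rewrite -[X in measurable X]setTI; exact: measurable_tcons.
split.
- by rewrite E// preimage_set0 measure0.
- by move=> A; apply: integral_ge0 => x _; exact: (measure_ge0 m).
- move=> F mF tF mUF; rewrite E//.
  rewrite (_ : (fun k : nat => _) = fun k => \sum_(0 <= i < k) P1 (@tcons n @^-1` F i))%E; last first.
    by apply/funext => k; apply: eq_bigr => i _; rewrite E.
  rewrite preimage_bigcup.
  apply: (@measure_semi_sigma_additive _ _ _ P1 (fun k => @tcons n @^-1` F k)).
  + by move=> k; rewrite -[X in measurable X]setTI; exact: measurable_tcons.
  + apply/trivIsetP => /= i j _ _ ij; rewrite -preimage_setI.
    by move/trivIsetP : tF => /(_ _ _ _ _ ij) ->//; rewrite preimage_set0.
  + by rewrite -preimage_bigcup -[X in measurable X]setTI; exact: measurable_tcons.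
- have [G GT Gfin] := product_sigma_finite lebR m.
  (* The inverse of [tcons] carries the exhaustion of the product over to tuples. *)
  pose unc (x : n.+1.-tuple R) : R * n.-tuple R := (thead x, [tuple of behead x]).
  have munc : mfunT unc.
    apply: measurable_fun_pair; last exact: measurable_behead.
    exact: (measurable_tnth ord0).
  exists (fun k => unc @^-1` G k).
    by rewrite -preimage_bigcup -GT preimage_setT.
  move=> k; have [mG Gk] := Gfin k; split.
    by rewrite -[X in measurable X]setTI; exact: munc.
  rewrite E; last by rewrite -[X in measurable X]setTI; exact: munc.
  rewrite (_ : _ @^-1` _ = G k)//.
  by apply/seteqP; split => -[a x] /=; rewrite /unc theadE (_ : [tuple of _] = x)//;
    apply/val_inj.
Qed.

HB.instance Definition _ n := isMeasure.Build _ _ _ (@lebn R n)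
  (let: And4 h _ _ _ := lebn_is_sfmeasure n in h)
  (let: And4 _ h _ _ := lebn_is_sfmeasure n in h)
  (let: And4 _ _ h _ := lebn_is_sfmeasure n in h).
HB.instance Definition _ n := Measure_isSigmaFinite.Build _ _ _ (@lebn R n)
  (let: And4 _ _ _ h := lebn_is_sfmeasure n in h).
Lemma lebnSE n (A : set (n.+1.-tuple R)) : measurable A ->
  lebn n.+1 A = (lebR \x lebn n)%E (@tcons n @^-1` A).
Proof.
move=> mA; apply: (@product_lebRE _ _ _ (lebn n)).
by rewrite -[X in measurable X]setTI; exact: measurable_tcons.
Qed.

(** Agrees with [mu_st] on measurable sets, but is built from [lebR] and carries a measure
    structure, so that Fubini applies to it. *)
Definition must n : set (R * n.-tuple R) -> \bar R := (lebR \x lebn n)%E.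
HB.instance Definition _ n := Measure.on (@must n).
HB.instance Definition _ n := Measure_isSigmaFinite.Build _ _ _ (@must n)
  (product_sigma_finite lebR (lebn n)).

Lemma mu_stE n (A : set (R * n.-tuple R)) : measurable A -> mu_st n A = must A.
Proof. by move=> mA; apply: (@product_lebRE _ _ _ (lebn n)). Qed.

Definition tadd n (x y : n.-tuple R) : n.-tuple R :=
  [tuple tnth x i + tnth y i | i < n].

Lemma tnth_tadd n (x y : n.-tuple R) i : tnth (tadd x y) i = tnth x i + tnth y i.
Proof. by rewrite tnth_mktuple. Qed.

Lemma tadd_tcons n p (y : n.+1.-tuple R) : tadd (tcons p) y =
  tcons (p.1 + thead y, tadd p.2 [tuple of behead y]).
Proof.
apply: eq_from_tnth => i; rewrite tnth_tadd.
have [->|] := eqVneq i ord0; first by [].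
case: (unliftP ord0 i) => [j ->|->] //_.
by rewrite !tnthS tnth_tadd [in LHS](tuple_eta y) tnthS.
Qed.

Lemma measurable_tadd d (T : measurableType d) n (f g : T -> n.-tuple R) :
  mfunT f -> mfunT g -> mfunT (fun x => tadd (f x) (g x)).
Proof.
move=> mf mg; apply/measurable_fun_tnthP => i.
rewrite (_ : _ \o _ = fun x => tnth (f x) i + tnth (g x) i).
  by apply: measurable_funD; apply: (measurableT_comp (measurable_tnth i)).
by apply/funext => x /=; rewrite tnth_tadd.
Qed.

Lemma lebn_shift_mpres n (y : n.-tuple R) : mpres (lebn n) (fun x => tadd x y).
Proof.
have mt k (z : k.-tuple R) : mfunT (fun x : k.-tuple R => tadd x z) by exact: measurable_tadd.
elim: n y => [|n ih] y; split; [exact: mt|move=> A mA|exact: mt|move=> A mA].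
  rewrite /lebn !indicE; congr (_%:R%:E); congr nat_of_bool.
  by apply/idP/idP => /set_mem h; apply/mem_set; move: h; rewrite /= [tadd _ _]tuple0.
have := mpres_prod (lebR_shift_mpres (thead y)) (ih [tuple of behead y]).
rewrite !lebnSE//; last by rewrite -[X in measurable X]setTI; exact: mt.
move=> [_ /(_ (@tcons n @^-1` A))] => <-; last first.
  by rewrite -[X in measurable X]setTI; exact: measurable_tcons.
congr (product_measure1 _ _ _).
by apply/seteqP; split => p /=; rewrite tadd_tcons.
Qed.

Lemma must_shift_mpres n (y : n.-tuple R) :
  mpres (@must n) (fun p => (p.1, tadd p.2 y)).
Proof. exact: mpres_prod (mpres_id _) (lebn_shift_mpres y). Qed.

Lemma intg_lebnS n (f : n.+1.-tuple R -> R) :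
  intg (lebR \x lebn n)%E (fun p => f (tcons p)) ->
  mfunT f -> intg (lebn n.+1) f.
Proof.
move=> fi mf; have [_ fy] := integrableP _ _ _ fi.
apply/integrableP; split; first exact/measurable_EFinP.
move: fy; apply: le_lt_trans; rewrite le_eqVlt; apply/orP; left; apply/eqP.
have := @ge0_integral_pushforward _ _ _ _ R (@tcons n) (@measurable_tcons n)
  (lebR \x lebn n)%E setT (fun x => `|(f x)%:E|%E) measurableT.
rewrite preimage_setT => <-//.
  apply: eq_measure_integral; first exact: measurable_tcons.
  by move=> ? A mA _; exact: lebnSE.
by apply: measurableT_comp => //; exact/measurable_EFinP.
Qed.

Lemma intg_lebn_prod n (h : R -> R) : intg lebR h ->
  intg (lebn n) (fun x : n.-tuple R => \prod_(i < n) h (tnth x i)).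
Proof.
move=> hi; have mh := intg_measurable hi.
have mp k : mfunT (fun x : k.-tuple R => \prod_(i < k) h (tnth x i)).
  apply: measurable_prod => i _; apply: measurableT_comp => //.
  exact: measurable_tnth.
elim: n => [|n ih].
  apply/integrableP; split; first by apply/measurable_EFinP; exact: mp.
  rewrite (eq_integral (fun=> 1%:E)) => [|x _]; last by rewrite /= big_ord0 normr1.
  by rewrite integral_cst// mul1e /= /lebn indicE ltry.
apply: intg_lebnS => //.
apply: intg_eq (intg_tensor hi ih) => p /=; rewrite big_ord_recl /tcons.
by congr (_ * _); apply: eq_bigr => i _; rewrite tnthS.
Qed.

Lemma Int_lebnS n (f : n.+1.-tuple R -> R) :
  intg (lebR \x lebn n)%E (fun p => f (tcons p)) -> mfunT f ->
  \int[lebn n.+1]_x f x = \int[(lebR \x lebn n)%E]_p f (tcons p).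
Proof.
move=> fi mf; rewrite /Rintegral; congr fine.
have := @integral_pushforward _ _ _ _ R (@tcons n) (@measurable_tcons n)
  (lebR \x lebn n)%E setT (EFin \o f).
rewrite preimage_setT => <-//.
  apply: eq_measure_integral; first exact: measurable_tcons.
  by move=> ? A mA _; exact: lebnSE.
exact/measurable_EFinP.
Qed.

Lemma Int_lebn_prod n (h : R -> R) : intg lebR h ->
  \int[lebn n]_x (\prod_(i < n) h (tnth x i)) = (\int[lebR]_r h r) ^+ n.
Proof.
move=> hi; have mh := intg_measurable hi.
have mp k : mfunT (fun x : k.-tuple R => \prod_(i < k) h (tnth x i)).
  apply: measurable_prod => i _; apply: measurableT_comp => //.
  exact: measurable_tnth.
elim: n => [|n ih].
  rewrite expr0 /Rintegral (eq_integral (fun=> 1%:E)) => [|x _]; last by rewrite big_ord0.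
  by rewrite integral_cst// mul1e /= /lebn indicE mem_set.
have E p : \prod_(i < n.+1) h (tnth (@tcons n p) i) =
    h p.1 * \prod_(i < n) h (tnth p.2 i).
  by rewrite big_ord_recl; congr (_ * _); apply: eq_bigr => i _; rewrite tnthS.
have iE := intg_tensor hi (intg_lebn_prod n hi).
rewrite Int_lebnS//; last first.
  by apply: intg_eq iE => p; rewrite E.
under eq_Rintegral do rewrite E.
rewrite (Int_fubini1 iE) exprS -ih -IntZr//.
by apply: Int_eq => r /=; rewrite IntZ//; exact: intg_lebn_prod.
Qed.

End lebn_measure.

(** * Vector operations on tuples *)

Section tuple_vectors.
Context {R : realType} {n : nat}.
Implicit Types x y z : n.-tuple R.

Definition tsc (r : R) x : n.-tuple R := [tuple r * tnth x i | i < n].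
Definition te (j : 'I_n) (h : R) : n.-tuple R := [tuple if i == j then h else 0 | i < n].
Definition t0 : n.-tuple R := [tuple 0 | i < n].
Definition topp x : n.-tuple R := [tuple - tnth x i | i < n].

Lemma tnth_tsc r x i : tnth (tsc r x) i = r * tnth x i.
Proof. by rewrite tnth_mktuple. Qed.
Lemma tnth_te j h i : tnth (te j h) i = if i == j then h else 0.
Proof. by rewrite tnth_mktuple. Qed.
Lemma tnth_t0 i : tnth t0 i = 0.
Proof. by rewrite tnth_mktuple. Qed.
Lemma tnth_topp x i : tnth (topp x) i = - tnth x i.
Proof. by rewrite tnth_mktuple. Qed.

Definition tnthE := (@tnth_tadd R n, tnth_tsc, tnth_te, tnth_t0, tnth_topp).

Lemma taddC x y : tadd x y = tadd y x.
Proof. by apply: eq_from_tnth => i; rewrite !tnthE addrC. Qed.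
Lemma taddA x y z : tadd x (tadd y z) = tadd (tadd x y) z.
Proof. by apply: eq_from_tnth => i; rewrite !tnthE addrA. Qed.
Lemma taddAC x y z : tadd (tadd x y) z = tadd (tadd x z) y.
Proof. by apply: eq_from_tnth => i; rewrite !tnthE addrAC. Qed.
Lemma tadd0 x : tadd x t0 = x.
Proof. by apply: eq_from_tnth => i; rewrite !tnthE addr0. Qed.
Lemma tsc_tadd r x y : tsc r (tadd x y) = tadd (tsc r x) (tsc r y).
Proof. by apply: eq_from_tnth => i; rewrite !tnthE mulrDr. Qed.
Lemma tsc_te r j h : tsc r (te j h) = te j (r * h).
Proof. by apply: eq_from_tnth => i; rewrite !tnthE; case: ifP => _; rewrite ?mulr0. Qed.
Lemma tsc0 x : tsc 0 x = t0.
Proof. by apply: eq_from_tnth => i; rewrite !tnthE mul0r. Qed.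
Lemma tscD r s x : tsc (r + s) x = tadd (tsc r x) (tsc s x).
Proof. by apply: eq_from_tnth => i; rewrite !tnthE mulrDl. Qed.
Lemma measurable_tsc d (T : measurableType d) (f : T -> R) (g : T -> n.-tuple R) :
  mfunT f -> mfunT g -> mfunT (fun a => tsc (f a) (g a)).
Proof.
move=> mf mg; apply/measurable_fun_tnthP => i.
rewrite (_ : _ \o _ = fun a => f a * tnth (g a) i).
  by apply: measurable_funM => //; apply: (measurableT_comp (measurable_tnth i)).
by apply/funext => a /=; rewrite tnth_tsc.
Qed.

End tuple_vectors.

(** * One-variable weight and Gaussian estimates *)

Section gaussian_bounds.
Context {R : realType}.
Implicit Types x y z h : R.

Definition jap x : R := (1 + x ^+ 2)^-1.

Lemma onesqr_gt0 x : 0 < 1 + x ^+ 2.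
Proof. by have := sqr_ge0 x; lra. Qed.

Lemma jap_gt0 x : 0 < jap x.
Proof. by rewrite invr_gt0 onesqr_gt0. Qed.

Lemma jap_le1 x : jap x <= 1.
Proof. by rewrite invf_le1 ?onesqr_gt0//; have := sqr_ge0 x; lra. Qed.

Lemma japK x : jap x * (1 + x ^+ 2) = 1.
Proof. by rewrite mulVf// gt_eqF// onesqr_gt0. Qed.

Lemma jap_add x y : jap (x + y) <= jap x * (2 * (1 + y ^+ 2)).
Proof.
rewrite /jap -ler_pdivrMr; last by have := onesqr_gt0 y; lra.
rewrite -invfM lef_pV2 ?posrE ?onesqr_gt0 ?mulr_gt0 ?onesqr_gt0//.
(* The difference of the two sides is [1 + (x + 2 * y) ^+ 2 + 2 * ((x + y) ^+ 2 * y ^+ 2)]. *)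
have := sqr_ge0 (x + 2 * y); have := mulr_ge0 (sqr_ge0 (x + y)) (sqr_ge0 y).
nra.
Qed.

Lemma measurable_jap : mfunT jap.
Proof.
apply: continuous_measurable_fun => x; apply: cvgV.
  by rewrite gt_eqF// onesqr_gt0.
by apply: cvgD; [exact: cvg_cst|exact: exprn_continuous].
Qed.

Lemma intg_jap : intg lebR jap.
Proof.
apply: intg_ge0P => [|x|]; [exact: measurable_jap|exact/ltW/jap_gt0|].
rewrite ge0_integral_lebR//; last 2 first.
- by apply/measurable_EFinP; exact: measurable_jap.
- by move=> x _; rewrite lee_fin; exact/ltW/jap_gt0.
rewrite ge0_symfun_integralT/=.
- by rewrite -set_itvcy (integral0y_oneDsqr R) -EFinM ltry.
- by move=> x; exact/ltW/jap_gt0.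
- move=> x; apply: cvgV; first by rewrite gt_eqF// onesqr_gt0.
  by apply: cvgD; [exact: cvg_cst|exact: exprn_continuous].
- by move=> x; rewrite /jap /= sqrrN.
Qed.

Definition gau x : R := expR (- (x ^+ 2 / 2)).

Lemma gau_gt0 x : 0 < gau x. Proof. exact: expR_gt0. Qed.

Lemma measurable_gau : mfunT gau.
Proof.
apply: (measurableT_comp (@measurable_expR R)).
apply: (measurableT_comp (@oppr_measurable R setT)).
by apply: measurable_funM => //; exact: measurable_funX.
Qed.

Lemma expR_quarter_bound m : exists2 C : R, 0 < C &
  forall x, expR (- (x ^+ 2 / 4)) <= C * jap x ^+ m.
Proof.
(* With this [k], raising [1 + x^2 <= k e^(x^2/k)] to the power [m.+1] gives the exponent [x^2/4]
   exactly. *)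
pose k : R := 4 * m.+1%:R; have k0 : 0 < k by rewrite mulr_gt0.
exists (k ^+ m.+1); first exact: exprn_gt0.
move=> x; rewrite expRN -ler_pdivrMl ?exprn_gt0//.
rewrite -invfM exprVn lef_pV2 ?posrE ?mulr_gt0 ?exprn_gt0 ?expR_gt0 ?onesqr_gt0//.
have k1 : 1 <= k by rewrite /k -{1}(mulr1 1) ler_pM// ?ler1n// ; lra.
have h1 : 1 + x ^+ 2 <= k * expR (x ^+ 2 / k).
  apply: (@le_trans _ _ (k * (1 + x ^+ 2 / k))).
    by rewrite mulrDr mulr1 mulrCA divff ?gt_eqF// mulr1 lerD2r.
  by rewrite ler_pM2l// expR_ge1Dx.
apply: (@le_trans _ _ ((1 + x ^+ 2) ^+ m.+1)).
  rewrite [leRHS]exprS; apply: ler_peMl; last by have := sqr_ge0 x; lra.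
  by rewrite exprn_ge0// ltW// onesqr_gt0.
apply: (@le_trans _ _ ((k * expR (x ^+ 2 / k)) ^+ m.+1)).
  rewrite lerXn2r// nnegrE; first exact/ltW/onesqr_gt0.
  by rewrite mulr_ge0 ?expR_ge0// ltW.
rewrite exprMn -expRM_natl; apply: ler_wpM2l; first by rewrite exprn_ge0 ?ltW.
rewrite le_eqVlt; apply/orP; left; apply/eqP; congr expR.
have : m.+1%:R != 0 :> R by rewrite pnatr_eq0.
by rewrite /k; move: (m.+1%:R) => c c0; field.
Qed.

Lemma gau_bound m : exists2 C : R, 0 < C & forall x, gau x <= C * jap x ^+ m.
Proof.
have [C C0 CP] := expR_quarter_bound m; exists C => // x.
by apply: le_trans (CP x); rewrite ler_expR; have := sqr_ge0 x; lra.
Qed.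

(** The inequality [1 + q <= expR q], taken at [q] and at [- q], gives
    [0 <= expR q - 1 - q <= q * (expR q - 1)]. *)
Lemma expR_taylor1 (q : R) : `|expR q - 1 - q| <= q ^+ 2 * expR `|q|.
Proof.
have h0 := expR_ge1Dx q; have h1 := expR_ge1Dx (- q).
have e0 := expR_gt0 q.
have h2 : expR q - 1 <= q * expR q.
  move: h1; rewrite expRN -(ler_pM2r e0) mulVf ?gt_eqF//; lra.
have h3 : `|expR q - 1| <= `|q| * expR `|q|.
  have [q0|q0] := leP 0 q.
    by rewrite !ger0_norm//; lra.
  rewrite ler0_norm; last by rewrite subr_le0 expR_le1 ltW.
  rewrite ltr0_norm// opprB.
  apply: (@le_trans _ _ (- q)); first by lra.
  by rewrite ler_peMr; [|lra|rewrite -expR0 ler_expR; lra].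
rewrite ger0_norm; last by lra.
have := ler_norm (q * (expR q - 1)); rewrite normrM.
have := ler_wpM2l (normr_ge0 q) h3; rewrite mulrA -expr2 real_normK ?num_real//.
lra.
Qed.

(** [gau (z + h)] is [gau z * expR q], up to [h^2/2] the bracket is the second-order remainder of
    [expR q]. Since [|q| <= z^2/4 + 2], the factor [expR |q|] uses up only half of the Gaussian
    exponent. The other half, through [expR_quarter_bound] at 2, pays for the factor [1 + z^2] of
    [q^2] and still leaves [jap z]. *)
Lemma gau_taylor : exists2 C : R, 0 < C & forall z h, `|h| <= 1 ->
  `|gau (z + h) - gau z + h * (z * gau z)| <= C * h ^+ 2 * jap z.
Proof.
have [C C0 CP] := expR_quarter_bound 2.
have e1 : 1 <= expR (2 : R) by rewrite -expR0 ler_expR.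
exists (3 * expR 2 * C); first by rewrite !mulr_gt0// expR_gt0.
move=> z h h1; set q := - (h * z + h ^+ 2 / 2).
have gq : gau (z + h) = gau z * expR q.
  by rewrite /gau -expRD; congr expR; rewrite /q; lra.
have -> : gau (z + h) - gau z + h * (z * gau z) =
    gau z * ((expR q - 1 - q) - h ^+ 2 / 2) by rewrite gq /q; ring.
have hh : h ^+ 2 = `|h| ^+ 2 by rewrite real_normK ?num_real.
have zz : z ^+ 2 = `|z| ^+ 2 by rewrite real_normK ?num_real.
have n0 := normr_ge0 h; have z0 := normr_ge0 z.
have qb : `|q| <= `|h| * (`|z| + 1).
  rewrite /q normrN; apply: (le_trans (ler_normD _ _)).
  rewrite normrM (ger0_norm (_ : 0 <= h ^+ 2 / 2)); last by have := sqr_ge0 h; lra.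
  by rewrite hh; nra.
have qb1 : `|q| <= z ^+ 2 / 4 + 2.
  apply: (le_trans qb); apply: (@le_trans _ _ (`|z| + 1)); first by nra.
  by have := sqr_ge0 (`|z| - 2); rewrite zz; lra.
have q2 : q ^+ 2 <= h ^+ 2 * (2 * (1 + z ^+ 2)).
  rewrite (_ : q ^+ 2 = `|q| ^+ 2); last by rewrite real_normK ?num_real.
  apply: (@le_trans _ _ ((`|h| * (`|z| + 1)) ^+ 2)).
    by rewrite lerXn2r ?nnegrE// mulr_ge0//; lra.
  rewrite exprMn hh zz; apply: ler_wpM2l; first exact: sqr_ge0.
  by have := sqr_ge0 (`|z| - 1); lra.
have ge : gau z * expR `|q| <= expR 2 * expR (- (z ^+ 2 / 4)).
  by rewrite /gau -!expRD ler_expR; lra.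
have g1 : gau z <= expR 2 * expR (- (z ^+ 2 / 4)).
  by rewrite /gau -!expRD ler_expR; have := sqr_ge0 z; lra.
set E := expR 2 * expR (- (z ^+ 2 / 4)) in ge g1.
have E0 : 0 <= E by rewrite mulr_ge0 ?expR_ge0.
have EC : E * (1 + z ^+ 2) <= expR 2 * C * jap z.
  rewrite /E -2!mulrA ler_pM2l ?expR_gt0//.
  apply: (@le_trans _ _ (C * jap z ^+ 2 * (1 + z ^+ 2))).
    by rewrite ler_pM2r ?onesqr_gt0.
  by rewrite [jap z ^+ 2]expr2 -!mulrA japK mulr1.
rewrite normrM (gtr0_norm (gau_gt0 z)).
apply: (@le_trans _ _ (gau z * (q ^+ 2 * expR `|q| + h ^+ 2 / 2))).
  rewrite ler_pM2l ?gau_gt0//; apply: (le_trans (ler_normB _ _)).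
  rewrite lerD ?expR_taylor1// ger0_norm//; by have := sqr_ge0 h; lra.
rewrite mulrDr.
have s1 : gau z * (q ^+ 2 * expR `|q|) <= h ^+ 2 * (2 * (1 + z ^+ 2)) * E.
  rewrite mulrCA; apply: ler_pM => //; first exact: sqr_ge0.
  by rewrite mulr_ge0 ?expR_ge0// ltW// gau_gt0.
have s2 : gau z * (h ^+ 2 / 2) <= h ^+ 2 * (E * (1 + z ^+ 2)).
  rewrite mulrC; have := ler_wpM2l (sqr_ge0 h) g1.
  have := mulr_ge0 (sqr_ge0 h) (mulr_ge0 E0 (sqr_ge0 z)).
  have := mulr_ge0 (sqr_ge0 h) (ltW (gau_gt0 z)).
  nra.
have := ler_wpM2l (sqr_ge0 h) EC.
lra.
Qed.

End gaussian_bounds.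

(** * The product weight and the product Gaussian *)

Section weight.
Context {R : realType} {n : nat}.
Implicit Types x y z : n.-tuple R.

(* [wgt] is a Peetre-type factor: [rho (x + y) <= rho x * wgt y]. *)
Definition rho x : R := \prod_(i < n) jap (tnth x i).
Definition wgt x : R := \prod_(i < n) (2 * (1 + tnth x i ^+ 2)).
Definition kap x : R := \prod_(i < n) gau (tnth x i).

Lemma rho_gt0 x : 0 < rho x.
Proof. by apply: prodr_gt0 => i _; exact: jap_gt0. Qed.

Lemma rho_le1 x : rho x <= 1.
Proof. by apply: prodr_ile1 => i _; rewrite ltW ?jap_gt0 ?jap_le1. Qed.

Lemma kap_gt0 x : 0 < kap x.
Proof. by apply: prodr_gt0 => i _; exact: gau_gt0. Qed.

Lemma wgt_ge1 x : 1 <= wgt x.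
Proof.
rewrite -[leLHS](@big1_eq _ _ *%R _ (index_enum 'I_n) xpredT); apply: ler_prod => i _.
by rewrite ler01/=; have := sqr_ge0 (tnth x i); lra.
Qed.

Lemma rho_tadd x y : rho (tadd x y) <= rho x * wgt y.
Proof.
rewrite /rho /wgt -big_split/=; apply: ler_prod => i _.
by rewrite ltW ?jap_gt0//= tnth_tadd jap_add.
Qed.

Lemma measurable_prodtnth (f : R -> R) : mfunT f ->
  mfunT (fun x : n.-tuple R => \prod_(i < n) f (tnth x i)).
Proof.
move=> mf; apply: measurable_prod => i _; apply: measurableT_comp => //.
exact: measurable_tnth.
Qed.

Lemma measurable_rho : mfunT rho.
Proof. exact: measurable_prodtnth measurable_jap. Qed.

Lemma measurable_wgt : mfunT wgt.
Proof.
apply: (@measurable_prodtnth (fun s => 2 * (1 + s ^+ 2))).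
by apply: measurable_funM => //; apply: measurable_funD => //; exact: measurable_funX.
Qed.

Lemma measurable_kap : mfunT kap.
Proof. exact: measurable_prodtnth measurable_gau. Qed.

Lemma intg_rho : intg (lebn n) rho.
Proof. exact: intg_lebn_prod intg_jap. Qed.

Lemma kap_bound m : exists2 C : R, 0 < C & forall z, kap z <= C * rho z ^+ m.
Proof.
have [C C0 CP] := @gau_bound R m; exists (C ^+ n); first exact: exprn_gt0.
move=> z; rewrite /rho -prodrXl.
rewrite -[C ^+ n](_ : \prod_(i < n) C = _); last by rewrite prodr_const card_ord.
by rewrite -big_split; apply: ler_prod => i _; rewrite ltW ?gau_gt0//= CP.
Qed.

Lemma norm_tnth_le z i : `|tnth z i| <= (rho z)^-1.
Proof.
rewrite /rho -prodfV (bigD1 i)//= /jap invrK.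
apply: (@le_trans _ _ (1 + tnth z i ^+ 2)).
  have := sqr_ge0 (`|tnth z i| - 1); rewrite -(real_normK (num_real (tnth z i))).
  by have := sqr_ge0 `|tnth z i|; lra.
apply: ler_peMr; first exact/ltW/onesqr_gt0.
rewrite -[leLHS](@big1_eq _ _ *%R _ (index_enum 'I_n) (fun k => k != i)); apply: ler_prod => k _.
by rewrite ler01/= invrK; have := sqr_ge0 (tnth z k); lra.
Qed.

Lemma wgt_rho x : wgt x = 2 ^+ n * (rho x)^-1.
Proof.
rewrite /wgt big_split/= prodr_const card_ord /rho -prodfV; congr (_ * _).
by apply: eq_bigr => i _; rewrite /jap invrK.
Qed.

Lemma wgt_tsc r z : wgt (tsc r z) <= (2 * (1 + r ^+ 2)) ^+ n * (rho z)^-1.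
Proof.
rewrite -[X in X * _](_ : \prod_(i < n) (2 * (1 + r ^+ 2)) = _); last first.
  by rewrite prodr_const card_ord.
rewrite /rho -prodfV -big_split/=; apply: ler_prod => i _; rewrite /jap invrK tnth_tsc.
have := sqr_ge0 (r * tnth z i); have := sqr_ge0 r; have := sqr_ge0 (tnth z i).
by move=> *; apply/andP; split; rewrite ?exprMn; nra.
Qed.

End weight.

(** * From coordinate increments to arbitrary increments *)

Section coordinate_calculus.
Context {R : realType} {n : nat}.
Implicit Types (g : n.-tuple R -> R) (x y : n.-tuple R).

Definition bddx (M : R) g := forall x, `|g x| <= M.
Definition lipx (M : R) g :=
  forall j x h, `|g (tadd x (te j h)) - g x| <= M * `|h|.
Definition derx (M : R) j g g' :=
  forall x h, `|g (tadd x (te j h)) - g x - h * g' x| <= M * h ^+ 2.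

(** Partial displacements: adding indices to [s] leads from [x] to [x + y] along the coordinate
    axes, one coordinate per step of an induction. *)
Definition tmask (s : seq 'I_n) y : n.-tuple R :=
  [tuple if i \in s then tnth y i else 0 | i < n].

Lemma tmask_nil y : tmask [::] y = t0.
Proof. by apply: eq_from_tnth => i; rewrite !tnth_mktuple. Qed.

Lemma tmask_enum y : tmask (index_enum 'I_n) y = y.
Proof. by apply: eq_from_tnth => i; rewrite tnth_mktuple mem_index_enum. Qed.

Lemma tmask_cons j s y : j \notin s ->
  tmask (j :: s) y = tadd (tmask s y) (te j (tnth y j)).
Proof.
move=> js; apply: eq_from_tnth => i.
rewrite tnth_tadd tnth_te !tnth_mktuple in_cons.
by case: eqVneq => [->|_] /=; rewrite ?(negbTE js) ?add0r ?addr0.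
Qed.

Lemma lipx_tadd M g x y : lipx M g ->
  `|g (tadd x y) - g x| <= M * \sum_i `|tnth y i|.
Proof.
move=> gM; rewrite -{1}(tmask_enum y).
elim: (index_enum _) (index_enum_uniq 'I_n) => [|j s ih].
  by rewrite tmask_nil tadd0 subrr normr0 big_nil mulr0.
rewrite cons_uniq => /andP[js us]; rewrite tmask_cons// big_cons mulrDr taddA.
have := gM j (tadd x (tmask s y)) (tnth y j); have := ih us.
set a := g _; set b := g _; set c := g _ => h1 h2.
have -> : c - b = (c - a) + (a - b) by ring.
by apply: (le_trans (ler_normD _ _)); rewrite lerD.
Qed.

Lemma derx_tadd M g (g' : 'I_n -> n.-tuple R -> R) x y :
  0 <= M -> (forall j, derx M j g (g' j)) -> (forall j, lipx M (g' j)) ->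
  `|g (tadd x y) - g x - \sum_i tnth y i * g' i x| <=
    2 * M * (\sum_i `|tnth y i|) ^+ 2.
Proof.
move=> M0 gd g'l; set S := \sum_i `|tnth y i|.
have S0 : 0 <= S by apply: sumr_ge0.
have Sj j : `|tnth y j| <= S by rewrite /S (bigD1 j)//= lerDl sumr_ge0.
(* One factor [S] stays the full sum; the bound is then additive over the coordinates and can be
   proved by induction on the mask. *)
suff : `|g (tadd x (tmask (index_enum 'I_n) y)) - g x - \sum_i tnth y i * g' i x|
    <= 2 * M * S * \sum_i `|tnth y i|.
  by rewrite tmask_enum -mulrA -expr2.
elim: (index_enum _) (index_enum_uniq 'I_n) => [|j s ih].
  by rewrite tmask_nil tadd0 !big_nil !subrr normr0 mulr0.
rewrite cons_uniq => /andP[js us]; rewrite tmask_cons// 2!big_cons mulrDr taddA.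
have := gd j (tadd x (tmask s y)) (tnth y j).
have := lipx_tadd x (tmask s y) (g'l j).
have mS : \sum_i `|tnth (tmask s y) i| <= S.
  by apply: ler_sum => i _; rewrite tnth_mktuple; case: ifP => _ //; rewrite normr0.
have := ih us.
set X1 := tadd x (tmask s y); set X2 := tadd X1 _.
set Sg := \sum_(i <- s) _; set Sn := \sum_(i <- s) _.
move=> h1 h2 h3.
have -> : g X2 - g x - (tnth y j * g' j x + Sg) =
  (g X2 - g X1 - tnth y j * g' j X1) + (g X1 - g x - Sg) +
  tnth y j * (g' j X1 - g' j x) by ring.
have h4 : `|tnth y j * (g' j X1 - g' j x)| <= M * S * `|tnth y j|.
  rewrite normrM mulrC ler_wpM2r//; apply: (le_trans h2); exact: ler_wpM2l.
have h5 : M * tnth y j ^+ 2 <= M * S * `|tnth y j|.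
  rewrite -mulrA; apply: ler_wpM2l => //.
  by rewrite -(real_normK (num_real (tnth y j))) expr2 ler_wpM2r.
apply: (le_trans (ler_normD _ _)).
have := ler_normD (g X2 - g X1 - tnth y j * g' j X1) (g X1 - g x - Sg).
lra.
Qed.

Lemma sum_norm_tnth_rho (z : n.-tuple R) : \sum_i `|tnth z i| <= n%:R * (rho z)^-1.
Proof.
apply: (@le_trans _ _ (\sum_(i < n) (rho z)^-1)).
  by apply: ler_sum => i _; exact: norm_tnth_le.
by rewrite sumr_const card_ord mulr_natl.
Qed.

End coordinate_calculus.

(** Turns an estimate [|h a| <= C h^2], divided by [h], into an identity; this is how the limit
    [h -> 0] is taken when an integral identity is derived from a remainder estimate. *)
Lemma eq0_small (R : realType) (a C : R) :
  (forall h : R, 0 < h <= 1 -> `|a| <= C * h) -> a = 0.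
Proof.
move=> aC; apply/eqP/negPn/negP => a0.
have C1 : `|a| <= C by have := aC 1; rewrite mulr1; apply; lra.
have na : 0 < `|a| by rewrite normr_gt0.
have C0 : 0 < C by lra.
have := aC (`|a| / (2 * C)) _.
have -> : C * (`|a| / (2 * C)) = `|a| / 2 by field; rewrite gt_eqF.
have : 0 < `|a| / (2 * C) <= 1.
  rewrite divr_gt0 ?mulr_gt0//= ler_pdivrMr ?mulr_gt0//; lra.
by move=> h /(_ h); lra.
Qed.

Lemma mul_remainder (R : realType) (u0 u1 u' v0 v1 v' h U V : R) :
  `|u1 - u0 - h * u'| <= U -> `|v1 - v0 - h * v'| <= V ->
  `|u1 * v1 - u0 * v0 - h * (u' * v0 + u0 * v')| <=
    U * `|v1| + `|u0| * V + `|h| * `|u'| * `|v1 - v0|.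
Proof.
move=> hU hV.
have -> : u1 * v1 - u0 * v0 - h * (u' * v0 + u0 * v') =
  (u1 - u0 - h * u') * v1 + u0 * (v1 - v0 - h * v') + h * u' * (v1 - v0) by ring.
apply: (le_trans (ler_normD _ _)); rewrite lerD//; last by rewrite !normrM.
by apply: (le_trans (ler_normD _ _)); rewrite !normrM lerD// ?ler_wpM2r// ler_wpM2l.
Qed.

(** * Gaussian integration by parts *)

Section gaussian_ibp.
Context {R : realType} {n : nat}.
Implicit Types (g : n.-tuple R -> R) (x y z : n.-tuple R).

Lemma kap_taylor : exists2 C : R, 0 < C & forall z j h, `|h| <= 1 ->
  `|kap (tadd z (te j h)) - kap z + h * (tnth z j * kap z)| <= C * h ^+ 2 * rho z.
Proof.
have [C C0 CP] := @gau_taylor R; have [D D0 DP] := @gau_bound R 1.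
exists (C * D ^+ n.-1); first by rewrite mulr_gt0// exprn_gt0.
move=> z j h h1.
rewrite /kap /rho (bigD1 j)//= [X in _ - X](bigD1 j)//= [X in h * (_ * X)](bigD1 j)//=.
rewrite [X in _ <= _ * X](bigD1 j)//= tnth_tadd tnth_te eqxx.
rewrite (eq_bigr (fun i => gau (tnth z i))); last first.
  by move=> i ij; rewrite tnth_tadd tnth_te (negbTE ij) addr0.
set P := \prod_(i | _) gau _; set Q := \prod_(i | _) jap _.
have P0 : 0 <= P by apply: prodr_ge0 => i _; rewrite ltW ?gau_gt0.
have PQ : P <= D ^+ n.-1 * Q.
  have -> : D ^+ n.-1 = \prod_(i < n | i != j) D by rewrite prodr_const cardC1 card_ord.
  rewrite /Q -big_split/=; apply: ler_prod => i _; rewrite ltW ?gau_gt0//=.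
set zj := tnth z j.
have -> : gau (zj + h) * P - gau zj * P + h * (zj * (gau zj * P)) =
  (gau (zj + h) - gau zj + h * (zj * gau zj)) * P by ring.
rewrite normrM (ger0_norm P0).
apply: (@le_trans _ _ ((C * h ^+ 2 * jap zj) * (D ^+ n.-1 * Q))).
  by apply: ler_pM => //; exact: CP.
by rewrite le_eqVlt; apply/orP; left; apply/eqP; ring.
Qed.

Variables (M : R) (g g' : n.-tuple R -> R) (j : 'I_n).
Hypotheses (mg : mfunT g) (mg' : mfunT g') (gM : bddx M g) (g'M : bddx M g')
  (gd : derx M j g g').

Let M0 : 0 <= M. Proof. by apply: le_trans (gM t0). Qed.

Lemma derx_lip x h : `|g (tadd x (te j h)) - g x| <= M * (h ^+ 2 + `|h|).
Proof.
have := gd x h; have := ler_wpM2l (normr_ge0 h) (g'M x).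
have := ler_normD (g (tadd x (te j h)) - g x - h * g' x) (h * g' x).
by rewrite subrK normrM; lra.
Qed.

Lemma measurable_affine (s : R) x (f : n.-tuple R -> R) : mfunT f ->
  mfunT (fun z => f (tadd x (tsc s z))).
Proof.
move=> mf; apply: measurableT_comp => //; apply: measurable_tadd => //.
exact: measurable_tsc.
Qed.

Lemma kap_rho_bound m : exists2 C : R, 0 < C & forall z, kap z * (rho z)^-1 ^+ m <= C * rho z.
Proof.
have [C C0 CP] := @kap_bound R n m.+1; exists C => // z.
have r0 := rho_gt0 z; rewrite exprVn ler_pdivrMr ?exprn_gt0//.
by apply: (le_trans (CP z)); rewrite exprS mulrA.
Qed.

Lemma intg_kapM (f : n.-tuple R -> R) (K : R) m : mfunT f ->
  (forall z, `|f z| <= K * (rho z)^-1 ^+ m) -> intg (lebn n) (fun z => f z * kap z).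
Proof.
move=> mf fK; have [C C0 CP] := kap_rho_bound m.
apply: (intg_dom _ (intgZ (K * C) intg_rho)).
  exact: measurable_funM mf measurable_kap.
move=> z; rewrite normrM (gtr0_norm (kap_gt0 z)).
have K0 : 0 <= K.
  have := le_trans (normr_ge0 _) (fK z); rewrite pmulr_lge0//.
  by rewrite exprn_gt0// invr_gt0 rho_gt0.
apply: (@le_trans _ _ (K * (kap z * (rho z)^-1 ^+ m))).
  rewrite mulrCA mulrC; apply: ler_wpM2l; last exact: fK.
  exact/ltW/kap_gt0.
by rewrite -mulrA; apply: ler_wpM2l.
Qed.

(** [D] is the derivative along [z_j] of the product [G]. The integral of [G] is invariant under
    shifts of [z], while the remainder [G (z + h e_j) - G z - h D z] is at most [K h^2 rho z];
    integrating and dividing by [h] leaves a zero integral for [D]. *)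
Lemma gaussian_ibp (s : R) x :
  \int[lebn n]_z (tnth z j * g (tadd x (tsc s z)) * kap z) =
  s * \int[lebn n]_z (g' (tadd x (tsc s z)) * kap z).
Proof.
pose G z := g (tadd x (tsc s z)) * kap z.
pose D z := s * (g' (tadd x (tsc s z)) * kap z) - tnth z j * g (tadd x (tsc s z)) * kap z.
have rV z : 1 <= (rho z)^-1 by rewrite invf_ge1 ?rho_gt0// rho_le1.
have iG : intg (lebn n) G.
  apply: (@intg_kapM _ M 0); first exact: measurable_affine.
  by move=> z; rewrite expr0 mulr1.
have iD1 : intg (lebn n) (fun z => g' (tadd x (tsc s z)) * kap z).
  apply: (@intg_kapM _ M 0); first exact: measurable_affine.
  by move=> z; rewrite expr0 mulr1.
have mt : mfunT (fun z : n.-tuple R => tnth z j) by exact: measurable_tnth.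
have iD2 : intg (lebn n) (fun z => tnth z j * g (tadd x (tsc s z)) * kap z).
  apply: (@intg_kapM _ M 1); first by apply: measurable_funM => //; exact: measurable_affine.
  move=> z; rewrite expr1 normrM mulrC ler_pM//; exact: norm_tnth_le.
have iD : intg (lebn n) D by apply: intgB => //; exact: intgZ.
suff : \int[lebn n]_z D z = 0.
  rewrite IntB//; last exact: intgZ.
  by rewrite IntZ// => /eqP; rewrite subr_eq0 => /eqP.
have [C1 C10 C1P] := kap_taylor.
have [C2 C20 C2P] := kap_rho_bound 0; have [C3 C30 C3P] := kap_rho_bound 1.
(* One term for each term of [mul_remainder]: the remainder of [kap], the remainder of [g], and the
   derivative of [kap] times the increment of [g]. *)
pose K := C1 * M + M * s ^+ 2 * C2 + M * (s ^+ 2 + `|s|) * C3.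
have rem z h : 0 < h <= 1 ->
    `|G (tadd z (te j h)) - G z - h * D z| <= K * h ^+ 2 * rho z.
  move=> /andP[h0 h1]; have r0 := rho_gt0 z.
  have hn : `|h| = h by rewrite gtr0_norm.
  have k1 := C1P z j h; rewrite hn in k1; have {}k1 := k1 h1.
  have := gd (tadd x (tsc s z)) (s * h).
  rewrite [s * h * _](_ : _ = h * (s * g' (tadd x (tsc s z)))); last by ring.
  move=> k2.
  have := @mul_remainder R (kap z) (kap (tadd z (te j h))) (- (tnth z j * kap z))
    (g (tadd x (tsc s z))) (g (tadd x (tsc s (tadd z (te j h)))))
    (s * g' (tadd x (tsc s z))) h (C1 * h ^+ 2 * rho z) (M * (s * h) ^+ 2).
  rewrite tsc_tadd tsc_te taddA [h * - _]mulrN opprK => /(_ k1 k2).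
  have -> : G (tadd z (te j h)) = kap (tadd z (te j h)) *
      g (tadd (tadd x (tsc s z)) (te j (s * h))).
    by rewrite /G tsc_tadd tsc_te taddA mulrC.
  have -> : h * D z = h * (- (tnth z j * kap z) * g (tadd x (tsc s z)) +
      kap z * (s * g' (tadd x (tsc s z)))) by rewrite /D; ring.
  rewrite /G [g (tadd x (tsc s z)) * kap z]mulrC => /le_trans; apply.
  have n1 : C1 * h ^+ 2 * rho z * `|g (tadd (tadd x (tsc s z)) (te j (s * h)))| <=
      C1 * M * h ^+ 2 * rho z.
    have P0 : 0 <= C1 * h ^+ 2 * rho z by rewrite !mulr_ge0 ?sqr_ge0 ?ltW.
    by have := ler_wpM2l P0 (gM (tadd (tadd x (tsc s z)) (te j (s * h)))); lra.
  have n2 : `|kap z| * (M * (s * h) ^+ 2) <= M * s ^+ 2 * C2 * h ^+ 2 * rho z.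
    rewrite gtr0_norm ?kap_gt0//; have := C2P z; rewrite expr0 mulr1 => c2.
    have P0 : 0 <= M * (s * h) ^+ 2 by rewrite mulr_ge0 ?sqr_ge0.
    by have := ler_wpM2r P0 c2; rewrite exprMn; lra.
  have n3 : `|h| * `|- (tnth z j * kap z)| *
      `|g (tadd (tadd x (tsc s z)) (te j (s * h))) - g (tadd x (tsc s z))| <=
      M * (s ^+ 2 + `|s|) * C3 * h ^+ 2 * rho z.
    rewrite hn normrN normrM (gtr0_norm (kap_gt0 z)).
    have l1 : `|g (tadd (tadd x (tsc s z)) (te j (s * h))) - g (tadd x (tsc s z))| <=
        M * (s ^+ 2 + `|s|) * h.
      apply: (le_trans (derx_lip _ _)); rewrite -mulrA; apply: ler_wpM2l => //.
      rewrite exprMn normrM hn mulrDl lerD2r; apply: ler_wpM2l; first exact: sqr_ge0.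
      by rewrite expr2 ler_piMl// ltW.
    have l2 : `|tnth z j| * kap z <= C3 * rho z.
      apply: le_trans (C3P z); rewrite expr1 mulrC; apply: ler_wpM2l.
        exact/ltW/kap_gt0.
      exact: norm_tnth_le.
    have P0 : 0 <= h * (`|tnth z j| * kap z) by rewrite !mulr_ge0 ?normr_ge0 ?(ltW h0) ?(ltW (kap_gt0 _)).
    have := ler_pM P0 (normr_ge0 _) (ler_wpM2l (ltW h0) l2) l1; lra.
  by rewrite /K; lra.
apply: (@eq0_small _ _ (K * \int[lebn n]_z rho z)) => h /andP[h0 h1].
have iGs : intg (lebn n) (fun z => G (tadd z (te j h))).
  exact: mpres_intg (lebn_shift_mpres (te j h)) iG.
have eqG : \int[lebn n]_z G (tadd z (te j h)) = \int[lebn n]_z G z.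
  exact: mpres_Int (lebn_shift_mpres (te j h)) iG.
have := @Int_norm_le _ _ _ (lebn n) (fun z => G (tadd z (te j h)) - G z - h * D z)
  (fun z => K * h ^+ 2 * rho z).
rewrite IntB; [|exact: intgB|exact: intgZ]; rewrite IntB// eqG subrr sub0r normrN.
rewrite (IntZ _ iD) (IntZ _ intg_rho).
rewrite normrM gtr0_norm// => le.
rewrite -(ler_pM2l h0) [leRHS](_ : _ = K * h ^+ 2 * \int[lebn n]_z rho z); last by ring.
apply: le.
- by apply: (@intg_measurable _ _ _ (lebn n)); apply: intgB; [exact: intgB|exact: intgZ].
- exact: intgZ intg_rho.
- by move=> z; apply: rem; rewrite h0 h1.
Qed.

End gaussian_ibp.

(** Differences of two such functions are indicators of half-open intervals, and they keep the sign
    of an oriented integral when the endpoints are exchanged. *)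
Definition ltI {R : realType} (a b : R) : R := if a < b then 1 else 0.

Lemma measurable_ltI d (T : measurableType d) (R : realType) (f g : T -> R) :
  mfunT f -> mfunT g -> mfunT (fun x => ltI (f x) (g x)).
Proof.
by move=> mf mg; apply: measurable_fun_ifT => //; exact: measurable_fun_ltr.
Qed.

Lemma ltI_ge0 (R : realType) (a b : R) : 0 <= ltI a b.
Proof. by rewrite /ltI; case: ifP. Qed.

Lemma ltI_le1 (R : realType) (a b : R) : ltI a b <= 1.
Proof. by rewrite /ltI; case: ifP. Qed.

Lemma norm_ltI_le1 (R : realType) (a b : R) : `|ltI a b| <= 1.
Proof. by rewrite ger0_norm ?ltI_ge0// ltI_le1. Qed.

Lemma ltI_indic (R : realType) (a b : R) : a <= b ->
  (fun r : R => ltI a r - ltI b r) = \1_(`]a, b]%classic : set R).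
Proof.
move=> ab; apply/funext => r; rewrite indicE /ltI.
case: ltP => ar; case: ltP => br; rewrite ?subrr ?subr0 ?sub0r.
- by rewrite memNset//= in_itv/= => /andP[_]; rewrite leNgt br.
- by rewrite mem_set//= in_itv/= ar br.
- by move: (lt_le_trans br ar); rewrite ltNge ab.
- by rewrite memNset//= in_itv/= ltNge ar.
Qed.

Lemma intg_ltI (R : realType) (a b : R) : a <= b ->
  intg lebR (fun r : R => ltI a r - ltI b r) /\
  \int[lebR]_r (ltI a r - ltI b r) = b - a.
Proof.
move=> ab; have E := ltI_indic ab.
have mE : measurable (`]a, b]%classic : set R) by [].
have lE : lebR `]a, b]%classic = (b - a)%:E.
  rewrite /lebR lebesgue_measure_itv/= lte_fin; case: ltP => // ba.
  by rewrite (_ : b = a) ?subrr//; apply/eqP; rewrite eq_le ab ba.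
have iE : (\int[lebR]_x (\1_(`]a, b]%classic : set R) x)%:E = (b - a)%:E)%E.
  by rewrite integral_indic// setIT; exact: lE.
rewrite E; split; last by rewrite /Rintegral iE.
apply: intg_ge0P => [|r|]; [exact: measurable_indic|by rewrite indicE|].
by apply: le_lt_trans (ltry (b - a)); rewrite le_eqVlt; apply/orP; left; apply/eqP.
Qed.

(** * Fundamental theorem on the half-line *)

Section half_line.
Context {R : realType}.
Variables (F F' : R -> R) (C : R).
Hypotheses (mF : mfunT F) (mF' : mfunT F') (FC : forall r, `|F r| <= C * jap r)
  (F'C : forall r, `|F' r| <= C * jap r)
  (Fd : forall r h, 0 < h <= 1 -> `|F (r + h) - F r - h * F' r| <= C * h ^+ 2 * jap r).

Let C0 : 0 <= C.
Proof. by have := le_trans (normr_ge0 _) (FC 0); rewrite pmulr_lge0// jap_gt0. Qed.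

(** A shift by [h] shows that the integral of [F (r + h) - F r] over [r > 0] is minus the integral
    of [F] over []0, h]], which is [- h * F 0] up to [O(h^2)]. *)
Lemma half_line_ftc : \int[lebR]_r (ltI 0 r * F' r) = - F 0.
Proof.
have ij := @intg_jap R.
have mpos (a : R) : mfunT (fun r : R => ltI a r) by exact: measurable_ltI.
have iF : intg lebR F by apply: (intg_dom mF (intgZ C ij)).
have iF' : intg lebR F' by apply: (intg_dom mF' (intgZ C ij)).
have iP (a : R) f : intg lebR f -> intg lebR (fun r => ltI a r * f r).
  by move=> fi; apply: (intgM_bounded (mpos a) (norm_ltI_le1 a) fi).
apply/eqP; rewrite -addr_eq0; apply/eqP.
apply: (@eq0_small _ _ (C * (\int[lebR]_r jap r) + 2 * C)) => h /andP[h0 h1].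
have iFs : intg lebR (fun r => F (r + h)) by exact: mpres_intg (lebR_shift_mpres h) iF.
have e1 : \int[lebR]_r (ltI 0 r * F (r + h)) = \int[lebR]_r (ltI h r * F r).
  rewrite -(mpres_Int (lebR_shift_mpres h) (iP h _ iF)).
  by apply: Int_eq => r; rewrite /ltI ltrDr.
have [ik Ik] := intg_ltI (ltW h0).
have ikF : intg lebR (fun r => (ltI 0 r - ltI h r) * F r).
  by apply: intg_eq (intgB (iP 0 _ iF) (iP h _ iF)) => r; rewrite mulrBl.
have e2 : \int[lebR]_r (ltI 0 r * (F (r + h) - F r - h * F' r)) =
    - (\int[lebR]_r ((ltI 0 r - ltI h r) * F r)) - h * \int[lebR]_r (ltI 0 r * F' r).
  have -> : \int[lebR]_r ((ltI 0 r - ltI h r) * F r) =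
    (\int[lebR]_r (ltI 0 r * F r)) - \int[lebR]_r (ltI h r * F r).
    by rewrite -IntB; [apply: Int_eq => r; rewrite mulrBl|exact: iP|exact: iP].
  rewrite -e1 (@Int_eq _ _ _ lebR _ (fun r => ltI 0 r * F (r + h) - ltI 0 r * F r -
    h * (ltI 0 r * F' r))); last by move=> r; ring.
  rewrite IntB; last 2 first.
  - by apply: intgB; exact: iP.
  - by apply: intgZ; exact: iP.
  rewrite IntB; [|exact: iP|exact: iP]; rewrite IntZ; last exact: iP.
  by ring.
have b1 : `|\int[lebR]_r (ltI 0 r * (F (r + h) - F r - h * F' r))| <=
    C * h ^+ 2 * \int[lebR]_r jap r.
  rewrite -IntZ//; apply: Int_norm_le; last 2 first.
  - exact: intgZ.
  - move=> r; rewrite normrM -[leRHS]mul1r; apply: ler_pM => //; first exact: norm_ltI_le1.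
    by apply: Fd; rewrite h0.
  apply: measurable_funM => //.
  by apply: (@intg_measurable _ _ _ lebR); apply: intgB; [exact: intgB|exact: intgZ].
(* On []0, h]] the Taylor bound at 0 keeps [F] within [2 * C * h] of [F 0]. *)
have b2 : `|(\int[lebR]_r ((ltI 0 r - ltI h r) * F r)) - h * F 0| <= 2 * C * h * h.
  have -> : h * F 0 = \int[lebR]_r ((ltI 0 r - ltI h r) * F 0).
    by rewrite IntZr// Ik subr0.
  rewrite -IntB//; last by apply: intg_eq (intgZ (F 0) ik) => r; rewrite mulrC.
  have -> : 2 * C * h * h = \int[lebR]_r ((2 * C * h) * (ltI 0 r - ltI h r)).
    by rewrite IntZ// Ik subr0.
  apply: Int_norm_le; last 2 first.
  - exact: intgZ.
  - move=> r; rewrite -mulrBr normrM /ltI.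
    case: ltP => r0; case: ltP => hr.
    + by rewrite subrr normr0 mul0r mulr0.
    + rewrite subr0 normr1 mul1r mulr1.
      have := @Fd 0 r; rewrite add0r r0 (le_trans hr h1) => /(_ isT).
      have := F'C 0; have := @jap_le1 R 0; have := ler_normD (F r - F 0 - r * F' 0) (r * F' 0).
      rewrite subrK normrM (gtr0_norm r0) => a1 a2 a3 a4.
      have a5 : C * jap 0 <= C by rewrite ler_piMr.
      have a6 : r * `|F' 0| <= h * C.
        by apply: ler_pM; rewrite ?(ltW r0)//; exact: le_trans a3 a5.
      have a7 : C * r ^+ 2 * jap 0 <= C * h.
        have r2 : r ^+ 2 <= h by rewrite expr2 (le_trans _ hr)// ler_piMr ?(ltW r0)// (le_trans hr).
        have := ler_wpM2l C0 r2; apply: le_trans.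
        by rewrite ler_piMr// mulr_ge0 ?sqr_ge0.
      lra.
    + by have := lt_le_trans hr r0; rewrite ltNge (ltW h0).
    + by rewrite subrr normr0 mul0r mulr0.
  apply: (@intg_measurable _ _ _ lebR); apply: intgB => //.
  by apply: intg_eq (intgZ (F 0) ik) => r; rewrite mulrC.
rewrite -(ler_pM2l h0).
have -> : h * `|(\int[lebR]_r (ltI 0 r * F' r)) + F 0| =
    `|h * (\int[lebR]_r (ltI 0 r * F' r)) + h * F 0|.
  by rewrite -mulrDr normrM (gtr0_norm h0).
move: b1 b2; rewrite e2.
set I1 := \int[lebR]_r (_ * F r); set I2 := \int[lebR]_r (_ * F' r) => b1 b2.
have -> : h * I2 + h * F 0 = - (- I1 - h * I2) - (I1 - h * F 0) by ring.
apply: (le_trans (ler_normB _ _)); rewrite normrN.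
lra.
Qed.

End half_line.

(** * The kernel of the resolvent of the Laplacian *)

Section kernel.
Context {R : realType} {n : nat}.
Implicit Types (x z : n.-tuple R) (r : R) (w : R * n.-tuple R).

(** The Gaussian normalization $(2\pi)^{n/2}$. *)
Definition mass : R := \int[lebn n]_z kap (z : n.-tuple R).

Lemma intg_gau : intg lebR (@gau R).
Proof.
have [C C0 CP] := @gau_bound R 1.
apply: (intg_dom measurable_gau (intgZ C intg_jap)) => r.
by rewrite (gtr0_norm (gau_gt0 r)); have := CP r; rewrite expr1.
Qed.

Lemma intg_kap : intg (lebn n) (@kap R n).
Proof. exact: intg_lebn_prod intg_gau. Qed.

Lemma mass_gt0 : 0 < mass.
Proof.
rewrite /mass /kap Int_lebn_prod; last exact: intg_gau.
apply: exprn_gt0; have [i1 I1] := @intg_ltI R 0 1 ler01.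
have c0 : 0 < expR (- (1 / 2)) :> R by exact: expR_gt0.
apply: (@lt_le_trans _ _ (expR (- (1 / 2)) * \int[lebR]_r (ltI 0 r - ltI 1 r))).
  by rewrite I1 subr0 mulr1.
rewrite -IntZ//; apply: Int_le; [exact: intgZ|exact: intg_gau|].
move=> r; rewrite /ltI; case: ltP => r0; case: ltP => r1; rewrite ?subrr ?mulr0 ?subr0 ?mulr1.
- exact/ltW/gau_gt0.
- rewrite /gau ler_expR lerN2 ler_pM2r ?invr_gt0//.
  by rewrite expr_le1// ltW.
- by move: (lt_le_trans r1 r0); rewrite ltNge ler01.
- exact/ltW/gau_gt0.
Qed.

(* Averaging [g (x - r z)] over [w = (r, z)] against [ker None] gives [(1 - Delta)^-1 g],
   since [r e^(-r^2/2) dr] turns the Gaussian semigroup at time [r^2/2] into its Laplace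
   transform; one Gaussian integration by parts shows that [ker (Some j)] gives
   [d_j (1 - Delta)^-1 g]. *)
Definition ker (k : option 'I_n) w : R :=
  mass^-1 * (ltI 0 w.1 * gau w.1 * (if k is Some j then - tnth w.2 j else w.1) * kap w.2).

Lemma measurable_ker k : mfunT (ker k).
Proof.
apply: measurable_funM => //; apply: measurable_funM; last first.
  exact: measurableT_comp measurable_kap measurable_snd.
apply: measurable_funM.
  apply: measurable_funM; first by apply: measurable_ltI.
  exact: measurableT_comp measurable_gau measurable_fst.
case: k => [j|]; last exact: measurable_fst.
apply: (measurableT_comp (@oppr_measurable R setT)).
by apply: (measurableT_comp (measurable_tnth j)).
Qed.

(** The factor [wgt] is the price of translating the weight [rho] by [r z]; including it lets the
    kernel act on functions controlled by [rho]. *)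
Definition kerbound (C : R) k := forall w,
  `|ker k w| * wgt (tsc w.1 w.2) <= C * (jap w.1 * rho w.2).

Lemma ker_bound : exists2 C : R, 0 < C & forall k, kerbound C k.
Proof.
(* Origin of the exponents: [wgt_tsc] costs [n] powers of [(jap r)^-1] and one of [(rho z)^-1], the
   linear factor of [ker] costs one more of each, and one power of [jap r] and of [rho z] has to
   remain. *)
have [G G0 GP] := @gau_bound R n.+2; have [K K0 KP] := @kap_rho_bound R n 2.
exists (mass^-1 * 2 ^+ n * G * K).
  by rewrite !mulr_gt0// ?invr_gt0 ?mass_gt0// exprn_gt0.
move=> k [r z] /=; have j0 := jap_gt0 r; have r0 := rho_gt0 z.
have rV : 1 <= (rho z)^-1 by rewrite invf_ge1 ?rho_le1.
have jV : 1 <= (jap r)^-1 by rewrite invf_ge1 ?jap_le1.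
have jE : (jap r)^-1 = 1 + r ^+ 2 by rewrite /jap invrK.
have g0 := gau_gt0 r; have k0 := kap_gt0 z; have m0 := mass_gt0.
pose b := (if k is Some j then - tnth z j else r).
have bb : `|b| <= (jap r)^-1 * (rho z)^-1.
  rewrite /b; case: (k) => [j|].
    rewrite normrN (le_trans (norm_tnth_le z j))// ler_peMl// invr_ge0 ltW//.
  apply: (@le_trans _ _ (jap r)^-1); last by rewrite ler_peMr// invr_ge0 ltW.
  rewrite jE; have := sqr_ge0 (`|r| - 1); rewrite -(real_normK (num_real r)).
  by have := sqr_ge0 `|r|; lra.
have kb : `|ker k (r, z)| <= mass^-1 * (gau r * ((jap r)^-1 * (rho z)^-1) * kap z).
  rewrite /ker /= normrM (gtr0_norm (_ : 0 < mass^-1)) ?invr_gt0//.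
  rewrite ler_pM2l ?invr_gt0// 3!normrM (gtr0_norm g0) (gtr0_norm k0) ler_pM2r//.
  apply: ler_pM => //; first by rewrite mulr_ge0// ltW.
  by rewrite -[leRHS]mul1r ler_pM2r// norm_ltI_le1.
have gb : gau r * (jap r)^-1 ^+ n.+1 <= G * jap r.
  rewrite exprVn ler_pdivrMr ?exprn_gt0// -mulrA -exprS; exact: GP.
apply: (@le_trans _ _ (mass^-1 * (gau r * ((jap r)^-1 * (rho z)^-1) * kap z) *
    ((2 * (jap r)^-1) ^+ n * (rho z)^-1))).
  apply: ler_pM => //; first by apply: le_trans (wgt_ge1 _).
  by have := wgt_tsc r z; rewrite -jE.
have p1 : 0 <= gau r * (jap r)^-1 ^+ n.+1.
  by apply: mulr_ge0; [exact: ltW|apply: exprn_ge0; rewrite invr_ge0; exact: ltW].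
have p2 : 0 <= kap z * (rho z)^-1 ^+ 2.
  by apply: mulr_ge0; [exact: ltW|apply: exprn_ge0; rewrite invr_ge0; exact: ltW].
have H := ler_pM p1 p2 gb (KP z).
have c0 : 0 <= mass^-1 * 2 ^+ n by rewrite mulr_ge0 ?invr_ge0 ?exprn_ge0// ltW.
have := ler_wpM2l c0 H; rewrite [_ ^+ n.+1]exprS [(rho z)^-1 ^+ 2]expr2 => {}H.
rewrite [leLHS](_ : _ = mass^-1 * 2 ^+ n * (gau r * ((jap r)^-1 * (jap r)^-1 ^+ n) *
  (kap z * ((rho z)^-1 * (rho z)^-1)))); last by rewrite exprMn; ring.
by apply: (le_trans H); rewrite [leLHS](_ : _ = mass^-1 * 2 ^+ n * G * K * (jap r * rho z)); last by ring.
Qed.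

Lemma intg_jap_rho : intg (@must R n) (fun w => jap w.1 * rho w.2).
Proof. exact: intg_tensor intg_jap intg_rho. Qed.

Lemma intg_kerW k : intg (@must R n) (fun w => `|ker k w| * wgt (tsc w.1 w.2)).
Proof.
have [C C0 CP] := ker_bound.
apply: (intg_dom _ (intgZ C intg_jap_rho)).
  apply: measurable_funM.
    by apply: measurableT_comp => //; exact: measurable_ker.
  by apply: measurableT_comp measurable_wgt _; apply: measurable_tsc.
by move=> w; rewrite normrM normr_id [`|wgt _|]ger0_norm ?(le_trans ler01 (wgt_ge1 _))//; exact: CP.
Qed.

Lemma intg_ker k : intg (@must R n) (ker k).
Proof.
apply: (intg_dom (measurable_ker k) (intg_kerW k)) => w.
by rewrite ler_peMr// wgt_ge1.
Qed.

(** Fubini yields measurability of a partial integral only under joint integrability. Multiplying by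
    the positive integrable [jap r] provides it, and the factor is divided out afterwards. *)
Lemma measurable_average (f : R * n.-tuple R -> R) (K : R) : mfunT f ->
  (forall w, `|f w| <= K) -> mfunT (fun r => \int[lebn n]_z (f (r, z) * kap z)).
Proof.
move=> mf fK.
have iF : intg (@must R n) (fun w => f w * (jap w.1 * kap w.2)).
  by apply: (intgM_bounded mf fK); exact: intg_tensor intg_jap intg_kap.
have /intg_measurable mF := intg_fubini1 iF.
rewrite (_ : (fun r => _) = (fun r => (jap r)^-1 *
    \int[lebn n]_z (f (r, z) * (jap r * kap z)))).
  apply: measurable_funM => //; rewrite (_ : (fun r => _) = fun r => 1 + r ^+ 2).
    by apply: measurable_funD => //; exact: measurable_funX.
  by apply/funext => r; rewrite /jap invrK.
apply/funext => r.
rewrite (@Int_eq _ _ _ (lebn n) (fun z => f (r, z) * (jap r * kap z))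
  (fun z => jap r * (f (r, z) * kap z))); last by move=> z; ring.
rewrite IntZ ?mulKf ?gt_eqF ?jap_gt0//.
apply: (intgM_bounded (M := K)) intg_kap => //.
exact: measurable_fun_pair2 mf.
Qed.

Definition ysub x w := tadd x (tsc (- w.1) w.2).

Lemma measurable_ysub x (f : n.-tuple R -> R) : mfunT f -> mfunT (fun w => f (ysub x w)).
Proof.
move=> mf; apply: measurableT_comp => //; apply: measurable_tadd => //.
by apply: measurable_tsc => //; apply: (measurableT_comp (@oppr_measurable R setT)).
Qed.

Lemma Int_ker x (f : n.-tuple R -> R) (K : R) k : mfunT f -> bddx K f ->
  \int[@must R n]_w (f (ysub x w) * ker k w) =
  \int[lebR]_r (mass^-1 * (ltI 0 r * (gau r * \int[lebn n]_z
    ((if k is Some j then - tnth z j else r) * f (tadd x (tsc (- r) z)) * kap z)))).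
Proof.
move=> mf fK.
have i1 : intg (@must R n) (fun w => f (ysub x w) * ker k w).
  apply: (intgM_bounded (M := K)) (intg_ker k) => //; exact: measurable_ysub.
rewrite (Int_fubini1 i1); apply: Int_eq => r; rewrite !mulrA -IntZ; last first.
  have ma := measurable_affine (- r) x mf.
  case: (k) => [j|].
    apply: (@intg_kapM _ _ _ K 1).
      apply: measurable_funM => //; apply: (measurableT_comp (@oppr_measurable R setT)).
      exact: measurable_tnth.
    move=> z; rewrite expr1 normrM normrN mulrC ler_pM//; exact: norm_tnth_le.
  apply: (@intg_kapM _ _ _ (`|r| * K) 0); first exact: measurable_funM.
  by move=> z; rewrite expr0 mulr1 normrM ler_wpM2l.
by apply: Int_eq => z; rewrite /ker /ysub /=; ring.
Qed.

Lemma ker_der (M : R) (g g' : n.-tuple R -> R) j x : mfunT g -> mfunT g' ->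
  bddx M g -> bddx M g' -> derx M j g g' ->
  \int[@must R n]_w (g' (ysub x w) * ker None w) =
  \int[@must R n]_w (g (ysub x w) * ker (Some j) w).
Proof.
move=> mg mg' gM g'M gd; rewrite (Int_ker _ _ mg' g'M) (Int_ker _ _ mg gM).
apply: Int_eq => r; congr (_ * (_ * (_ * _))).
have ibp := gaussian_ibp mg mg' gM g'M gd (- r) x.
have i1 : intg (lebn n) (fun z => g' (tadd x (tsc (- r) z)) * kap z).
  apply: (@intg_kapM _ _ _ M 0); first exact: measurable_affine.
  by move=> z; rewrite expr0 mulr1.
have i2 : intg (lebn n) (fun z => tnth z j * g (tadd x (tsc (- r) z)) * kap z).
  apply: (@intg_kapM _ _ _ M 1).
    by apply: measurable_funM; [exact: measurable_tnth|exact: measurable_affine].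
  by move=> z; rewrite expr1 normrM mulrC ler_pM//; exact: norm_tnth_le.
rewrite (@Int_eq _ _ _ (lebn n) _ (fun z => r * (g' (tadd x (tsc (- r) z)) * kap z))); last first.
  by move=> z; ring.
rewrite [RHS](@Int_eq _ _ _ (lebn n) _ (fun z => - (tnth z j * g (tadd x (tsc (- r) z)) * kap z))); last first.
  by move=> z; ring.
by rewrite IntN// IntZ// ibp mulNr opprK.
Qed.

Variables (M : R) (g : n.-tuple R -> R) (g1 g2 : 'I_n -> n.-tuple R -> R).
Hypotheses (mg : mfunT g) (mg1 : forall j, mfunT (g1 j)) (mg2 : forall j, mfunT (g2 j))
  (gM : bddx M g) (g1M : forall j, bddx M (g1 j)) (g2M : forall j, bddx M (g2 j))
  (gd : forall j, derx M j g (g1 j)) (g1d : forall j, derx M j (g1 j) (g2 j))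
  (g1l : forall j, lipx M (g1 j)).

Let M0 : 0 <= M. Proof. by apply: le_trans (gM t0). Qed.

(** Let [av g r] be the Gaussian mean of [g (x - r z)]. Integration by parts gives its derivative in
    [r] as [r] times the mean of the Laplacian, so [F = gau * av g] has derivative
    [- r * gau r * av (g - Delta g) r]. Integrating over the half-line leaves [F 0 = g x * mass]. *)
Lemma ker_inv x :
  \int[@must R n]_w ((g (ysub x w) - \sum_j g2 j (ysub x w)) * ker None w) = g x.
Proof.
pose av f r := \int[lebn n]_z (f (tadd x (tsc (- r) z)) * kap z).
have iav (f : n.-tuple R -> R) K r : mfunT f -> bddx K f ->
    intg (lebn n) (fun z => f (tadd x (tsc (- r) z)) * kap z).
  move=> mf fK; apply: (@intg_kapM _ _ _ K 0); first exact: measurable_affine.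
  by move=> z; rewrite expr0 mulr1.
have mav (f : n.-tuple R -> R) K : mfunT f -> bddx K f -> mfunT (av f).
  move=> mf fK; rewrite /av.
  by apply: (@measurable_average (fun w => f (ysub x w)) K) => //; exact: measurable_ysub.
have bav (f : n.-tuple R -> R) K r : mfunT f -> bddx K f -> `|av f r| <= K * mass.
  move=> mf fK; rewrite /mass -IntZ; last exact: intg_kap.
  apply: Int_norm_le; last 2 first.
  - by apply: intgZ; exact: intg_kap.
  - by move=> z; rewrite normrM (gtr0_norm (kap_gt0 z)) ler_pM2r ?kap_gt0.
  exact: intg_measurable (iav _ _ r mf fK).
pose m' r := r * \sum_j av (g2 j) r.
(* The exponent 2 absorbs the square of [\sum_i |z_i|] that [derx_tadd] leaves. *)
have [K K0 KP] := @kap_rho_bound R n 2.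
have mass0 := mass_gt0.
pose Cm := 2 * M * n%:R ^+ 2 * K * \int[lebn n]_z rho (z : n.-tuple R).
have irho : intg (lebn n) (@rho R n) by exact: intg_rho.
have rho0 : 0 <= \int[lebn n]_z rho (z : n.-tuple R).
  by apply: Int_ge0 => z; exact/ltW/rho_gt0.
have Cm0 : 0 <= Cm by rewrite !mulr_ge0 ?sqr_ge0// ltW.
have md r h : `|av g (r + h) - av g r - h * m' r| <= Cm * h ^+ 2.
  have e j : \int[lebn n]_z (tnth z j * g1 j (tadd x (tsc (- r) z)) * kap z) = - r * av (g2 j) r.
    exact: gaussian_ibp (mg1 j) (mg2 j) (g1M j) (g2M j) (g1d j) (- r) x.
  have i1 j : intg (lebn n) (fun z => tnth z j * g1 j (tadd x (tsc (- r) z)) * kap z).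
    apply: (@intg_kapM _ _ _ M 1).
      by apply: measurable_funM; [exact: measurable_tnth|exact: measurable_affine].
    by move=> z; rewrite expr1 normrM mulrC ler_pM//; [exact: g1M|exact: norm_tnth_le].
  have e' : m' r = - \int[lebn n]_z (\sum_j tnth z j * g1 j (tadd x (tsc (- r) z)) * kap z).
    rewrite Int_sum// /m' mulr_sumr -sumrN; apply: eq_bigr => j _.
    by rewrite e mulNr opprK.
  have i2 := iav _ _ (r + h) mg gM; have i3 := iav _ _ r mg gM.
  have i4 : intg (lebn n) (fun z => \sum_j tnth z j * g1 j (tadd x (tsc (- r) z)) * kap z).
    exact: intg_sum.
  rewrite e' mulrN opprK /av -IntZ// -IntB// -IntD//; [|exact: intgB|exact: intgZ].
  have -> : Cm * h ^+ 2 = \int[lebn n]_z ((2 * M * n%:R ^+ 2 * h ^+ 2 * K) * rho (z : n.-tuple R)).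
    by rewrite IntZ// /Cm; ring.
  apply: Int_norm_le; last 2 first.
  - exact: intgZ.
  - move=> z; have k0 := kap_gt0 z; have r0 := rho_gt0 z.
    rewrite -mulr_suml mulrA -mulrBl -mulrDl normrM (gtr0_norm k0).
    have := @derx_tadd R n M g g1 (tadd x (tsc (- r) z)) (tsc (- h) z) M0 gd g1l.
    rewrite -taddA -tscD -opprD.
    rewrite (_ : \sum_i tnth (tsc (- h) z) i * g1 i _ =
      - (h * \sum_j tnth z j * g1 j (tadd x (tsc (- r) z)))); last first.
      rewrite mulr_sumr -sumrN; apply: eq_bigr => j _; rewrite tnth_tsc; ring.
    rewrite opprK => H.
    have sb : (\sum_i `|tnth (tsc (- h) z) i|) ^+ 2 <= h ^+ 2 * (n%:R ^+ 2 * (rho z)^-1 ^+ 2).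
      rewrite (_ : \sum_i _ = `|h| * \sum_i `|tnth z i|); last first.
        by rewrite mulr_sumr; apply: eq_bigr => i _; rewrite tnth_tsc normrM normrN.
      rewrite exprMn real_normK ?num_real//; apply: ler_wpM2l; first exact: sqr_ge0.
      rewrite -exprMn lerXn2r ?nnegrE ?sumr_ge0//; last exact: sum_norm_tnth_rho.
      by rewrite mulr_ge0// invr_ge0 ltW.
    have c0 : 0 <= 2 * M by rewrite mulr_ge0.
    have := ler_wpM2r (ltW k0) (le_trans H (ler_wpM2l c0 sb)).
    move=> /le_trans; apply.
    have c1 : 0 <= 2 * M * n%:R ^+ 2 * h ^+ 2.
      by rewrite mulr_ge0 ?sqr_ge0// mulr_ge0 ?sqr_ge0.
    have := ler_wpM2l c1 (KP z).
    set q := (rho z)^-1 ^+ 2; lra.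
  by apply: (@intg_measurable _ _ _ (lebn n)); apply: intgD; [exact: intgB|exact: intgZ].
(* Two powers absorb the factors [|r|] and [|r| * |r|] in [F'] and in its remainder; the third
   leaves [jap r]. *)
have [G G0 GP] := @gau_bound R 3.
have gb r : gau r * (1 + r ^+ 2) ^+ 2 <= G * jap r.
  have o0 := onesqr_gt0 r; have j0 := jap_gt0 r.
  rewrite -ler_pdivlMr ?exprn_gt0// -exprVn -/(jap r) -mulrA -exprS; exact: GP.
have rb r : `|r| <= 1 + r ^+ 2.
  by have := sqr_ge0 (`|r| - 1); rewrite -(real_normK (num_real r)); have := sqr_ge0 `|r|; lra.
have [D D0 DP] := @gau_taylor R.
pose F r := gau r * av g r.
pose F' r := - (r * gau r) * av g r + gau r * m' r.
have m'b r : `|m' r| <= `|r| * (n%:R * (M * mass)).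
  rewrite /m' normrM ler_wpM2l//; apply: (le_trans (ler_norm_sum _ _ _)).
  apply: (@le_trans _ _ (\sum_(j < n) (M * mass))).
    by apply: ler_sum => j _; exact: bav.
  by rewrite sumr_const card_ord mulr_natl.
have mm' : mfunT m'.
  apply: measurable_funM => //; apply: measurable_sum => j; exact: mav (g2M j).
have mag := mav _ _ mg gM.
have B0 : 0 <= M * mass by rewrite mulr_ge0// ltW.
have NB0 : 0 <= n%:R * (M * mass) by rewrite mulr_ge0.
pose C := D * (M * mass) + 2 * G * Cm + 2 * G * (n%:R * (M * mass)) + 2 * G * (M * mass).
have gq1 r : gau r <= G * jap r.
  apply: le_trans (gb r); rewrite ler_peMr ?(ltW (gau_gt0 r))//.
  by rewrite exprn_ege1//; have := sqr_ge0 r; lra.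
have gqr r : gau r * `|r| <= G * jap r.
  apply: le_trans (gb r); rewrite ler_pM2l ?gau_gt0// (le_trans (rb r))//.
  by rewrite expr2 ler_peMr//; have := sqr_ge0 r; lra.
have gqr2 r : gau r * (`|r| * `|r|) <= G * jap r.
  by apply: le_trans (gb r); rewrite ler_pM2l ?gau_gt0// expr2 ler_pM.
have DB0 : 0 <= D * (M * mass) by rewrite mulr_ge0// ltW.
have GC0 : 0 <= G * Cm by rewrite mulr_ge0// ltW.
have GNB0 : 0 <= G * (n%:R * (M * mass)) by rewrite mulr_ge0// ltW.
have GB0 : 0 <= G * (M * mass) by rewrite mulr_ge0// ltW.
have F'b r : `|F' r| <= C * jap r.
  rewrite /F'; apply: (le_trans (ler_normD _ _)).
  rewrite normrM normrN [`|r * gau r|]normrM [`|gau r * m' r|]normrM.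
  rewrite (gtr0_norm (gau_gt0 r)) [`|r| * _]mulrC.
  have g0 := ltW (gau_gt0 r); have gr0 : 0 <= gau r * `|r| by rewrite mulr_ge0.
  have h1 := ler_pM gr0 (normr_ge0 _) (gqr r) (bav _ _ r mg gM).
  have h2 : gau r * `|m' r| <= G * jap r * (n%:R * (M * mass)).
    apply: (@le_trans _ _ (gau r * (`|r| * (n%:R * (M * mass))))); first exact: ler_wpM2l.
    by rewrite [leLHS]mulrA ler_wpM2r.
  have j0 := ltW (jap_gt0 r).
  have := mulr_ge0 j0 DB0; have := mulr_ge0 j0 GC0; have := mulr_ge0 j0 GNB0.
  by have := mulr_ge0 j0 GB0; rewrite /C; lra.
have hl : \int[lebR]_r (ltI 0 r * F' r) = - F 0.
  apply: (@half_line_ftc R F F' C).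
  - exact: measurable_funM measurable_gau mag.
  - apply: measurable_funD; apply: measurable_funM => //; last exact: measurable_gau.
    apply: (measurableT_comp (@oppr_measurable R setT)).
    exact: measurable_funM measurable_gau.
  - move=> r; rewrite /F normrM (gtr0_norm (gau_gt0 r)).
    have := ler_pM (ltW (gau_gt0 r)) (normr_ge0 _) (gq1 r) (bav _ _ r mg gM).
    move=> /le_trans; apply; have j0 := ltW (jap_gt0 r).
    have := mulr_ge0 j0 DB0; have := mulr_ge0 j0 GC0; have := mulr_ge0 j0 GNB0.
    by have := mulr_ge0 j0 GB0; rewrite /C; lra.
  - exact: F'b.
  - move=> r h /andP[h0 h1]; have j0 := ltW (jap_gt0 r).
    have hn : `|h| = h by rewrite gtr0_norm.
    have t1 : `|gau (r + h) - gau r - h * - (r * gau r)| <= D * h ^+ 2 * jap r.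
      by rewrite mulrN opprK; apply: DP; rewrite hn.
    have := mul_remainder t1 (md r h); rewrite -/(F (r + h)) -/(F r) -/(F' r).
    move=> /le_trans; apply.
    have g0 := ltW (gau_gt0 r); have h20 := sqr_ge0 h.
    have n1 : D * h ^+ 2 * jap r * `|av g (r + h)| <= D * h ^+ 2 * jap r * (M * mass).
      by apply: ler_wpM2l; [rewrite !mulr_ge0// ltW|exact: bav].
    have n2 : `|gau r| * (Cm * h ^+ 2) <= G * jap r * (Cm * h ^+ 2).
      by rewrite (ger0_norm g0) ler_wpM2r// mulr_ge0.
    have n3 : `|h| * `|- (r * gau r)| * `|av g (r + h) - av g r| <=
        h ^+ 2 * (G * jap r * (Cm + n%:R * (M * mass))).
      have d1 : `|av g (r + h) - av g r| <= h * (Cm + `|r| * (n%:R * (M * mass))).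
        have := md r h; have := ler_normD (av g (r + h) - av g r - h * m' r) (h * m' r).
        rewrite subrK normrM hn.
        have := ler_wpM2l (ltW h0) (m'b r).
        have : Cm * h ^+ 2 <= Cm * h by rewrite ler_wpM2l// expr2 ler_piMr// ltW.
        lra.
      rewrite hn normrN normrM (ger0_norm g0).
      have p0 : 0 <= h * (`|r| * gau r) by rewrite !mulr_ge0// ltW.
      have := ler_wpM2l p0 d1 => /le_trans; apply.
      have := ler_wpM2r Cm0 (gqr r); have := ler_wpM2r NB0 (gqr2 r) => a1 a2.
      have := ler_wpM2l h20 (lerD a1 a2); rewrite expr2; lra.
    have := mulr_ge0 (mulr_ge0 h20 j0) DB0; have := mulr_ge0 (mulr_ge0 h20 j0) GC0.
    have := mulr_ge0 (mulr_ge0 h20 j0) GNB0; have := mulr_ge0 (mulr_ge0 h20 j0) GB0.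
    by rewrite /C; lra.
have mf : mfunT (fun y => g y - \sum_j g2 j y).
  by apply: measurable_funB => //; apply: measurable_sum.
have bf : bddx (M + n%:R * M) (fun y => g y - \sum_j g2 j y).
  move=> y; apply: (le_trans (ler_normB _ _)); rewrite lerD//.
  apply: (le_trans (ler_norm_sum _ _ _)).
  apply: (@le_trans _ _ (\sum_(j < n) M)); first by apply: ler_sum => j _; exact: g2M.
  by rewrite sumr_const card_ord mulr_natl.
rewrite (Int_ker _ _ mf bf).
have FE r : mass^-1 * (ltI 0 r * (gau r * \int[lebn n]_z
    (r * (g (tadd x (tsc (- r) z)) - \sum_j g2 j (tadd x (tsc (- r) z))) * kap z))) =
    - mass^-1 * (ltI 0 r * F' r).
  rewrite (@Int_eq _ _ _ (lebn n) _ (fun z => r * (g (tadd x (tsc (- r) z)) * kap z -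
    \sum_j (g2 j (tadd x (tsc (- r) z)) * kap z)))); last first.
    by move=> z; rewrite -mulr_suml; ring.
  have ig2 j := iav _ _ r (mg2 j) (g2M j); have ig := iav _ _ r mg gM.
  have is2 : intg (lebn n) (fun z => \sum_j g2 j (tadd x (tsc (- r) z)) * kap z).
    exact: intg_sum.
  rewrite IntZ; last exact: intgB.
  rewrite IntB// Int_sum// /F' /m' -/(av g r).
  by set S := \sum_j _; rewrite (_ : S = \sum_j av (g2 j) r)//; ring.
rewrite (@Int_eq _ _ _ lebR _ _ FE) IntZ; last first.
  apply: (intgM_bounded (M := 1)) => //; first exact: measurable_ltI.
    by move=> r; exact: norm_ltI_le1.
  apply: (intg_dom _ (intgZ C intg_jap)).
    apply: measurable_funD; apply: measurable_funM => //; last exact: measurable_gau.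
    apply: (measurableT_comp (@oppr_measurable R setT)).
    exact: measurable_funM measurable_gau.
  exact: F'b.
rewrite hl mulrNN /F /gau expr0n/= mul0r oppr0 expR0 mul1r.
have -> : av g 0 = g x * mass.
  rewrite /av /mass -IntZ; last exact: intg_kap.
  by apply: Int_eq => z; rewrite oppr0 tsc0 tadd0.
by rewrite mulrC mulfK// gt_eqF.
Qed.

End kernel.

(** The device of [measurable_average] in general form, with an arbitrary positive integrable
    [b]. *)
Lemma measurable_param d d' (T : measurableType d) (Q : measurableType d')
    (R : realType) (m : {sigma_finite_measure set T -> \bar R})
    (mq : {sigma_finite_measure set Q -> \bar R}) (b : Q -> R)
    (F : Q * T -> R) (K : T -> R) :
  (forall q, 0 < b q) -> intg mq b -> mfunT F -> intg m K ->
  (forall q t, `|F (q, t)| <= K t) -> mfunT (fun q => \int[m]_t F (q, t)).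
Proof.
move=> b0 ib mF iK FK; have mb := intg_measurable ib.
have iF : intg (mq \x m)%E (fun p => b p.1 * F p).
  apply: (intg_dom _ (intg_tensor ib iK)).
    by apply: measurable_funM => //; exact: measurableT_comp mb measurable_fst.
  by move=> -[q t]; rewrite normrM (gtr0_norm (b0 q)) ler_pM2l.
have /intg_measurable mI := intg_fubini1 iF.
rewrite (_ : (fun q => _) = (fun q => (b q)^-1 * \int[m]_t (b q * F (q, t)))).
  apply: measurable_funM => //.
  rewrite (_ : (fun q => _) = (fun q => b q `^ (-1))).
    exact: (measurableT_comp (@measurable_powR R (-1)) mb).
  by apply/funext => q; rewrite powR_inv1// ltW.
apply/funext => q; rewrite IntZ ?mulKf ?gt_eqF//.
exact: intg_dom (measurable_fun_pair2 q mF) iK (FK q).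
Qed.

Lemma geometric_squeeze (R : realType) (a b K : R) :
  (forall k : nat, a <= b + K * 2^-1 ^+ k) -> a <= b.
Proof.
move=> h; apply/ler_addgt0Pr => e e0.
have : (fun k => K * 2^-1 ^+ k) @ \oo --> (0 : R).
  rewrite -(mulr0 K); apply: cvgMr; apply: cvg_expr.
  by rewrite ger0_norm ?invr_ge0// invf_lt1// ltr1n.
move=> /cvgrPdist_lt /(_ e e0) [N _ /(_ N (leqnn N))] /=.
rewrite sub0r normrN => KN; apply: (le_trans (h N)); rewrite lerD2l.
exact: le_trans (ler_norm _) (ltW KN).
Qed.

(** * Resolvent and time-integral operators on bounded functions *)

Section operators.
Context {R : realType} {n : nat}.
Variable T : R.
Hypothesis T0 : 0 < T.
Implicit Types (p q w : R * n.-tuple R) (f u : R * n.-tuple R -> R).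

Definition bm (M : R) f := mfunT f /\ forall q, `|f q| <= M.
(** A pointwise bound by such a weight survives [Cv] at the cost of the constant [kmass]. Besides
    functions of time alone, the class contains their products with [rho]. *)
Definition wadm f := (forall q, 0 <= f q) /\
  forall t x y, f (t, tadd x y) <= f (t, x) * wgt y.
Definition yadd (x : n.-tuple R) w := tadd x (tsc w.1 w.2).
(* Convolution with the reflected kernel, so that [Cv (Some j)] is [- d_j (1 - Delta)^-1]. *)
Definition Cv (k : option 'I_n) f p : R :=
  \int[@must R n]_w (f (p.1, yadd p.2 w) * ker k w).
(** A sum over [k], so that a single constant bounds all [n + 1] operators. *)
Definition kmass : R := \sum_(k : option 'I_n) \int[@must R n]_w (`|ker k w| * wgt (tsc w.1 w.2)).

Lemma kmass_le k : \int[@must R n]_w (`|ker k w| * wgt (tsc w.1 w.2)) <= kmass.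
Proof.
rewrite /kmass (bigD1 k)//= lerDl; apply: sumr_ge0 => i _; apply: Int_ge0 => w.
by rewrite mulr_ge0//; apply: le_trans (wgt_ge1 _).
Qed.

Lemma kmass_ge0 : 0 <= kmass.
Proof.
apply: le_trans (kmass_le None); apply: Int_ge0 => w.
by rewrite mulr_ge0//; apply: le_trans (wgt_ge1 _).
Qed.

Lemma bm_ge0 M f : bm M f -> 0 <= M.
Proof. by move=> [_ /(_ (0, t0))]; exact: le_trans. Qed.

Lemma wadm_cst c : 0 <= c -> wadm (fun=> c).
Proof.
by move=> c0; split => // t x y; rewrite ler_peMr// wgt_ge1.
Qed.

Lemma measurable_yadd d (Q : measurableType d) (f : Q -> n.-tuple R) (g : Q -> R * n.-tuple R) :
  mfunT f -> mfunT g -> mfunT (fun a => yadd (f a) (g a)).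
Proof.
move=> mf mg; apply: measurable_tadd => //; apply: measurable_tsc.
  exact: measurableT_comp measurable_fst mg.
exact: measurableT_comp measurable_snd mg.
Qed.

Lemma measurable_Cv_integrand k f : mfunT f ->
  mfunT (fun pw : (R * n.-tuple R) * (R * n.-tuple R) =>
    f (pw.1.1, yadd pw.1.2 pw.2) * ker k pw.2).
Proof.
move=> mf; apply: measurable_funM; last first.
  exact: measurableT_comp (measurable_ker k) measurable_snd.
apply: measurableT_comp => //; apply: measurable_fun_pair => /=.
  exact: measurableT_comp measurable_fst measurable_fst.
apply: measurable_yadd => //; exact: measurableT_comp measurable_snd measurable_fst.
Qed.

Lemma Cv_dom k f W p w : wadm W -> (forall q, `|f q| <= W q) ->
  `|f (p.1, yadd p.2 w) * ker k w| <= W p * (`|ker k w| * wgt (tsc w.1 w.2)).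
Proof.
move=> [W0 WD] fW; rewrite normrM mulrCA [leRHS](_ : _ = (W p * wgt (tsc w.1 w.2)) * `|ker k w|); last by ring.
rewrite ler_wpM2r// (le_trans (fW _))//.
by case: p => t x; exact: WD.
Qed.

Lemma intg_Cv k f W p : mfunT f -> wadm W -> (forall q, `|f q| <= W q) ->
  intg (@must R n) (fun w => f (p.1, yadd p.2 w) * ker k w).
Proof.
move=> mf WP fW; apply: (intg_dom _ (intgZ (W p) (intg_kerW k))) => [|w].
  exact: (measurable_fun_pair2 p (measurable_Cv_integrand k mf)).
exact: Cv_dom.
Qed.

Lemma norm_Cv_le k f W p : mfunT f -> wadm W -> (forall q, `|f q| <= W q) ->
  `|Cv k f p| <= kmass * W p.
Proof.
move=> mf WP fW; apply: (@le_trans _ _ (W p * \int[@must R n]_w (`|ker k w| * wgt (tsc w.1 w.2)))).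
  rewrite -IntZ; last exact: intg_kerW.
  apply: Int_norm_le; last by move=> w; exact: Cv_dom.
    exact: (measurable_fun_pair2 p (measurable_Cv_integrand k mf)).
  exact: intgZ (intg_kerW k).
by rewrite mulrC ler_wpM2r ?kmass_le//; exact: WP.1.
Qed.

Lemma intg_bm_Cv k f M p : bm M f -> intg (@must R n) (fun w => f (p.1, yadd p.2 w) * ker k w).
Proof.
move=> fM; have M0 := bm_ge0 fM; exact: (intg_Cv k p fM.1 (wadm_cst M0) fM.2).
Qed.

Lemma measurable_bm_Cv k f M : bm M f -> mfunT (Cv k f).
Proof.
move=> fM; have M0 := bm_ge0 fM; have WP := wadm_cst M0.
apply: (@measurable_param _ _ _ _ _ (@must R n) (@must R n) (fun q => jap q.1 * rho q.2)
  (fun pw => f (pw.1.1, yadd pw.1.2 pw.2) * ker k pw.2) (fun w => M * (`|ker k w| * wgt (tsc w.1 w.2)))).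
- by move=> q; rewrite mulr_gt0 ?jap_gt0 ?rho_gt0.
- exact: intg_jap_rho.
- exact: measurable_Cv_integrand fM.1.
- exact: intgZ (intg_kerW k).
- by move=> q w /=; exact: (Cv_dom k q w WP fM.2).
Qed.

Lemma bm_Cv k f M : bm M f -> bm (kmass * M) (Cv k f).
Proof.
move=> fM; split; first exact: measurable_bm_Cv fM.
by move=> q; exact: (norm_Cv_le k q fM.1 (wadm_cst (bm_ge0 fM)) fM.2).
Qed.

Lemma Cv_sub k f g M M' p : bm M f -> bm M' g ->
  Cv k (fun q => f q - g q) p = Cv k f p - Cv k g p.
Proof.
move=> fM gM; rewrite /Cv -IntB; [|exact: intg_bm_Cv fM|exact: intg_bm_Cv gM].
by apply: Int_eq => w; rewrite mulrBl.
Qed.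

Lemma Cv_scale k f c M p : bm M f -> Cv k (fun q => c * f q) p = c * Cv k f p.
Proof.
move=> fM; rewrite /Cv -IntZ; last exact: intg_bm_Cv fM.
by apply: Int_eq => w; rewrite mulrA.
Qed.

Definition shx j (h : R) p : R * n.-tuple R := (p.1, tadd p.2 (te j h)).

Lemma measurable_shx j h : mfunT (shx j h).
Proof.
apply: measurable_fun_pair => //; apply: measurable_tadd => //.
Qed.

Lemma Cv_shx k f j h p : Cv k (fun q => f (shx j h q)) p = Cv k f (shx j h p).
Proof. by apply: Int_eq => w; rewrite /shx /yadd /= taddAC. Qed.

Lemma bm_shx f M j h : bm M f -> bm M (fun q => f (shx j h q)).
Proof.
move=> [mf fM]; split => [|q]; last exact: fM.
exact: measurableT_comp mf (measurable_shx j h).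
Qed.

Lemma bm_sub f g M M' : bm M f -> bm M' g -> bm (M + M') (fun q => f q - g q).
Proof.
move=> [mf fM] [mg gM]; split; first exact: measurable_funB.
by move=> q; apply: (le_trans (ler_normB _ _)); rewrite lerD.
Qed.

Lemma bm_add f g M M' : bm M f -> bm M' g -> bm (M + M') (fun q => f q + g q).
Proof.
move=> [mf fM] [mg gM]; split; first exact: measurable_funD.
by move=> q; apply: (le_trans (ler_normD _ _)); rewrite lerD.
Qed.

Lemma bm_mul f g M M' : bm M f -> bm M' g -> bm (M * M') (fun q => f q * g q).
Proof.
move=> [mf fM] [mg gM]; split; first exact: measurable_funM.
by move=> q; rewrite normrM ler_pM.
Qed.

Lemma bm_scale f c M : bm M f -> bm (`|c| * M) (fun q => c * f q).
Proof.
move=> [mf fM]; split; first exact: measurable_funM.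
by move=> q; rewrite normrM ler_wpM2l.
Qed.

Lemma bm_sum (I : finType) (f : I -> R * n.-tuple R -> R) M :
  (forall i, bm M (f i)) -> bm (#|I|%:R * M) (fun q => \sum_i f i q).
Proof.
move=> fM; split; first by apply: measurable_sum => i; exact: (fM i).1.
move=> q; apply: (le_trans (ler_norm_sum _ _ _)).
apply: (@le_trans _ _ (\sum_(i : I) M)); first by apply: ler_sum => i _; exact: (fM i).2.
by rewrite sumr_const mulr_natl.
Qed.

(** With time frozen outside [[0, T]], the time integral [It] is bounded and Lipschitz in time on
    the whole line. The function [chi t] is then the indicator of []0, clamp t]]. *)
Definition clamp (t : R) : R := Num.max 0 (Num.min t T).

Lemma clamp_ge0 t : 0 <= clamp t. Proof. by rewrite /clamp le_max lexx. Qed.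
Lemma clamp_leT t : clamp t <= T.
Proof. by rewrite /clamp ge_max ltW//= ge_min lexx orbT. Qed.
Lemma clamp_id t : 0 <= t <= T -> clamp t = t.
Proof. by move=> /andP[t0 tT]; rewrite /clamp min_l// max_r. Qed.
Lemma clamp_lip t t' : `|clamp t' - clamp t| <= `|t' - t|.
Proof.
rewrite /clamp !maxEle !minEle.
by repeat case: ifPn; rewrite -?ltNge => *; rewrite ?subrr ?normr0//;
  apply/ler_normlP; split; (have [?|?] := leP 0 (t' - t);
  [rewrite (@ger0_norm _ (t' - t))//|rewrite (@ltr0_norm _ (t' - t))//]); lra.
Qed.

Definition chi (t s : R) : R := ltI 0 s - ltI (clamp t) s.

Lemma chi_ge0 t s : 0 <= chi t s.
Proof.
rewrite /chi /ltI subr_ge0; case: ifPn => // h; case: ifPn => // /negP; case.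
exact: le_lt_trans (clamp_ge0 t) h.
Qed.

Lemma chi_le1 t s : chi t s <= 1.
Proof. by rewrite /chi; have := ltI_ge0 (clamp t) s; have := ltI_le1 0 s; lra. Qed.

Lemma chi_le_chiT t s : chi t s <= chi T s.
Proof.
rewrite /chi lerD2l lerN2 /ltI; case: ifPn => // h; case: ifPn => // /negP; case.
apply: le_lt_trans (clamp_leT t) _; move: h; rewrite clamp_id// lexx ltW//.
Qed.

Lemma measurable_chi2 : mfunT (fun ts : R * R => chi ts.1 ts.2).
Proof.
apply: measurable_funB; apply: measurable_ltI => //.
by apply: measurable_maxr => //; exact: measurable_minr.
Qed.

Lemma measurable_chi t : mfunT (chi t).
Proof. by apply: measurable_funB; apply: measurable_ltI. Qed.

Lemma intg_chi t : intg lebR (chi t).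
Proof. by have [] := intg_ltI (clamp_ge0 t). Qed.

Lemma Int_chi t : \int[lebR]_s chi t s = clamp t.
Proof. by have [_] := intg_ltI (clamp_ge0 t); rewrite subr0. Qed.

Definition It f p : R := \int[lebR]_s (chi p.1 s * f (s, p.2)).

Lemma measurable_section2 f (x : n.-tuple R) : mfunT f -> mfunT (fun s => f (s, x)).
Proof. exact: measurable_fun_pair1. Qed.

Lemma intg_It f M p : bm M f -> intg lebR (fun s => chi p.1 s * f (s, p.2)).
Proof.
move=> [mf fM]; apply: (intg_dom _ (intgZ M (intg_chi p.1))).
  by apply: measurable_funM; [exact: measurable_chi|exact: measurable_section2].
by move=> s; rewrite normrM mulrC (ger0_norm (chi_ge0 _ _)) ler_wpM2r ?chi_ge0.
Qed.

Lemma It_sub f g M M' p : bm M f -> bm M' g ->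
  It (fun q => f q - g q) p = It f p - It g p.
Proof.
move=> fM gM; rewrite /It -IntB; [|exact: intg_It fM|exact: intg_It gM].
by apply: Int_eq => w; rewrite mulrBr.
Qed.

Lemma It_scale f c M p : bm M f -> It (fun q => c * f q) p = c * It f p.
Proof.
move=> fM; rewrite /It -IntZ; last exact: intg_It fM.
by apply: Int_eq => w; rewrite mulrCA.
Qed.

Lemma It_shx f j h p : It (fun q => f (shx j h q)) p = It f (shx j h p).
Proof. by []. Qed.

Lemma bm_It f M : bm M f -> bm (M * T) (It f).
Proof.
move=> [mf fM]; have M0 : 0 <= M by apply: le_trans (fM (0, t0)).
split.
  apply: (@measurable_param _ _ _ _ _ lebR (@must R n) (fun q => jap q.1 * rho q.2)
    (fun ps => chi ps.1.1 ps.2 * f (ps.2, ps.1.2)) (fun s => M * chi T s)).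
  - by move=> q; rewrite mulr_gt0 ?jap_gt0 ?rho_gt0.
  - exact: intg_jap_rho.
  - apply: measurable_funM.
      apply: (@measurableT_comp _ _ _ _ _ _ (fun ts : R * R => chi ts.1 ts.2) _
        (fun x : (R * n.-tuple R) * R => (x.1.1, x.2)) measurable_chi2).
      apply: measurable_fun_pair => //.
      exact: measurableT_comp measurable_fst measurable_fst.
    apply: measurableT_comp => //; apply: measurable_fun_pair => //.
    exact: measurableT_comp measurable_snd measurable_fst.
  - exact: intgZ (intg_chi T).
  - move=> q s /=; rewrite normrM mulrC (ger0_norm (chi_ge0 _ _)).
    by rewrite ler_pM ?chi_ge0 ?chi_le_chiT.
move=> q; have -> : M * T = \int[lebR]_s (M * chi T s).
  by rewrite IntZ ?Int_chi ?clamp_id ?lexx ?ltW//; exact: intg_chi.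
apply: Int_norm_le; last 2 first.
- exact: intgZ (intg_chi T).
- move=> s /=; rewrite normrM mulrC (ger0_norm (chi_ge0 _ _)).
  by rewrite ler_pM ?chi_ge0 ?chi_le_chiT.
by apply: measurable_funM; [exact: measurable_chi|exact: measurable_section2].
Qed.

End operators.

(** * Fundamental theorem of calculus in time *)

Section time_ftc.
Context {R : realType}.

Lemma intg_ltI_cont (f : R -> R) (a b : R) : a <= b -> continuous f ->
  intg lebR (fun s => (ltI a s - ltI b s) * f s).
Proof.
move=> ab cf; have [ic Ic] := intg_ltI ab.
have mf : mfunT f by exact: continuous_measurable_fun.
have [M [_ MP]] : bounded_set (f @` `[a, b]%classic).
  apply: compact_bounded; apply: continuous_compact; last exact: segment_compact.
  exact: continuous_subspaceT.
pose K := Num.max 0 M + 1.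
have KM : M < K by rewrite /K ltr_pwDr// le_max lexx orbT.
have K0 : 0 <= K by rewrite /K addr_ge0// le_max lexx.
apply: (intg_dom _ (intgZ K ic)).
  by apply: measurable_funM => //; exact: intg_measurable ic.
move=> s; rewrite normrM mulrC /ltI.
case: ltP => sa; case: ltP => sb; rewrite ?subrr ?normr0 ?mulr0// ?subr0 ?sub0r ?normrN ?normr1 ?mulr1.
  apply: (MP K KM); exists s => //=; rewrite in_itv/= sb andbT ltW//.
by have := lt_le_trans sb sa; rewrite ltNge ab.
Qed.

Lemma Int_ftc (F f : R -> R) (a b : R) : a <= b ->
  (forall x, is_derive x (1 : R) F (f x)) -> continuous f ->
  \int[lebR]_s ((ltI a s - ltI b s) * f s) = F b - F a.
Proof.
move=> ab dF cf.
have [->|anb] := eqVneq a b.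
  rewrite subrr (@Int_eq _ _ _ lebR _ (fun=> 0)) ?Int0// => s.
  by rewrite subrr mul0r.
have {anb}ab' : a < b by rewrite lt_neqAle anb.
have cF : continuous F.
  by move=> x; apply: differentiable_continuous; apply/derivable1_diffP; have := dF x.
have := @continuous_FTC2 R f F a b ab' (continuous_subspaceT cf) _ _.
have -> : (\int[lebesgue_measure]_(x in `[a, b]) (f x)%:E)%E =
   (\int[lebR]_s ((ltI a s - ltI b s) * f s)%:E)%E.
  have mf : mfunT f by exact: continuous_measurable_fun.
  have icb : (@lebesgue_measure R).-integrable `[a, b] (EFin \o f).
    exact: continuous_compact_integrable (@segment_compact _ _ _) (continuous_subspaceT cf).
  rewrite -integral_itv_obnd_cbnd; last first.
    by apply/measurable_EFinP; exact: measurable_funTS.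
  have {}icb : (@lebesgue_measure R).-integrable `]a, b] (EFin \o f).
    by apply: integrableS icb => //; exact: subset_itv_oc_cc.
  have mab : measurable (`]a, b]%classic : set R) by [].
  have e := integral_lebR mab icb; move: e; rewrite /Rintegral => e.
  rewrite -[LHS]fineK; last exact: integrable_fin_num icb.
  rewrite -e fineK; last by apply: integrable_fin_num => //; exact: integrable_lebR.
  rewrite integral_mkcond; apply: eq_integral => s _.
  have /(congr1 (fun g => g s)) /= -> := ltI_indic ab.
  by rewrite patchE indicE; case: ifP => _; rewrite ?mul1r ?mul0r.
move=> H; rewrite /Rintegral H -?EFinB//.
- split => //.
  + by apply: cvg_at_right_filter; exact: cF.
  + by apply: cvg_at_left_filter; exact: cF.
- by move=> x _; rewrite derive1E; apply: derive_val.
Qed.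

Lemma Int_expR (lam c : R) : 0 < lam -> 0 <= c ->
  intg lebR (fun s => (ltI 0 s - ltI c s) * expR (lam * s)) /\
  \int[lebR]_s ((ltI 0 s - ltI c s) * expR (lam * s)) <= expR (lam * c) / lam.
Proof.
move=> l0 c0.
have cE : continuous (fun s : R => expR (lam * s)).
  move=> s; apply: (@continuous_comp _ _ _ (fun s => lam * s) expR); last exact: continuous_expR.
  exact: mulrl_continuous.
split; first exact: intg_ltI_cont.
have dE (s : R) : is_derive s (1 : R) (fun s => lam^-1 * expR (lam * s)) (expR (lam * s)).
  have -> : expR (lam * s) = lam^-1 * (expR (lam * s) * (lam * 1)).
    by rewrite mulr1 mulrCA mulVf ?mulr1 ?gt_eqF.
  have h : is_derive s (1 : R) (lam *: (id : R -> R)) (lam *: (1 : R)) by apply: is_deriveZ.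
  by apply: is_deriveZ; apply: (@is_derive1_comp _ expR (fun s => lam * s)).
rewrite (Int_ftc c0 dE cE).
by rewrite mulr0 expR0 mulr1 mulrC lerBlDr lerDl invr_ge0 ltW.
Qed.

End time_ftc.

(** * The mild equation: estimates and Gronwall *)

Section mild.
Context {R : realType} {n : nat}.
Variable T : R.
Hypothesis T0 : 0 < T.
Implicit Types (p q w : R * n.-tuple R) (f u e : R * n.-tuple R -> R)
  (g : 'I_n -> R * n.-tuple R -> R) (ui : n.-tuple R -> R).
Local Notation It := (It T).
Local Notation clamp := (clamp T).
Local Notation kmass := (@kmass R n).

(* The equation [u_t + div g = Delta u + d_t Delta u] after applying [(1 - Delta)^-1], which
   maps [Delta u] to [- u + (1 - Delta)^-1 u]. *)
Definition Nop u g p : R := - u p + Cv None u p + \sum_j Cv (Some j) (g j) p.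
Definition Sol u ui g := forall p, u p = ui p.2 + It (Nop u g) p.

Lemma norm_Nop_le u g W W' p : mfunT u -> (forall j, mfunT (g j)) ->
  wadm W -> wadm W' -> (forall q, `|u q| <= W q) -> (forall j q, `|g j q| <= W' q) ->
  `|Nop u g p| <= (1 + kmass) * W p + n%:R * kmass * W' p.
Proof.
move=> mu mg WP W'P uW gW; rewrite /Nop mulrDl mul1r.
apply: (le_trans (ler_normD _ _)); apply: lerD.
  apply: (le_trans (ler_normD _ _)); rewrite normrN lerD//.
  exact: norm_Cv_le.
apply: (le_trans (ler_norm_sum _ _ _)).
apply: (@le_trans _ _ (\sum_(j < n) (kmass * W' p))).
  by apply: ler_sum => j _; apply: norm_Cv_le => //; exact: gW.
by rewrite sumr_const card_ord -[leRHS]mulrA mulr_natl.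
Qed.

Lemma bm_Nop u g M M' : bm M u -> (forall j, bm M' (g j)) ->
  bm (M + kmass * M + n%:R * (kmass * M')) (Nop u g).
Proof.
move=> uM gM; apply: bm_add; last first.
  have := @bm_sum R n 'I_n (fun j => Cv (Some j) (g j)) (kmass * M').
  by rewrite card_ord; apply => j; exact: bm_Cv.
apply: bm_add; last exact: bm_Cv.
by have := bm_scale (-1) uM; rewrite normrN1 mul1r; under eq_fun do rewrite mulN1r.
Qed.

Lemma Nop_sub u v g g' M p : bm M u -> bm M v ->
  (forall j, bm M (g j)) -> (forall j, bm M (g' j)) ->
  Nop (fun q => u q - v q) (fun j q => g j q - g' j q) p = Nop u g p - Nop v g' p.
Proof.
move=> uM vM gM g'M; rewrite /Nop (Cv_sub None p uM vM).
under eq_bigr do rewrite (Cv_sub _ p (gM _) (g'M _)).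
by rewrite sumrB; ring.
Qed.

Lemma Nop_scale u g c M p : bm M u -> (forall j, bm M (g j)) ->
  Nop (fun q => c * u q) (fun j q => c * g j q) p = c * Nop u g p.
Proof.
move=> uM gM; rewrite /Nop (Cv_scale None c p uM).
under eq_bigr do rewrite (Cv_scale _ c p (gM _)).
by rewrite -mulr_sumr; ring.
Qed.

Lemma Nop_shx u g j h p : Nop (fun q => u (shx j h q)) (fun i q => g i (shx j h q)) p =
  Nop u g (shx j h p).
Proof.
by rewrite /Nop Cv_shx; congr (_ + _); apply: eq_bigr => i _; rewrite Cv_shx.
Qed.

Lemma Sol_sub u v ui vi g g' M : bm M u -> bm M v ->
  (forall j, bm M (g j)) -> (forall j, bm M (g' j)) -> Sol u ui g -> Sol v vi g' ->
  Sol (fun q => u q - v q) (fun x => ui x - vi x) (fun j q => g j q - g' j q).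
Proof.
move=> uM vM gM g'M su sv p.
have -> : Nop (fun q => u q - v q) (fun j q => g j q - g' j q) =
    fun q => Nop u g q - Nop v g' q.
  by apply/funext => q; rewrite (Nop_sub q uM vM gM g'M).
rewrite (It_sub T p (bm_Nop uM gM) (bm_Nop vM g'M)) (su p) (sv p).
by rewrite opprD addrACA.
Qed.

Lemma Sol_scale u ui g c M : bm M u -> (forall j, bm M (g j)) -> Sol u ui g ->
  Sol (fun q => c * u q) (fun x => c * ui x) (fun j q => c * g j q).
Proof.
move=> uM gM su p.
have -> : Nop (fun q => c * u q) (fun j q => c * g j q) = fun q => c * Nop u g q.
  by apply/funext => q; rewrite (Nop_scale c q uM gM).
by rewrite (It_scale T c p (bm_Nop uM gM)) (su p) mulrDr.
Qed.

Lemma Sol_shx u ui g j h : Sol u ui g ->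
  Sol (fun q => u (shx j h q)) (fun x => ui (tadd x (te j h))) (fun i q => g i (shx j h q)).
Proof.
move=> su p; rewrite (su (shx j h p)) -(It_shx T (Nop u g)); congr (_ + It _ p).
by apply/funext => q; rewrite Nop_shx.
Qed.

Lemma bm_mono M M' f : M <= M' -> bm M f -> bm M' f.
Proof. by move=> MM' [mf fM]; split => // q; exact: le_trans MM'. Qed.

Definition expw lam (t : R) : R := expR (lam * clamp t).

Lemma expw_ge1 lam t : 0 <= lam -> 1 <= expw lam t.
Proof.
by move=> l0; rewrite /expw -expR0 ler_expR mulr_ge0// clamp_ge0.
Qed.

Lemma expw_le lam t : 0 <= lam -> expw lam t <= expR (lam * T).
Proof. by move=> l0; rewrite /expw ler_expR ler_wpM2l// clamp_leT. Qed.

(** Integrating [e^(lam s)] gains the factor [1 / lam]; this is the source of the halving in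
    [gronwall] and in the Picard iteration. *)
Lemma norm_It_le f lam a b p : mfunT f -> 0 < lam -> 0 <= a -> 0 <= b ->
  (forall s, `|f (s, p.2)| <= a * expw lam s + b) ->
  `|It f p| <= a / lam * expw lam p.1 + b * T.
Proof.
move=> mf l0 a0 b0 fb; have c0 := clamp_ge0 T p.1.
have [iE IE] := Int_expR l0 c0.
have i1 : intg lebR (fun s => a * (chi T p.1 s * expR (lam * s)) + b * chi T p.1 s).
  by apply: intgD; [exact: intgZ|apply: intgZ; exact: intg_chi].
apply: (@le_trans _ _ (\int[lebR]_s (a * (chi T p.1 s * expR (lam * s)) + b * chi T p.1 s))).
  apply: Int_norm_le => //.
    by apply: measurable_funM; [exact: measurable_chi|exact: measurable_section2].
  move=> s; rewrite normrM (ger0_norm (chi_ge0 _ _ _)).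
  apply: (@le_trans _ _ (chi T p.1 s * (a * expw lam s + b))).
    by rewrite ler_wpM2l ?chi_ge0.
  rewrite mulrDr [chi _ _ _ * b]mulrC lerD2r mulrCA ler_wpM2l// /chi /ltI.
  case: ltP => s0; case: ltP => sc; rewrite ?subrr ?mul0r// ?subr0 ?mul1r.
    rewrite /expw clamp_id// ltW//= (le_trans sc)//; exact: clamp_leT.
  by have := lt_le_trans sc s0; rewrite ltNge c0.
rewrite IntD; [|exact: intgZ|by apply: intgZ; exact: intg_chi].
rewrite !IntZ//; last exact: intg_chi.
rewrite Int_chi lerD//; last by rewrite ler_wpM2l// clamp_leT.
have -> : a / lam * expw lam p.1 = a * (expw lam p.1 / lam) by ring.
by rewrite ler_wpM2l.
Qed.

Lemma wadm_time (c : R -> R) : (forall t, 0 <= c t) -> wadm (fun p => c p.1).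
Proof. by move=> c0; split => //= t x y; rewrite ler_peMr ?wgt_ge1. Qed.

Lemma wadm_timeX (c : R -> R) (W : n.-tuple R -> R) : (forall t, 0 <= c t) ->
  (forall x, 0 <= W x) -> (forall x y, W (tadd x y) <= W x * wgt y) ->
  wadm (fun p => c p.1 * W p.2).
Proof.
move=> c0 W0 WD; split => [q|t x y] /=; first by rewrite mulr_ge0.
by rewrite -mulrA ler_wpM2l.
Qed.

(** Twice the bound of [norm_Nop_le] for sources with Lipschitz constant [L], so that the gain
    [1 / lam] leaves the factor 1/2. *)
Definition rate (L : R) : R := 2 * (1 + kmass + n%:R * kmass * L).

Lemma rate_gt0 L : 0 <= L -> 0 < rate L.
Proof.
move=> L0; have := @kmass_ge0 R n => k0; rewrite mulr_gt0// -addrA.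
by rewrite ltr_pwDl// addr_ge0// !mulr_ge0.
Qed.

(** A bound [K * e^(lam t)] on [e] improves to [(c * eps + K / 2) * e^(lam t)], and iteration from
    the a priori bound [M] converges to [2 * c * eps]. The contribution of [M] vanishes like [2^-k],
    so [C] is independent of [M]; the lemma can thus be applied to increments and remainders, with
    [eps] of order [|h|] or [h^2]. *)
Lemma gronwall (L : R) : 0 <= L -> exists2 C : R, 0 <= C & forall e ui g (eps M : R),
  bm M e -> (forall j, bm M (g j)) -> Sol e ui g -> 0 <= eps ->
  (forall x, `|ui x| <= eps) -> (forall j q, `|g j q| <= L * `|e q| + eps) ->
  forall p, `|e p| <= C * eps.
Proof.
move=> L0; set lam := rate L; have l0 : 0 < lam := rate_gt0 L0.
have k0 := @kmass_ge0 R n; have nk0 : 0 <= n%:R * kmass by rewrite mulr_ge0.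
pose c := 1 + n%:R * kmass * T.
have c0 : 0 <= c by rewrite addr_ge0// mulr_ge0// ltW.
exists (2 * c * expR (lam * T)); first by rewrite !mulr_ge0 ?expR_ge0.
move=> e ui g eps M eM gM se eps0 uie ge p.
have M0 := bm_ge0 eM.
have step K : 0 <= K -> (forall q, `|e q| <= K * expw lam q.1) ->
    forall q, `|e q| <= (c * eps + K / 2) * expw lam q.1.
  move=> K0 eK q; have E1 t : 1 <= expw lam t by apply: expw_ge1; exact: ltW.
  have E0 t : 0 <= expw lam t by exact: le_trans (E1 t).
  have W1 : wadm (fun q : R * n.-tuple R => K * expw lam q.1).
    by apply: (@wadm_time (fun t => K * expw lam t)) => t; rewrite mulr_ge0.
  have W2 : wadm (fun q : R * n.-tuple R => L * (K * expw lam q.1) + eps).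
    by apply: (@wadm_time (fun t => L * (K * expw lam t) + eps)) => t; rewrite addr_ge0// !mulr_ge0.
  have Nb q' : `|Nop e g q'| <= (lam / 2 * K) * expw lam q'.1 + n%:R * kmass * eps.
    have := @norm_Nop_le e g _ _ q' eM.1 (fun j => (gM j).1) W1 W2 eK.
    move=> /(_ (fun j q => le_trans (ge j q) (lerD (ler_wpM2l L0 (eK q)) (lexx _)))) /le_trans; apply.
    by rewrite /lam /rate le_eqVlt; apply/orP; left; apply/eqP; field.
  have lK0 : 0 <= lam / 2 * K by rewrite mulr_ge0// divr_ge0// ltW.
  have ne0 : 0 <= n%:R * kmass * eps by rewrite mulr_ge0.
  have Itb := @norm_It_le (Nop e g) lam _ _ q (bm_Nop eM gM).1 l0 lK0 ne0
    (fun s => Nb (s, q.2)).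
  rewrite se; apply: (le_trans (ler_normD _ _)).
  have -> : (c * eps + K / 2) * expw lam q.1 = eps * expw lam q.1 +
    (lam / 2 * K / lam * expw lam q.1 + n%:R * kmass * eps * T * expw lam q.1).
    by rewrite /c; field; rewrite gt_eqF.
  apply: lerD; first by rewrite (le_trans (uie _))// ler_peMr.
  apply: (le_trans Itb); rewrite lerD2l ler_peMr// mulr_ge0// ltW//.
have iter k : forall q, `|e q| <= (2 * c * eps + M * 2^-1 ^+ k) * expw lam q.1.
  have P0 : 0 <= 2 * c * eps by rewrite !mulr_ge0.
  elim: k => [|k ih] q.
    rewrite expr0 mulr1 (le_trans (eM.2 q))//.
    apply: (@le_trans _ _ (M * expw lam q.1)); first by rewrite ler_peMr// expw_ge1// ltW.
    by rewrite ler_wpM2r ?expR_ge0// lerDr.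
  have Q0 : 0 <= 2 * c * eps + M * 2^-1 ^+ k by rewrite addr_ge0// mulr_ge0// exprn_ge0// invr_ge0.
  apply: (le_trans (step _ Q0 ih q)).
  by rewrite le_eqVlt; apply/orP; left; apply/eqP; rewrite exprS; field.
apply: (@geometric_squeeze _ _ _ (M * expR (lam * T))) => k.
apply: (le_trans (iter k p)).
rewrite [leRHS](_ : _ = (2 * c * eps + M * 2^-1 ^+ k) * expR (lam * T)); last by ring.
rewrite ler_wpM2l ?expw_le ?(ltW l0)//.
by rewrite addr_ge0 ?mulr_ge0 ?exprn_ge0 ?invr_ge0// !mulr_ge0.
Qed.

(** * Picard iteration in a weighted sup norm *)

Section existence.
Variables (W : n.-tuple R -> R) (G : 'I_n -> R * n.-tuple R -> R -> R)
  (ui : n.-tuple R -> R) (L M : R).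
Hypotheses (W0 : forall x, 0 <= W x) (W1 : forall x, W x <= 1)
  (WD : forall x y, W (tadd x y) <= W x * wgt y)
  (mG : forall j, mfunT (fun q : (R * n.-tuple R) * R => G j q.1 q.2))
  (L0 : 0 <= L) (GL : forall j q s s', `|G j q s - G j q s'| <= L * `|s - s'|)
  (GM : forall j q, `|G j q 0| <= M * W q.2)
  (mui : mfunT ui) (uiM : forall x, `|ui x| <= M * W x) (M0 : 0 <= M).

Let lam := rate L.
Let l0 : 0 < lam. Proof. exact: rate_gt0. Qed.
Let src u j q := G j q (u q).
Let Phi u p := ui p.2 + It (Nop u (src u)) p.

Let msrc u j : mfunT u -> mfunT (src u j).
Proof.
move=> mu; apply: (@measurableT_comp _ _ _ _ _ _ (fun q : (R * n.-tuple R) * R => G j q.1 q.2)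
  _ (fun q => (q, u q)) (mG j)).
exact: (measurable_fun_pair (@measurable_id _ _ _) mu).
Qed.

Let bsrc u K : bm K u -> forall j, bm (L * K + M) (src u j).
Proof.
move=> [mu uK] j; split; first exact: msrc.
move=> q; have := GL j q (u q) 0; have := GM j q; rewrite subr0 => g0 gl.
have := ler_normD (G j q (u q) - G j q 0) (G j q 0); rewrite subrK => h.
apply: (le_trans h); apply: lerD; first by apply: (le_trans gl); rewrite ler_wpM2l.
by apply: (le_trans g0); rewrite ler_piMr.
Qed.

Let bPhi u K : bm K u -> exists K', bm K' (Phi u).
Proof.
move=> uK; eexists; apply: (@bm_add _ _ (fun q => ui q.2) _ M).
  split; first exact: measurableT_comp mui measurable_snd.
  by move=> q; apply: (le_trans (uiM _)); rewrite ler_piMr.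
exact: (bm_It T0 (bm_Nop uK (bsrc uK))).
Qed.

(* One Picard step halves the distance in the norm weighted by [W x * e^(lam t)]. *)
Let contraction u v K K' : bm K u -> bm K v -> 0 <= K' ->
  (forall q, `|u q - v q| <= K' * expw lam q.1 * W q.2) ->
  forall q, `|Phi u q - Phi v q| <= K' / 2 * expw lam q.1 * W q.2.
Proof.
move=> uK vK K'0 uv q; have k0 := @kmass_ge0 R n.
have E0 t : 0 <= expw lam t by exact: expR_ge0.
have WW c : 0 <= c -> wadm (fun q : R * n.-tuple R => c * expw lam q.1 * W q.2).
  by move=> c0; apply: (wadm_timeX (c := fun t => c * expw lam t)) => // t; rewrite mulr_ge0.
have W2 := WW _ (mulr_ge0 L0 K'0).
have KK : 0 <= K by exact: bm_ge0 uK.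
pose B := K + (L * K + M).
have KB : K <= B by rewrite lerDl addr_ge0// mulr_ge0.
have LB : L * K + M <= B by rewrite lerDr.
have uB := bm_mono KB uK; have vB := bm_mono KB vK.
have suB j := bm_mono LB (bsrc uK j); have svB j := bm_mono LB (bsrc vK j).
rewrite /Phi opprD addrACA subrr add0r.
rewrite -(It_sub T q (bm_Nop uB suB) (bm_Nop vB svB)).
have NE : (fun q => Nop u (src u) q - Nop v (src v) q) =
    Nop (fun q => u q - v q) (fun j q => src u j q - src v j q).
  by apply/funext => p; rewrite (Nop_sub p uB vB suB svB).
rewrite NE.
have duB := bm_sub uB vB; have dsB j := bm_sub (suB j) (svB j).
have Nb p : `|Nop (fun q => u q - v q) (fun j q => src u j q - src v j q) p| <=
    (lam / 2 * K') * expw lam p.1 * W p.2.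
  have := @norm_Nop_le _ _ _ _ p duB.1 (fun j => (dsB j).1) (WW _ K'0) W2 uv.
  move=> H; apply: (le_trans (H _)) => [j p'|].
    by apply: (le_trans (GL _ _ _ _)); rewrite -!mulrA ler_wpM2l// mulrA; exact: uv.
  by rewrite /lam /rate le_eqVlt; apply/orP; left; apply/eqP; field.
have lK0 : 0 <= lam / 2 * K' * W q.2.
  by apply: mulr_ge0 => //; apply: mulr_ge0 => //; apply: divr_ge0 => //; exact: ltW.
have := @norm_It_le _ lam _ 0 q (bm_Nop duB dsB).1 l0 lK0 (lexx _).
move=> H; apply: (le_trans (H _)) => [s|].
  by rewrite addr0; apply: (le_trans (Nb _)); rewrite mulrAC.
rewrite mul0r addr0 le_eqVlt; apply/orP; left; apply/eqP.
by field; rewrite gt_eqF.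
Qed.

Let picard k : R * n.-tuple R -> R := iter k Phi (fun q => ui q.2).

Let bm_picard k : exists K, bm K (picard k).
Proof.
elim: k => [|k [K ih]]; last exact: bPhi ih.
exists M; split; first exact: measurableT_comp mui measurable_snd.
by move=> q; apply: (le_trans (uiM _)); rewrite ler_piMr.
Qed.

(** Size of the first Picard increment: [Nop] at the initial datum, integrated over a time of at
    most [T]. *)
Let K1 := ((1 + kmass) * M + n%:R * kmass * (L * M + M)) * T.

Let K10 : 0 <= K1.
Proof.
have k0 := @kmass_ge0 R n.
by rewrite mulr_ge0 ?(ltW T0)// addr_ge0// !mulr_ge0// addr_ge0// mulr_ge0.
Qed.

Let picard_step k q : `|picard k.+1 q - picard k q| <=
  K1 * 2^-1 ^+ k * expw lam q.1 * W q.2.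
Proof.
have k0 := @kmass_ge0 R n.
have E1 t : 1 <= expw lam t by apply: expw_ge1; exact: ltW.
elim: k q => [|k ih] q; last first.
  have [K bK] := bm_picard k; have [K' bK'] := bm_picard k.+1.
  have u1 : bm (Num.max K K') (picard k.+1) by apply: bm_mono bK'; rewrite le_max lexx orbT.
  have u2 : bm (Num.max K K') (picard k) by apply: bm_mono bK; rewrite le_max lexx.
  have P0 : 0 <= K1 * 2^-1 ^+ k by rewrite mulr_ge0// exprn_ge0// invr_ge0.
  have := contraction u1 u2 P0 ih q.
  by rewrite exprSr mulrA.
rewrite /picard /= /Phi addrAC subrr add0r expr0 mulr1.
set u := fun q => ui q.2.
have uM : bm M u.
  split; first exact: measurableT_comp mui measurable_snd.
  by move=> p; apply: (le_trans (uiM _)); rewrite ler_piMr.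
have WW c : 0 <= c -> wadm (fun q : R * n.-tuple R => c * W q.2).
  by move=> c0; apply: (wadm_timeX (c := fun=> c)).
have LM0 : 0 <= L * M + M by rewrite addr_ge0// mulr_ge0.
have Nb p : `|Nop u (src u) p| <= (((1 + kmass) * M + n%:R * kmass * (L * M + M)) * W p.2).
  have := @norm_Nop_le _ _ _ _ p uM.1 (fun j => (bsrc uM j).1) (WW _ M0) (WW _ LM0) (fun q => uiM q.2).
  move=> H; apply: (le_trans (H _)) => [j p'|]; last by rewrite le_eqVlt; apply/orP; left; apply/eqP; ring.
  have := GL j p' (u p') 0; have := GM j p'; rewrite subr0 => g0 gl.
  have := ler_normD (G j p' (u p') - G j p' 0) (G j p' 0); rewrite subrK => h.
  apply: (le_trans h); rewrite mulrDl; apply: lerD => //; apply: (le_trans gl).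
  by rewrite -mulrA; apply: ler_wpM2l => //; exact: uiM.
pose c := ((1 + kmass) * M + n%:R * kmass * (L * M + M)) * W q.2.
have c0 : 0 <= c by rewrite mulr_ge0// addr_ge0// !mulr_ge0// addr_ge0.
have := @norm_It_le _ lam 0 c q (bm_Nop uM (bsrc uM)).1 l0 (lexx _) c0.
move=> H; apply: (le_trans (H _)) => [s|]; first by rewrite mul0r add0r; exact: Nb.
rewrite !mul0r add0r /c /K1 mulrAC [leRHS]mulrAC ler_peMr//.
by have := mulr_ge0 K10 (W0 q.2); rewrite /K1.
Qed.

Let picard_tail k m q : `|picard (k + m) q - picard k q| <=
  2 * K1 * 2^-1 ^+ k * expw lam q.1 * W q.2.
Proof.
have EW : 0 <= expw lam q.1 * W q.2 by rewrite mulr_ge0 ?expR_ge0.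
(* The exact partial sum of the geometric series makes the induction on [m] close. *)
suff : `|picard (k + m) q - picard k q| <=
    2 * K1 * (2^-1 ^+ k - 2^-1 ^+ (k + m)) * (expw lam q.1 * W q.2).
  move=> /le_trans; apply; rewrite -[leRHS]mulrA; apply: ler_wpM2r => //.
  apply: ler_wpM2l; first by rewrite mulr_ge0.
  by rewrite gerBl exprn_ge0// invr_ge0.
elim: m => [|m ih]; first by rewrite addn0 !subrr normr0 mulr0 mul0r.
have := picard_step (k + m) q; rewrite addnS.
have := ler_normD (picard (k + m).+1 q - picard (k + m) q) (picard (k + m) q - picard k q).
rewrite addrA subrK => h1 h2; apply: (le_trans h1); apply: (le_trans (lerD h2 ih)).
by rewrite le_eqVlt; apply/orP; left; apply/eqP; rewrite exprS; field.
Qed.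

Let KW := 2 * K1 * expR (lam * T).

Let picard_tail' k m q : `|picard (k + m) q - picard k q| <= KW * 2^-1 ^+ k.
Proof.
apply: (le_trans (picard_tail k m q)).
have -> : KW * 2^-1 ^+ k = 2 * K1 * 2^-1 ^+ k * expR (lam * T) * 1.
  by rewrite /KW; move: (2^-1 ^+ k) (K1) (expR _) => *; ring.
have P0 : 0 <= 2 * K1 * 2^-1 ^+ k by rewrite mulr_ge0 ?exprn_ge0 ?invr_ge0// mulr_ge0.
apply: ler_pM => //; first by rewrite mulr_ge0// expR_ge0.
by apply: ler_wpM2l => //; apply: expw_le; exact: ltW.
Qed.

Let picard_cvg q : cvg (picard k q @[k --> \oo]).
Proof.
apply: cauchy_cvg; apply: cauchy_exP => e e0.
have : (fun k => KW * 2^-1 ^+ k) @ \oo --> (0 : R).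
  rewrite -(mulr0 KW); apply: cvgMr; apply: cvg_expr.
  by rewrite ger0_norm ?invr_ge0// invf_lt1// ltr1n.
move=> /cvgrPdist_lt /(_ e e0) [N _ /(_ N (leqnn N))] /=.
rewrite sub0r normrN => KN.
exists (picard N q); exists N => // m /= Nm; rewrite -ball_normE /= distrC.
have := picard_tail' N (m - N) q; rewrite subnKC// => /le_lt_trans; apply.
exact: le_lt_trans (ler_norm _) KN.
Qed.

Let u q : R := lim (picard k q @[k --> \oo]).

Let u_tail k q : `|u q - picard k q| <= 2 * K1 * 2^-1 ^+ k * expw lam q.1 * W q.2.
Proof.
apply/ler_addgt0Pr => e e0.
have : picard k q @[k --> \oo] --> u q := @picard_cvg q.
move=> /cvgrPdist_le /(_ e e0) [N _ /(_ (k + N)%N)] /=.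
rewrite leq_addl => /(_ isT) h1; have h2 := picard_tail k N q.
have := ler_normD (u q - picard (k + N) q) (picard (k + N) q - picard k q).
rewrite addrA subrK => h3; apply: (le_trans h3).
by rewrite addrC; exact: lerD.
Qed.

Let u_tail' k q : `|u q - picard k q| <= KW * 2^-1 ^+ k.
Proof.
apply: (le_trans (u_tail k q)).
have -> : KW * 2^-1 ^+ k = 2 * K1 * 2^-1 ^+ k * expR (lam * T) * 1.
  by rewrite /KW; move: (2^-1 ^+ k) (K1) (expR _) => *; ring.
have P0 : 0 <= 2 * K1 * 2^-1 ^+ k by rewrite mulr_ge0 ?exprn_ge0 ?invr_ge0// mulr_ge0.
apply: ler_pM => //; first by rewrite mulr_ge0// expR_ge0.
by apply: ler_wpM2l => //; apply: expw_le; exact: ltW.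
Qed.

Let Ku := M + 2 * K1 * expR (lam * T).

Let uW q : `|u q| <= Ku * W q.2.
Proof.
have := u_tail 0 q; have := uiM q.2; rewrite expr0 mulr1 /picard /=.
have := ler_normD (u q - ui q.2) (ui q.2); rewrite subrK => h1 h2 h3.
apply: (le_trans h1); rewrite addrC /Ku mulrDl; apply: lerD => //; apply: (le_trans h3).
apply: ler_wpM2r => //; apply: ler_wpM2l; first by rewrite mulr_ge0.
by apply: expw_le; exact: ltW.
Qed.

Let bmu : bm Ku u.
Proof.
have Ku0 : 0 <= Ku.
  by apply: addr_ge0 => //; apply: mulr_ge0; [rewrite mulr_ge0|exact: expR_ge0].
split; last by move=> q; apply: (le_trans (uW q)); rewrite ler_piMr.
apply: (@measurable_fun_cvg _ _ _ setT (fun k => picard k)) => //.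
by move=> k; have [K []] := bm_picard k.
Qed.

(** The limit is a fixed point because [u - Phi u] is within [2^-k], up to a constant, of 0 for
    every [k]. The weight is a parameter for two uses: [W = rho] gives the decay of the solution,
    [W = 1] solves the linear equations for its derivatives, whose coefficients are merely
    bounded. *)
Lemma mild_exists : exists v K, [/\ bm K v, forall q, `|v q| <= K * W q.2 &
  Sol v ui (fun j q => G j q (v q))].
Proof.
exists u, Ku; split => // q; rewrite -/(Phi u q); apply/eqP; rewrite -subr_eq0 -normr_le0.
apply: (@geometric_squeeze _ _ _ KW) => k; rewrite add0r.
have [K bK] := bm_picard k.
have u1 : bm (Num.max K Ku) u by apply: bm_mono bmu; rewrite le_max lexx orbT.
have u2 : bm (Num.max K Ku) (picard k) by apply: bm_mono bK; rewrite le_max lexx.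
have P0 : 0 <= 2 * K1 * 2^-1 ^+ k by rewrite mulr_ge0 ?exprn_ge0 ?invr_ge0// mulr_ge0.
have h1 := contraction u1 u2 P0 (u_tail k) q.
have h2 := u_tail' k.+1 q.
have E : 2 * K1 * 2^-1 ^+ k / 2 * expw lam q.1 * W q.2 <= KW * 2^-1 ^+ k.+1.
  have -> : KW * 2^-1 ^+ k.+1 = 2 * K1 * 2^-1 ^+ k / 2 * expR (lam * T) * 1.
    by rewrite /KW exprS; move: (2^-1 ^+ k) (K1) (expR _) => *; field.
  have P1 : 0 <= 2 * K1 * 2^-1 ^+ k / 2 by apply: divr_ge0.
  apply: ler_pM => //; first by rewrite mulr_ge0// expR_ge0.
  by apply: ler_wpM2l => //; apply: expw_le; exact: ltW.
have h3 := ler_normB (u q - picard k.+1 q) (Phi u q - Phi (picard k) q).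
rewrite (_ : u q - Phi u q = u q - picard k.+1 q - (Phi u q - Phi (picard k) q)); last first.
  rewrite -[Phi (picard k) q]/(picard k.+1 q).
  by move: (u q) (Phi u q) (picard k.+1 q) => *; ring.
apply: (le_trans h3); apply: (@le_trans _ _ (KW * 2^-1 ^+ k.+1 + KW * 2^-1 ^+ k.+1)).
  by apply: lerD => //; exact: le_trans h1 E.
by rewrite exprS; move: (2^-1 ^+ k) (KW) => a b; lra.
Qed.

End existence.

End mild.

Lemma fin_bound (R : realType) (I : finType) (P : I -> R -> Prop) :
  (forall i M M', M <= M' -> P i M -> P i M') -> (forall i, exists M, P i M) ->
  exists2 M : R, 0 <= M & forall i, P i M.
Proof.
move=> Pmono /choice[m mP]; exists (\sum_i `|m i|); first exact: sumr_ge0.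
move=> i; apply: Pmono (mP i); rewrite (bigD1 i)//=.
apply: (le_trans (ler_norm (m i))); rewrite lerDl; exact: sumr_ge0.
Qed.

(** * Differentiability classes defined by quadratic remainders *)

Section smooth_classes.
Context {R : realType} {n : nat}.
Variable T : R.
Hypothesis T0 : 0 < T.
Implicit Types (p q w : R * n.-tuple R) (f g u : R * n.-tuple R -> R) (d : option 'I_n).

(* [None] is the time direction, restricted to [[0, T]]; [Some j] is the direction of [x_j].
   Derivatives are encoded by uniform quadratic remainders, which pass through the integral
   operators without differentiation under the integral sign. *)
Definition moved d q q' (h : R) : Prop :=
  match d with
  | Some j => q' = shx j h q
  | None => [/\ q'.2 = q.2, h = q'.1 - q.1, 0 <= q.1 <= T & 0 <= q'.1 <= T]
  end.

Definition lipD (M : R) f := forall d q q' h, moved d q q' h -> `|f q' - f q| <= M * `|h|.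
Definition derD (M : R) d f f' :=
  forall q q' h, moved d q q' h -> `|f q' - f q - h * f' q| <= M * h ^+ 2.
Definition isC0 f := exists M, bm M f /\ lipD M f.
Definition isD d f f' := exists M, derD M d f f'.

(** Each derivative is existential and chosen anew at every order; [isD_derive] later identifies it
    with the value of [derive] inside the slab. *)
Fixpoint isCk k f : Prop := isC0 f /\
  if k is k'.+1 then forall d, exists f', isD d f f' /\ isCk k' f' else True.

Lemma isCk_C0 k f : isCk k f -> isC0 f.
Proof. by case: k => [|k] []. Qed.

Lemma isCkW k f : isCk k.+1 f -> isCk k f.
Proof.
elim: k f => [|k ih] f [f0 fd]; split => // d.
by have [f' [ff' f'k]] := fd d; exists f'; split => //; exact: ih.
Qed.

Lemma isCk_bm k f : isCk k f -> exists M, bm M f.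
Proof. by move=> /isCk_C0[M [fM _]]; exists M. Qed.

Lemma isC0_uniform f : isC0 f -> exists M, [/\ 0 <= M, bm M f & lipD M f].
Proof. by move=> [M [fM fl]]; exists M; split => //; exact: bm_ge0 fM. Qed.

Lemma lipD_mono M M' f : M <= M' -> lipD M f -> lipD M' f.
Proof.
by move=> MM' fl d q q' h dq; apply: (le_trans (fl _ _ _ _ dq)); rewrite ler_wpM2r.
Qed.

Lemma derD_mono M M' d f f' : M <= M' -> derD M d f f' -> derD M' d f f'.
Proof.
by move=> MM' fl q q' h dq; apply: (le_trans (fl _ _ _ dq)); rewrite ler_wpM2r ?sqr_ge0.
Qed.

Lemma isC0_add f g : isC0 f -> isC0 g -> isC0 (fun q => f q + g q).
Proof.
move=> [M [fM fl]] [M' [gM gl]]; exists (M + M'); split; first exact: bm_add.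
move=> d q q' h dq; rewrite opprD addrACA mulrDl.
by apply: (le_trans (ler_normD _ _)); apply: lerD; [exact: fl dq|exact: gl dq].
Qed.

Lemma isC0_scale c f : isC0 f -> isC0 (fun q => c * f q).
Proof.
move=> [M [fM fl]]; exists (`|c| * M); split; first exact: bm_scale.
by move=> d q q' h dq; rewrite -mulrBr normrM -mulrA ler_wpM2l//; exact: fl dq.
Qed.

Lemma isC0_mul f g : isC0 f -> isC0 g -> isC0 (fun q => f q * g q).
Proof.
move=> /isC0_uniform[M [M0 fM fl]] /isC0_uniform[M' [M'0 gM gl]].
exists (M * M' + M * M'); split.
  by apply: bm_mono (bm_mul fM gM); rewrite lerDl mulr_ge0.
move=> d q q' h dq.
have -> : f q' * g q' - f q * g q = (f q' - f q) * g q' + f q * (g q' - g q) by ring.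
apply: (le_trans (ler_normD _ _)); rewrite !normrM mulrDl; apply: lerD.
  rewrite mulrAC; apply: ler_pM => //; [exact: fl dq|exact: gM.2].
by rewrite -mulrA; apply: ler_pM => //; [exact: fM.2|exact: gl dq].
Qed.

Lemma isD_add d f g f' g' : isD d f f' -> isD d g g' ->
  isD d (fun q => f q + g q) (fun q => f' q + g' q).
Proof.
move=> [M fd] [M' gd]; exists (M + M') => q q' h dq.
have -> : f q' + g q' - (f q + g q) - h * (f' q + g' q) =
  (f q' - f q - h * f' q) + (g q' - g q - h * g' q) by ring.
by rewrite mulrDl; apply: (le_trans (ler_normD _ _)); apply: lerD; [exact: fd|exact: gd].
Qed.

Lemma isD_scale d c f f' : isD d f f' -> isD d (fun q => c * f q) (fun q => c * f' q).
Proof.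
move=> [M fd]; exists (`|c| * M) => q q' h dq.
have -> : c * f q' - c * f q - h * (c * f' q) = c * (f q' - f q - h * f' q) by ring.
by rewrite normrM -mulrA ler_wpM2l//; exact: fd.
Qed.

Lemma isD_mul d f g f' g' : isC0 f -> isC0 g -> isC0 f' -> isD d f f' -> isD d g g' ->
  isD d (fun q => f q * g q) (fun q => f' q * g q + f q * g' q).
Proof.
move=> /isC0_uniform[A [A0 fM fl]] /isC0_uniform[B [B0 gM gl]] /isC0_uniform[C [C0 f'M _]].
move=> [M fd] [M' gd]; exists (`|M| * B + A * `|M'| + C * B) => q q' h dq.
have fd' := derD_mono (ler_norm M) fd dq; have gd' := derD_mono (ler_norm M') gd dq.
apply: (le_trans (mul_remainder fd' gd')).
rewrite 2!mulrDl; apply: lerD; first apply: lerD.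
- by rewrite [leRHS]mulrAC; apply: ler_wpM2l; [rewrite mulr_ge0 ?sqr_ge0|exact: gM.2].
- by rewrite -mulrA; apply: ler_wpM2r; [rewrite mulr_ge0 ?sqr_ge0|exact: fM.2].
- have -> : C * B * h ^+ 2 = (`|h| * C) * (B * `|h|).
    by rewrite -(real_normK (num_real h)); ring.
  apply: ler_pM => //.
    by apply: ler_wpM2l => //; exact: f'M.2.
  exact: gl dq.
Qed.

(** Moves in time and along [x_j] commute with spatial translations, which is why [Cv] inherits the
    Lipschitz and remainder bounds of its argument. *)
Lemma moved_yadd d q q' h w : moved d q q' h ->
  moved d (q.1, yadd q.2 w) (q'.1, yadd q'.2 w) h.
Proof.
case: d => [j|] /=; first by move=> ->; rewrite /shx /yadd /= taddAC.
by move=> [-> -> a b].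
Qed.

Lemma norm_Int_ker_le k (F : R * n.-tuple R -> R) (K : R) : mfunT F ->
  (forall w, `|F w| <= K) -> `|\int[@must R n]_w (F w * ker k w)| <= K * kmass (n := n).
Proof.
move=> mF FK; have K0 : 0 <= K by apply: le_trans (FK (0, t0)).
apply: (@le_trans _ _ (K * \int[@must R n]_w (`|ker k w| * wgt (tsc w.1 w.2)))); last first.
  by rewrite ler_wpM2l// kmass_le.
rewrite -IntZ; last exact: intg_kerW.
apply: Int_norm_le; last 2 first.
- exact: intgZ (intg_kerW k).
- move=> w; rewrite normrM; apply: ler_pM => //.
  by rewrite ler_peMr// wgt_ge1.
exact: measurable_funM mF (measurable_ker k).
Qed.

Lemma measurable_yadd_section f q : mfunT f -> mfunT (fun w => f (q.1, yadd q.2 w)).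
Proof.
move=> mf; apply: measurableT_comp => //; apply: measurable_fun_pair => //.
exact: measurable_yadd.
Qed.

Lemma isC0_Cv k f : isC0 f -> isC0 (Cv k f).
Proof.
move=> /isC0_uniform[M [M0 fM fl]]; exists (kmass (n := n) * M); split; first exact: bm_Cv.
move=> d q q' h dq; rewrite /Cv -IntB; [|exact: intg_bm_Cv fM|exact: intg_bm_Cv fM].
rewrite (@Int_eq _ _ _ (@must R n) _ (fun w => (f (q'.1, yadd q'.2 w) - f (q.1, yadd q.2 w)) * ker k w)); last first.
  by move=> w; rewrite mulrBl.
rewrite -mulrA mulrC; apply: norm_Int_ker_le.
  by apply: measurable_funB; apply: measurable_yadd_section fM.1.
by move=> w; exact: fl (moved_yadd w dq).
Qed.

Lemma isD_Cv d k f f' : isC0 f -> isC0 f' -> isD d f f' -> isD d (Cv k f) (Cv k f').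
Proof.
move=> [A [fM _]] [B [f'M _]] [M fd]; exists (M * kmass (n := n)) => q q' h dq.
have i1 := intg_bm_Cv k q' fM; have i2 := intg_bm_Cv k q fM.
have i3 := intg_bm_Cv k q f'M.
rewrite /Cv -IntB// -IntZ// -IntB; [|exact: intgB|exact: intgZ].
rewrite (@Int_eq _ _ _ (@must R n) _ (fun w => (f (q'.1, yadd q'.2 w) - f (q.1, yadd q.2 w)
  - h * f' (q.1, yadd q.2 w)) * ker k w)); last first.
  by move=> w; rewrite !mulrBl mulrA.
rewrite mulrAC; apply: norm_Int_ker_le.
  apply: measurable_funB; last first.
    by apply: measurable_funM => //; apply: measurable_yadd_section f'M.1.
  by apply: measurable_funB; apply: measurable_yadd_section fM.1.
by move=> w; exact: fd (moved_yadd w dq).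
Qed.

Lemma isCk_add k f g : isCk k f -> isCk k g -> isCk k (fun q => f q + g q).
Proof.
elim: k f g => [|k ih] f g fk gk; split => //; try exact: isC0_add (isCk_C0 fk) (isCk_C0 gk).
move=> d; have [f' [ff' f'k]] := fk.2 d; have [g' [gg' g'k]] := gk.2 d.
by exists (fun q => f' q + g' q); split; [exact: isD_add|exact: ih].
Qed.

Lemma isCk_scale k c f : isCk k f -> isCk k (fun q => c * f q).
Proof.
elim: k f => [|k ih] f fk; split => //; try exact: isC0_scale (isCk_C0 fk).
move=> d; have [f' [ff' f'k]] := fk.2 d.
by exists (fun q => c * f' q); split; [exact: isD_scale|exact: ih].
Qed.

Lemma isCk_mul k f g : isCk k f -> isCk k g -> isCk k (fun q => f q * g q).
Proof.
elim: k f g => [|k ih] f g fk gk; split => //; try exact: isC0_mul (isCk_C0 fk) (isCk_C0 gk).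
move=> d; have [f' [ff' f'k]] := fk.2 d; have [g' [gg' g'k]] := gk.2 d.
exists (fun q => f' q * g q + f q * g' q); split.
  by apply: isD_mul => //; [exact: isCk_C0 fk|exact: isCk_C0 gk|exact: isCk_C0 f'k].
by apply: isCk_add; apply: ih => //; exact: isCkW.
Qed.

Lemma isCk_Cv k i f : isCk k f -> isCk k (Cv i f).
Proof.
elim: k f => [|k ih] f fk; split => //; try exact: isC0_Cv (isCk_C0 fk).
move=> d; have [f' [ff' f'k]] := fk.2 d.
exists (Cv i f'); split; last exact: ih.
by apply: isD_Cv => //; [exact: isCk_C0 fk|exact: isCk_C0 f'k].
Qed.

Lemma isCk_cst0 k : isCk k (fun=> 0).
Proof.
have c0 : isC0 (fun=> 0).
  exists 0; split; first by split => // q; rewrite normr0.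
  by move=> d q q' h _; rewrite subrr normr0 mul0r.
elim: k => [|k ih]; split => // d; exists (fun=> 0); split => //.
by exists 0 => q q' h _; rewrite mulr0 !subr0 normr0 mul0r.
Qed.

Lemma isCk_sum k (I : Type) (s : seq I) (f : I -> R * n.-tuple R -> R) :
  (forall i, isCk k (f i)) -> isCk k (fun q => \sum_(i <- s) f i q).
Proof.
move=> fk; elim: s => [|i s ih].
  by under eq_fun do rewrite big_nil; exact: isCk_cst0.
by under eq_fun do rewrite big_cons; exact: isCk_add.
Qed.

Lemma isCk_Nop k u (g : 'I_n -> R * n.-tuple R -> R) : isCk k u -> (forall j, isCk k (g j)) ->
  isCk k (Nop u g).
Proof.
move=> uk gk; apply: isCk_add; last by apply: isCk_sum => j; exact: isCk_Cv.
apply: isCk_add; last exact: isCk_Cv.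
by have := isCk_scale (-1) uk; under eq_fun do rewrite mulN1r.
Qed.

End smooth_classes.

(** * Composition with the flux *)

Section composition.
Context {R : realType} {n : nat}.
Variable T : R.
Implicit Types (g : n.-tuple R -> R -> R) (u : R * n.-tuple R -> R).
Local Notation isC0 := (isC0 T).
Local Notation isCk := (isCk T).
Local Notation isD := (isD T).

Definition isS0 g := exists M, [/\ mfunT (fun p : n.-tuple R * R => g p.1 p.2),
  forall x s, `|g x s| <= M,
  forall j x h s, `|g (tadd x (te j h)) s - g x s| <= M * `|h| &
  forall x s s', `|g x s' - g x s| <= M * `|s' - s|].
Definition derSx j g g' := exists M : R, forall x h s,
  `|g (tadd x (te j h)) s - g x s - h * g' x s| <= M * h ^+ 2.
Definition derSs g g' := exists M : R, forall x s s',
  `|g x s' - g x s - (s' - s) * g' x s| <= M * (s' - s) ^+ 2.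

Fixpoint isSk k g : Prop := isS0 g /\
  if k is k'.+1 then (forall j, exists g', derSx j g g' /\ isSk k' g') /\
    (exists g', derSs g g' /\ isSk k' g') else True.

Lemma isSk_S0 k g : isSk k g -> isS0 g.
Proof. by case: k => [|k] []. Qed.

Definition scomp g u q : R := g q.2 (u q).

Lemma measurable_scomp g u : mfunT (fun p : n.-tuple R * R => g p.1 p.2) -> mfunT u ->
  mfunT (scomp g u).
Proof.
move=> mg mu; apply: (@measurableT_comp _ _ _ _ _ _ (fun p : n.-tuple R * R => g p.1 p.2)
  _ (fun q : R * n.-tuple R => (q.2, u q)) mg).
exact: (measurable_fun_pair measurable_snd mu).
Qed.

Lemma isC0_scomp g u : isS0 g -> isC0 u -> isC0 (scomp g u).
Proof.
move=> [A [mg gA gx gs]] /isC0_uniform[M [M0 uM ul]].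
have A0 : 0 <= A by apply: le_trans (gA t0 0).
exists (A + A * M); split.
  split; first exact: measurable_scomp uM.1.
  by move=> q; apply: (le_trans (gA _ _)); rewrite lerDl mulr_ge0.
move=> d q q' h dq; rewrite /scomp.
have h1 : `|g q'.2 (u q) - g q.2 (u q)| <= A * `|h|.
  case: d dq => [j|] /=; first by move=> ->; exact: gx.
  by move=> [-> _ _ _]; rewrite subrr normr0 mulr_ge0.
have h2 := gs q'.2 (u q) (u q'); have h3 := ul _ _ _ _ dq.
have h4 := ler_wpM2l A0 h3.
have := ler_normD (g q'.2 (u q') - g q'.2 (u q)) (g q'.2 (u q) - g q.2 (u q)).
by rewrite addrA subrK; lra.
Qed.

(** The chain rule is stated with an arbitrary number [y] where the derivative of [u] would stand.
    In [nonlin_reg] that derivative is not yet known to exist, and [y] is the value of the solution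
    of the linearized equation. *)
Lemma scomp_remainder d g gx gs u : isS0 g -> isS0 gs -> isC0 u ->
  (if d is Some j then derSx j g gx else gx = fun _ _ => 0) -> derSs g gs ->
  exists L B, [/\ 0 <= L, 0 <= B & forall q q' h (y : R), moved T d q q' h ->
    `|scomp g u q' - scomp g u q - h * (scomp gx u q + scomp gs u q * y)| <=
    L * `|u q' - u q - h * y| + B * h ^+ 2].
Proof.
move=> [A [_ gA _ _]] [B [_ gsB gsx _]] /isC0_uniform[M [M0 uM ul]] gxP [C gsP].
have B0 : 0 <= B by apply: le_trans (gsB t0 0).
have [E E0 EP] : exists2 E : R, 0 <= E & forall q q' h, moved T d q q' h ->
    `|g q'.2 (u q) - g q.2 (u q) - h * gx q.2 (u q)| <= E * h ^+ 2.
  case: d gxP => [j|] gxP.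
    have [E EP] := gxP; exists `|E| => // q q' h /= ->.
    by apply: (le_trans (EP _ _ _)); rewrite ler_wpM2r ?sqr_ge0// ler_norm.
  by exists 0 => // q q' h [-> _ _ _]; rewrite gxP subrr mulr0 subrr normr0 mul0r.
exists B, (`|C| * M ^+ 2 + M * B + E); split => //.
  by rewrite !addr_ge0// mulr_ge0// sqr_ge0.
move=> q q' h y dq; rewrite /scomp.
have hE := EP _ _ _ dq.
have hC : `|g q'.2 (u q') - g q'.2 (u q) - (u q' - u q) * gs q'.2 (u q)| <= `|C| * M ^+ 2 * h ^+ 2.
  apply: (le_trans (gsP _ _ _)); rewrite -mulrA.
  apply: (@le_trans _ _ (`|C| * (u q' - u q) ^+ 2)); first by rewrite ler_wpM2r ?sqr_ge0// ler_norm.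
  apply: ler_wpM2l => //; rewrite -exprMn -(real_normK (num_real (u q' - u q))).
  rewrite -(real_normK (num_real (M * h))) lerXn2r ?nnegrE// normrM (ger0_norm M0).
  exact: ul dq.
have hB : `|(u q' - u q) * (gs q'.2 (u q) - gs q.2 (u q))| <= M * B * h ^+ 2.
  have -> : M * B * h ^+ 2 = (M * `|h|) * (B * `|h|).
    by rewrite -(real_normK (num_real h)); ring.
  rewrite normrM; apply: ler_pM => //; first exact: ul dq.
  case: d dq {gxP EP} => [j|] /=; first by move=> ->; exact: gsx.
  by move=> [-> _ _ _]; rewrite subrr normr0 mulr_ge0.
have hD : `|gs q.2 (u q) * (u q' - u q - h * y)| <= B * `|u q' - u q - h * y|.
  by rewrite normrM ler_wpM2r.
set a := g q'.2 (u q') in hC *; set b := g q'.2 (u q) in hC hE.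
set c := g q.2 (u q) in hE *; set s' := gs q'.2 (u q) in hC hB; set s := gs q.2 (u q) in hB hD *.
set e := gx q.2 (u q) in hE *.
(* Taylor in the second argument at the new point [q'.2], then in [x] at the old value [u q]; the
   middle term moves [gs] from [q'.2] back to [q.2]. *)
have -> : a - c - h * (e + s * y) = s * (u q' - u q - h * y) + ((a - b - (u q' - u q) * s') +
  (u q' - u q) * (s' - s) + (b - c - h * e)) by ring.
apply: (le_trans (ler_normD _ _)); apply: lerD => //.
apply: (le_trans (ler_normD _ _)); rewrite [leRHS]mulrDl; apply: lerD => //.
by apply: (le_trans (ler_normD _ _)); rewrite [leRHS]mulrDl; apply: lerD.
Qed.

Lemma isD_scomp d g gx gs u u' : isS0 g -> isS0 gs -> isC0 u ->
  (if d is Some j then derSx j g gx else gx = fun _ _ => 0) -> derSs g gs -> isD d u u' ->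
  isD d (scomp g u) (fun q => scomp gx u q + scomp gs u q * u' q).
Proof.
move=> g0 gs0 u0 gxP gsP [D uD].
have [L [B [L0 B0 LB]]] := scomp_remainder g0 gs0 u0 gxP gsP.
exists (L * D + B) => q q' h dq; apply: (le_trans (LB _ _ _ _ dq)).
by rewrite mulrDl lerD2r -mulrA ler_wpM2l//; exact: uD.
Qed.

Lemma isCk_scomp k g u : isSk k g -> isCk k u -> isCk k (scomp g u).
Proof.
elim: k g u => [|k ih] g u gk uk; split => //; try exact: isC0_scomp (isSk_S0 gk) (isCk_C0 uk).
move=> d; have [u' [uu' u'k]] := uk.2 d; have [_ [gx [gs [gsP gsk]]]] := gk.
case: d uu' => [j|] uu'.
  have [gj [gjP gjk]] := gx j; exists (fun q => scomp gj u q + scomp gs u q * u' q).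
  split; last first.
    apply: isCk_add; first by apply: ih => //; exact: isCkW.
    by apply: isCk_mul => //; apply: ih => //; exact: isCkW.
  by apply: isD_scomp => //; [exact: isSk_S0 gk|exact: isSk_S0 gsk|exact: isCk_C0 uk].
exists (fun q => scomp gs u q * u' q); split; last first.
  by apply: isCk_mul => //; apply: ih => //; exact: isCkW.
have := @isD_scomp None g (fun _ _ => 0) gs u u' (isSk_S0 gk) (isSk_S0 gsk) (isCk_C0 uk)
  erefl gsP uu'.
by rewrite /scomp; under [X in isD _ _ X -> _]eq_fun do rewrite add0r.
Qed.

End composition.

(** * Differentiability of mild solutions *)

Section regularity.
Context {R : realType} {n : nat}.
Variable T : R.
Hypothesis T0 : 0 < T.
Implicit Types (p q : R * n.-tuple R) (f u v w : R * n.-tuple R -> R)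
  (g : 'I_n -> R * n.-tuple R -> R) (ui vi : n.-tuple R -> R).
Local Notation isC0 := (isC0 T).
Local Notation isCk := (isCk T).
Local Notation isD := (isD T).
Local Notation Sol := (Sol T).

Lemma It_lip f M t t' x : bm M f -> `|It T f (t', x) - It T f (t, x)| <= M * `|t' - t|.
Proof.
move=> fM; have M0 := bm_ge0 fM.
wlog tt' : t t' / clamp T t <= clamp T t'.
  move=> H; have [/H//|/ltW/H] := leP (clamp T t) (clamp T t').
  by rewrite distrC [`|t - t'|]distrC.
have [i1 I1] := intg_ltI tt'.
rewrite /It -IntB; [|exact: intg_It (t', x) fM|exact: intg_It (t, x) fM].
apply: (@le_trans _ _ (M * (clamp T t' - clamp T t))); last first.
  by rewrite ler_wpM2l// (le_trans (ler_norm _))// clamp_lip.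
rewrite -I1 -IntZ//; apply: Int_norm_le; last 2 first.
- exact: intgZ.
- move=> s /=; rewrite -mulrBl normrM mulrC /chi opprB addrC addrA subrK.
  rewrite (ger0_norm (_ : 0 <= ltI (clamp T t) s - ltI (clamp T t') s)).
    by rewrite ler_wpM2r ?fM.2//; move: (ltI_indic tt') => /(congr1 (fun f : R -> R => f s)) /= ->; rewrite indicE.
  by move: (ltI_indic tt') => /(congr1 (fun f : R -> R => f s)) /= ->; rewrite indicE.
by apply: (@intg_measurable _ _ _ lebR); apply: intgB; [exact: (intg_It T (t', x) fM)|exact: (intg_It T (t, x) fM)].
Qed.

Lemma Int_abs_ltI (a b : R) : intg lebR (fun s => `|ltI a s - ltI b s|) /\
  \int[lebR]_s `|ltI a s - ltI b s| = `|b - a|.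
Proof.
wlog ab : a b / a <= b.
  move=> H; have [/H//|/ltW/H] := leP a b; rewrite distrC.
  by under [X in intg _ X]eq_fun do rewrite distrC; under eq_Rintegral do rewrite distrC.
have [i1 I1] := intg_ltI ab.
have E : (fun s => `|ltI a s - ltI b s|) = (fun s => ltI a s - ltI b s).
  apply/funext => s; rewrite ger0_norm//.
  by move: (ltI_indic ab) => /(congr1 (fun f : R -> R => f s)) /= ->; rewrite indicE.
by rewrite E ger0_norm ?subr_ge0.
Qed.

(** Freezing [f] at time [t] costs at most [M * |t' - t|] at each point of an interval of length
    [|t' - t|]. *)
Lemma It_der f M : bm M f -> (forall q q' h, moved T None q q' h -> `|f q' - f q| <= M * `|h|) ->
  derD T M None (It T f) f.
Proof.
move=> fM fl q q' h [/= e -> tq tq']; have M0 := bm_ge0 fM.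
case: q q' e tq tq' => [t x] [t' x'] /= -> tq tq' {x'}.
have [ia Ia] := Int_abs_ltI t t'.
have ct := clamp_id tq; have ct' := clamp_id tq'.
have i1 := intg_It T (t', x) fM; have i2 := intg_It T (t, x) fM.
have kE s : chi T t' s - chi T t s = ltI t s - ltI t' s.
  by rewrite /chi ct ct'; ring.
have [ik Ik] : intg lebR (fun s => chi T t' s - chi T t s) /\
    \int[lebR]_s (chi T t' s - chi T t s) = t' - t.
  split; first by apply: intgB; exact: intg_chi.
  by rewrite IntB ?Int_chi ?ct ?ct'//; exact: intg_chi.
have -> : It T f (t', x) - It T f (t, x) - (t' - t) * f (t, x) =
    \int[lebR]_s ((ltI t s - ltI t' s) * (f (s, x) - f (t, x))).
  rewrite -{1}Ik /It -IntB// -IntZr// -IntB; last 2 first.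
  - exact: intgB.
  - by apply: intg_eq (intgZ (f (t, x)) ik) => s; rewrite mulrC.
  by apply: Int_eq => s /=; rewrite -kE; ring.
have -> : M * (t' - t) ^+ 2 = \int[lebR]_s (M * `|t' - t| * `|ltI t s - ltI t' s|).
  by rewrite IntZ// Ia -mulrA -expr2 real_normK ?num_real.
apply: Int_norm_le; last 2 first.
- exact: intgZ.
- move=> s; rewrite normrM mulrC.
  have [->|k0] := eqVneq (ltI t s - ltI t' s) 0; first by rewrite normr0 !mulr0.
  rewrite ler_wpM2r//; move: k0; rewrite /ltI.
  have sb : `|s - t| <= `|t' - t| -> 0 <= s <= T -> `|f (s, x) - f (t, x)| <= M * `|t' - t|.
    move=> st sT; apply: (le_trans (fl (t, x) (s, x) (s - t) _)) => //.
    by rewrite ler_wpM2l.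
  case: ltP => h1; case: ltP => h2; rewrite ?subrr ?eqxx// => _; apply: sb; move: tq tq' => /andP[? ?] /andP[? ?].
  + by rewrite !ger0_norm; lra.
  + by apply/andP; split; lra.
  + by rewrite !ler0_norm; lra.
  + by apply/andP; split; lra.
apply: measurable_funM; first by apply: measurable_funB; apply: measurable_ltI.
by apply: measurable_funB => //; exact: measurable_section2 fM.1.
Qed.

Variables (w : R * n.-tuple R -> R) (ui : n.-tuple R -> R) (g : 'I_n -> R * n.-tuple R -> R)
  (L M B : R).
Hypotheses (L0 : 0 <= L) (wM : bm M w) (gM : forall j, bm M (g j)) (ws : Sol w ui g).

(** In space, the increment of [w] solves an equation of the same form with data of size [|h|], and
    [gronwall] applies. In time, [w] is the integral of the bounded function [Nop w g]. *)
Lemma sol_lip : (forall j x h, `|ui (tadd x (te j h)) - ui x| <= B * `|h|) ->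
  (forall i j q h, `|g i (shx j h q) - g i q| <= L * `|w (shx j h q) - w q| + B * `|h|) ->
  isC0 w.
Proof.
move=> uil gl; have [C C0 CP] := @gronwall R n T T0 L L0.
have NM := bm_Nop wM gM; set K := (X in bm X (Nop w g)) in NM.
have M0 := bm_ge0 wM; have K0 := bm_ge0 NM.
exists (M + C * `|B| + K); split.
  by apply: bm_mono wM; rewrite -addrA lerDl addr_ge0// mulr_ge0.
case=> [j|] q q' h /=.
  move=> ->; have bs := bm_sub (bm_shx j h wM) wM.
  have gs i := bm_sub (bm_shx j h (gM i)) (gM i).
  have S := Sol_sub (bm_shx j h wM) wM (fun i => bm_shx j h (gM i)) gM (Sol_shx j h ws) ws.
  have B0 : 0 <= `|B| * `|h| by rewrite mulr_ge0.
  have Bh : B * `|h| <= `|B| * `|h| by rewrite ler_wpM2r// ler_norm.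
  have := CP _ _ _ _ _ bs gs S B0 (fun x => le_trans (uil j x h) Bh)
    (fun i q => le_trans (gl i j q h) (lerD (lexx _) Bh)) q.
  move=> /le_trans; apply; rewrite mulrA ler_wpM2r//.
  by rewrite addrAC lerDr addr_ge0.
move=> [e -> _ _]; case: q q' e => [t x] [t' x'] /= -> {x'}.
rewrite ws [w (t, x)]ws /=.
have -> (a b c : R) : c + a - (c + b) = a - b by rewrite opprD addrACA subrr add0r.
apply: (le_trans (It_lip t t' x NM)); rewrite ler_wpM2r// lerDr.
by rewrite addr_ge0// mulr_ge0.
Qed.

Lemma sol_derX v vi (g' : 'I_n -> R * n.-tuple R -> R) j : bm M v ->
  (forall j, bm M (g' j)) -> Sol v vi g' ->
  (forall x h, `|ui (tadd x (te j h)) - ui x - h * vi x| <= B * h ^+ 2) ->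
  (forall i q h, `|g i (shx j h q) - g i q - h * g' i q| <=
     L * `|w (shx j h q) - w q - h * v q| + B * h ^+ 2) ->
  isD (Some j) w v.
Proof.
move=> vM g'M vs uid gd; have [C C0 CP] := @gronwall R n T T0 L L0.
exists (C * `|B|) => q q' h /= ->; have M0 := bm_ge0 wM.
have bs := bm_sub (bm_shx j h wM) wM.
have gs i := bm_sub (bm_shx j h (gM i)) (gM i).
have S := Sol_sub (bm_shx j h wM) wM (fun i => bm_shx j h (gM i)) gM (Sol_shx j h ws) ws.
have S2 := Sol_scale h vM g'M vs.
(* This a priori bound depends on [h]; the constant of [gronwall] does not depend on it. *)
pose K := (M + M) + `|h| * M.
have K1 : M + M <= K by rewrite lerDl mulr_ge0.
have K2 : `|h| * M <= K by rewrite lerDr addr_ge0.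
have S3 := Sol_sub (bm_mono K1 bs) (bm_mono K2 (bm_scale h vM))
  (fun i => bm_mono K1 (gs i)) (fun i => bm_mono K2 (bm_scale h (g'M i))) S S2.
have b3 := bm_sub (bm_mono K1 bs) (bm_mono K2 (bm_scale h vM)).
have g3 i := bm_sub (bm_mono K1 (gs i)) (bm_mono K2 (bm_scale h (g'M i))).
have B0 : 0 <= `|B| * h ^+ 2 by rewrite mulr_ge0 ?sqr_ge0.
have Bh : B * h ^+ 2 <= `|B| * h ^+ 2 by rewrite ler_wpM2r ?sqr_ge0// ler_norm.
have := CP _ _ _ _ _ b3 g3 S3 B0 (fun x => le_trans (uid x h) Bh)
    (fun i q => le_trans (gd i q h) (lerD (lexx _) Bh)) q.
by rewrite mulrA.
Qed.

Lemma sol_derT : isC0 (Nop w g) -> isD None w (Nop w g).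
Proof.
move=> /isC0_uniform[K [K0 NM Nl]]; exists K => q q' h dq.
have := It_der NM (fun q q' h dq => Nl None q q' h dq) dq.
case: (dq) => e _ _ _; rewrite [w q']ws [w q]ws e.
by have -> (a b c : R) : c + a - (c + b) = a - b by rewrite opprD addrACA subrr add0r.
Qed.

End regularity.

(** * The bootstrap to all orders *)

Section regularity_theorem.
Context {R : realType} {n : nat}.
Variable T : R.
Hypothesis T0 : 0 < T.
Implicit Types (p q : R * n.-tuple R) (f u v w : R * n.-tuple R -> R)
  (g a r : 'I_n -> R * n.-tuple R -> R) (ui vi wi : n.-tuple R -> R).
Local Notation isC0 := (isC0 T).
Local Notation isCk := (isCk T).
Local Notation isD := (isD T).
Local Notation Sol := (Sol T).

(** The derivative that [isCk] provides for a datum [wi q.2] is formally a function of [(t, x)];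
    freezing it at [t = 0] turns it into an initial datum again. *)
Lemma isCk_freeze k f : isCk k f -> isCk k (fun q => f (0, q.2)).
Proof.
elim: k f => [|k ih] f fk.
  split => //; have [M [[mf fM] fl]] := isCk_C0 fk; exists M; split.
    split => //; apply: (@measurableT_comp _ _ _ _ _ _ f _ (fun q => (0, q.2)) mf).
    by apply: measurable_fun_pair.
  move=> [j|] q q' h /=; first by move=> ->; apply: (fl (Some j) (0, q.2)).
  by move=> [-> _ _ _]; rewrite subrr normr0 mulr_ge0// (bm_ge0 (conj mf fM)).
have f0 := (ih _ (isCkW fk)); split; first exact: isCk_C0 f0.
move=> [j|]; last first.
  exists (fun=> 0); split; last exact: isCk_cst0.
  by exists 0 => q q' h /= [-> _ _ _]; rewrite subrr mulr0 subrr normr0 mul0r.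
have [f' [[M ff'] f'k]] := fk.2 (Some j); exists (fun q => f' (0, q.2)); split; last exact: ih.
by exists M => q q' h /= ->; exact: (ff' (0, q.2)).
Qed.

Lemma isC0_fin (I : finType) (a : I -> R * n.-tuple R -> R) : (forall j, isC0 (a j)) ->
  exists2 A : R, 0 <= A & forall j, bm A (a j) /\ lipD T A (a j).
Proof.
move=> aC; apply: (@fin_bound _ _ (fun j A => bm A (a j) /\ lipD T A (a j))).
  by move=> j M M' MM' [h1 h2]; split; [exact: bm_mono h1|exact: lipD_mono h2].
by move=> j; exact: aC.
Qed.

Lemma bm_fin (I : finType) (a : I -> R * n.-tuple R -> R) : (forall j, exists M, bm M (a j)) ->
  exists2 A : R, 0 <= A & forall j, bm A (a j).
Proof.
by move=> aC; apply: (@fin_bound _ _ (fun j A => bm A (a j))) => // j M M'; exact: bm_mono.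
Qed.

Lemma lin_C0 w wi a r : (exists M, bm M w) -> Sol w wi (fun j q => a j q * w q + r j q) ->
  isC0 (fun q => wi q.2) -> (forall j, isC0 (a j)) -> (forall j, isC0 (r j)) -> isC0 w.
Proof.
move=> [M wM] ws [D [_ wil]] /isC0_fin[A A0 aP] /isC0_fin[B B0 rP].
have M0 := bm_ge0 wM.
have K1 : M <= M + (A * M + B) by rewrite lerDl addr_ge0// mulr_ge0.
have K2 : A * M + B <= M + (A * M + B) by rewrite lerDr.
apply: (@sol_lip R n T T0 w wi _ A _ (`|D| + A * M + B) A0 (bm_mono K1 wM) _ ws).
- by move=> j; apply: bm_mono K2 _; apply: bm_add (rP j).1; exact: bm_mul (aP j).1 wM.
- move=> j x h; apply: (le_trans (wil (Some j) (0, x) _ h erefl)).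
  by rewrite ler_wpM2r// -addrA (le_trans (ler_norm D))// lerDl addr_ge0// mulr_ge0.
move=> i j q h; set q' := shx j h q.
have -> : a i q' * w q' + r i q' - (a i q * w q + r i q) =
  a i q' * (w q' - w q) + ((a i q' - a i q) * w q + (r i q' - r i q)) by ring.
apply: (le_trans (ler_normD _ _)); apply: lerD.
  by rewrite normrM ler_wpM2r//; exact: (aP i).1.2.
apply: (le_trans (ler_normD _ _)); rewrite -addrA ![in leRHS]mulrDl.
have h1 : `|(a i q' - a i q) * w q| <= A * M * `|h|.
  rewrite normrM mulrAC; apply: ler_pM => //; last exact: wM.2.
  exact: ((aP i).2 (Some j)).
have h2 : `|r i q' - r i q| <= B * `|h| by exact: ((rP i).2 (Some j)).
have : 0 <= `|D| * `|h| by rewrite mulr_ge0.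
by lra.
Qed.

(** Named because it serves twice: as the induction hypothesis of [lin_reg] and as the input of the
    nonlinear bootstrap. *)
Definition linear_regular k := forall w wi a r, (exists M, bm M w) ->
  Sol w wi (fun j q => a j q * w q + r j q) ->
  isCk k (fun q => wi q.2) -> (forall j, isCk k (a j)) -> (forall j, isCk k (r j)) -> isCk k w.

Lemma lin_exists vi a r : (exists M, bm M (fun q => vi q.2)) -> (forall j, exists M, bm M (a j)) ->
  (forall j, exists M, bm M (r j)) -> exists v M, bm M v /\ Sol v vi (fun j q => a j q * v q + r j q).
Proof.
move=> [D vD] /bm_fin[A A0 aA] /bm_fin[B B0 rB].
have D0 := bm_ge0 vD.
have BD : 0 <= B + D by rewrite addr_ge0.
have [||||||||||v [K [vK _ vS]]] := @mild_exists R n T T0 (fun=> 1) (fun j q s => a j q * s + r j q) vi A (B + D).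
- by [].
- by [].
- by move=> x y; rewrite mul1r wgt_ge1.
- move=> j; apply: measurable_funD.
    apply: measurable_funM => //.
    by apply: (@measurableT_comp _ _ _ _ _ _ (a j)) => //; exact: (aA j).1.
  by apply: (@measurableT_comp _ _ _ _ _ _ (r j)) => //; exact: (rB j).1.
- by [].
- by move=> j q s s'; rewrite opprD addrACA subrr addr0 -mulrBr normrM ler_wpM2r//; exact: (aA j).2.
- by move=> j q; rewrite mulr0 add0r mulr1; apply: (le_trans ((rB j).2 q)); rewrite lerDl.
- apply: (@measurableT_comp _ _ _ _ _ _ (fun q => vi q.2) _ (fun x => (0, x)) vD.1).
  by apply: measurable_fun_pair.
- by move=> x; rewrite mulr1; apply: (le_trans (vD.2 (0, x))); rewrite lerDr.
- by [].
by exists v, K.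
Qed.

(** The candidate derivative along [x_i] is the solution [v] of the linear equation with
    coefficients [a] and [r i]. These are only [C^k], since they may contain [w] itself, but that
    suffices: [linear_regular k] makes [v] of class [C^k], and [sol_derX] shows that it is the
    derivative. The time derivative is [Nop w g]. *)
Lemma sol_Ck_step k w wi g a (r : 'I_n -> 'I_n -> R * n.-tuple R -> R) : linear_regular k ->
  (exists M, bm M w) -> Sol w wi g -> isCk k w -> isCk k.+1 (fun q => wi q.2) ->
  (forall j, isCk k (g j)) -> (forall j, isCk k (a j)) -> (forall i j, isCk k (r i j)) ->
  (forall i j, exists L B, [/\ 0 <= L, 0 <= B & forall q h y,
     `|g j (shx i h q) - g j q - h * (a j q * y + r i j q)| <=
     L * `|w (shx i h q) - w q - h * y| + B * h ^+ 2]) ->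
  isCk k.+1 w.
Proof.
move=> lk [M wM] ws wk wik gk ak rk gP; split; first exact: isCk_C0 wk.
have Nk : isCk k (Nop w g) by apply: isCk_Nop.
have [Mg Mg0 gM] := bm_fin (fun j => isCk_bm (gk j)).
move=> [i|]; last first.
  exists (Nop w g); split => //.
  by apply: sol_derT ws (isCk_C0 Nk).
have [wi' [[D wiD] wi'k]] := wik.2 (Some i).
pose vi x := wi' (0, x).
have vik : isCk k (fun q => vi q.2) by exact: isCk_freeze wi'k.
have [v [K [vK vS]]] := lin_exists (isCk_bm vik) (fun j => isCk_bm (ak j)) (fun j => isCk_bm (rk i j)).
have vk : isCk k v by apply: (lk v vi a (r i)) => //; exists K.
have g'k j : isCk k (fun q => a j q * v q + r i j q) by apply: isCk_add => //; exact: isCk_mul.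
have [Mg' Mg'0 g'M] := bm_fin (fun j => isCk_bm (g'k j)).
have [L L0 LP] : exists2 L : R, 0 <= L & forall j q h y,
     `|g j (shx i h q) - g j q - h * (a j q * y + r i j q)| <=
     L * `|w (shx i h q) - w q - h * y| + L * h ^+ 2.
  apply: (@fin_bound _ _ (fun j L => forall q h y,
     `|g j (shx i h q) - g j q - h * (a j q * y + r i j q)| <=
     L * `|w (shx i h q) - w q - h * y| + L * h ^+ 2)).
    move=> j L L' LL' H q h y; apply: (le_trans (H _ _ _)).
    by apply: lerD; rewrite ler_wpM2r// sqr_ge0.
  move=> j; have [L [B [L0 B0 H]]] := gP i j; exists (L + B) => q h y.
  apply: (le_trans (H _ _ _)).
  by apply: lerD; rewrite ler_wpM2r// ?sqr_ge0// ?lerDl// lerDr.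
exists v; split => //.
pose K' := M + Mg + K + Mg'.
have M0 := bm_ge0 wM; have K0 := bm_ge0 vK.
apply: (@sol_derX R n T T0 w wi g L K' (L + `|D|) L0 _ _ ws v vi (fun j q => a j q * v q + r i j q) i) => //.
- by apply: bm_mono wM; rewrite /K'; lra.
- by move=> j; apply: bm_mono (gM j); rewrite /K'; lra.
- by apply: bm_mono vK; rewrite /K'; lra.
- by move=> j; apply: bm_mono (g'M j); rewrite /K'; lra.
- move=> x h; apply: (le_trans (wiD (0, x) _ h erefl)).
  by rewrite ler_wpM2r ?sqr_ge0// (le_trans (ler_norm D))// lerDr.
move=> j q h; apply: (le_trans (LP j q h (v q))); rewrite lerD2l ler_wpM2r ?sqr_ge0//.
by rewrite lerDl.
Qed.

Lemma lin_reg k : linear_regular k.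
Proof.
elim: k => [|k ih] w wi a r wM ws wik ak rk.
  split => //; apply: lin_C0 wM ws (isCk_C0 wik) _ _ => j; [exact: isCk_C0 (ak j)|exact: isCk_C0 (rk j)].
have wk : isCk k w by apply: ih wM ws (isCkW wik) _ _ => j; exact: isCkW.
have /choice[a' /all_and2[aa' a'k]] : forall i, exists a', (forall j, isD (Some i) (a j) (a' j)) /\ (forall j, isCk k (a' j)).
  move=> i; have /choice[a' /all_and2[? ?]] := fun j => (ak j).2 (Some i).
  by exists a'.
have /choice[r' /all_and2[rr' r'k]] : forall i, exists r', (forall j, isD (Some i) (r j) (r' j)) /\ (forall j, isCk k (r' j)).
  move=> i; have /choice[r' /all_and2[? ?]] := fun j => (rk j).2 (Some i).
  by exists r'.
apply: (@sol_Ck_step k w wi _ a (fun i j q => a' i j q * w q + r' i j q) ih wM ws wk wik).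
- move=> j; apply: isCk_add; last exact: isCkW.
  by apply: isCk_mul => //; exact: isCkW.
- by move=> j; exact: isCkW.
- by move=> i j; apply: isCk_add => //; exact: isCk_mul.
move=> i j; have [A [A0 aA al]] := isC0_uniform (isCk_C0 (ak j)).
have [W [W0 wW wl]] := isC0_uniform (isCk_C0 wk).
have [D aD] := aa' i j; have [E rE] := rr' i j.
exists A, (`|D| * W + A * W + `|E|); split => //.
  by rewrite !addr_ge0// mulr_ge0.
move=> q h y; set q' := shx i h q.
have -> : a j q' * w q' + r j q' - (a j q * w q + r j q) -
   h * (a j q * y + (a' i j q * w q + r' i j q)) =
  a j q * (w q' - w q - h * y) + ((a j q' - a j q - h * a' i j q) * w q +
   (a j q' - a j q) * (w q' - w q) + (r j q' - r j q - h * r' i j q)) by ring.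
apply: (le_trans (ler_normD _ _)); apply: lerD.
  by rewrite normrM ler_wpM2r//; exact: aA.2.
apply: (le_trans (ler_normD _ _)); rewrite [leRHS]mulrDl; apply: lerD; last first.
  by apply: (le_trans (rE q q' h erefl)); rewrite ler_wpM2r ?sqr_ge0// ler_norm.
apply: (le_trans (ler_normD _ _)); rewrite [leRHS]mulrDl; apply: lerD.
  rewrite normrM [leRHS]mulrAC; apply: ler_pM => //; last exact: wW.2.
  by apply: (le_trans (aD q q' h erefl)); rewrite ler_wpM2r ?sqr_ge0// ler_norm.
have -> : A * W * h ^+ 2 = (A * `|h|) * (W * `|h|).
  by rewrite -(real_normK (num_real h)); ring.
by rewrite normrM; apply: ler_pM => //; [exact: (al (Some i))|exact: (wl (Some i))].
Qed.

Lemma nonlin_reg (f : 'I_n -> n.-tuple R -> R -> R) u ui : (exists M, bm M u) ->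
  Sol u ui (fun j => scomp (f j) u) ->
  (forall k, isCk k (fun q => ui q.2)) -> (forall k j, isSk k (f j)) -> forall k, isCk k u.
Proof.
move=> [M uM] us uik fk; elim=> [|k uk].
  split => //; have M0 := bm_ge0 uM; have [D [_ uil]] := isCk_C0 (uik 0%N).
  have [A A0 AP] : exists2 A : R, 0 <= A & forall j, bm A (scomp (f j) u) /\
      (forall i x h s, `|f j (tadd x (te i h)) s - f j x s| <= A * `|h|) /\
      (forall x s s', `|f j x s' - f j x s| <= A * `|s' - s|).
    apply: (@fin_bound _ _ (fun j A => bm A (scomp (f j) u) /\
      (forall i x h s, `|f j (tadd x (te i h)) s - f j x s| <= A * `|h|) /\
      (forall x s s', `|f j x s' - f j x s| <= A * `|s' - s|))).
      move=> j A A' AA' [h1 [h2 h3]]; split; first exact: bm_mono h1.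
      split; first by move=> *; apply: le_trans (h2 _ _ _ _) _; rewrite ler_wpM2r.
      by move=> *; apply: le_trans (h3 _ _ _) _; rewrite ler_wpM2r.
    move=> j; have [A [mf fA h2 h3]] := isSk_S0 (fk 0%N j); exists A; split => //.
    by split; [exact: measurable_scomp mf uM.1|move=> q; exact: fA].
  apply: (@sol_lip R n T T0 u ui _ A (M + A) (`|D| + A) A0 _ _ us).
  - by apply: bm_mono uM; rewrite lerDl.
  - by move=> j; apply: bm_mono (AP j).1; rewrite lerDr.
  - move=> j x h; apply: (le_trans (uil (Some j) (0, x) _ h erefl)).
    by rewrite ler_wpM2r// (le_trans (ler_norm D))// lerDl.
  move=> i j q h; rewrite /scomp; set q' := shx j h q.
  have h1 := (AP i).2.1 j q.2 h (u q); have h2 := (AP i).2.2 q'.2 (u q) (u q').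
  rewrite -/(shx j h q).2 -/q' in h1.
  have := ler_normD (f i q'.2 (u q') - f i q'.2 (u q)) (f i q'.2 (u q) - f i q.2 (u q)).
  have : 0 <= `|D| * `|h| by rewrite mulr_ge0.
  by rewrite addrA subrK mulrDl => h3 h4; apply: (le_trans h4); lra.
have /choice[fx /all_and2[fxP fxk]] : forall i, exists fx, (forall j, derSx i (f j) (fx j)) /\
    (forall j, isSk k (fx j)).
  move=> i; have /choice[fx /all_and2[? ?]] := fun j => (fk k.+1 j).2.1 i.
  by exists fx.
have /choice[fs /all_and2[fsP fsk]] : forall j, exists fs, derSs (f j) fs /\ isSk k fs.
  by move=> j; exact: (fk k.+1 j).2.2.
apply: (@sol_Ck_step k u ui _ (fun j => scomp (fs j) u) (fun i j => scomp (fx i j) u)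
  (@lin_reg k) (ex_intro _ M uM) us uk (uik _)).
- by move=> j; exact: isCk_scomp.
- by move=> j; exact: isCk_scomp.
- by move=> i j; exact: isCk_scomp.
move=> i j.
have [L [B [L0 B0 LB]]] := @scomp_remainder _ _ T (Some i) (f j) (fx i j) (fs j) u
  (isSk_S0 (fk k j)) (isSk_S0 (fsk j)) (isCk_C0 uk) (fxP i j) (fsP j).
by exists L, B; split => // q h y; rewrite [X in h * X]addrC; exact: LB.
Qed.

End regularity_theorem.

(** * Mean value estimates and derivatives along lines *)

Section mean_value.
Context {R : realType}.
Variables (f f' : R -> R) (M : R).
Hypothesis df : forall x, is_derive x (1 : R) f (f' x).

Lemma mean_value a b : exists2 c, `|c - a| <= `|b - a| & f b - f a = f' c * (b - a).
Proof.
have cf (i : interval R) : {within [set` i], continuous f}.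
  by apply: derivable_within_continuous => x _; exact: (ex_derive (is_derive := df x)).
have [ab|/ltW ba] := leP a b.
  have [c + ->] := MVT_segment ab (fun x _ => df x) (cf _).
  by rewrite in_itv/= => /andP[ac cb]; exists c => //; rewrite !ger0_norm; lra.
have [c + e] := MVT_segment ba (fun x _ => df x) (cf _).
rewrite in_itv/= => /andP[ac cb]; exists c; first by rewrite !ler0_norm; lra.
by apply: oppr_inj; rewrite opprB e; ring.
Qed.

Lemma mean_value_lip : (forall x, `|f' x| <= M) -> forall a b, `|f b - f a| <= M * `|b - a|.
Proof. by move=> f'M a b; have [c _ ->] := mean_value a b; rewrite normrM ler_wpM2r. Qed.

Lemma mean_value_quad : 0 <= M -> (forall a b, `|f' b - f' a| <= M * `|b - a|) ->
  forall a b, `|f b - f a - (b - a) * f' a| <= M * (b - a) ^+ 2.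
Proof.
move=> M0 f'M a b; have [c ca ->] := mean_value a b.
rewrite -(real_normK (num_real (b - a))) [(b - a) * _]mulrC -mulrBl normrM expr2 mulrA.
by rewrite ler_wpM2r//; apply: (le_trans (f'M _ _)); rewrite ler_wpM2l.
Qed.

End mean_value.

Lemma is_derive_quad (R : realType) (V : normedModType R) (g : V -> R) (v e : V) (c M del : R) : 0 < del ->
  (forall h, `|h| < del -> `|g (h *: e + v) - g v - h * c| <= M * h ^+ 2) -> is_derive v e g c.
Proof.
move=> d0 gM.
have H : h^-1 *: ((g \o shift v) (h *: e) - g v) @[h --> 0^'] --> c.
  apply/cvgrPdist_le => eps e0.
  near=> h.
  have h0 : h != 0 by near: h; exact: nbhs_dnbhs_neq.
  have hd : `|h| < del.
    near: h; apply: dnbhs0_lt => //.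
  have he : `|h| < eps / (`|M| + 1).
    near: h; apply: dnbhs0_lt; rewrite divr_gt0// ltr_wpDl//.
  have := gM h hd; rewrite /shift /= => gh.
  have -> : c - h^-1 *: (g (h *: e + v) - g v) = - (h^-1 * (g (h *: e + v) - g v - h * c)).
    rewrite {1}/GRing.scale/= [h^-1 * (_ - h * c)]mulrBr mulrA mulVf// mul1r opprB; ring.
  rewrite normrN normrM normfV ler_pdivrMl ?normr_gt0//.
  apply: (le_trans gh); rewrite -(real_normK (num_real h)) expr2 mulrA [leRHS]mulrC.
  rewrite ler_wpM2r//; apply: (@le_trans _ _ ((`|M| + 1) * `|h|)).
    by rewrite ler_wpM2r// (le_trans (ler_norm M))// lerDl.
  by rewrite mulrC -ler_pdivlMr ?ltW// ltr_wpDl.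
by split; [apply/cvg_ex; exists c|exact: cvg_lim].
Unshelve. all: by end_near. Qed.

Section directional.
Context {R : realType} {m : nat}.
Implicit Types (v e : 'rV[R]_m) (g : 'rV[R]_m -> R).

Lemma is_derive_line g v e h : (forall w, derivable g w e) ->
  is_derive h (1 : R) (fun k : R => g (v + k *: e)) ('D_e g (v + h *: e)).
Proof.
move=> dg.
have E : (fun k : R => k^-1 *: (((fun k : R => g (v + k *: e)) \o shift h) (k *: 1) - g (v + h *: e))) =
    (fun k : R => k^-1 *: ((g \o shift (v + h *: e)) (k *: e) - g (v + h *: e))).
  apply/funext => k /=; congr (_ *: (g _ - _)).
  by rewrite -[k%:A]/(k * 1) mulr1 scalerDl addrCA.
by split; [rewrite /derivable E; exact: dg|rewrite /derive E].
Qed.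

End directional.

(** * Compactly supported smooth functions on row vectors *)

Section compactly_supported.
Context {R : realType} {m : nat}.
Implicit Types (v e : 'rV[R]_m) (g : 'rV[R]_m -> R) (K : set 'rV[R]_m) (l : seq 'I_m).
Local Notation D := (iter_pd m).

Lemma iter_pd_out K g l v : closed K -> (forall w, ~ K w -> g w = 0) -> ~ K v -> D l g v = 0.
Proof.
move=> cK g0; elim: l v => [|i l ih] v Kv; first exact: g0.
rewrite /= /pd; have : 'D_(delta_mx 0 i) (D l g) v = 'D_(delta_mx 0 i) (cst 0 : 'rV[R]_m -> R) v.
  apply: near_eq_derive; have : nbhs v (~` K) by apply: open_nbhs_nbhs; split => //; exact: closed_openC.
  by apply: filterS => w Kw; exact: ih.
by move=> ->; rewrite derive_cst.
Qed.

Lemma norm_entry_le v i : `|v ord0 i| <= `|v|.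
Proof.
rewrite [leRHS]mx_normrE.
exact: (le_bigmax _ (fun ij : 'I_1 * 'I_m => `|v ij.1 ij.2|) (ord0, i)).
Qed.

Lemma compact_entries_bounded K : compact K -> exists2 A : R, 0 <= A & forall v i, K v -> `|v ord0 i| <= A.
Proof.
move=> /compact_bounded[A [_ AP]]; exists (`|A| + 1) => [|v i Kv]; first by rewrite addr_ge0.
apply: (le_trans (norm_entry_le v i)); apply: (AP (`|A| + 1)) => //.
by rewrite ltr_pwDr// ler_norm.
Qed.

Lemma compact_supp_bounded K g : compact K -> continuous g -> (forall w, ~ K w -> g w = 0) ->
  exists2 M : R, 0 <= M & forall v, `|g v| <= M.
Proof.
move=> cK cg g0.
have /compact_bounded[A [_ AP]] : compact (g @` K).
  by apply: continuous_compact cK; apply: continuous_subspaceT.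
exists (`|A| + 1) => [|v]; first by rewrite addr_ge0.
have [Kv|Kv] := pselect (K v); last by rewrite g0// normr0 addr_ge0.
by apply: (AP (`|A| + 1)); [rewrite ltr_pwDr// ler_norm|exists v].
Qed.

Definition quad_bounds (M : R) g (g' : 'I_m -> 'rV[R]_m -> R) := [/\ 0 <= M, forall v, `|g v| <= M,
  forall i v h, `|g (v + h *: delta_mx 0 i) - g v| <= M * `|h| &
  forall i v h, `|g (v + h *: delta_mx 0 i) - g v - h * g' i v| <= M * h ^+ 2].

(** Compact support bounds every iterated derivative, and the mean value theorem along a coordinate
    line turns the bounds on the next two orders into Lipschitz and remainder estimates. *)
Lemma cc_smooth_bounds g l : cc_smooth m g ->
  exists M, quad_bounds M (D l g) (fun i => D (i :: l) g).
Proof.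
move=> [sg cK]; set K := closure _ in cK.
have clK : closed K by exact: closed_closure.
have g0 v : ~ K v -> g v = 0.
  by move=> Kv; apply/eqP/negPn/negP => gv; apply: Kv; exact: subset_closure.
have bd l' : exists2 M : R, 0 <= M & forall v, `|D l' g v| <= M.
  apply: (compact_supp_bounded cK); first by move=> v; exact: (sg l').1.
  by move=> w; exact: iter_pd_out.
have dr l' v i h : is_derive h (1 : R) (fun k : R => D l' g (v + k *: delta_mx 0 i))
    (D (i :: l') g (v + h *: delta_mx 0 i)).
  by apply: is_derive_line => w; exact: (sg l').2.
have [M M0 MP] := bd l.
have [A A0 AP] : exists2 A : R, 0 <= A & forall i, forall v, `|D (i :: l) g v| <= A.
  apply: (@fin_bound _ _ (fun i A => forall v, `|D (i :: l) g v| <= A)).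
    by move=> i A A' AA' H v; exact: le_trans AA'.
  by move=> i; have [A _ ?] := bd (i :: l); exists A.
have [B B0 BP] : exists2 B : R, 0 <= B & forall i, forall v, `|D [:: i, i & l] g v| <= B.
  apply: (@fin_bound _ _ (fun i A => forall v, `|D [:: i, i & l] g v| <= A)).
    by move=> i C C' CC' H v; exact: le_trans CC'.
  by move=> i; have [C _ ?] := bd [:: i, i & l]; exists C.
have hA : A <= M + A + B by lra.
have hB : B <= M + A + B by lra.
exists (M + A + B); split.
- by rewrite !addr_ge0.
- by move=> v; apply: (le_trans (MP v)); lra.
- move=> i v h; have := mean_value_lip (dr l v i) (fun x => AP i _) 0 h.
  by rewrite scale0r addr0 subr0 => /le_trans; apply; rewrite ler_wpM2r.
- move=> i v h; have := mean_value_quad (dr l v i) B0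
    (mean_value_lip (dr (i :: l) v i) (fun x => BP i _)) 0 h.
  by rewrite scale0r addr0 subr0 => /le_trans; apply; rewrite ler_wpM2r// sqr_ge0.
Qed.

Lemma cc_smooth_supp g : cc_smooth m g -> exists2 A : R, 0 <= A &
  forall l v, D l g v != 0 -> forall i, `|v ord0 i| <= A.
Proof.
move=> [sg cK]; have [A A0 AP] := compact_entries_bounded cK; exists A => // l v lv i.
apply: AP; apply: contrapT => Kv; move: lv; rewrite (@iter_pd_out (closure [set v | g v != 0])) ?eqxx//.
  exact: closed_closure.
by move=> w Kw; apply/eqP/negPn/negP => gv; apply: Kw; exact: subset_closure.
Qed.

End compactly_supported.

Section tuple_functions.
Context {R : realType} {n : nat}.
Implicit Types (x y : n.-tuple R) (g : n.-tuple R -> R).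

Lemma taddBK x y : tadd y (tadd x (topp y)) = x.
Proof. by rewrite taddC -taddA [tadd (topp y) y]taddC; apply: eq_from_tnth => i; rewrite !tnthE; ring. Qed.

(* [{g < a}] is the countable union over rational [w] of the sets [{g w + M |x - w|_1 < a}]. *)
Lemma lipx_measurable M g : 0 <= M -> lipx M g -> mfunT g.
Proof.
move=> M0 gM.
have gD x y : g x <= g y + M * \sum_i `|tnth x i - tnth y i|.
  have := lipx_tadd y (tadd x (topp y)) gM; rewrite taddBK => h.
  rewrite -lerBlDl; apply: (le_trans (ler_norm _)); apply: (le_trans h).
  by rewrite le_eqVlt; apply/orP; left; apply/eqP; congr (_ * _); apply: eq_bigr => i _; rewrite !tnthE.
pose rw (w : {ffun 'I_n -> rat}) : n.-tuple R := [tuple ratr (w i) | i < n].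
have rE w i : tnth (rw w) i = ratr (w i) by rewrite tnth_mktuple.
apply: (measurability _ (RGenInftyO.measurableE R)) => // _ [_ [a ->] <-].
rewrite setTI preimage_itvNyo.
pose F w := [set x | g (rw w) + M * \sum_i `|tnth x i - tnth (rw w) i| < a].
have -> : [set x | g x < a] = \bigcup_w F w.
  apply/seteqP; split => [x /= xa|x [w _]]; last by apply: le_lt_trans; exact: gD.
  (* Replacing [x] by a rational point within [e] costs [M * n * e] in the value and again in the
     penalty; the [+ 1] keeps the total strictly below [a - g x] and the denominator positive. *)
  pose e := (a - g x) / (2 * M * n%:R + 1).
  have D0 : 0 < 2 * M * n%:R + 1 by rewrite ltr_wpDl// !mulr_ge0.
  have e0 : 0 < e by rewrite divr_gt0// subr_gt0.
  have /choice[w wP] : forall i, exists q : rat, `|tnth x i - ratr q| < e.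
    move=> i; have [|q] := @rat_in_itvoo R (tnth x i - e) (tnth x i + e); first by lra.
    by rewrite in_itv/= => /andP[h1 h2]; exists q; rewrite ltr_norml; apply/andP; split; lra.
  exists [ffun i => w i] => //=; rewrite /F/=.
  set S := \sum_i _; have SE : S <= n%:R * e.
    rewrite -[X in X%:R](card_ord n) mulr_natl -sumr_const; apply: ler_sum => i _.
    by rewrite rE ffunE ltW.
  have h1 : g (rw [ffun i => w i]) <= g x + M * S.
    rewrite /S; under eq_bigr do rewrite distrC; exact: gD.
  have h2 := ler_wpM2l M0 SE.
  have h3 : (2 * M * n%:R + 1) * e = a - g x by rewrite mulrC divfK// gt_eqF.
  by move: h3; rewrite mulrDl mul1r -!mulrA; lra.
apply: countable_bigcupT_measurable => [|w]; first exact: countableP.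
have mF : mfunT (fun x => g (rw w) + M * \sum_i `|tnth x i - tnth (rw w) i|); last first.
  have := mF measurableT _ (measurable_itv `]-oo, a[).
  by rewrite setTI preimage_itvNyo.
apply: measurable_funD => //; apply: measurable_funM => //.
apply: measurable_sum => i; apply: (measurableT_comp (@normr_measurable R setT)).
by apply: measurable_funB => //; exact: measurable_tnth.
Qed.

Lemma rho_lower (A : R) x : 0 <= A -> (forall i, `|tnth x i| <= A) -> 1 <= (1 + A ^+ 2) ^+ n * rho x.
Proof.
move=> A0 xA.
have -> : (1 + A ^+ 2) ^+ n = \prod_(i < n) (1 + A ^+ 2) by rewrite prodr_const card_ord.
rewrite /rho -big_split/= -[leLHS](@big1_eq _ _ *%R _ (index_enum 'I_n) xpredT).
apply: ler_prod => i _; rewrite ler01/= /jap ler_pdivlMr ?mul1r; last first.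
  by rewrite ltr_pwDl// sqr_ge0.
rewrite lerD2l -(real_normK (num_real (tnth x i))); apply: lerXn2r => //; exact: xA.
Qed.

End tuple_functions.

(** * Flux, initial datum and space-time in coordinates *)

Section row_vectors.
Context {R : realType}.

Lemma rv_te (n : nat) (x : n.-tuple R) j h : rv n (tadd x (te j h)) = rv n x + h *: delta_mx 0 j.
Proof. by apply/rowP => i; rewrite !mxE !tnthE eqxx/=; case: (i == j); rewrite ?mulr1 ?mulr0. Qed.

Lemma tup_rv (n : nat) (x : n.-tuple R) : tup n (rv n x) = x.
Proof. by apply: eq_from_tnth => i; rewrite tnth_mktuple mxE. Qed.

Lemma rv_tup (n : nat) (v : 'rV[R]_n) : rv n (tup n v) = v.
Proof. by apply/rowP => i; rewrite mxE tnth_mktuple. Qed.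

Lemma quad_bounds_measurable m (M : R) (g : 'rV[R]_m -> R) g' (d : measure_display)
  (Y : measurableType d) (phi : Y -> 'rV[R]_m) : quad_bounds M g g' ->
  (forall i, mfunT (fun y => phi y ord0 i)) -> mfunT (fun y => g (phi y)).
Proof.
move=> [M0 _ gl _] mphi.
have := @lipx_measurable R m M (fun x => g (rv m x)) M0 _.
have -> : (fun y => g (phi y)) = (fun x => g (rv m x)) \o (fun y => tup m (phi y)).
  by apply/funext => y /=; rewrite rv_tup.
move=> H; apply: measurableT_comp; first by apply: H => j x h; rewrite rv_te.
apply/measurable_fun_tnthP => i.
rewrite (_ : _ \o _ = fun y => phi y ord0 i)//.
by apply/funext => y /=; rewrite tnth_mktuple.
Qed.

(** On the support of [g] the coordinates of [phi y], and hence those of [x y], are at most [A],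
    which bounds [rho] from below there. *)
Lemma cc_smooth_rho m n (g : 'rV[R]_m -> R) (Y : Type) (phi : Y -> 'rV[R]_m) (x : Y -> n.-tuple R) :
  cc_smooth m g -> (forall y i, exists i', phi y ord0 i' = tnth (x y) i) ->
  forall l, exists2 M : R, 0 <= M & forall y, `|iter_pd m l g (phi y)| <= M * rho (x y).
Proof.
move=> gs phix l; have [A A0 AP] := cc_smooth_supp gs.
have [M [M0 gM _ _]] := cc_smooth_bounds l gs.
exists (M * (1 + A ^+ 2) ^+ n); first by rewrite mulr_ge0// exprn_ge0// addr_ge0// sqr_ge0.
move=> y; have [->|g0] := eqVneq (iter_pd m l g (phi y)) 0.
  by rewrite normr0 !mulr_ge0// ?(ltW (rho_gt0 _))// exprn_ge0// addr_ge0// sqr_ge0.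
apply: (le_trans (gM _)); rewrite -mulrA ler_peMr//; apply: rho_lower => // i.
by have [i' <-] := phix y i; exact: AP g0 _.
Qed.

Section flux.
Context {d : nat}.
Variable f : d.-tuple R -> R -> R.
Hypothesis fs : cc_smooth (d + 1) (ofXU d f).

Definition xu (x : d.-tuple R) (s : R) : 'rV[R]_(d + 1) := row_mx (rv d x) (const_mx s).

Lemma ofXU_xu x s : ofXU d f (xu x s) = f x s.
Proof. by rewrite /ofXU /xu row_mxKl row_mxKr tup_rv mxE. Qed.

Lemma xu_te x j h s : xu (tadd x (te j h)) s = xu x s + h *: delta_mx 0 (lshift 1 j).
Proof.
rewrite /xu rv_te; apply/rowP => i; rewrite !mxE.
by case: (split_ordP i) => k ->; rewrite !mxE ?eq_lshift ?eq_rlshift//=; ring.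
Qed.

Lemma xu_s x s s' : xu x s' = xu x s + (s' - s) *: delta_mx 0 (rshift d ord0).
Proof.
rewrite /xu; apply/rowP => i; rewrite !mxE.
by case: (split_ordP i) => k ->; rewrite !mxE ?eq_rshift ?eq_lrshift ?(ord1 k)//=; ring.
Qed.

Lemma measurable_xu i : mfunT (fun p : d.-tuple R * R => xu p.1 p.2 ord0 i).
Proof.
rewrite /xu; case: (split_ordP i) => k ->.
  under eq_fun do rewrite row_mxEl mxE.
  by apply: (measurableT_comp (measurable_tnth k)).
by under eq_fun do rewrite row_mxEr mxE; exact: measurable_snd.
Qed.

Lemma isSk_cc k : isSk k f.
Proof.
have H l : isSk k (fun x s => iter_pd (d + 1) l (ofXU d f) (xu x s)).
  elim: k l => [|k ih] l; have [M qb] := cc_smooth_bounds l fs; have [M0 gM gl gq] := qb.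
    split => //; exists M; split => //.
    - exact: (quad_bounds_measurable qb measurable_xu).
    - by move=> j x h s; rewrite xu_te.
    - by move=> x s s'; rewrite (xu_s x s s').
  split.
    exists M; split => //.
    - exact: (quad_bounds_measurable qb measurable_xu).
    - by move=> j x h s; rewrite xu_te.
    - by move=> x s s'; rewrite (xu_s x s s').
  split => [j|].
    exists (fun x s => iter_pd (d + 1) (lshift 1 j :: l) (ofXU d f) (xu x s)); split; last exact: ih.
    by exists M => x h s; rewrite xu_te; exact: gq.
  exists (fun x s => iter_pd (d + 1) (rshift d ord0 :: l) (ofXU d f) (xu x s)); split; last exact: ih.
  by exists M => x s s'; rewrite (xu_s x s s'); exact: gq.
by have := H [::]; under eq_fun do under eq_fun do rewrite /= ofXU_xu.
Qed.

Lemma flux_rho : exists2 M : R, 0 <= M & forall x s, `|f x s| <= M * rho x.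
Proof.
have [|M M0 MP] := @cc_smooth_rho _ d _ (d.-tuple R * R)%type (fun p => xu p.1 p.2) fst fs _ [::].
  by move=> p i; exists (lshift 1 i); rewrite /xu row_mxEl mxE.
by exists M => // x s; have := MP (x, s); rewrite /= ofXU_xu.
Qed.

End flux.

Section initial_datum.
Context {d : nat}.
Variable ui : d.-tuple R -> R.
Hypothesis us : cc_smooth d (fun v => ui (tup d v)).
Let g := fun v : 'rV[R]_d => ui (tup d v).

Lemma isCk_cc (T : R) k : isCk T k (fun q => ui q.2).
Proof.
have H l : isCk T k (fun q : R * d.-tuple R => iter_pd d l g (rv d q.2)).
  have mr i : mfunT (fun q : R * d.-tuple R => rv d q.2 ord0 i).
    by under eq_fun do rewrite mxE; apply: (measurableT_comp (measurable_tnth i)).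
  elim: k l => [|k ih] l; have [M qb] := cc_smooth_bounds l us; have [M0 gM gl gq] := qb.
    split => //; exists M; split; first by split => //; exact: (quad_bounds_measurable qb mr).
    move=> [j|] q q' h /=; first by move=> ->; rewrite rv_te; exact: gl.
    by move=> [-> _ _ _]; rewrite subrr normr0 mulr_ge0.
  split.
    exists M; split; first by split => //; exact: (quad_bounds_measurable qb mr).
    move=> [j|] q q' h /=; first by move=> ->; rewrite rv_te; exact: gl.
    by move=> [-> _ _ _]; rewrite subrr normr0 mulr_ge0.
  move=> [j|]; last first.
    exists (fun=> 0); split; last exact: isCk_cst0.
    by exists 0 => q q' h /= [-> _ _ _]; rewrite subrr mulr0 subrr normr0 mul0r.
  exists (fun q => iter_pd d (j :: l) g (rv d q.2)); split; last exact: ih.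
  by exists M => q q' h /= ->; rewrite rv_te; exact: gq.
by have := H [::]; rewrite /g; under eq_fun do rewrite /= tup_rv.
Qed.

Lemma initial_rho : exists2 M : R, 0 <= M & forall x, `|ui x| <= M * rho x.
Proof.
have [|M M0 MP] := @cc_smooth_rho _ d _ (d.-tuple R) (fun x => rv d x) id us _ [::].
  by move=> p i; exists i; rewrite mxE.
by exists M => // x; have := MP x; rewrite /= tup_rv.
Qed.

End initial_datum.

(** * Smoothness on the open slab *)

Section space_time.
Context {d : nat}.
Implicit Types (p q : R * d.-tuple R) (w u phi : R * d.-tuple R -> R).

Lemma ofST_st u p : ofST d u (st d p) = u p.
Proof.
rewrite /ofST /st row_mxKr tup_rv row_mxEl mxE; by case: p.
Qed.

Lemma st_shx j h q : st d (shx j h q) = st d q + h *: delta_mx 0 (xidx d j).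
Proof.
rewrite /st /shx /= rv_te; apply/rowP => i; rewrite !mxE /xidx.
by case: (split_ordP i) => k ->; rewrite !mxE ?eq_rshift ?eq_lrshift//=; ring.
Qed.

Lemma st_time (t t' : R) (x : d.-tuple R) : st d (t', x) = st d (t, x) + (t' - t) *: delta_mx 0 (tidx d).
Proof.
rewrite /st /=; apply/rowP => i; rewrite !mxE /tidx.
by case: (split_ordP i) => k ->; rewrite !mxE ?eq_lshift ?eq_rlshift ?(ord1 k)//=; ring.
Qed.

Lemma measurable_st i : mfunT (fun p => st d p ord0 i).
Proof.
rewrite /st; case: (split_ordP i) => k ->.
  by under eq_fun do rewrite row_mxEl mxE; exact: measurable_fst.
under eq_fun do rewrite row_mxEr mxE.
by apply: (measurableT_comp (measurable_tnth k)).
Qed.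

Definition unst (v : 'rV[R]_(1 + d)) : R * d.-tuple R := (v ord0 (tidx d), tup d (rsubmx v)).

Lemma ofSTE u v : ofST d u v = u (unst v). Proof. by []. Qed.

Lemma st_unst v : st d (unst v) = v.
Proof.
rewrite /st /unst/= rv_tup -[RHS]hsubmxK; congr (row_mx _ _); apply/rowP => i.
by rewrite !mxE (ord1 i); congr (v _ _); exact: val_inj.
Qed.

Lemma unst_st p : unst (st d p) = p.
Proof. by rewrite /unst /st row_mxKr tup_rv row_mxEl mxE; case: p. Qed.

Lemma test_rho phi l : cc_smooth (1 + d) (ofST d phi) -> exists2 M : R, 0 <= M & forall p,
  `|iter_pd (1 + d) l (ofST d phi) (st d p)| <= M * rho p.2.
Proof.
move=> ps; have [|M M0 MP] := @cc_smooth_rho _ d _ _ (st d) snd ps _ l; last by exists M.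
by move=> p i; exists (rshift 1 i); rewrite /st row_mxEr mxE.
Qed.

Section regular.
Variable T : R.
Local Notation U := [set v : 'rV[R]_(1 + d) | 0 < v ord0 (tidx d) < T].

Let dir (i : 'I_(1 + d)) : option 'I_d := match fintype.split i with inl _ => None | inr j => Some j end.

Let unst_moved i h v : U v -> U (h *: delta_mx 0 i + v) ->
  moved T (dir i) (unst v) (unst (h *: delta_mx 0 i + v)) h.
Proof.
move=> /= /andP[a1 a2] /andP[b1 b2]; rewrite /dir.
case: (split_ordP i) b1 b2 => k -> b1 b2.
  rewrite /moved; split; rewrite /=.
  - by apply: eq_from_tnth => j; rewrite !tnth_mktuple !mxE eq_rlshift/=; ring.
  - by rewrite !mxE (ord1 k) !eqxx/=; ring.
  - by rewrite !ltW.
  - by rewrite !ltW.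
have -> : h *: delta_mx 0 (rshift 1 k) + v = st d (shx k h (unst v)).
  by rewrite st_shx st_unst addrC.
by rewrite unst_st.
Qed.

Let U_open : open U.
Proof.
have -> : U = (fun v : 'rV[R]_(1 + d) => v ord0 (tidx d)) @^-1` `]0, T[.
  by apply/seteqP; split => v /=; rewrite in_itv.
by apply: open_comp; [move=> v _; exact: coord_continuous|exact: interval_open].
Qed.

Let isD_derive i w w' v : U v -> isD T (dir i) w w' -> is_derive v (delta_mx 0 i) (ofST d w) (ofST d w' v).
Proof.
move=> Uv [M wD].
have : \forall h \near (0 : R), U (h *: delta_mx 0 i + v).
  have c : {for (0 : R), continuous (fun h : R => h *: delta_mx 0 i + v : 'rV[R]_(1 + d))}.
    by apply: cvgD; [apply: cvgZr_tmp; exact: cvg_id|exact: cvg_cst].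
  apply: c; rewrite scale0r add0r; exact: open_nbhs_nbhs.
move=> /nbhs_ballP[del /= d0 dP]; apply: (@is_derive_quad _ _ _ _ _ _ M del d0) => h hd.
rewrite !ofSTE; apply: wD; apply: unst_moved => //.
by apply: dP; rewrite /ball/= sub0r normrN.
Qed.

Let isC0_continuous w v : U v -> isC0 T w -> {for v, continuous (ofST d w)}.
Proof.
move=> Uv /isC0_uniform[M [M0 _ wl]].
have bound v' : U v' -> `|ofST d w v - ofST d w v'| <=
    M * (`|v ord0 (tidx d) - v' ord0 (tidx d)| + \sum_i `|v ord0 (xidx d i) - v' ord0 (xidx d i)|).
  move=> Uv'; rewrite !ofSTE.
  have h1 : `|w (unst v) - w ((unst v').1, (unst v).2)| <= M * `|v ord0 (tidx d) - v' ord0 (tidx d)|.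
    apply: (wl None); split => //=; move: Uv Uv' => /= /andP[? ?] /andP[? ?]; by rewrite !ltW.
  have h2 : `|w ((unst v').1, (unst v).2) - w (unst v')| <= M * \sum_i `|v ord0 (xidx d i) - v' ord0 (xidx d i)|.
    have lx : lipx M (fun x => w ((unst v').1, x)).
      by move=> j x h; apply: (wl (Some j)).
    have := lipx_tadd (unst v').2 (tadd (unst v).2 (topp (unst v').2)) lx; rewrite taddBK.
    move=> /le_trans; apply; rewrite ler_wpM2l//; apply: ler_sum => i _.
    by rewrite !tnthE !tnth_mktuple !mxE.
  rewrite mulrDr; apply: le_trans (lerD h1 h2).
  by rewrite -[X in `|X|](subrKA (w ((unst v').1, (unst v).2))) ler_normD.
suff H e : 0 < e -> \forall v' \near v, `|ofST d w v - ofST d w v'| <= e.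
  exact: (proj2 (@cvgrPdist_le _ _ _ (nbhs v) _ (ofST d w) (ofST d w v))).
move=> e0.
pose eta := e / (M + 1) / (1 + d%:R).
have eta0 : 0 < eta by rewrite !divr_gt0// ?ltr_wpDl// ltr_pwDl.
near=> v'.
have Uv' : U v' by near: v'; exact: open_nbhs_nbhs.
apply: (le_trans (bound _ Uv')).
have vv i : `|v ord0 i - v' ord0 i| <= eta.
  move: (i); near: v'; apply: filter_forall => k.
  exact: (proj1 (@cvgrPdist_le _ _ _ (nbhs v) _ (fun v : 'rV[R]_(1 + d) => v ord0 k) (v ord0 k))
    (@coord_continuous R 1 (1 + d) ord0 k v) eta eta0).
apply: (@le_trans _ _ (M * ((1 + d%:R) * eta))).
  rewrite ler_wpM2l// mulrDl mul1r lerD// mulr_natl -[X in _ *+ X]card_ord -sumr_const.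
  by apply: ler_sum => i _.
have d1 : 1 + d%:R != 0 :> R by rewrite gt_eqF// ltr_pwDl.
have -> : (1 + d%:R) * eta = e / (M + 1) by rewrite mulrC divfK.
rewrite mulrA ler_pdivrMr; last by rewrite ltr_wpDl.
by rewrite mulrC ler_wpM2l ?(ltW e0)// lerDl.
Unshelve. all: by end_near. Qed.

Lemma smooth_on_slab u : (forall k, isCk T k u) -> smooth_on (1 + d) U (ofST d u).
Proof.
move=> uk.
(* Stated for every [k], because each derivative in [l] consumes one order. The agreement on the
   open set [U] is what allows the next derivative to be compared. *)
have H l k : exists2 w, isCk T k w & forall v, U v -> iter_pd (1 + d) l (ofST d u) v = ofST d w v.
  elim: l k => [|i l ih] k; first by exists u.
  have [w wk wE] := ih k.+1; have [w' [ww' w'k]] := wk.2 (dir i); exists w' => // v Uv /=.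
  rewrite /pd (_ : 'D_(delta_mx 0 i) _ v = 'D_(delta_mx 0 i) (ofST d w) v).
    by have dw := isD_derive Uv ww'; rewrite derive_val.
  apply: near_eq_derive; have : nbhs v U by exact: open_nbhs_nbhs.
  by apply: filterS => v' Uv'; exact: wE.
have eqn l w v : U v -> (forall v, U v -> iter_pd (1 + d) l (ofST d u) v = ofST d w v) ->
    \forall v' \near v, ofST d w v' = iter_pd (1 + d) l (ofST d u) v'.
  move=> Uv wE; have : nbhs v U by exact: open_nbhs_nbhs.
  by apply: filterS => v' Uv'; rewrite wE.
move=> l; split => [v Uv|i v Uv].
  have [w wk wE] := H l 0%N; have cw := isC0_continuous Uv (isCk_C0 wk).
  rewrite /prop_for /continuous_at wE//; apply: cvg_trans cw.
  exact: (near_eq_cvg (eqn _ _ _ Uv wE)).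
have [w wk wE] := H l 1%N; have [w' [ww' _]] := wk.2 (dir i).
apply: near_eq_derivable (ex_derive (is_derive := isD_derive Uv ww')).
exact: eqn.
Qed.

End regular.
End space_time.
End row_vectors.

(** * Linearity without integrability *)

Section nonintegrable.
Context d (T : measurableType d) (R : realType) (mu : {measure set T -> \bar R}).

(** Without integrability the extended integral is infinite and [fine] sends it to 0. Hence
    [Int_scale] holds for all measurable functions and applies to every section of a Fubini
    integrand, although only almost all sections are integrable. *)
Lemma Int_nonintg (f : T -> R) : mfunT f -> ~ intg mu f -> \int[mu]_x f x = 0.
Proof.
move=> mf nf; rewrite /Rintegral integralE.
have mef : mfunT (EFin \o f) by exact/measurable_EFinP.
have a0 : (0 <= \int[mu]_x ((EFin \o f)^\+ x))%E by apply: integral_ge0.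
have b0 : (0 <= \int[mu]_x ((EFin \o f)^\- x))%E by apply: integral_ge0.
have h : (\int[mu]_x ((EFin \o f)^\+ x) + \int[mu]_x ((EFin \o f)^\- x) = +oo)%E.
  apply/eqP/negPn/negP => h; apply: nf; apply/integrableP; split => //.
  rewrite ltey; apply: contra h => /eqP <-; apply/eqP.
  rewrite -ge0_integralD//; [|exact: measurable_funepos|exact: measurable_funeneg].
  by apply: eq_integral => x _; rewrite -[RHS]/((abse \o (EFin \o f)) x) fune_abse.
by move: a0 b0 h; case: (\int[mu]_x _)%E => [a||] //; case: (\int[mu]_x _)%E => [b||].
Qed.

Lemma Int_scale c (f : T -> R) : mfunT f -> \int[mu]_x (c * f x) = c * \int[mu]_x f x.
Proof.
move=> mf; have [->|c0] := eqVneq c 0.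
  by rewrite mul0r; under eq_Rintegral do rewrite mul0r; rewrite Int0.
have [fi|nf] := pselect (intg mu f); first by rewrite IntZ.
rewrite (Int_nonintg mf nf) mulr0; apply: Int_nonintg; first exact: measurable_funM.
move=> /(intgZ c^-1) cf; apply: nf; apply: intg_eq cf => x.
by rewrite mulrA mulVf// mul1r.
Qed.

(** The bookkeeping of [weak_dual] with abstract integrands: duality exchanges [S] with [S'] and [V]
    with [C]. *)
Lemma Int_regroup (W N A S S' V B C : T -> R) : intg mu A -> intg mu S -> intg mu S' ->
  intg mu V -> intg mu B -> intg mu C ->
  (forall x, W x = A x + (S x + (V x - B x))) -> (forall x, N x = - B x + C x + S' x) ->
  \int[mu]_x S x = \int[mu]_x S' x -> \int[mu]_x V x = \int[mu]_x C x ->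
  [/\ intg mu W, intg mu N & \int[mu]_x W x = \int[mu]_x A x + \int[mu]_x N x].
Proof.
move=> iA iS iS' iV iB iC WE NE eS eV.
have iSV := intgD iS (intgB iV iB); have iBC := intgD (intgN iB) iC.
split.
- by apply: (intg_eq _ (intgD iA iSV)) => x; rewrite WE.
- by apply: (intg_eq _ (intgD iBC iS')) => x; rewrite NE.
rewrite (Int_eq _ WE) (Int_eq _ NE) (IntD iA iSV) (IntD iS (intgB iV iB)) (IntB iV iB).
rewrite (IntD iBC iS') (IntD (intgN iB) iC) (IntN iB) eS eV.
by move: (\int[mu]_x _) (\int[mu]_x _) (\int[mu]_x _) (\int[mu]_x _) => a b c e; ring.
Qed.

End nonintegrable.

(** * Duality in weighted L^1 *)

Section duality.
Context {R : realType} {n : nat}.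
Implicit Types (p q w : R * n.-tuple R) (f G u : R * n.-tuple R -> R) (k : option 'I_n).
Local Notation mu := (@must R n).

Definition wL1 f := intg mu (fun p => f p * rho p.2).
(** [Av None] is $(1-\Delta)^{-1}$ and [Av (Some j)] is $\partial_j(1-\Delta)^{-1}$. They act on the
    side of the test functions; the transposed [Cv] acts on the side of the solutions. *)
Definition Av k G p : R := \int[mu]_w (G (p.1, ysub p.2 w) * ker k w).
Definition rbd (M : R) G := mfunT G /\ forall p, `|G p| <= M * rho p.2.

Lemma rhoV_cancel (a : R) (x : n.-tuple R) : a * rho x * (rho x)^-1 = a.
Proof. by rewrite mulfK// gt_eqF// rho_gt0. Qed.

Lemma measurable_rho2 : mfunT (fun p : R * n.-tuple R => rho p.2).
Proof. exact: (measurableT_comp measurable_rho measurable_snd). Qed.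

Lemma wL1_measurable f : wL1 f -> mfunT f.
Proof.
move=> /intg_measurable mf.
have -> : f = fun p => f p * rho p.2 * (rho p.2)^-1 by apply/funext => p; rewrite rhoV_cancel.
apply: measurable_funM => //.
rewrite (_ : (fun _ => _) = fun p => (2 ^+ n)^-1 * wgt p.2).
  by apply: measurable_funM => //; exact: (measurableT_comp measurable_wgt measurable_snd).
by apply/funext => p; rewrite wgt_rho mulKf// gt_eqF// exprn_gt0.
Qed.

Lemma wL1_rbd f G M : wL1 f -> rbd M G -> intg mu (fun p => f p * G p).
Proof.
move=> fi [mG GM]; apply: (intg_dom _ (intgZ M (intg_norm fi))).
  by apply: measurable_funM => //; exact: wL1_measurable.
move=> p; rewrite normrM normrM (gtr0_norm (rho_gt0 _)) mulrCA.
by rewrite ler_wpM2l.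
Qed.

Lemma wL1D f g : wL1 f -> wL1 g -> wL1 (fun p => f p + g p).
Proof. by move=> fi gi; apply: intg_eq (intgD fi gi) => p; rewrite mulrDl. Qed.

Lemma wL1Z c f : wL1 f -> wL1 (fun p => c * f p).
Proof. by move=> fi; apply: intg_eq (intgZ c fi) => p; rewrite mulrA. Qed.

Lemma wL1N f : wL1 f -> wL1 (fun p => - f p).
Proof. by move=> fi; apply: intg_eq (intgN fi) => p; rewrite mulNr. Qed.

Lemma wL1_norm f : wL1 f -> wL1 (fun p => `|f p|).
Proof. by move=> fi; apply: intg_eq (intg_norm fi) => p; rewrite normrM (gtr0_norm (rho_gt0 _)). Qed.

Lemma wL1_sum (I : Type) (s : seq I) (F : I -> R * n.-tuple R -> R) :
  (forall i, wL1 (F i)) -> wL1 (fun p => \sum_(i <- s) F i p).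
Proof.
move=> Fi; apply: (@intg_eq _ _ _ mu (fun p => \sum_(i <- s) F i p * rho p.2)).
  by move=> p; rewrite mulr_suml.
exact: intg_sum.
Qed.

Lemma wL1_dom f g : mfunT f -> wL1 g -> (forall p, `|f p| <= g p) -> wL1 f.
Proof.
move=> mf gi fg; apply: (intg_dom _ gi) => [|p].
  by apply: measurable_funM => //; exact: measurable_rho2.
by rewrite normrM (gtr0_norm (rho_gt0 _)) ler_wpM2r// ltW// rho_gt0.
Qed.

Lemma wL1_bm f (c : R * n.-tuple R -> R) M : wL1 f -> mfunT c -> (forall p, `|c p| <= M) -> wL1 (fun p => c p * f p).
Proof.
move=> fi mc cM; apply: (wL1_dom _ (wL1Z M (wL1_norm fi))) => [|p].
  by apply: measurable_funM => //; exact: wL1_measurable.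
by rewrite normrM ler_wpM2r.
Qed.

Lemma wgt_tscN (r : R) (z : n.-tuple R) : wgt (tsc (- r) z) = wgt (tsc r z).
Proof. by apply: eq_bigr => i _; rewrite !tnthE; congr (_ * (_ + _)); ring. Qed.

Lemma rho_ysub (x : n.-tuple R) w : rho (ysub x w) <= rho x * wgt (tsc w.1 w.2).
Proof. by rewrite -wgt_tscN; exact: rho_tadd. Qed.

Lemma ysubK (x : n.-tuple R) w : ysub (yadd x w) w = x.
Proof. by apply: eq_from_tnth => i; rewrite !tnthE; ring. Qed.

Lemma measurable_ysub2 : mfunT (fun a : (R * n.-tuple R) * (R * n.-tuple R) =>
  (a.2.1, ysub a.2.2 a.1)).
Proof.
apply: measurable_fun_pair; first exact: (measurableT_comp measurable_fst measurable_snd).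
apply: measurable_tadd; first exact: (measurableT_comp measurable_snd measurable_snd).
apply: measurable_tsc.
  by apply: (measurableT_comp (@oppr_measurable R setT)); exact: (measurableT_comp measurable_fst measurable_fst).
exact: (measurableT_comp measurable_snd measurable_fst).
Qed.

Lemma measurable_yadd2 : mfunT (fun a : (R * n.-tuple R) * (R * n.-tuple R) =>
  (a.2.1, yadd a.2.2 a.1)).
Proof.
apply: measurable_fun_pair; first exact: (measurableT_comp measurable_fst measurable_snd).
apply: measurable_yadd; [exact: (measurableT_comp measurable_snd measurable_snd)|exact: measurable_fst].
Qed.

Section pair.
Variables (k : option 'I_n) (f G : R * n.-tuple R -> R) (M : R).
Hypotheses (fi : wL1 f) (GM : rbd M G).
Let M0 : 0 <= M.
Proof.
have := le_trans (normr_ge0 _) (GM.2 (0, t0)).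
by rewrite pmulr_lge0// rho_gt0.
Qed.

(** [H] and [H'] differ by the shear that moves the point [p] by [r z]. It preserves [must] for each
    fixed [w], so the two double integrals agree; integrating over [w] first gives [Av] in one and
    [Cv] in the other. *)
Let H (a : (R * n.-tuple R) * (R * n.-tuple R)) := f a.2 * G (a.2.1, ysub a.2.2 a.1) * ker k a.1.
Let H' (a : (R * n.-tuple R) * (R * n.-tuple R)) := f (a.2.1, yadd a.2.2 a.1) * G a.2 * ker k a.1.

Let iH : intg (mu \x mu)%E H.
Proof.
have mf := wL1_measurable fi.
apply: (@intg_dom _ _ _ (mu \x mu)%E H (fun a => M * ((`|ker k a.1| * wgt (tsc a.1.1 a.1.2)) * `|f a.2 * rho a.2.2|))).
- apply: measurable_funM; last exact: (measurableT_comp (measurable_ker k) measurable_fst).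
  apply: measurable_funM; first exact: (measurableT_comp mf measurable_snd).
  exact: (measurableT_comp GM.1 measurable_ysub2).
- by apply: intgZ; exact: (intg_tensor (intg_kerW k) (intg_norm fi)).
- move=> [w p]; rewrite /H /= [`|_ * ker k w|]normrM [`|f p * G _|]normrM [`|f p * rho _|]normrM (gtr0_norm (rho_gt0 _)).
  have h1 : `|G (p.1, ysub p.2 w)| <= M * (rho p.2 * wgt (tsc w.1 w.2)).
    by apply: (le_trans (GM.2 _)); rewrite ler_wpM2l// rho_ysub.
  rewrite mulrAC [leRHS](_ : _ = `|f p| * `|ker k w| * (M * (rho p.2 * wgt (tsc w.1 w.2)))); last by ring.
  by rewrite ler_wpM2l// mulr_ge0.
Qed.

Let H'E : H' = fun a => H (a.1, (a.2.1, tadd a.2.2 (tsc a.1.1 a.1.2))).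
Proof. by apply/funext => -[w p]; rewrite /H /H' /= ysubK; case: p. Qed.

Let iH' : intg (mu \x mu)%E H'.
Proof.
rewrite H'E; apply: (@intg_shear _ _ _ _ _ mu mu H (fun w p => (p.1, tadd p.2 (tsc w.1 w.2)))).
- by move=> w; exact: must_shift_mpres.
- rewrite -[X in mfunT X]H'E; have mf := wL1_measurable fi.
  apply: measurable_funM; last exact: (measurableT_comp (measurable_ker k) measurable_fst).
  apply: measurable_funM; last exact: (measurableT_comp GM.1 measurable_snd).
  exact: (measurableT_comp mf measurable_yadd2).
exact: iH.
Qed.

Let fib1 p : \int[mu]_w H (w, p) = f p * Av k G p.
Proof.
rewrite /H /Av /= -Int_scale; first by apply: Int_eq => w; rewrite mulrA.
apply: measurable_funM (measurable_ker k); apply: (measurableT_comp GM.1).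
by apply: (@measurableT_comp _ _ _ _ _ _ _ _ (fun w => (w, p)) measurable_ysub2).
Qed.

Let fib2 p : \int[mu]_w H' (w, p) = Cv k f p * G p.
Proof.
rewrite /H' /Cv /= mulrC -Int_scale; first by apply: Int_eq => w; ring.
apply: measurable_funM (measurable_ker k); exact: measurable_yadd_section (wL1_measurable fi).
Qed.

Let IHH' : \int[mu]_w \int[mu]_p H (w, p) = \int[mu]_w \int[mu]_p H' (w, p).
Proof.
apply: Int_eq => w.
have iw : intg mu (fun p => H (w, p)).
  have : intg mu (fun p => ker k w * (f p * G (p.1, ysub p.2 w))).
    apply: intgZ; apply: (@wL1_rbd _ _ (M * wgt (tsc w.1 w.2)) fi); split.
      exact: (measurable_fun_pair2 w (measurableT_comp GM.1 measurable_ysub2)).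
    by move=> p; apply: (le_trans (GM.2 _)); rewrite -mulrA ler_wpM2l// mulrC rho_ysub.
  by apply: intg_eq => p; rewrite /H /=; ring.
by rewrite H'E /= (mpres_Int (must_shift_mpres (tsc w.1 w.2)) iw).
Qed.

Lemma intg_Av : intg mu (fun p => f p * Av k G p).
Proof. by have := intg_fubini2 iH; apply: intg_eq => p; exact: fib1. Qed.

Lemma intg_CvG : intg mu (fun p => Cv k f p * G p).
Proof. by have := intg_fubini2 iH'; apply: intg_eq => p; exact: fib2. Qed.

Lemma Cv_dual : \int[mu]_p (f p * Av k G p) = \int[mu]_p (Cv k f p * G p).
Proof.
under [LHS]eq_Rintegral do rewrite -fib1; under [RHS]eq_Rintegral do rewrite -fib2.
rewrite -(Int_fubini2 iH) -(Int_fubini2 iH') (Int_fubini1 iH) (Int_fubini1 iH').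
exact: IHH'.
Qed.

(** The other order of integration: pairing with [Av k G] is a kernel average of pairings with
    translates of [G]. Uniqueness rests on this form. *)
Lemma Int_Av : intg mu (fun w => ker k w * \int[mu]_p (f p * G (p.1, ysub p.2 w))) /\
  \int[mu]_p (f p * Av k G p) = \int[mu]_w (ker k w * \int[mu]_p (f p * G (p.1, ysub p.2 w))).
Proof.
have E w : \int[mu]_p H (w, p) = ker k w * \int[mu]_p (f p * G (p.1, ysub p.2 w)).
  rewrite -Int_scale; first by apply: Int_eq => p; rewrite /H /=; ring.
  apply: measurable_funM; first exact: wL1_measurable.
  exact: (measurable_fun_pair2 w (measurableT_comp GM.1 measurable_ysub2)).
split; first by apply: (intg_eq E); exact: (intg_fubini1 iH).
under eq_Rintegral do rewrite -fib1.
by rewrite -(Int_fubini2 iH) (Int_fubini1 iH); apply: Int_eq => w; exact: E.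
Qed.

End pair.

Lemma rbd_rho : rbd 1 (fun p : R * n.-tuple R => rho p.2).
Proof.
by split => [|p]; [exact: measurable_rho2|rewrite mul1r (gtr0_norm (rho_gt0 _))].
Qed.

Lemma wL1_Cv k f : wL1 f -> wL1 (Cv k f).
Proof. by move=> fi; exact: (intg_CvG k fi rbd_rho). Qed.

Lemma norm_Av_le k G M p : rbd M G -> `|Av k G p| <= M * kmass (n := n) * rho p.2.
Proof.
move=> [mG GM]; have M0 : 0 <= M.
  by have := le_trans (normr_ge0 _) (GM (0, t0)); rewrite pmulr_lge0// rho_gt0.
apply: (@le_trans _ _ (M * rho p.2 * \int[mu]_w (`|ker k w| * wgt (tsc w.1 w.2)))); last first.
  by rewrite [leRHS]mulrAC ler_wpM2l ?kmass_le// mulr_ge0// ltW// rho_gt0.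
rewrite -IntZ; last exact: intg_kerW.
apply: Int_norm_le; last 2 first.
- exact: intgZ (intg_kerW k).
- move=> w; rewrite [leRHS](_ : _ = M * (rho p.2 * wgt (tsc w.1 w.2)) * `|ker k w|); last by ring.
  rewrite normrM ler_wpM2r//; apply: (le_trans (GM _)).
  by rewrite ler_wpM2l// rho_ysub.
apply: measurable_funM (measurable_ker k).
exact: (measurable_fun_pair1 p (measurableT_comp mG measurable_ysub2)).
Qed.

(* Dualizing against [sign (Cv k f) * rho] reduces the bound to the pointwise one for [Av]. *)
Lemma Cv_L1 k f : wL1 f ->
  \int[mu]_p (`|Cv k f p| * rho p.2) <= kmass (n := n) * \int[mu]_p (`|f p| * rho p.2).
Proof.
move=> fi; pose G p := (1 - 2 * ltI (Cv k f p) 0) * rho p.2.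
have mC := wL1_measurable (wL1_Cv k fi).
have G1 : rbd 1 G.
  split; first apply: measurable_funM measurable_rho2.
    apply: measurable_funB => //; apply: measurable_funM => //.
    exact: measurable_ltI.
  move=> p; rewrite normrM (gtr0_norm (rho_gt0 _)) ler_wpM2r ?(ltW (rho_gt0 _))//.
  by rewrite /ltI; case: ifP => _; rewrite ?mulr0 ?subr0 ?normr1// mulr1 ler_norml; lra.
rewrite (@Int_eq _ _ _ mu _ (fun p => Cv k f p * G p)); last first.
  move=> p; rewrite /G mulrA; congr (_ * _); rewrite /ltI; case: ltP => h.
    by rewrite ltr0_norm//; ring.
  by rewrite ger0_norm//; ring.
rewrite -(Cv_dual k fi G1) -IntZ; last exact: (wL1_norm fi).
apply: (le_trans (ler_norm _)); apply: Int_norm_le.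
- exact: intg_measurable (intg_Av k fi G1).
- exact: intgZ (wL1_norm fi).
move=> p; rewrite normrM; have := norm_Av_le k p G1; rewrite mul1r => h.
by rewrite mulrCA ler_wpM2l.
Qed.

Lemma wL1_Nop u (F : 'I_n -> R * n.-tuple R -> R) : wL1 u -> (forall j, wL1 (F j)) -> wL1 (Nop u F).
Proof.
move=> ui Fi; apply: wL1D; last by apply: wL1_sum => j; exact: wL1_Cv.
by apply: wL1D; [exact: wL1N|exact: wL1_Cv].
Qed.

(** [Av k] commutes with the move [mv], so [Av k G'] is a derivative of [Av k G = phi], and so is
    [phi']; two such numbers differ by [O(h)]. *)
Lemma Av_unique_derivative k (mv : R -> R * n.-tuple R -> R * n.-tuple R) (phi phi' G G' : R * n.-tuple R -> R)
    (A B M q : _) :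
  (forall h q w, mv h (q.1, ysub q.2 w) = ((mv h q).1, ysub (mv h q).2 w)) ->
  rbd A G -> rbd A G' ->
  (forall h q, `|G (mv h q) - G q - h * G' q| <= M * h ^+ 2) ->
  (forall h q, `|phi (mv h q) - phi q - h * phi' q| <= B * h ^+ 2) ->
  (forall q, Av k G q = phi q) -> Av k G' q = phi' q.
Proof.
move=> mvP GA G'A Gd phid AvG; apply/esym/eqP; rewrite -subr_eq0; apply/eqP.
have A0 : 0 <= A.
  by have := le_trans (normr_ge0 _) (GA.2 (0, t0)); rewrite pmulr_lge0// rho_gt0.
have bmr H : rbd A H -> bm A H.
  move=> [mH HA]; split => // p; apply: (le_trans (HA p)).
  by rewrite ler_piMr// rho_le1.
have ms (H : R * n.-tuple R -> R) p : mfunT H -> mfunT (fun w => H (p.1, ysub p.2 w)).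
  by move=> mH; exact: (measurable_fun_pair1 p (measurableT_comp mH measurable_ysub2)).
have iA H p : rbd A H -> intg mu (fun w => H (p.1, ysub p.2 w) * ker k w).
  move=> HA; apply: (@intgM_bounded _ _ _ mu _ _ A); [exact: ms HA.1| |exact: intg_ker].
  by move=> w; exact: (bmr _ HA).2.
apply: (@eq0_small _ _ (B + M * kmass (n := n))) => h /andP[h0 h1].
have E : h * (phi' q - Av k G' q) = - (phi (mv h q) - phi q - h * phi' q) +
   (Av k G (mv h q) - Av k G q - h * Av k G' q) by rewrite !AvG; ring.
have h2 : `|Av k G (mv h q) - Av k G q - h * Av k G' q| <= M * h ^+ 2 * kmass (n := n).
  rewrite /Av -IntB; [|exact: iA|exact: iA].
  rewrite -IntZ; last exact: iA.
  rewrite -IntB; [|by apply: intgB; exact: iA|by apply: intgZ; exact: iA].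
  rewrite (@Int_eq _ _ _ mu _ (fun w => (G (mv h (q.1, ysub q.2 w)) - G (q.1, ysub q.2 w)
    - h * G' (q.1, ysub q.2 w)) * ker k w)); last by move=> w; rewrite mvP; ring.
  apply: norm_Int_ker_le => [|w]; last exact: Gd.
  apply: measurable_funB; last by apply: measurable_funM => //; exact: ms G'A.1.
  apply: measurable_funB; last exact: ms GA.1.
  by under eq_fun do rewrite mvP; exact: ms GA.1.
have h3 := phid h q.
have : `|h * (phi' q - Av k G' q)| <= (B + M * kmass (n := n)) * h ^+ 2.
  rewrite E; apply: (le_trans (ler_normD _ _)); rewrite normrN mulrDl.
  by apply: lerD => //; rewrite mulrAC.
by rewrite normrM gtr0_norm// expr2 mulrA [leLHS]mulrC ler_pM2r.
Qed.

End duality.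

(** * Test functions as images of the resolvent *)

Section test_functions.
Context {R : realType} {d : nat}.
Variable phi : R * d.-tuple R -> R.
Hypothesis ps : cc_smooth (1 + d) (ofST d phi).
Local Notation mu := (@must R d).

Definition tD (l : seq 'I_(1 + d)) (p : R * d.-tuple R) : R := iter_pd (1 + d) l (ofST d phi) (st d p).
(* [tG l] is [phi - Delta phi] differentiated along [l], so that [Av None (tG l) = tD l]. *)
Definition tG (l : seq 'I_(1 + d)) p : R := tD l p - \sum_j tD (l ++ [:: xidx d j; xidx d j]) p.

Definition stmv (i : 'I_(1 + d)) (h : R) (q : R * d.-tuple R) := unst (st d q + h *: delta_mx 0 i).

Lemma st_stmv i h q : st d (stmv i h q) = st d q + h *: delta_mx 0 i.
Proof. by rewrite /stmv st_unst. Qed.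

Lemma stmv_x j h q : stmv (xidx d j) h q = shx j h q.
Proof. by rewrite /stmv -st_shx unst_st. Qed.

Lemma stmv_t h t x : stmv (tidx d) h (t, x) = (t + h, x).
Proof.
rewrite /stmv (_ : st d (t, x) + _ = st d (t + h, x)) ?unst_st//.
by rewrite (st_time t (t + h) x) addrAC subrr add0r.
Qed.

Lemma stmv_ysub i h q w : stmv i h (q.1, ysub q.2 w) = ((stmv i h q).1, ysub (stmv i h q).2 w).
Proof.
case: q => t x; case: (split_ordP i) => j ->.
  by rewrite (ord1 j) -/(tidx d) !stmv_t.
by rewrite -/(xidx d j) !stmv_x /shx /ysub /= taddAC.
Qed.

Lemma tD_nil p : tD [::] p = phi p.
Proof. exact: ofST_st. Qed.

Lemma tD_rbd l : exists M, rbd M (tD l).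
Proof.
have [M M0 MP] := test_rho l ps; exists M; split => //.
by have [K qb] := cc_smooth_bounds l ps; exact: (quad_bounds_measurable qb (@measurable_st R d)).
Qed.

Lemma tD_quad l : exists2 M : R, 0 <= M & forall i h q,
  `|tD l (stmv i h q) - tD l q - h * tD (i :: l) q| <= M * h ^+ 2 /\ `|tD l (stmv i h q) - tD l q| <= M * `|h|.
Proof.
have [M [M0 _ gl gq]] := cc_smooth_bounds l ps; exists M => // i h q.
by rewrite /tD st_stmv; split; [exact: gq|exact: gl].
Qed.

Lemma tG_rbd l : exists M, rbd M (tG l).
Proof.
have [M [mM MP]] := tD_rbd l.
have [K K0 KP] : exists2 K : R, 0 <= K & forall j, rbd K (tD (l ++ [:: xidx d j; xidx d j])).
  apply: (@fin_bound _ _ (fun j K => rbd K (tD (l ++ [:: xidx d j; xidx d j])))).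
    move=> j A B AB [mA AP]; split => // p; apply: (le_trans (AP p)).
    by rewrite ler_wpM2r// ltW// rho_gt0.
  by move=> j; exact: tD_rbd.
exists (M + d%:R * K); split.
  by apply: measurable_funB => //; apply: measurable_sum => j; exact: (KP j).1.
move=> p; rewrite /tG; apply: (le_trans (ler_normB _ _)); rewrite mulrDl; apply: lerD => //.
apply: (le_trans (ler_norm_sum _ _ _)).
rewrite -mulrA mulr_natl -[X in _ *+ X]card_ord -sumr_const; apply: ler_sum => j _.
exact: (KP j).2.
Qed.

Lemma tG_quad l : exists2 M : R, 0 <= M & forall i h q,
  `|tG l (stmv i h q) - tG l q - h * tG (i :: l) q| <= M * h ^+ 2.
Proof.
have [M M0 MP] := tD_quad l.
have [K K0 KP] : exists2 K : R, 0 <= K & forall j i h q,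
    `|tD (l ++ [:: xidx d j; xidx d j]) (stmv i h q) - tD (l ++ [:: xidx d j; xidx d j]) q
      - h * tD (i :: l ++ [:: xidx d j; xidx d j]) q| <= K * h ^+ 2.
  apply: (@fin_bound _ _ (fun j K => forall i h q, `|tD (l ++ [:: xidx d j; xidx d j]) (stmv i h q)
      - tD (l ++ [:: xidx d j; xidx d j]) q
      - h * tD (i :: l ++ [:: xidx d j; xidx d j]) q| <= K * h ^+ 2)).
    by move=> j A B AB AP i h q; apply: (le_trans (AP i h q)); rewrite ler_wpM2r// sqr_ge0.
  by move=> j; have [K _ KP] := tD_quad (l ++ [:: xidx d j; xidx d j]); exists K => i h q; exact: (KP i h q).1.
exists (M + d%:R * K) => [|i h q]; first by rewrite addr_ge0// mulr_ge0.
have -> : tG l (stmv i h q) - tG l q - h * tG (i :: l) q =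
    (tD l (stmv i h q) - tD l q - h * tD (i :: l) q) -
    \sum_j (tD (l ++ [:: xidx d j; xidx d j]) (stmv i h q) - tD (l ++ [:: xidx d j; xidx d j]) q
      - h * tD (i :: l ++ [:: xidx d j; xidx d j]) q).
  by rewrite /tG !sumrB -mulr_sumr; ring.
apply: (le_trans (ler_normB _ _)); rewrite mulrDl; apply: lerD; first exact: (MP _ _ _).1.
apply: (le_trans (ler_norm_sum _ _ _)).
by rewrite -mulrA mulr_natl -[X in _ *+ X]card_ord -sumr_const; apply: ler_sum => j _.
Qed.

Lemma Av_tG p : Av None (tG [::]) p = phi p.
Proof.
case: p => t x.
have [A [mA AP]] := tD_rbd [::]; have [B B0 BP] := tD_quad [::].
have A0 : 0 <= A.
  by have := le_trans (normr_ge0 _) (AP (0, t0)); rewrite pmulr_lge0// rho_gt0.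
have [K K0 KP] : exists2 K : R, 0 <= K & forall j, [/\ rbd K (tD [:: xidx d j]),
    rbd K (tD [:: xidx d j; xidx d j]) & forall i h q,
    `|tD [:: xidx d j] (stmv i h q) - tD [:: xidx d j] q - h * tD [:: i; xidx d j] q| <= K * h ^+ 2 /\
        `|tD [:: xidx d j] (stmv i h q) - tD [:: xidx d j] q| <= K * `|h|].
  have rm L L' (H : R * d.-tuple R -> R) : L <= L' -> rbd L H -> rbd L' H.
    move=> LL' [mH HL]; split => // q; apply: (le_trans (HL q)).
    by rewrite ler_wpM2r// ltW// rho_gt0.
  apply: (@fin_bound _ _ (fun j K => [/\ rbd K (tD [:: xidx d j]),
    rbd K (tD [:: xidx d j; xidx d j]) & forall i h q,
    `|tD [:: xidx d j] (stmv i h q) - tD [:: xidx d j] q - h * tD [:: i; xidx d j] q| <= K * h ^+ 2 /\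
        `|tD [:: xidx d j] (stmv i h q) - tD [:: xidx d j] q| <= K * `|h|])).
    move=> j L L' LL' [h1 h2 h3]; split; [exact: rm h1|exact: rm h2|].
    move=> i h q; have [a b] := h3 i h q; split.
      by apply: (le_trans a); rewrite ler_wpM2r// sqr_ge0.
    by apply: (le_trans b); rewrite ler_wpM2r.
  move=> j; have [M1 h1] := tD_rbd [:: xidx d j]; have [M2 h2] := tD_rbd [:: xidx d j; xidx d j].
  have [M3 M30 h3] := tD_quad [:: xidx d j].
  exists (`|M1| + `|M2| + M3); split.
  - by apply: rm h1; have := ler_norm M1; have := normr_ge0 M2; lra.
  - by apply: rm h2; have := ler_norm M2; have := normr_ge0 M1; lra.
  - have M33 : M3 <= `|M1| + `|M2| + M3 by rewrite lerDr addr_ge0.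
    move=> i h q; have [a b] := h3 i h q; split.
      by apply: (le_trans a); rewrite ler_wpM2r// sqr_ge0.
    by apply: (le_trans b); rewrite ler_wpM2r.
pose M := A + B + K.
have AM : A <= M by rewrite /M; lra.
have BM : B <= M by rewrite /M; lra.
have KM : K <= M by rewrite /M; lra.
have bdd L (H : R * d.-tuple R -> R) : 0 <= L -> L <= M -> rbd L H -> bddx M (fun y => H (t, y)).
  move=> L0 LM [_ HL] y; apply: (le_trans (HL _)); apply: le_trans LM.
  by rewrite ler_piMr// rho_le1.
have ms (H : R * d.-tuple R -> R) : mfunT H -> mfunT (fun y => H (t, y)).
  by move=> mH; exact: (measurable_fun_pair2 t mH).
have qM L (h : R) : L <= M -> L * h ^+ 2 <= M * h ^+ 2 by move=> LM; rewrite ler_wpM2r// sqr_ge0.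
have := @ker_inv R d M (fun y => tD [::] (t, y)) (fun j y => tD [:: xidx d j] (t, y))
  (fun j y => tD [:: xidx d j; xidx d j] (t, y)) (ms _ mA) _ _ _ _ _ _ _ _ x.
rewrite tD_nil; apply.
- by move=> j; apply: ms; have [[]] := KP j.
- by move=> j; apply: ms; have [_ []] := KP j.
- exact: bdd A0 AM (conj mA AP).
- by move=> j; have [h1 _ _] := KP j; exact: bdd K0 KM h1.
- by move=> j; have [_ h1 _] := KP j; exact: bdd K0 KM h1.
- move=> j y h; apply: (le_trans _ (qM _ h BM)).
  by have := (BP (xidx d j) h (t, y)).1; rewrite stmv_x.
- move=> j y h; apply: (le_trans _ (qM _ h KM)).
  by have [_ _ h3] := KP j; have := (h3 (xidx d j) h (t, y)).1; rewrite stmv_x.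
- move=> j i y h; apply: (@le_trans _ _ (K * `|h|)); last by rewrite ler_wpM2r.
  by have [_ _ h3] := KP j; have := (h3 (xidx d i) h (t, y)).2; rewrite stmv_x.
Qed.

Lemma rbd_mono M M' (H : R * d.-tuple R -> R) : M <= M' -> rbd M H -> rbd M' H.
Proof.
move=> MM' [mH HM]; split => // p; apply: (le_trans (HM p)).
by rewrite ler_wpM2r// ltW// rho_gt0.
Qed.

Lemma Av_tG1 i p : Av None (tG [:: i]) p = tD [:: i] p.
Proof.
have [A GA] := tG_rbd [::]; have [B GB] := tG_rbd [:: i].
have [M _ MP] := tG_quad [::]; have [C _ CP] := tD_quad [::].
apply: (@Av_unique_derivative R d None (stmv i) (tD [::]) (tD [:: i]) (tG [::]) (tG [:: i])
  (`|A| + `|B|) C M).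
- by move=> *; exact: stmv_ysub.
- by apply: rbd_mono GA; have := ler_norm A; have := normr_ge0 B; lra.
- by apply: rbd_mono GB; have := ler_norm B; have := normr_ge0 A; lra.
- by move=> h q; exact: MP.
- by move=> h q; exact: (CP i h q).1.
- by move=> q; rewrite Av_tG tD_nil.
Qed.

Lemma Av_tGx j p : Av (Some j) (tG [::]) p = tD [:: xidx d j] p.
Proof.
rewrite -Av_tG1; apply/esym.
have [A GA] := tG_rbd [::]; have [B GB] := tG_rbd [:: xidx d j].
have [M M0 MP] := tG_quad [::].
have ms (H : R * d.-tuple R -> R) : mfunT H -> mfunT (fun y => H (p.1, y)).
  by move=> mH; exact: (measurable_fun_pair2 p.1 mH).
have bdd L (H : R * d.-tuple R -> R) : L <= `|A| + `|B| + M -> rbd L H -> bddx (`|A| + `|B| + M) (fun y => H (p.1, y)).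
  move=> LM HL y; apply: (le_trans ((rbd_mono LM HL).2 _)).
  by rewrite ler_piMr// ?rho_le1// !addr_ge0.
apply: (@ker_der R d (`|A| + `|B| + M) (fun y => tG [::] (p.1, y)) (fun y => tG [:: xidx d j] (p.1, y)) j p.2).
- exact: ms GA.1.
- exact: ms GB.1.
- by apply: bdd GA; have := ler_norm A; have := normr_ge0 B; lra.
- by apply: bdd GB; have := ler_norm B; have := normr_ge0 A; lra.
- move=> x h; have := MP (xidx d j) h (p.1, x); rewrite stmv_x => /le_trans; apply.
  by rewrite ler_wpM2r ?sqr_ge0// lerDr addr_ge0.
Qed.

Lemma pd_lapx p : pd (1 + d) (tidx d) (lapx d (ofST d phi)) (st d p) =
  \sum_j tD [:: tidx d; xidx d j; xidx d j] p.
Proof.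
have [sg _] := ps; rewrite /pd.
have -> : lapx d (ofST d phi) = \sum_j iter_pd (1 + d) [:: xidx d j; xidx d j] (ofST d phi).
  by apply/funext => v; rewrite /lapx fct_sumE.
rewrite derive_sum// => j; exact: (sg [:: xidx d j; xidx d j]).2.
Qed.

Definition weak_integrand (u : R * d.-tuple R -> R) (F : 'I_d -> R * d.-tuple R -> R) p : R :=
  u p * pd (1 + d) (tidx d) (ofST d phi) (st d p)
         + \sum_(j < d) F j p * pd (1 + d) (xidx d j) (ofST d phi) (st d p)
         + u p * lapx d (ofST d phi) (st d p)
         - u p * pd (1 + d) (tidx d) (lapx d (ofST d phi)) (st d p).

(** With [G = tG [::]], the derivative [phi_t - d_t Delta phi] is [tG [:: tidx d]], the Laplacian of
    [phi] is [Av None G - G], and [d_j phi] is [Av (Some j) G]. Moving each [Av] across as [Cv]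
    collects exactly [Nop u F] against [G]. *)
Lemma weak_dual u F : wL1 u -> (forall j, wL1 (F j)) ->
  [/\ intg mu (weak_integrand u F), intg mu (fun p => u p * tG [:: tidx d] p),
    intg mu (fun p => Nop u F p * tG [::] p) &
  \int[mu]_p weak_integrand u F p =
  \int[mu]_p (u p * tG [:: tidx d] p) + \int[mu]_p (Nop u F p * tG [::] p)].
Proof.
move=> ui Fi; have [A GA] := tG_rbd [::]; have [B GB] := tG_rbd [:: tidx d].
have E p : weak_integrand u F p = u p * tG [:: tidx d] p +
    (\sum_j F j p * Av (Some j) (tG [::]) p + (u p * Av None (tG [::]) p - u p * tG [::] p)).
  rewrite /weak_integrand pd_lapx Av_tG -tD_nil.
  under [X in _ = _ + (X + _)]eq_bigr do rewrite Av_tGx.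
  rewrite /tG /= -[lapx d _ _]/(\sum_j tD [:: xidx d j; xidx d j] p).
  rewrite -[pd _ (tidx d) (ofST d phi) _]/(tD [:: tidx d] p).
  rewrite -[\sum_(j < d) F j p * pd _ _ _ _]/(\sum_(j < d) F j p * tD [:: xidx d j] p).
  have id (U a S L K f : R) : U * a + S + U * L - U * K = U * (a - K) + (S + (U * f - U * (f - L))) by ring.
  exact: id.
have NE p : Nop u F p * tG [::] p = - (u p * tG [::] p) + Cv None u p * tG [::] p +
    \sum_j Cv (Some j) (F j) p * tG [::] p.
  by rewrite /Nop !mulrDl mulNr mulr_suml.
have i1 := wL1_rbd ui GB; have i2 := wL1_rbd ui GA.
have i3 := intg_Av None ui GA; have i4 j := intg_Av (Some j) (Fi j) GA.
have i5 := intg_CvG None ui GA; have i6 j := intg_CvG (Some j) (Fi j) GA.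
have iS := intg_sum (index_enum 'I_d) i4; have iS' := intg_sum (index_enum 'I_d) i6.
have [|h1 h2 h3] := Int_regroup i1 iS iS' i3 i2 i5 E NE _ (Cv_dual None ui GA); last by split.
apply: etrans (Int_sum _ i4) _; apply: etrans _ (esym (Int_sum _ i6)).
by apply: eq_bigr => j _; exact: Cv_dual GA.
Qed.

End test_functions.

Import HBNNSimple.

(** [mu_st] is a bare set function without measure structure. Its integral is nevertheless
    determined by its values on measurable sets, because simple functions only evaluate it on
    measurable preimages of points. *)
Lemma eq_set_integral d (X : measurableType d) (R : realType) (m1 m2 : set X -> \bar R)
    (D : set X) (f : X -> \bar R) : (forall A, measurable A -> m1 A = m2 A) ->
  (\int[m1]_(x in D) f x = \int[m2]_(x in D) f x)%E.
Proof.
move=> m12; rewrite /integral; congr (_ - _)%E; congr ereal_sup;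
apply/seteqP; split => _ [h hf <-]; exists h => //;
rewrite /sintegral; apply: eq_fsbigr => x _; congr (_ * _)%E; rewrite m12//;
by have := @measurable_funPTI _ _ _ _ h [set x] (measurable_set1 x).
Qed.

(** * Exchanging two time variables *)

Section permutation.
Context {R : realType} {n : nat}.
Local Notation X := (n.-tuple R).
Local Notation mu := (@must R n).
(** Regroups [((t, x), s)] as [(t, (s, x))]: the integration variable of [It] takes the place of the
    time coordinate. *)
Let pi (a : (R * X) * R) : R * (R * X) := (a.1.1, (a.2, a.1.2)).

Lemma measurable_perm : mfunT pi.
Proof.
apply: measurable_fun_pair; first exact: (measurableT_comp measurable_fst measurable_fst).
apply: measurable_fun_pair => //; exact: (measurableT_comp measurable_snd measurable_fst).
Qed.

Lemma perm_ge0_integral (G : R * (R * X) -> \bar R) : mfunT G -> (forall a, (0 <= G a)%E) ->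
  (\int[(mu \x lebR)%E]_a G (pi a) = \int[(lebR \x mu)%E]_a G a)%E.
Proof.
move=> mG G0; have mGp : mfunT (fun a => G (pi a)) by exact: (measurableT_comp mG measurable_perm).
rewrite (fubini_tonelli1 _ mGp)// (fubini_tonelli1 _ mG)//.
have mF := @measurable_fun_fubini_tonelli_F _ _ (R * X)%type R R lebR _ mGp (fun a => G0 _).
rewrite [LHS](fubini_tonelli1 _ mF); last by move=> p; apply: integral_ge0.
apply: eq_integral => t _; rewrite /fubini_F /=.
rewrite [RHS](@fubini_tonelli2 _ _ _ _ R lebR (lebn n) (fun q => G (t, q)))//.
exact: measurable_fun_pair2 mG.
Qed.

Lemma intg_perm (G : R * (R * X) -> R) : intg (lebR \x mu)%E G -> intg (mu \x lebR)%E (fun a => G (pi a)).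
Proof.
move=> Gi; have mG := intg_measurable Gi; have [_ Gy] := integrableP _ _ _ Gi.
apply/integrableP; split; first by apply/measurable_EFinP; exact: (measurableT_comp mG measurable_perm).
rewrite (perm_ge0_integral (G := fun a => `|(G a)%:E|%E))//.
by apply: measurableT_comp => //; exact/measurable_EFinP.
Qed.

Lemma Int_perm (G : R * (R * X) -> R) : intg (lebR \x mu)%E G ->
  \int[(mu \x lebR)%E]_a G (pi a) = \int[(lebR \x mu)%E]_a G a.
Proof.
move=> Gi; have mG : mfunT (EFin \o G) by apply/measurable_EFinP; exact: intg_measurable Gi.
rewrite /Rintegral; congr fine; rewrite integralE [RHS]integralE; congr (_ - _)%E.
  apply: etrans (@perm_ge0_integral (EFin \o G)^\+%E (measurable_funepos mG) _) => //.
  by apply: eq_integral => a _; rewrite !funeposE.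
apply: etrans (@perm_ge0_integral (EFin \o G)^\-%E (measurable_funeneg mG) _) => //.
  by apply: eq_integral => a _; rewrite !funenegE.
Qed.

End permutation.

(** * Integration by parts in time *)

Section time.
Context {R : realType}.
Variable T : R.
Hypothesis T0 : 0 < T.
Let lt0 := ltW T0.

(** As a factor of the integrand, this indicator replaces integrals over the slab by integrals over
    all of space-time, where translations act. *)
Definition sI (t : R) : R := ltI 0 t * ltI t T.

Lemma sI1 t : 0 < t < T -> sI t = 1.
Proof. by move=> /andP[a b]; rewrite /sI /ltI a b mulr1. Qed.

Lemma sI0 t : ~~ (0 < t < T) -> sI t = 0.
Proof. by rewrite negb_and /sI /ltI => /orP[] /negbTE ->; rewrite ?mul0r ?mulr0. Qed.

Lemma sI_ge0 t : 0 <= sI t.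
Proof. by rewrite mulr_ge0// ltI_ge0. Qed.

Lemma sI_idem t : sI t * sI t = sI t.
Proof. by rewrite /sI /ltI; do 2 case: ifP; rewrite ?(mulr0, mul0r, mulr1). Qed.

Lemma measurable_sI : mfunT sI.
Proof. by apply: measurable_funM; apply: measurable_ltI. Qed.

Lemma intg_sI : intg lebR sI.
Proof.
apply: (intg_dom measurable_sI (intg_chi T T)) => t; rewrite (ger0_norm (sI_ge0 t)).
have [h|h] := boolP (0 < t < T); last by rewrite sI0// chi_ge0.
rewrite sI1// /chi clamp_id ?lexx ?lt0// /ltI; case/andP: h => -> h.
by rewrite ltNge (ltW h) subr0.
Qed.

(* [e] may differ from the indicator of the interval at its two endpoints. *)
Lemma Int_ftc_ends (F f e : R -> R) (a b : R) : a <= b ->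
  (forall x, is_derive x (1 : R) F (f x)) -> continuous f -> mfunT e ->
  (forall t, t != a -> t != b -> e t = ltI a t - ltI b t) ->
  \int[lebR]_t (e t * f t) = F b - F a.
Proof.
move=> ab dF cf me eE; rewrite -(Int_ftc ab dF cf).
have mf : mfunT f by exact: continuous_measurable_fun.
rewrite /Rintegral; congr fine; apply: ae_eq_integral => //.
- by apply/measurable_EFinP; exact: measurable_funM.
- by apply/measurable_EFinP; apply: measurable_funM => //; apply: measurable_funB; exact: measurable_ltI.
exists [set a; b]; split.
- by apply: measurableU; exact: measurable_set1.
- have c2 : countable [set a; b] by apply: finite_set_countable.
  exact: (countable_lebesgue_measure0 c2).
move=> t /= H; apply: contrapT => nab; apply: H => _; congr (_%:E); congr (_ * _).
apply: eE; apply/eqP => tE; apply: nab; [by left|by right].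
Qed.

End time.

Section time_fubini.
Context {R : realType} {n : nat}.
Variable T : R.
Hypothesis T0 : 0 < T.
Local Notation mu := (@must R n).
Local Notation sI := (sI T).
Implicit Types (h phi : R * n.-tuple R -> R).

Let F h phi' (a : R * (R * n.-tuple R)) : R :=
  sI a.1 * chi T a.1 a.2.1 * phi' (a.1, a.2.2) * h a.2.

Let iF h phi' M : wL1 h -> rbd M phi' -> intg (lebR \x mu)%E (F h phi').
Proof.
move=> hi [mp pM]; have mh := wL1_measurable hi.
apply: (intg_dom _ (intgZ M (intg_tensor (intg_sI T0) (wL1_norm hi)))).
  apply: measurable_funM; last exact: (measurableT_comp mh measurable_snd).
  apply: measurable_funM.
    apply: measurable_funM; first exact: (measurableT_comp (measurable_sI T) measurable_fst).
    apply: (@measurableT_comp _ _ _ _ _ _ (fun ts : R * R => chi T ts.1 ts.2) _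
      (fun a : R * (R * n.-tuple R) => (a.1, a.2.1)) (measurable_chi2 T)).
    by apply: measurable_fun_pair => //; exact: (measurableT_comp measurable_fst measurable_snd).
  apply: (@measurableT_comp _ _ _ _ _ _ phi' _ (fun a : R * (R * n.-tuple R) => (a.1, a.2.2)) mp).
  by apply: measurable_fun_pair => //; exact: (measurableT_comp measurable_snd measurable_snd).
move=> [t q]; rewrite /F /= 3!normrM (ger0_norm (sI_ge0 T t)) (ger0_norm (chi_ge0 _ _ _)).
rewrite [leRHS](_ : _ = sI t * 1 * (M * rho q.2) * `|h q|); last by ring.
rewrite ler_wpM2r//; apply: ler_pM => //; last exact: pM.
  by rewrite mulr_ge0// ?sI_ge0 ?chi_ge0.
by rewrite ler_wpM2l ?sI_ge0// chi_le1.
Qed.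

Let fib h phi' p : mfunT h -> \int[lebR]_s F h phi' (p.1, (s, p.2)) = sI p.1 * It T h p * phi' p.
Proof.
move=> mh; rewrite /F /= /It (mulrC (sI _)) -mulrA mulrC -Int_scale; last first.
  by apply: measurable_funM; [exact: measurable_chi|exact: measurable_section2].
by apply: Int_eq => s; case: p => t x /=; ring.
Qed.

Lemma intg_It_phi h phi' M : wL1 h -> rbd M phi' -> intg mu (fun p => sI p.1 * It T h p * phi' p).
Proof.
move=> hi pM; have := intg_fubini1 (intg_perm (iF hi pM)).
by apply: intg_eq => p /=; rewrite fib//; exact: wL1_measurable.
Qed.

Lemma wL1_It (h : R * n.-tuple R -> R) : wL1 h -> wL1 (fun p => sI p.1 * It T h p).
Proof. by move=> hi; exact: (intg_It_phi hi rbd_rho). Qed.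

Let fib2 h phi' M q : rbd M phi' ->
  \int[lebR]_t F h phi' (t, q) = (\int[lebR]_t (sI t * chi T t q.1 * phi' (t, q.2))) * h q.
Proof.
move=> pM; rewrite /F /= [RHS]mulrC -Int_scale; last first.
  apply: measurable_funM; last exact: (measurable_fun_pair1 q.2 pM.1).
  apply: measurable_funM; first exact: measurable_sI.
  exact: (@measurable_fun_pair1 _ _ _ _ _ _ (fun ts : R * R => chi T ts.1 ts.2) q.1 (measurable_chi2 T)).
by apply: Int_eq => t; ring.
Qed.

Lemma Int_It_phi h phi' M : wL1 h -> rbd M phi' ->
  intg mu (fun q => (\int[lebR]_t (sI t * chi T t q.1 * phi' (t, q.2))) * h q) /\
  \int[mu]_p (sI p.1 * It T h p * phi' p) =
  \int[mu]_q ((\int[lebR]_t (sI t * chi T t q.1 * phi' (t, q.2))) * h q).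
Proof.
move=> hi pM; have iF' := iF hi pM; split.
  by have := intg_fubini2 iF'; apply: intg_eq => q; exact: fib2 pM.
rewrite (@Int_eq _ _ _ mu _ (fun p => \int[lebR]_s F h phi' (p.1, (s, p.2)))); last first.
  by move=> p; rewrite fib//; exact: wL1_measurable.
rewrite -(Int_fubini1 (intg_perm iF')) (Int_perm iF') (Int_fubini2 iF').
by apply: Int_eq => q; exact: fib2 pM.
Qed.

Lemma sI_chi s t : 0 < s < T -> t != s -> t != T -> sI t * chi T t s = ltI s t - ltI T t.
Proof.
move=> /andP[s0 sT] ts tT.
have [tT'|Tt] := ltP t T; last first.
  have {}Tt : T < t by rewrite lt_neqAle eq_sym tT.
  rewrite sI0; last by rewrite negb_and -!leNgt (ltW Tt) orbT.
  by rewrite /ltI Tt (lt_trans sT Tt) subrr mul0r.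
have [st|st] := ltP s t.
  have t0 := lt_trans s0 st.
  rewrite sI1 ?t0// /chi clamp_id ?(ltW t0) ?(ltW tT')// /ltI s0 st.
  by rewrite ltNge (ltW st) ltNge (ltW tT') !subr0 mulr1.
have {}st : t < s by rewrite lt_neqAle ts.
rewrite /ltI [s < t]ltNge (ltW st) [T < t]ltNge (ltW tT') subrr.
rewrite /chi /ltI s0; have [t0|t0] := leP 0 t; last by rewrite sI0 ?mul0r// negb_and -leNgt (ltW t0).
by rewrite clamp_id ?t0 ?(ltW tT')// st subrr mulr0.
Qed.

Section test.
Variables (h phi phi' : R * n.-tuple R -> R) (M M' : R).
Hypotheses (hi : wL1 h) (hs : forall p, sI p.1 * h p = h p) (pM0 : rbd M' phi) (pM : rbd M phi')
  (dphi : forall t x, is_derive t (1 : R) (fun s => phi (s, x)) (phi' (t, x)))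
  (cphi : forall x, continuous (fun s : R => phi' (s, x)))
  (phiT : forall x, phi (T, x) = 0).

(** After the two times are exchanged, [h (s, x)] is paired with the integral of [phi'] from [s] to
    [T], which is [- phi (s, x)] because [phi] vanishes at [T]. *)
Lemma time_fubini : \int[mu]_p (sI p.1 * It T h p * phi' p) = - \int[mu]_p (h p * phi p).
Proof.
rewrite (Int_It_phi hi pM).2 -IntN; last exact: wL1_rbd hi pM0.
apply: Int_eq => -[s x] /=.
have [sT|sT] := boolP (0 < s < T); last by rewrite -(hs (s, x)) /= sI0// mul0r mulr0 mul0r oppr0.
have /andP[s0 s1] := sT.
rewrite (@Int_ftc_ends R (fun t => phi (t, x)) (fun t => phi' (t, x)) (fun t => sI t * chi T t s) s T (ltW s1)).
- by rewrite phiT; ring.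
- exact: cphi.
- apply: measurable_funM; first exact: measurable_sI.
  exact: (@measurable_fun_pair1 _ _ _ _ _ _ (fun ts : R * R => chi T ts.1 ts.2) s (measurable_chi2 T)).
- by move=> t; exact: sI_chi.
Qed.

Lemma time_ftc x : \int[lebR]_t (sI t * phi' (t, x)) = - phi (0, x).
Proof.
rewrite (@Int_ftc_ends R (fun t => phi (t, x)) (fun t => phi' (t, x)) sI 0 T (ltW T0)).
- by rewrite phiT sub0r.
- exact: cphi.
- exact: measurable_sI.
move=> t t0 tT; have [a|a] := ltP 0 t; last first.
  have {}a : t < 0 by rewrite lt_neqAle t0.
  rewrite sI0; last by rewrite negb_and -leNgt (ltW a).
  by rewrite /ltI ltNge (ltW a) ltNge (ltW (lt_trans a T0)) subrr.
have [b|b] := ltP t T; first by rewrite sI1 ?a// /ltI a ltNge (ltW b) subr0.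
have {}b : T < t by rewrite lt_neqAle eq_sym tT.
rewrite sI0; last by rewrite negb_and -!leNgt (ltW b) orbT.
by rewrite /ltI a b subrr.
Qed.

End test.
End time_fubini.

Section test_time.
Context {R : realType} {d : nat}.
Variables (T : R) (phi : R * d.-tuple R -> R).
Hypothesis tphi : test_fun d T phi.
Let ps : cc_smooth (1 + d) (ofST d phi). Proof. exact: tphi.1. Qed.

Lemma tD_derive l t x : is_derive t (1 : R) (fun s => tD phi l (s, x)) (tD phi (tidx d :: l) (t, x)).
Proof.
have [M M0 MP] := tD_quad ps l.
apply: (@is_derive_quad R R _ t 1 _ M 1 ltr01) => h _.
have := (MP (tidx d) h (t, x)).1; rewrite stmv_t.
by rewrite -[h *: 1]/(h * 1) mulr1 [h + t]addrC.
Qed.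

Lemma tG_derive l t x : is_derive t (1 : R) (fun s => tG phi l (s, x)) (tG phi (tidx d :: l) (t, x)).
Proof.
have [M M0 MP] := tG_quad ps l.
apply: (@is_derive_quad R R _ t 1 _ M 1 ltr01) => h _.
have := MP (tidx d) h (t, x); rewrite stmv_t.
by rewrite -[h *: 1]/(h * 1) mulr1 [h + t]addrC.
Qed.

Lemma tG_continuous l x : continuous (fun s : R => tG phi l (s, x)).
Proof.
by move=> t; apply: differentiable_continuous; apply/derivable1_diffP; have := tG_derive l t x.
Qed.

Lemma tD_continuous l x : continuous (fun s : R => tD phi l (s, x)).
Proof.
by move=> t; apply: differentiable_continuous; apply/derivable1_diffP; have := tD_derive l t x.
Qed.

Lemma tD_T l t x : T <= t -> tD phi l (t, x) = 0.
Proof.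
move=> Tt; apply: (@iter_pd_out _ _ (closure [set v | ofST d phi v != 0])).
- exact: closed_closure.
- by move=> w Kw; apply/eqP/negPn/negP => gv; apply: Kw; exact: subset_closure.
move=> /tphi.2 /=; rewrite /st row_mxEl mxE /=; by rewrite ltNge Tt.
Qed.

Lemma tG_T l x : tG phi l (T, x) = 0.
Proof. by rewrite /tG tD_T// big1 ?subr0// => j _; rewrite tD_T. Qed.

End test_time.

(** * The weak identity as a real integral over space-time *)

Section weak_form.
Context {R : realType} {d : nat}.
Variable T : R.
Hypothesis T0 : 0 < T.
Local Notation mu := (@must R d).
Local Notation sI := (sI T).
Implicit Types (u v : R * d.-tuple R -> R) (F : 'I_d -> R * d.-tuple R -> R).

Definition cut u p : R := sI p.1 * u p.

Lemma slabE p : p \in slab d T = (0 < p.1 < T).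
Proof.
apply/idP/idP => [/set_mem|h]; first by move=> [/=]; rewrite in_itv.
by apply/mem_set; split => //=; rewrite in_itv.
Qed.

Lemma integral_slab (g : R * d.-tuple R -> R) :
  (\int[mu_st d]_(p in slab d T) (g p)%:E = \int[mu]_p (sI p.1 * g p)%:E)%E.
Proof.
rewrite (@eq_set_integral _ _ _ _ mu); last by move=> A; exact: mu_stE.
rewrite integral_mkcond; apply: eq_integral => p _; rewrite patchE slabE.
by case: ifPn => h; [rewrite sI1// mul1r|rewrite sI0// mul0r].
Qed.

Lemma weak_integrand_cut phi u F p :
  sI p.1 * weak_integrand phi u F p = weak_integrand phi (cut u) (fun j => cut (F j)) p.
Proof.
have id (c U a S L K S' : R) : c * S = S' -> c * (U * a + S + U * L - U * K) =
    c * U * a + S' + c * U * L - c * U * K by move=> <-; ring.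
apply: id; rewrite mulr_sumr; apply: eq_bigr => j _; exact: mulrA.
Qed.

Lemma weak_identityE phi u F ui : test_fun d T phi -> wL1 (cut u) -> (forall j, wL1 (cut (F j))) ->
  intg (lebn d) (fun x => ui x * tG phi [::] (0, x)) ->
  ((\int[mu_st d]_(p in slab d T)
        (u p * pd (1 + d) (tidx d) (ofST d phi) (st d p)
         + \sum_(j < d) F j p * pd (1 + d) (xidx d j) (ofST d phi) (st d p)
         + u p * lapx d (ofST d phi) (st d p)
         - u p * pd (1 + d) (tidx d) (lapx d (ofST d phi)) (st d p))%:E)
     + \int[lebn d]_x (ui x * (phi (0, x) - lapx d (ofST d phi) (st d (0, x))))%:E =
  (\int[mu]_p weak_integrand phi (cut u) (fun j => cut (F j)) p +
   \int[lebn d]_x (ui x * tG phi [::] (0, x)))%:E)%E.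
Proof.
move=> tphi ui1 Fi1 u0i.
have [wi _ _ _] := weak_dual tphi.1 ui1 Fi1.
rewrite EFinD (IntE wi) (IntE u0i); congr (_ + _)%E.
  rewrite (@integral_slab (weak_integrand phi u F)).
  by apply: eq_integral => p _; rewrite weak_integrand_cut.
by apply: eq_integral => x _; rewrite /tG tD_nil.
Qed.

Lemma intg_sI_rho : intg mu (fun p => sI p.1 * rho p.2).
Proof. exact: intg_tensor (intg_sI T0) intg_rho. Qed.

Lemma measurable_sI1 : mfunT (fun p : R * d.-tuple R => sI p.1).
Proof. exact: (measurableT_comp (measurable_sI T) measurable_fst). Qed.

Lemma rho_wL1 u K : rbd K u -> wL1 (cut u).
Proof.
move=> [mu' uK]; apply: (intg_dom _ (intgZ K intg_sI_rho)).
  by apply: measurable_funM measurable_rho2; exact: measurable_funM measurable_sI1 mu'.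
move=> p; rewrite /cut 2!normrM (ger0_norm (sI_ge0 _ _)) (gtr0_norm (rho_gt0 _)) mulrCA -mulrA.
rewrite ler_wpM2l ?sI_ge0//; apply: (@le_trans _ _ (K * rho p.2 * 1)); last by rewrite mulr1.
by apply: ler_pM => //; [exact: ltW (rho_gt0 _)|exact: rho_le1].
Qed.

Lemma rho_L2 u K : rbd K u -> L2_st d T u.
Proof.
move=> [mu' uK]; split; first exact: measurable_funTS.
have K0 : 0 <= K by have := le_trans (normr_ge0 _) (uK (0, t0)); rewrite pmulr_lge0// rho_gt0.
rewrite integral_slab.
have i : intg mu (fun p => sI p.1 * u p ^+ 2).
  apply: (intg_dom _ (intgZ (K ^+ 2) intg_sI_rho)).
    by apply: measurable_funM; [exact: measurable_sI1|exact: measurable_funX].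
  move=> p; rewrite normrM (ger0_norm (sI_ge0 _ _)) mulrCA ler_wpM2l ?sI_ge0//.
  rewrite normrX; apply: (@le_trans _ _ ((K * rho p.2) ^+ 2)).
    by apply: lerXn2r; rewrite ?nnegrE// mulr_ge0// ltW// rho_gt0.
  rewrite exprMn ler_wpM2l ?sqr_ge0// expr2 ler_piMr ?rho_le1//; exact: ltW (rho_gt0 _).
by rewrite -(IntE i) ltry.
Qed.

(** Because [rho] is at most 1, [|v| * rho <= v^2 + rho], and [rho] is integrable over the slab.
    This places every competing solution in the space where uniqueness is proved. *)
Lemma L2_wL1 v : L2_st d T v -> wL1 (cut v).
Proof.
move=> [mv vy].
have mS : measurable (slab d T : set (R * d.-tuple R)).
  by apply: measurableX => //; exact: measurable_itv.
have cE : cut v = v \_ (slab d T).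
  apply/funext => p; rewrite /cut patchE slabE.
  by case: ifPn => h; [rewrite sI1// mul1r|rewrite sI0// mul0r].
have mc : mfunT (cut v) by rewrite cE; exact/(measurable_restrictT v mS).
have i2 : intg mu (fun p => cut v p ^+ 2).
  apply/integrableP; split; first by apply/measurable_EFinP; exact: measurable_funX.
  move: vy; rewrite integral_slab; apply: le_lt_trans; rewrite le_eqVlt; apply/orP; left; apply/eqP.
  apply: eq_integral => p _ /=; rewrite /cut exprMn expr2 sI_idem.
  by rewrite ger0_norm// mulr_ge0// ?sI_ge0 ?sqr_ge0.
apply: (intg_dom _ (intgD i2 intg_sI_rho)).
  exact: measurable_funM mc measurable_rho2.
move=> p; rewrite normrM (gtr0_norm (rho_gt0 _)).
have r0 := rho_gt0 p.2; have r1 := rho_le1 p.2.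
rewrite /cut; have [h|h] := boolP (0 < p.1 < T); last by rewrite sI0// !mul0r normr0 mul0r expr0n/= addr0.
rewrite sI1// !mul1r -(real_normK (num_real (v p))); set a := `|v p|; have a0 : 0 <= a by exact: normr_ge0.
by nra.
Qed.

End weak_form.

(** * Existence of a weak solution *)

Section existence.
Context {R : realType} {d : nat}.
Variable T : R.
Hypothesis T0 : 0 < T.
Local Notation mu := (@must R d).
Local Notation sI := (sI T).
Local Notation cut := (cut T).

Lemma Cv_time (c : R -> R) k (f : R * d.-tuple R -> R) p : mfunT f ->
  Cv k (fun q => c q.1 * f q) p = c p.1 * Cv k f p.
Proof.
move=> mf; rewrite /Cv /= -Int_scale; last first.
  by apply: measurable_funM (measurable_ker k); exact: measurable_yadd_section.
by apply: Int_eq => w; rewrite mulrA.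
Qed.

Lemma Nop_time (c : R -> R) u (F : 'I_d -> R * d.-tuple R -> R) p : mfunT u -> (forall j, mfunT (F j)) ->
  Nop (fun q => c q.1 * u q) (fun j q => c q.1 * F j q) p = c p.1 * Nop u F p.
Proof.
move=> mu' mF; rewrite /Nop Cv_time// !mulrDr mulrN mulr_sumr; congr (_ + _).
by apply: eq_bigr => j _; rewrite Cv_time.
Qed.

Lemma Nop_cut u (F : 'I_d -> R * d.-tuple R -> R) p : mfunT u -> (forall j, mfunT (F j)) ->
  Nop (cut u) (fun j => cut (F j)) p = sI p.1 * Nop u F p.
Proof. exact: Nop_time. Qed.

Lemma It_cut (h : R * d.-tuple R -> R) p : sI p.1 * It T (cut h) p = sI p.1 * It T h p.
Proof.
case: p => t x; have [tT|tT] := boolP (0 < t < T); last by rewrite /= sI0// !mul0r.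
congr (_ * _); apply: Int_eq => s; rewrite /cut /= mulrA; congr (_ * _).
have /andP[a b] := tT; rewrite /chi clamp_id ?(ltW a) ?(ltW b)//.
rewrite /sI /ltI; case: (ltP 0 s) => s0; case: (ltP t s) => ts; case: (ltP s T) => sT.
all: rewrite ?(mulr0, mul0r, mulr1, subr0, subrr)//; lra.
Qed.

(** The datum contributes the boundary term through [time_ftc]; the time integral contributes
    [- h * G] through [time_fubini]. *)
Lemma time_parts (v h G G' : R * d.-tuple R -> R) ui A B N :
  wL1 h -> (forall p, sI p.1 * h p = h p) -> rbd A G -> rbd B G' ->
  (forall t x, is_derive t (1 : R) (fun s => G (s, x)) (G' (t, x))) ->
  (forall x, continuous (fun s : R => G' (s, x))) -> (forall x, G (T, x) = 0) ->
  rbd N (fun p => ui p.2) -> intg (lebn d) (fun x => ui x * G (0, x)) ->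
  (forall p, cut v p = cut (fun p => ui p.2) p + sI p.1 * It T h p) ->
  \int[mu]_p (cut v p * G' p) + \int[mu]_p (h p * G p) + \int[lebn d]_x (ui x * G (0, x)) = 0.
Proof.
move=> hi hs GA GB dG cG GT uN ii vE; have u0i := rho_wL1 T0 uN.
have E p : cut v p * G' p = cut (fun p => ui p.2) p * G' p + sI p.1 * It T h p * G' p.
  by rewrite vE mulrDl.
rewrite (@Int_eq _ _ _ mu _ _ E) (IntD (wL1_rbd u0i GB) (intg_It_phi T0 hi GB)).
rewrite (@time_fubini R d T T0 h G G' B A hi hs GA GB dG cG GT) subrK.
rewrite (Int_fubini2 (wL1_rbd u0i GB)) [X in X + _](@Int_eq _ _ _ (lebn d) _ (fun x => - (ui x * G (0, x)))).
  by rewrite (IntN ii) addNr.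
move=> x; rewrite -mulrN -(time_ftc T0 dG cG GT) -Int_scale.
  by apply: Int_eq => t; rewrite /cut /= mulrCA mulrA.
apply: measurable_funM; first exact: measurable_sI.
exact: (measurable_fun_pair1 x GB.1).
Qed.

Variables (f : 'I_d -> d.-tuple R -> R -> R) (ui : d.-tuple R -> R).
Hypotheses (fs : forall j, cc_smooth (d + 1) (ofXU d (f j)))
  (us : cc_smooth d (fun v => ui (tup d v))).

Lemma mild_solution : exists u K, [/\ rbd K u, Sol T u ui (fun j => scomp (f j) u) &
  forall k, isCk T k u].
Proof.
(* Compact support of the flux in [x] gives the factor [rho x], uniformly in [s]; this is what lets
   the Picard iteration run with the weight [rho]. *)
have [M M0 MP] : exists2 M : R, 0 <= M & forall j, (forall x s, `|f j x s| <= M * rho x) /\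
    (forall x s s', `|f j x s' - f j x s| <= M * `|s' - s|).
  apply: (@fin_bound _ _ (fun j M => (forall x s, `|f j x s| <= M * rho x) /\
    (forall x s s', `|f j x s' - f j x s| <= M * `|s' - s|))).
    move=> j A B AB [h1 h2]; split => [x s|x s s'].
      by apply: (le_trans (h1 x s)); rewrite ler_wpM2r// ltW// rho_gt0.
    by apply: (le_trans (h2 x s s')); rewrite ler_wpM2r.
  move=> j; have [A A0 AP] := flux_rho (fs j); have [B [_ bB _ Bs]] := isSk_S0 (isSk_cc (fs j) 0).
  have B0 : 0 <= B by apply: le_trans (bB t0 0).
  exists (A + B); split => [x s|x s s'].
    by apply: (le_trans (AP x s)); rewrite ler_wpM2r ?lerDl// ltW// rho_gt0.
  by apply: (le_trans (Bs x s s')); rewrite ler_wpM2r ?lerDr.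
have [N N0 NP] := initial_rho us.
have [C [[mu0 _] _]] := isCk_C0 (isCk_cc us T 0).
have MN : 0 <= M + N by rewrite addr_ge0.
have [||||||||||u [K [uK uW uS]]] := @mild_exists R d T T0 (@rho R d) (fun j q s => f j q.2 s) ui M (M + N).
- by move=> x; rewrite ltW// rho_gt0.
- exact: rho_le1.
- exact: rho_tadd.
- move=> j; have [B [mf _ _ _]] := isSk_S0 (isSk_cc (fs j) 0).
  apply: (@measurableT_comp _ _ _ _ _ _ (fun p : d.-tuple R * R => f j p.1 p.2)
    _ (fun q : (R * d.-tuple R) * R => (q.1.2, q.2)) mf).
  by apply: measurable_fun_pair => //; exact: (measurableT_comp measurable_snd measurable_fst).
- exact: M0.
- by move=> j q s s'; exact: (MP j).2.
- move=> j q; apply: (le_trans ((MP j).1 _ _)); by rewrite ler_wpM2r ?lerDl// ltW// rho_gt0.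
- apply: (@measurableT_comp _ _ _ _ _ _ (fun q : R * d.-tuple R => ui q.2) _ (fun x => (0, x)) mu0).
  by apply: measurable_fun_pair.
- by move=> x; apply: (le_trans (NP x)); rewrite ler_wpM2r ?lerDr// ltW// rho_gt0.
- exact: MN.
exists u, K; split.
- by split => //; exact: uK.1.
- exact: uS.
apply: (@nonlin_reg R d T T0 f u ui _ uS).
- by exists K.
- by move=> k; exact: isCk_cc.
- by move=> k j; exact: isSk_cc.
Qed.

Lemma initial_intg phi : test_fun d T phi -> intg (lebn d) (fun x => ui x * tG phi [::] (0, x)).
Proof.
move=> tphi; have [N N0 NP] := initial_rho us; have [M [mG GM]] := tG_rbd tphi.1 [::].
have [C [[mu0 _] _]] := isCk_C0 (isCk_cc us T 0).
have mu1 : mfunT ui.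
  apply: (@measurableT_comp _ _ _ _ _ _ (fun q : R * d.-tuple R => ui q.2) _ (fun x => (0, x)) mu0).
  by apply: measurable_fun_pair.
apply: (intg_dom _ (intgZ (N * M) (@intg_rho R d))).
  have m2 : mfunT (fun x => tG phi [::] (0, x)).
    by apply: (@measurableT_comp _ _ _ _ _ _ (tG phi [::]) _ (fun x => (0, x)) mG); apply: measurable_fun_pair.
  exact: measurable_funM mu1 m2.
move=> x; rewrite normrM; apply: (@le_trans _ _ ((N * rho x) * (M * rho x))).
  by apply: ler_pM => //; exact: (GM (0, x)).
have M0 : 0 <= M by have := le_trans (normr_ge0 _) (GM (0, t0)); rewrite pmulr_lge0// rho_gt0.
by rewrite mulrACA ler_wpM2l ?mulr_ge0// ler_piMr ?rho_le1// ltW// rho_gt0.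
Qed.

Lemma mild_weak u K : rbd K u -> Sol T u ui (fun j => scomp (f j) u) -> weak_solution_nl d T f ui u.
Proof.
move=> uK uS; pose F j := scomp (f j) u.
have FM j : exists M, rbd M (F j).
  have [A A0 AP] := flux_rho (fs j); exists A; split; last by move=> p; exact: AP.
  have [B [mf _ _ _]] := isSk_S0 (isSk_cc (fs j) 0).
  exact: measurable_scomp mf uK.1.
have ui1 := rho_wL1 T0 uK.
have Fi1 j : wL1 (cut (F j)) by have [M h] := FM j; exact: rho_wL1 h.
split; first exact: rho_L2 uK.
split; first by move=> j; have [M h] := FM j; exact: rho_L2 h.
move=> phi tphi /=; have ii := initial_intg tphi.
rewrite (weak_identityE tphi ui1 Fi1 ii); congr (_%:E).
have [_ i1 i2 ->] := weak_dual tphi.1 ui1 Fi1.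
have [A GA] := tG_rbd tphi.1 [::]; have [B GB] := tG_rbd tphi.1 [:: tidx d].
have [N N0 NP] := initial_rho us.
have [C [[mu0 _] _]] := isCk_C0 (isCk_cc us T 0).
have hE : Nop (cut u) (fun j => cut (F j)) = cut (Nop u F).
  by apply/funext => p; rewrite Nop_cut//; [exact: uK.1|move=> j; have [M []] := FM j].
have hi : wL1 (cut (Nop u F)) by rewrite -hE; exact: wL1_Nop.
rewrite hE; apply: (@time_parts u _ _ _ ui A B N hi _ GA GB).
- by move=> p; rewrite /cut mulrA sI_idem.
- by move=> t x; exact: (tG_derive tphi [::]).
- by move=> x; exact: (tG_continuous tphi).
- by move=> x; exact: (tG_T tphi).
- by split => // p; exact: NP.
- exact: ii.
by move=> p; rewrite It_cut /cut [u p]uS; exact: mulrDr.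
Qed.

End existence.

(** * Smooth bumps on the line *)

Section smooth_line.
Context {R : realType}.
Implicit Types (f g : R -> R) (x : R).
Local Notation dv f x y := (is_derive x (1 : R) f y).

Lemma dv_mul f g x a b : dv f x a -> dv g x b -> dv (fun y => f y * g y) x (a * g x + f x * b).
Proof.
move=> df dg; apply: is_derive_eq (is_deriveM df dg) _.
by rewrite addrC -[g x *: a]/(g x * a) [g x * a]mulrC.
Qed.

Lemma dv_add f g x a b : dv f x a -> dv g x b -> dv (fun y => f y + g y) x (a + b).
Proof. by move=> df dg; exact: is_deriveD. Qed.

Lemma dv_scale c f x a : dv f x a -> dv (fun y => c * f y) x (c * a).
Proof. by move=> df; exact: is_deriveZ. Qed.

Lemma dv_cst (c : R) x : dv (fun=> c) x 0.
Proof. exact: is_derive_cst. Qed.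

Lemma dv_id x : dv (fun y => y) x 1.
Proof. exact: is_derive_id. Qed.

Lemma dv_comp f g x a b : dv f (g x) a -> dv g x b -> dv (fun y => f (g y)) x (a * b).
Proof. by move=> df dg; exact: (is_derive1_comp df dg). Qed.

Lemma dv_near f g x a : (\near x, f x = g x) -> dv f x a -> dv g x a.
Proof. exact: near_eq_is_derive. Qed.

Lemma dv_unique f x a b : dv f x a -> dv f x b -> a = b.
Proof. by move=> [_ <-] [_ <-]. Qed.

Lemma dv_continuous f (f' : R -> R) : (forall x, dv f x (f' x)) -> continuous f.
Proof.
by move=> df x; apply: differentiable_continuous; apply/derivable1_diffP; have := df x.
Qed.

Fixpoint sm k f : Prop := continuous f /\
  if k is k'.+1 then exists2 f', (forall x, dv f x (f' x)) & sm k' f' else True.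

Lemma sm_cont k f : sm k f -> continuous f.
Proof. by case: k => [|k] []. Qed.

Lemma smW k f : sm k.+1 f -> sm k f.
Proof. by elim: k f => [|k ih] f [cf [f' df f'k]]; split => //; exists f' => //; exact: ih. Qed.

Lemma sm_add k f g : sm k f -> sm k g -> sm k (fun x => f x + g x).
Proof.
elim: k f g => [|k ih] f g [cf df] [cg dg]; split => //;
  try by move=> x; apply: cvgD; [exact: cf|exact: cg].
have [f1 h1 h2] := df; have [g1 h3 h4] := dg; exists (fun x => f1 x + g1 x); last exact: ih.
by move=> x; exact: dv_add.
Qed.

Lemma sm_mul k f g : sm k f -> sm k g -> sm k (fun x => f x * g x).
Proof.
have c f' g' : continuous f' -> continuous g' -> continuous (fun x : R => f' x * g' x).
  by move=> cf cg x; apply: cvgM; [exact: cf|exact: cg].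
elim: k f g => [|k ih] f g fk gk; split => //; try exact: c (sm_cont fk) (sm_cont gk).
have [f' h1 h2] := fk.2; have [g' h3 h4] := gk.2; exists (fun x => f' x * g x + f x * g' x).
  by move=> x; exact: dv_mul.
by apply: sm_add; apply: ih => //; exact: smW.
Qed.

Lemma sm_cst k (c : R) : sm k (fun=> c).
Proof.
elim: k c => [|k ih] c; split => //; try exact: cst_continuous.
by exists (fun=> 0) => // x; exact: dv_cst.
Qed.

Lemma sm_id k : sm k (fun x => x).
Proof.
case: k => [|k]; split => //; try by move=> x; exact: cvg_id.
by exists (fun=> 1); [move=> x; exact: dv_id|exact: sm_cst].
Qed.

Lemma sm_affine k f (a b : R) : sm k f -> sm k (fun x => f (a * x + b)).
Proof.
have da x : dv (fun y => a * y + b) x a.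
  by have := dv_add (dv_scale a (dv_id x)) (dv_cst b x); rewrite mulr1 addr0.
have ca : continuous (fun y : R => a * y + b) by exact: dv_continuous da.
elim: k f => [|k ih] f fk.
  by split => // x; apply: (@continuous_comp _ _ _ (fun y => a * y + b) f); [exact: ca|exact: (sm_cont fk)].
split; first by move=> x; apply: (@continuous_comp _ _ _ (fun y => a * y + b) f); [exact: ca|exact: (sm_cont fk)].
have [f' h1 h2] := fk.2; exists (fun x => f' (a * x + b) * a).
  by move=> x; apply: dv_comp.
by apply: sm_mul; [exact: ih|exact: sm_cst].
Qed.

Lemma sm_inv k f : (forall x, f x != 0) -> sm k f -> sm k (fun x => (f x)^-1).
Proof.
move=> f0; elim: k => [|k ih] fk.
  by split => // x; apply: cvgV; [exact: f0|exact: (sm_cont fk)].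
have fV := ih (smW fk); split; first exact: sm_cont fV.
have [f' h1 h2] := fk.2; exists (fun x => (-1 * f' x) * ((f x)^-1 * (f x)^-1)).
  move=> x; apply: is_derive_eq (is_deriveV (f0 x) (h1 x)) _.
  by rewrite -[_ *: _]/(- f x ^- 2 * f' x) expr2 invfM; ring.
by apply: sm_mul; apply: sm_mul => //; exact: sm_cst.
Qed.

Lemma sm_jap k : sm k (@jap R).
Proof.
have -> : @jap R = fun x => (1 + x * x)^-1 by apply/funext => x; rewrite /jap expr2.
apply: sm_inv => [x|]; first by rewrite gt_eqF// ltr_pwDl// -expr2 sqr_ge0.
by apply: sm_add; [exact: sm_cst|apply: sm_mul; exact: sm_id].
Qed.

(** [flat 0] is $e^{-1/(2x^2)}$ on the positive half-line. The powers of $1/x$ make the family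
    closed, up to linear combinations, under differentiation, so smoothness is a single
    induction. *)
Definition flat (m : nat) (x : R) : R := if 0 < x then x^-1 ^+ m * gau x^-1 else 0.

(** A quadratic bound at 0 is the remainder estimate for a zero derivative there. With [y = h^-1],
    the power [m.+2] of [jap y] absorbs [y ^+ m] and the two further factors of [y], since
    [y * jap y <= 1]. *)
Lemma flat_bound m : exists2 C : R, 0 <= C & forall h, `|flat m h| <= C * h ^+ 2.
Proof.
have [C C0 CP] := @gau_bound R m.+2; exists C; first exact: ltW.
move=> h; rewrite /flat; case: ifPn => [h0|_]; last by rewrite normr0 mulr_ge0 ?sqr_ge0// ltW.
have y0 : 0 < h^-1 by rewrite invr_gt0.
set y := h^-1 in y0 *; have hy : h = y^-1 by rewrite invrK.
rewrite ger0_norm; last by rewrite mulr_ge0 ?exprn_ge0 ?ltW// gau_gt0.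
apply: (@le_trans _ _ (y ^+ m * (C * jap y ^+ m.+2))).
  by apply: ler_wpM2l; [rewrite exprn_ge0// ltW|exact: CP].
have -> : h ^+ 2 = (y ^+ 2)^-1 by rewrite hy exprVn.
rewrite mulrCA ler_wpM2l ?(ltW C0)// -[leRHS]mul1r ler_pdivlMr ?exprn_gt0//.
rewrite mulrAC -exprD addn2.
rewrite -exprMn exprn_ile1// /jap.
  by rewrite mulr_ge0 ?invr_ge0 ?ltW// ltr_pwDl// sqr_ge0.
rewrite ler_pdivrMr ?mul1r; last by rewrite ltr_pwDl// sqr_ge0.
have := sqr_ge0 (y - 1); rewrite sqrrB1 => hh.
have : 0 <= y ^+ 2 by exact: sqr_ge0.
by lra.
Qed.

Lemma dv_flat m x : dv (flat m) x (-1 * m%:R * flat m.+1 x + flat m.+3 x).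
Proof.
have [x0|] := ltP 0 x.
  have E : \near x, x^-1 ^+ m * gau x^-1 = flat m x.
    by near=> y; rewrite /flat ifT//; near: y; exact: lt_nbhsr.
  apply: dv_near E _; rewrite /flat x0.
  have dV : dv (fun y : R => y^-1) x (- (x^-1 ^+ 2)).
    have x0' : x != 0 by rewrite gt_eqF.
    apply: is_derive_eq (is_deriveV x0' (dv_id x)) _.
    by rewrite -[_ *: _]/(- x ^- 2 * 1) mulr1 exprVn.
  have dX (z : R) : dv (fun y : R => y ^+ m) z (m%:R * z ^+ m.-1).
    elim: m => [|m ih]; first by rewrite mul0r; exact: dv_cst.
    have -> : (fun y : R => y ^+ m.+1) = (fun y => y * y ^+ m) by apply/funext => y; rewrite exprS.
    apply: is_derive_eq (dv_mul (dv_id z) ih) _ => /=.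
    by case: m {ih} => [|m] /=; rewrite ?mul0r ?expr0 ?mulr0 ?addr0 ?exprS -?natr1; ring.
  have dgau (z : R) : dv (@gau R) z (- z * gau z).
    have dq : dv (fun y : R => - (y ^+ 2 / 2)) z (- z).
      have := dv_scale (- 2^-1) (dv_mul (dv_id z) (dv_id z)).
      have -> : (fun y : R => - 2^-1 * (y * y)) = (fun y : R => - (y ^+ 2 / 2)).
        by apply/funext => y; rewrite expr2; ring.
      by move=> h; apply: is_derive_eq h _; field.
    have := @dv_comp expR (fun y : R => - (y ^+ 2 / 2)) z _ _ (is_derive_expR _) dq.
    by move=> h; apply: is_derive_eq h _; rewrite /gau; ring.
  have := dv_comp (dv_mul (dX x^-1) (dgau x^-1)) dV.
  move=> h; apply: is_derive_eq h _; set y := x^-1; set g := gau y.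
  case: m {dX} => [|m] /=; rewrite ?mul0r ?expr0 !exprS; ring.
rewrite le_eqVlt => /predU1P[->|x0].
  rewrite /flat ltxx mulr0 addr0; have [C C0 CP] := flat_bound m.
  apply: (@is_derive_quad R R _ 0 1 0 C 1 ltr01) => h _.
  rewrite -[h *: 1]/(h * 1) mulr1 addr0 mulr0 subr0.
  by have := CP h; rewrite /flat ltxx subr0.
have E : \near x, 0 = flat m x.
  near=> y; rewrite /flat ifF//; apply/negbTE; rewrite -leNgt ltW//.
  by near: y; exact: lt_nbhsl.
apply: dv_near E _; rewrite /flat [0 < x]ltNge (ltW x0)/= mulr0 addr0; exact: dv_cst.
Unshelve. all: by end_near. Qed.

Lemma sm_flat k m : sm k (flat m).
Proof.
elim: k m => [|k ih] m; split => //; try exact: dv_continuous (dv_flat m).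
exists (fun x => -1 * m%:R * flat m.+1 x + flat m.+3 x); first by move=> x; exact: dv_flat.
by apply: sm_add => //; apply: sm_mul => //; exact: sm_cst.
Qed.

(** Scaling by [k.+1] keeps the bump zero outside []a, b[] while its values inside tend to 1, so
    bumps converge boundedly to the indicator of the interval. *)
Definition bump (k : nat) (a b x : R) : R :=
  flat 0 (k.+1%:R * x + - (k.+1%:R * a)) * flat 0 (- k.+1%:R * x + k.+1%:R * b).

Lemma sm_bump j k a b : sm j (bump k a b).
Proof. by apply: sm_mul; apply: sm_affine; exact: sm_flat. Qed.

Lemma flat0_ge0 x : 0 <= flat 0 x.
Proof. by rewrite /flat; case: ifP => // _; rewrite expr0 mul1r ltW// gau_gt0. Qed.

Lemma flat0_le1 x : flat 0 x <= 1.
Proof.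
rewrite /flat; case: ifP => // _; rewrite expr0 mul1r /gau -[leRHS]expR0 ler_expR.
by rewrite oppr_le0 divr_ge0// sqr_ge0.
Qed.

Lemma bump_ge0 k a b x : 0 <= bump k a b x.
Proof. by rewrite mulr_ge0// flat0_ge0. Qed.

Lemma bump_le1 k a b x : bump k a b x <= 1.
Proof. by rewrite mulr_ile1// ?flat0_ge0 ?flat0_le1. Qed.

Lemma bump_out k a b x : ~~ (a < x < b) -> bump k a b x = 0.
Proof.
have k0 : 0 < k.+1%:R :> R by [].
rewrite negb_and -!leNgt => /orP[h|h]; rewrite /bump /flat.
  by rewrite ifF ?mul0r//; apply/negbTE; rewrite -leNgt subr_le0 ler_pM2l.
rewrite [X in _ * X]ifF ?mulr0//; apply/negbTE; rewrite -leNgt mulNr addrC subr_le0 ler_pM2l//.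
Qed.

Lemma flat0_cvg (c : R) : 0 < c -> flat 0 (n.+1%:R * c) @[n --> \oo] --> (1 : R).
Proof.
move=> c0; have E n : flat 0 (n.+1%:R * c) = gau ((n.+1%:R * c)^-1).
  by rewrite /flat mulr_gt0// expr0 mul1r.
under eq_cvg do rewrite E.
have cg : {for (0 : R), continuous (@gau R)}.
  apply: (@continuous_comp _ _ _ (fun x : R => - (x ^+ 2 / 2)) expR); last exact: continuous_expR.
  by apply: cvgN; apply: cvgM; [apply: exprn_continuous|exact: cvg_cst].
have h0 : (n.+1%:R * c)^-1 @[n --> \oo] --> (0 : R).
  have -> : (fun n => (n.+1%:R * c)^-1) = (fun n => c^-1 * n.+1%:R^-1).
    by apply/funext => n; rewrite invfM mulrC.
  have : c^-1 * n.+1%:R^-1 @[n --> \oo] --> c^-1 * 0 by apply: cvgM; [exact: cvg_cst|exact: cvg_harmonic].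
  by rewrite mulr0.
have := cvg_comp _ _ h0 cg; rewrite [gau 0](_ : _ = 1)//.
by rewrite /gau expr0n/= mul0r oppr0 expR0.
Qed.

Lemma bump_cvg a b x : bump n a b x @[n --> \oo] --> (if a < x < b then 1 else 0 : R).
Proof.
case: ifPn => [/andP[ax xb]|h]; last by under eq_cvg do rewrite bump_out//; exact: cvg_cst.
suff : bump n a b x @[n --> \oo] --> (1 * 1 : R) by rewrite mulr1.
apply: cvgM.
  have e n : n.+1%:R * x + - (n.+1%:R * a) = n.+1%:R * (x - a) by ring.
  by under eq_cvg do rewrite e; apply: flat0_cvg; rewrite subr_gt0.
have e n : - n.+1%:R * x + n.+1%:R * b = n.+1%:R * (b - x) by ring.
by under eq_cvg do rewrite e; apply: flat0_cvg; rewrite subr_gt0.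
Qed.

Lemma antiderivative f a b : continuous f -> (forall x, ~~ (a < x < b) -> f x = 0) ->
  exists J : R -> R, forall x, dv J x (f x).
Proof.
move=> cf f0.
have fi : (@lebesgue_measure R).-integrable setT (EFin \o f).
  have : (@lebesgue_measure R).-integrable `[a, b] (EFin \o f).
    exact: continuous_compact_integrable (@segment_compact _ _ _) (continuous_subspaceT cf).
  move=> fab; have := proj1 (@integrable_mkcond _ _ R (@lebesgue_measure R) `[a, b]%classic (EFin \o f)
    (measurable_itv _)) fab; congr (is_true (integrable _ _ _)).
  apply/funext => x; rewrite patchE /=; case: ifPn => // /negP h; rewrite f0//.
  apply/negP => /andP[ax xb]; apply: h; apply/mem_set; rewrite /= in_itv/= !ltW//.
(* Integration starts at minus infinity, so one formula serves the whole line; [f] is integrable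
   because it lives on [[a, b]]. *)
exists (fun y => \int[lebesgue_measure]_(t in [set` Interval -oo%O (BRight y)]) f t).
move=> x; have x1 : x < x + 1 by rewrite ltrDl.
have [||h1 h2] := @continuous_FTC1 R f -oo%O x (x + 1) x1 _ _ (cf x).
  by apply: integrableS fi => //; exact: measurable_itv.
  by rewrite ltNyr.
by split; [exact: h1|rewrite -derive1E; exact: h2].
Qed.

End smooth_line.

(** * Smooth products of one-variable functions *)

Section product_functions.
Context {R : realType} {m : nat}.
Implicit Types (c : 'I_m -> R -> R) (v w : 'rV[R]_m).

Definition Sm (f : R -> R) := forall k, sm k f.

(** [sm] supplies a derivative for each order separately; uniqueness of derivatives identifies them
    all with the first. *)
Lemma Sm_derive f : Sm f -> exists2 f', Sm f' & forall x, is_derive x (1 : R) f (f' x).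
Proof.
move=> fS; have [f' h1 _] := (fS 1%N).2; exists f' => // k.
have [g h2 gk] := (fS k.+1).2.
by have -> : f' = g by apply/funext => x; exact: dv_unique (h1 x) (h2 x).
Qed.

Definition prodf c v : R := \prod_i c i (v ord0 i).

Lemma prodf_continuous c : (forall i, Sm (c i)) -> continuous (prodf c).
Proof.
move=> cS; rewrite /prodf.
elim: (index_enum _) => [|i s ih].
  have -> : (fun w : 'rV[R]_m => \prod_(i <- [::]) c i (w ord0 i)) = fun=> 1.
    by apply/funext => w; rewrite big_nil.
  exact: cst_continuous.
have -> : (fun w : 'rV[R]_m => \prod_(i <- i :: s) c i (w ord0 i)) =
    fun w => c i (w ord0 i) * \prod_(i <- s) c i (w ord0 i).
  by apply/funext => w; rewrite big_cons.
move=> v; apply: (@continuousM _ _ (fun w : 'rV[R]_m => c i (w ord0 i))); last exact: ih.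
apply: (@continuous_comp _ _ _ (fun w : 'rV[R]_m => w ord0 i) (c i)); first exact: coord_continuous.
exact: (sm_cont (cS i 0%N)).
Qed.

Lemma prodf_derive c (c' : 'I_m -> R -> R) j v : (forall x, is_derive x (1 : R) (c j) (c' j x)) ->
  is_derive v (delta_mx 0 j) (prodf c) (prodf (fun i => if i == j then c' i else c i) v).
Proof.
move=> dc; pose K := \prod_(i | i != j) c i (v ord0 i).
have E (h : R) : prodf c (h *: delta_mx 0 j + v) = c j (h + v ord0 j) * K.
  rewrite /prodf (bigD1 j)//= !mxE !eqxx/= mulr1; congr (_ * _); apply: eq_bigr => i ij.
  by rewrite !mxE eqxx/= (negbTE ij) mulr0 add0r.
have D : is_derive (v ord0 j) (1 : R) (fun s => c j s * K) (prodf (fun i => if i == j then c' i else c i) v).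
  rewrite /prodf (bigD1 j)//= eqxx.
  have -> : \prod_(i | i != j) (if i == j then c' i else c i) (v ord0 i) = K.
    by apply: eq_bigr => i ij; rewrite (negbTE ij).
  by have := dv_mul (dc (v ord0 j)) (dv_cst K (v ord0 j)); rewrite mulr0 addr0.
have F : (fun h : R => h^-1 *: ((prodf c \o shift v) (h *: delta_mx 0 j) - prodf c v)) =
   (fun h : R => h^-1 *: (((fun s => c j s * K) \o shift (v ord0 j)) (h *: 1) - c j (v ord0 j) * K)).
  apply/funext => h /=; rewrite E -[h%:A]/(h * 1) mulr1; congr (_ *: (_ - _)).
  by rewrite -{1}[v]add0r -{1}(scale0r (delta_mx 0 j)) E add0r.
by case: D => D1 D2; split; [rewrite /derivable F|rewrite /derive F].
Qed.

Lemma prodf_iter_pd c l : (forall i, Sm (c i)) ->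
  exists2 c', (forall i, Sm (c' i)) & iter_pd m l (prodf c) = prodf c'.
Proof.
move=> cS; elim: l => [|j l [c1 c1S E]]; first by exists c.
have [f' f'S df] := Sm_derive (c1S j).
exists (fun i => if i == j then f' else c1 i); first by move=> i; case: eqP.
apply/funext => v; rewrite /= E /pd.
by have D := @prodf_derive c1 (fun=> f') j v df; rewrite derive_val.
Qed.

Lemma prodf_smooth c : (forall i, Sm (c i)) -> smooth_on m setT (prodf c).
Proof.
move=> cS l; have [c' c'S ->] := prodf_iter_pd l cS; split=> [v _|i v _].
  exact: prodf_continuous.
have [f' f'S df] := Sm_derive (c'S i).
by have D := @prodf_derive c' (fun=> f') i v df; exact: ex_derive.
Qed.

Lemma box_closed (A : R) : closed [set v : 'rV[R]_m | forall i, `|v ord0 i| <= A].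
Proof.
have -> : [set v : 'rV[R]_m | forall i, `|v ord0 i| <= A] =
    \bigcap_i ((fun v : 'rV[R]_m => v ord0 i) @^-1` [set x : R | `|x| <= A]).
  by apply/seteqP; split => v /= h i; [move=> _; exact: h|exact: (h i)].
apply: closed_bigI => i _; apply: closed_comp; first by move=> v _; exact: coord_continuous.
have -> : [set x : R | `|x| <= A] = [set` `[- A, A]].
  by apply/seteqP; split => x /=; rewrite in_itv/= ler_norml.
exact: interval_closed.
Qed.

Lemma bounded_support_compact (g : 'rV[R]_m -> R) (A : R) :
  (forall v, g v != 0 -> forall i, `|v ord0 i| <= A) -> compact (closure [set v | g v != 0]).
Proof.
move=> gA; apply: bounded_closed_compact; last exact: closed_closure.
have sub : closure [set v | g v != 0] `<=` [set v : 'rV[R]_m | forall i, `|v ord0 i| <= A].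
  have := @closure_subset _ [set v | g v != 0] _ gA.
  move=> /subset_trans; apply; exact: (@box_closed A).
exists `|A|; split; first exact: num_real.
move=> B AB v /sub vA /=; rewrite [leLHS]mx_normrE; apply: bigmax_le.
  by rewrite (le_trans (normr_ge0 A))// ltW.
move=> [a i] _ /=; rewrite (ord1 a); apply: (le_trans (vA i)).
by rewrite (le_trans (ler_norm A))// ltW.
Qed.

Lemma iter_pd_shift (g : 'rV[R]_m -> R) w l v :
  iter_pd m l (fun v => g (v + w)) v = iter_pd m l g (v + w).
Proof.
elim: l v => [//|i l ih] v /=; rewrite /pd.
have -> : iter_pd m l (fun v => g (v + w)) = (fun v => iter_pd m l g (v + w)) by apply/funext => u; exact: ih.
have F : (fun h : R => h^-1 *: (((fun v => iter_pd m l g (v + w)) \o shift v) (h *: delta_mx 0 i)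
    - iter_pd m l g (v + w))) =
    (fun h : R => h^-1 *: ((iter_pd m l g \o shift (v + w)) (h *: delta_mx 0 i) - iter_pd m l g (v + w))).
  by apply/funext => h /=; rewrite addrA.
by rewrite /derive F.
Qed.

End product_functions.

(** * Product test functions and their translates *)

Section product_tests.
Context {R : realType} {d : nat}.
Variable T : R.
Implicit Types (th : R -> R) (b : 'I_d -> R -> R).

Definition ptest th b (p : R * d.-tuple R) : R := th p.1 * \prod_i b i (tnth p.2 i).

Let pc th b (i : 'I_(1 + d)) : R -> R := match fintype.split i with inl _ => th | inr j => b j end.

Let ptest_prodf th b : ofST d (ptest th b) = prodf (pc th b).
Proof.
apply/funext => v; rewrite /ofST /ptest /prodf big_split_ord/= big_ord1; congr (_ * _).
  by rewrite /pc; case: split_ordP => k; [move=> _|move=> /eqP; rewrite eq_lrshift].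
apply: eq_bigr => j _; rewrite /pc tnth_mktuple mxE.
case: split_ordP => k; first by move=> /eqP; rewrite eq_rlshift.
by move=> /rshift_inj ->.
Qed.

Lemma ptest_test th b (al be A : R) : Sm th -> (forall i, Sm (b i)) -> be < T ->
  (forall t, ~~ (al < t < be) -> th t = 0) -> (forall i s, A < `|s| -> b i s = 0) ->
  test_fun d T (ptest th b).
Proof.
move=> thS bS bT th0 b0; rewrite /test_fun ptest_prodf.
have cS i : Sm (pc th b i) by rewrite /pc; case: fintype.split.
have prodN0 (v : 'rV[R]_(1 + d)) : prodf (pc th b) v != 0 -> forall i, pc th b i (v ord0 i) != 0.
  by move=> /prodf_neq0 h i; exact: h.
split; first split.
- exact: prodf_smooth.
- apply: (@bounded_support_compact _ _ _ (`|al| + `|be| + `|A|)) => v /prodN0 /[swap] i /(_ i).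
  rewrite /pc; case: fintype.split => [_|j]; apply: contraR; rewrite -ltNge => h.
    rewrite th0//; apply/negP => /andP[h1 h2]; move: h; rewrite ltNge => /negP; apply.
    rewrite ler_norml; have := ler_norm al; have := ler_norm be; have := ler_norm (- al); have := ler_norm (- be).
    by rewrite !normrN; have := normr_ge0 A; have := normr_ge0 al; have := normr_ge0 be; move=> *; apply/andP; split; lra.
  rewrite b0//; apply: le_lt_trans h; apply: (le_trans (ler_norm A)).
  by rewrite lerDr addr_ge0.
have cl : closed [set v : 'rV[R]_(1 + d) | v ord0 (tidx d) <= be].
  apply: (@closed_comp _ _ (fun v : 'rV[R]_(1 + d) => v ord0 (tidx d)) [set x : R | x <= be]).
    by move=> v _; exact: coord_continuous.
  exact: closed_le.
have sub : [set v | prodf (pc th b) v != 0] `<=` [set v | v ord0 (tidx d) <= be].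
  move=> v /prodN0 /(_ (tidx d)) /=; rewrite /pc; case: split_ordP => k; last first.
    by move=> /eqP; rewrite eq_lrshift.
  move=> _; apply: contraR; rewrite -ltNge => h; rewrite th0// negb_and -!leNgt orbC (ltW h)//.
move=> v /(closure_subset sub) /cl /= h; exact: le_lt_trans bT.
Qed.

Lemma ptest_dt th th' b p : test_fun d T (ptest th b) ->
  (forall x, is_derive x (1 : R) th (th' x)) ->
  tD (ptest th b) [:: tidx d] p = th' p.1 * \prod_i b i (tnth p.2 i).
Proof.
case: p => t x tt dth; have D1 := tD_derive tt [::] t x.
have D2 := dv_mul (dth t) (dv_cst (\prod_i b i (tnth x i)) t).
rewrite mulr0 addr0 in D2; apply: dv_unique D1 _.
by under [X in is_derive _ _ X _]eq_fun do rewrite tD_nil.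
Qed.

Lemma ptest_shift th b y p : ptest th (fun i s => b i (s + tnth y i)) p = ptest th b (p.1, tadd p.2 y).
Proof. by rewrite /ptest /=; congr (_ * _); apply: eq_bigr => i _; rewrite tnth_tadd. Qed.

Lemma tD_shift (phi phi' : R * d.-tuple R -> R) y l p : (forall q, phi' q = phi (q.1, tadd q.2 y)) ->
  tD phi' l p = tD phi l (p.1, tadd p.2 y).
Proof.
move=> E; rewrite /tD.
have st_add q : st d (q.1, tadd q.2 y) = st d q + st d (0, y).
  apply/rowP => i; rewrite /st !mxE; case: (split_ordP i) => k _; rewrite !mxE ?addr0//.
  by rewrite tnth_tadd.
have -> : ofST d phi' = fun v => ofST d phi (v + st d (0, y)).
  apply/funext => v; rewrite !ofSTE E; congr phi.
  have -> : v + st d (0, y) = st d ((unst v).1, tadd (unst v).2 y) by rewrite st_add st_unst.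
  by rewrite unst_st.
by rewrite iter_pd_shift st_add.
Qed.

Lemma tG_shift (phi phi' : R * d.-tuple R -> R) y l p : (forall q, phi' q = phi (q.1, tadd q.2 y)) ->
  tG phi' l p = tG phi l (p.1, tadd p.2 y).
Proof.
move=> E; rewrite /tG (tD_shift _ _ E); congr (_ - _); apply: eq_bigr => j _.
by rewrite (tD_shift _ _ E).
Qed.

End product_tests.

(** * Functions whose integrals over all measurable sets vanish *)

Section null_functions.
Context d (T : measurableType d) (R : realType) (mu : {measure set T -> \bar R}).
Implicit Types (f g : T -> R).

Lemma Int_dct0 (fs : nat -> T -> R) f g : (forall n, mfunT (fs n)) -> mfunT f ->
  (forall x, fs n x @[n --> \oo] --> f x) -> intg mu g -> (forall n x, `|fs n x| <= g x) ->
  (forall n, \int[mu]_x fs n x = 0) -> \int[mu]_x f x = 0.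
Proof.
move=> mfs mf cf gi fg f0.
have [] := @dominated_convergence _ _ R mu setT measurableT (fun n => EFin \o fs n) (EFin \o f) (EFin \o g).
- by move=> n; exact/measurable_EFinP.
- exact/measurable_EFinP.
- by apply: aeW => x _ /=; apply: cvg_EFin; [exact: nearW|exact: cf].
- exact: gi.
- by apply: aeW => x n _ /=; rewrite lee_fin.
move=> _ _ /cvg_lim; rewrite /Rintegral => <-//.
rewrite (_ : (fun n => _) = fun=> 0%E) ?lim_cst//.
apply/funext => n; have := f0 n; rewrite /Rintegral => h.
rewrite -[LHS]fineK ?h//; apply: (integrable_fin_num measurableT).
exact: (intg_dom (mfs n) gi (fg n)).
Qed.

Definition nullf f := forall A, measurable A -> \int[mu]_x (f x * \1_A x) = 0.

Lemma intg_indic f A : intg mu f -> measurable A -> intg mu (fun x => f x * \1_A x).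
Proof.
move=> fi mA; apply: (intg_eq (f := fun x => \1_A x * f x)); first by move=> x; rewrite mulrC.
apply: (intgM_bounded (M := 1)) fi => //.
by move=> x; rewrite indicE; case: (_ \in _); rewrite ?normr1 ?normr0.
Qed.

(** The sets over which [f] has zero integral form a Dynkin system: the zero total integral handles
    complements, dominated convergence handles disjoint unions. *)
Lemma nullf_dynkin (C : set (set T)) f : @measurable _ T = <<s C >> -> setI_closed C ->
  intg mu f -> \int[mu]_x f x = 0 -> (forall A, C A -> \int[mu]_x (f x * \1_A x) = 0) -> nullf f.
Proof.
move=> CE CI fi f0 fC A; rewrite CE.
apply: (@dynkin_induction _ T C (fun A => \int[mu]_x (f x * \1_A x) = 0)) => //.
- by rewrite -[RHS]f0; apply: Int_eq => x; rewrite indicT mulr1.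
- move=> S mS S0; rewrite (@Int_eq _ _ _ mu _ (fun x => f x - f x * \1_S x)).
    by rewrite IntB//; [rewrite f0 S0 subr0|exact: intg_indic].
  by move=> x; rewrite !indicE in_setC; case: (x \in S) => /=; rewrite ?mulr1 ?mulr0 ?subrr ?subr0.
move=> F mF tF F0.
apply: (@Int_dct0 (fun n x => \sum_(i < n) f x * \1_(F i) x) _ (fun x => `|f x|)).
- move=> n; apply: measurable_sum => i; exact: intg_measurable (intg_indic fi (mF i)).
- by apply: (intg_measurable (mu := mu)); apply: intg_indic => //; exact: bigcupT_measurable.
- move=> x; rewrite indicE; case: (asboolP ((\bigcup_k F k) x)) => [[k _ Fkx]|nF].
    rewrite mem_set; last by exists k.
    apply: (@cvg_near_cst _ _ _ _ \oo); near=> n.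
    have kn : (k < n)%N by near: n; exact: nbhs_infty_gt.
    rewrite (bigD1 (Ordinal kn))//= big1 ?addr0.
      by rewrite indicE mem_set.
    move=> i ik; rewrite indicE memNset ?mulr0// => Fix'; move/eqP: ik; apply; apply/val_inj => /=.
    by apply: (tF i k) => //; exists x.
  rewrite memNset// mulr0; apply: (@cvg_near_cst _ _ _ _ \oo); apply: nearW => n.
  by rewrite big1// => i _; rewrite indicE memNset ?mulr0// => h; apply: nF; exists i.
- exact: intg_norm.
- move=> n x; rewrite -mulr_sumr normrM ler_piMr//.
  have [[k Fk]|nk] := pselect (exists k : 'I_n, F k x).
    rewrite (bigD1 k)//= big1 ?addr0 ?indicE ?mem_set ?normr1//.
    move=> i ik; rewrite indicE memNset// => Fix'; move/eqP: ik; apply; apply/val_inj => /=.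
    by apply: (tF i k) => //; exists x.
  by rewrite big1 ?normr0// => i _; rewrite indicE memNset// => h; apply: nk; exists i.
- move=> n; rewrite Int_sum; last by move=> i; exact: intg_indic.
  by rewrite big1.
Unshelve. all: by end_near. Qed.

Lemma nullf_norm f : intg mu f -> nullf f -> \int[mu]_x `|f x| = 0.
Proof.
move=> fi fn; have mf := intg_measurable fi.
pose A := [set x | 0 <= f x].
have mA : measurable A.
  have := mf measurableT _ (measurable_itv `[0, +oo[); rewrite setTI.
  by rewrite preimage_itvcy.
have nf := fn _ (measurableC mA).
rewrite (@Int_eq _ _ _ mu _ (fun x => f x * \1_A x - f x * \1_(~` A) x)).
  by rewrite (IntB (intg_indic fi mA) (intg_indic fi (measurableC mA))) nf (fn _ mA) subrr.
move=> x; rewrite !indicE in_setC; case: (asboolP (A x)) => h.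
  by rewrite mem_set//= mulr0 subr0 mulr1 ger0_norm.
rewrite memNset//= mulr0 sub0r mulr1 ltr0_norm// ltNge; exact/negP.
Qed.

End null_functions.

(** * Boxes separate integrable functions *)

Section boxes.
Context {R : realType}.

Definition bI (a b x : R) : R := if a < x < b then 1 else 0.

Lemma bIE a b x : bI a b x = \1_(`]a, b[%classic : set R) x.
Proof.
rewrite indicE /bI; case: ifPn => h; first by rewrite mem_set//= in_itv.
by rewrite memNset//= in_itv; exact/negP.
Qed.

Lemma measurable_bI a b : mfunT (bI a b).
Proof.
rewrite (_ : bI a b = \1_(`]a, b[%classic : set R)); last by apply/funext => x; exact: bIE.
by apply: measurable_indic; exact: measurable_itv.
Qed.

Lemma norm_bI_le1 a b x : `|bI a b x| <= 1.
Proof. by rewrite /bI; case: ifP; rewrite ?normr1 ?normr0. Qed.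

Lemma nullf_line (f : R -> R) : intg lebR f -> (forall a b, \int[lebR]_x (f x * bI a b x) = 0) ->
  nullf lebR f.
Proof.
move=> fi f0; have E : @measurable _ R = <<s @RGenOpens.G R >> by exact: RGenOpens.measurableE.
apply: (@nullf_dynkin _ R R lebR _ f E _ fi).
- move=> _ _ [a [b ->]] [a' [b' ->]]; exists (Num.max a a'), (Num.min b b').
  by apply/seteqP; split => x /=; rewrite !in_itv/= gt_max lt_min; lra.
(* The integral over the whole line is the limit of those over []-n, n[]. *)
- apply: (@Int_dct0 _ _ _ lebR (fun n x => f x * bI (- n%:R) n%:R x) f (fun x => `|f x|)).
  + by move=> n; apply: measurable_funM (measurable_bI _ _); exact: intg_measurable fi.
  + exact: intg_measurable fi.
  + move=> x; apply: (@cvg_near_cst _ _ _ _ \oo); near=> n.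
    rewrite /bI ifT ?mulr1//.
    have : `|x| < n%:R by near: n; exact: nbhs_infty_gtr.
    by rewrite ltr_norml.
  + exact: intg_norm.
  + by move=> n x; rewrite normrM ler_piMr// norm_bI_le1.
  + by move=> n; exact: f0.
move=> _ [a [b ->]]; rewrite -[RHS](f0 a b); apply: Int_eq => x.
by rewrite bIE.
Unshelve. all: by end_near. Qed.

Section step.
Context d2 (T2 : measurableType d2) (m2 : {sigma_finite_measure set T2 -> \bar R}).
Variable K : (T2 -> R) -> Prop.
Hypotheses (K1 : forall k, K k -> mfunT k /\ (forall y, `|k y| <= 1))
  (KZ : forall g, intg m2 g -> (forall k, K k -> \int[m2]_y (g y * k y) = 0) -> nullf m2 g).

(** One factor at a time. For a fixed interval, the partial integral over the line is a function on
    [T2] that [KZ] annihilates, which gives interval times measurable set. For a fixed measurable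
    set, [nullf_line] then extends intervals to measurable sets, and rectangles generate the
    product. The class [K] stays abstract because the lemma serves both the induction on the
    dimension and the passage to space-time. *)
Lemma nullf_step (F : R * T2 -> R) : intg (lebR \x m2)%E F ->
  (forall a b k, K k -> \int[(lebR \x m2)%E]_p (F p * (bI a b p.1 * k p.2)) = 0) ->
  nullf (lebR \x m2)%E F.
Proof.
move=> Fi FK; have mF := intg_measurable Fi.
have bdd (h : R -> R) (k : T2 -> R) : mfunT h -> (forall x, `|h x| <= 1) -> mfunT k -> (forall y, `|k y| <= 1) ->
    intg (lebR \x m2)%E (fun p => F p * (h p.1 * k p.2)).
  move=> mh h1 mk k1; apply: (intg_eq (f := fun p => (h p.1 * k p.2) * F p)); first by move=> p; rewrite mulrC.
  apply: (intgM_bounded (M := 1)) Fi => [|p]; last by rewrite normrM mulr_ile1.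
  apply: measurable_funM; first exact: (measurableT_comp mh measurable_fst).
  exact: (measurableT_comp mk measurable_snd).
have ind1 dd (Y : measurableType dd) (A : set Y) x : `|\1_A x : R| <= 1.
  by rewrite indicE; case: (_ \in _); rewrite ?normr1 ?normr0.
have swap1 (h : R -> R) (k : T2 -> R) : mfunT h -> (forall x, `|h x| <= 1) -> mfunT k -> (forall y, `|k y| <= 1) ->
    \int[(lebR \x m2)%E]_p (F p * (h p.1 * k p.2)) = \int[m2]_y ((\int[lebR]_s (F (s, y) * h s)) * k y).
  move=> mh h1 mk k1; rewrite (Int_fubini2 (bdd h k mh h1 mk k1)); apply: Int_eq => y /=.
  rewrite mulrC -Int_scale; first by apply: Int_eq => s; ring.
  by apply: measurable_funM => //; exact: (measurable_fun_pair1 y mF).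
have swap2 (h : R -> R) (k : T2 -> R) : mfunT h -> (forall x, `|h x| <= 1) -> mfunT k -> (forall y, `|k y| <= 1) ->
    \int[(lebR \x m2)%E]_p (F p * (h p.1 * k p.2)) = \int[lebR]_s ((\int[m2]_y (F (s, y) * k y)) * h s).
  move=> mh h1 mk k1; rewrite (Int_fubini1 (bdd h k mh h1 mk k1)); apply: Int_eq => s /=.
  rewrite mulrC -Int_scale; first by apply: Int_eq => y; ring.
  by apply: measurable_funM => //; exact: (measurable_fun_pair2 s mF).
have mi dd (Y : measurableType dd) (A : set Y) : measurable A -> mfunT (\1_A : Y -> R).
  by move=> mA; exact: measurable_indic.
have m1 dd (Y : measurableType dd) : mfunT (fun _ : Y => 1 : R) by exact: measurable_cst.
have n1 (Y : Type) (y : Y) : `|(fun=> 1 : R) y| <= 1 by rewrite normr1.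
have rect1 a b B : measurable B -> \int[(lebR \x m2)%E]_p (F p * (bI a b p.1 * \1_B p.2)) = 0.
  move=> mB; rewrite (swap1 (bI a b) \1_B (measurable_bI a b) (norm_bI_le1 a b))//; last exact: ind1.
  apply: KZ => // [|k Kk].
    have := intg_fubini2 (bdd (bI a b) (fun=> 1) (measurable_bI a b) (norm_bI_le1 a b) (m1 _ _) (n1 _)).
    by apply: intg_eq => y; apply: Int_eq => s /=; rewrite mulr1.
  have [mk k1] := K1 Kk.
  by rewrite -(swap1 (bI a b) k (measurable_bI a b) (norm_bI_le1 a b) mk k1); exact: FK.
have rect A B : measurable A -> measurable B -> \int[(lebR \x m2)%E]_p (F p * (\1_A p.1 * \1_B p.2)) = 0.
  move=> mA mB; rewrite (swap2 \1_A \1_B)//; [|exact: ind1|exact: ind1].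
  apply: nullf_line => // [|a b].
    have := intg_fubini1 (bdd (fun=> 1) \1_B (m1 _ _) (n1 _) (mi _ _ _ mB) (ind1 _ _ _)).
    by apply: intg_eq => s; apply: Int_eq => y /=; rewrite mul1r.
  rewrite -(swap2 (bI a b) \1_B (measurable_bI a b) (norm_bI_le1 a b))//; [exact: rect1|exact: ind1].
apply: (nullf_dynkin (C := [set A `*` B | A in measurable & B in measurable])) => //.
- exact: measurable_prod_measurableType.
- move=> _ _ [A1 mA1 [A2 mA2 <-]] [B1 mB1 [B2 mB2 <-]].
  exists (A1 `&` B1); first exact: measurableI.
  by exists (A2 `&` B2); [exact: measurableI|rewrite setXI].
- rewrite -[RHS](rect setT setT measurableT measurableT); apply: Int_eq => p.
  by rewrite !indicT !mulr1.
move=> _ [A mA [B mB <-]]; rewrite -[RHS](rect A B mA mB); apply: Int_eq => p.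
congr (_ * _); rewrite !indicE in_setX /=.
by case: (_ \in A); case: (_ \in B); rewrite ?mulr1 ?mulr0.
Qed.

End step.

Definition boxI n (k : n.-tuple R -> R) := exists a b : 'I_n -> R,
  k = fun x => \prod_i bI (a i) (b i) (tnth x i).

Lemma boxI1 n k : @boxI n k -> mfunT k /\ forall x, `|k x| <= 1.
Proof.
move=> [a [b ->]]; split.
  apply: measurable_prod => i _; apply: (measurableT_comp (measurable_bI _ _)).
  exact: measurable_tnth.
move=> x; rewrite normr_prod; apply: prodr_ile1 => i _.
by rewrite normr_ge0 norm_bI_le1.
Qed.

Lemma nullf_lebn n (g : n.-tuple R -> R) : intg (lebn n) g ->
  (forall k, boxI k -> \int[lebn n]_y (g y * k y) = 0) -> nullf (lebn n) g.
Proof.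
elim: n g => [|n ih] g gi gk.
  have g0 : \int[lebn 0]_y g y = 0.
    rewrite -[RHS](gk (fun=> 1)); first by apply: Int_eq => y; rewrite mulr1.
    by exists (fun=> 0), (fun=> 0); apply/funext => x; rewrite big_ord0.
  move=> A mA; have [At|At] := pselect (A [tuple]).
    rewrite -[RHS]g0; apply: Int_eq => y; rewrite indicE mem_set ?mulr1//.
    by rewrite (tuple0 y).
  rewrite -[RHS](@Int0 _ _ _ (lebn 0)); apply: Int_eq => y; rewrite indicE memNset ?mulr0//.
  by rewrite (tuple0 y).
have mg := intg_measurable gi.
have Fi : intg (lebR \x lebn n)%E (fun p => g (tcons p)).
  have [_ gy] := integrableP _ _ _ gi; apply/integrableP; split.
    by apply/measurable_EFinP; exact: (measurableT_comp mg (@measurable_tcons R n)).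
  move: gy; apply: le_lt_trans; rewrite le_eqVlt; apply/orP; left; apply/eqP/esym.
  have := @ge0_integral_pushforward _ _ _ _ R (@tcons R n) (@measurable_tcons R n)
    (lebR \x lebn n)%E setT (fun x => `|(g x)%:E|%E) measurableT.
  rewrite preimage_setT => <-//; last by apply: measurableT_comp => //; exact/measurable_EFinP.
  apply: eq_measure_integral; first exact: measurable_tcons.
  by move=> ? A mA _; exact: lebnSE.
have tr (k : n.+1.-tuple R -> R) : mfunT k -> (forall x, `|k x| <= 1) ->
    \int[lebn n.+1]_x (g x * k x) = \int[(lebR \x lebn n)%E]_p (g (tcons p) * k (tcons p)).
  move=> mk k1; apply: Int_lebnS; last exact: measurable_funM.
  apply: (intg_eq (f := fun p => k (tcons p) * g (tcons p))); first by move=> p; rewrite mulrC.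
  apply: (intgM_bounded (M := 1)) Fi => // ; exact: (measurableT_comp mk (@measurable_tcons R n)).
have := nullf_step (@boxI1 n) ih Fi.
move=> H A mA; rewrite (tr \1_A); last 2 first.
- exact: measurable_indic.
- by move=> x; rewrite indicE; case: (_ \in _); rewrite ?normr1 ?normr0.
have mtA : measurable (@tcons R n @^-1` A) by rewrite -[X in measurable X]setTI; exact: measurable_tcons.
rewrite -[RHS](H _ _ mtA).
  by apply: Int_eq => p; rewrite !indicE; congr (_ * _%:R); congr nat_of_bool; apply/idP/idP => /set_mem h; exact/mem_set.
move=> a b _ [a' [b' ->]].
pose a1 (i : 'I_n.+1) := if unlift ord0 i is Some j then a' j else a.
pose b1 (i : 'I_n.+1) := if unlift ord0 i is Some j then b' j else b.
have Kb : boxI (fun x : n.+1.-tuple R => \prod_i bI (a1 i) (b1 i) (tnth x i)) by exists a1, b1.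
have [mk k1] := boxI1 Kb.
rewrite -[RHS](gk _ Kb) tr//; apply: Int_eq => p; congr (_ * _).
rewrite big_ord_recl /a1 /b1 unlift_none; congr (_ * _).
by apply: eq_bigr => i _; rewrite liftK tnthS.
Qed.

End boxes.

(** * Time factors with prescribed derivative *)

Section time_bump.
Context {R : realType}.
Variables (T a b : R) (eta : R -> R).
Hypotheses (T0 : 0 < T) (bT : b < T) (etaS : Sm eta)
  (eta0 : forall x, ~~ (a < x < b) -> eta x = 0).

(* [J t - J (t + T)] for an antiderivative [J] of [eta] is compactly supported and has
   derivative [eta] on [(0, T)]. *)
Lemma compact_antiderivative : exists th th' : R -> R,
  [/\ Sm th, forall x, is_derive x (1 : R) th (th' x),
      forall t, ~~ (a - T < t < b) -> th t = 0 & forall t, 0 < t < T -> th' t = eta t].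
Proof.
have [J dJ] := antiderivative (sm_cont (etaS 0%N)) eta0.
have JS : Sm J by case=> [|k]; split; try exact: dv_continuous dJ => //; [|exists eta].
exists (fun t => J t + -1 * J (1 * t + T)), (fun t => eta t + -1 * (eta (1 * t + T) * 1)); split.
- move=> k; apply: sm_add; first exact: JS.
  by apply: sm_mul; [exact: sm_cst|apply: sm_affine; exact: JS].
- move=> x; have dA : is_derive x (1 : R) (fun t => 1 * t + T) 1.
    by have := dv_add (dv_scale 1 (dv_id x)) (dv_cst T x); rewrite mulr1 addr0.
  exact: (dv_add (dJ x) (dv_scale (-1) (@dv_comp _ J (fun t => 1 * t + T) x _ _ (dJ _) dA))).
- move=> t h; rewrite mul1r mulN1r.
  have tT : t <= t + T by rewrite lerDl ltW.
  (* The increment of [J] over [[t, t + T]] is [T * eta c], and for [t] outside []a - T, b[] the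
     interval [[t, t + T]] misses []a, b[]. *)
  have [c] := MVT_segment tT (fun x _ => dJ x) (continuous_subspaceT (dv_continuous dJ)).
  rewrite in_itv/= => /andP[tc cT] e; apply/eqP; rewrite subr_eq0 eq_sym -subr_eq0 e.
  rewrite eta0 ?mul0r//; apply: contra h => /andP[ac cb].
  by rewrite (le_lt_trans tc cb) andbT ltrBlDr (lt_le_trans ac cT).
move=> t /andP[t0 tT]; rewrite (eta0 (x := 1 * t + T)) ?mul0r ?mulr0 ?addr0//.
by apply/negP => /andP[_]; rewrite mul1r => hb; move: bT hb; lra.
Qed.

End time_bump.

Lemma translates_average {R : realType} {n : nat} k (f1 f2 G1 G2 : R * n.-tuple R -> R) M1 M2 :
  wL1 f1 -> wL1 f2 -> rbd M1 G1 -> rbd M2 G2 ->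
  (forall y, \int[@must R n]_p (f1 p * G1 (p.1, tadd p.2 y)) +
    \int[@must R n]_p (f2 p * G2 (p.1, tadd p.2 y)) = 0) ->
  \int[@must R n]_p (f1 p * Av k G1 p) + \int[@must R n]_p (f2 p * Av k G2 p) = 0.
Proof.
move=> i1 i2 G1M G2M tr; have [j1 e1] := Int_Av k i1 G1M; have [j2 e2] := Int_Av k i2 G2M.
rewrite e1 e2 -(IntD j1 j2) -[RHS](@Int0 _ _ _ (@must R n)); apply: Int_eq => v.
by rewrite -mulrDr (tr (tsc (- v.1) v.2)) mulr0.
Qed.

(** * Uniqueness in weighted L^1 *)

Section uniqueness.
Context {R : realType} {d : nat}.
Variable T : R.
Hypothesis T0 : 0 < T.
Local Notation mu := (@must R d).
Local Notation sI := (sI T).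
Local Notation cut := (cut T).
Variables (w : R * d.-tuple R -> R) (F : 'I_d -> R * d.-tuple R -> R).
Hypotheses (wi : wL1 w) (Fi : forall j, wL1 (F j)) (wc : cut w = w) (Fc : forall j, cut (F j) = F j)
  (wF0 : forall phi, test_fun d T phi -> \int[mu]_p weak_integrand phi w F p = 0).
Let h := Nop w F.
Let hi : wL1 h. Proof. exact: wL1_Nop. Qed.

Let hs p : sI p.1 * h p = h p.
Proof.
rewrite -Nop_cut; [|exact: wL1_measurable|by move=> j; exact: wL1_measurable].
by rewrite wc /h; congr (Nop w _ p); apply/funext => j; exact: Fc.
Qed.

(** This is [w_t = h] tested against products. A translate of a product test function is again one,
    with a larger support radius, so the weak identity holds for all translates, and their average
    replaces [tG phi] by [phi]. *)
Lemma product_identity th b (al be A : R) : Sm th -> (forall i, Sm (b i)) -> be < T ->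
  (forall t, ~~ (al < t < be) -> th t = 0) -> (forall i s, A < `|s| -> b i s = 0) ->
  \int[mu]_p (w p * tD (ptest th b) [:: tidx d] p) + \int[mu]_p (h p * ptest th b p) = 0.
Proof.
move=> thS bS beT th0 b0; set phi := ptest th b.
have tphi : test_fun d T phi by exact: (ptest_test thS bS beT th0 b0).
have tr y : \int[mu]_p (w p * tG phi [:: tidx d] (p.1, tadd p.2 y)) +
    \int[mu]_p (h p * tG phi [::] (p.1, tadd p.2 y)) = 0.
  pose b' i s := b i (s + tnth y i).
  have E q : ptest th b' q = phi (q.1, tadd q.2 y) by exact: ptest_shift.
  have tphi' : test_fun d T (ptest th b').
    apply: (@ptest_test _ _ T th b' al be (A + \sum_i `|tnth y i|)) => //.
      move=> i k; have := sm_affine 1 (tnth y i) (bS i k).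
      by congr (sm k _); apply/funext => s; rewrite mul1r.
    move=> i s hs'; apply: b0; have : `|tnth y i| <= \sum_i `|tnth y i|.
      by rewrite (bigD1 i)//= lerDl sumr_ge0.
    have := ler_normB (s + tnth y i) (tnth y i); rewrite addrK; lra.
  have [_ _ _] := weak_dual tphi'.1 wi Fi; rewrite (wF0 tphi') -/h => e.
  have cg (u u' v v' : R * d.-tuple R -> R) : (forall p, u p = u' p) -> (forall p, v p = v' p) ->
      \int[mu]_p (w p * u p) + \int[mu]_p (h p * v p) = \int[mu]_p (w p * u' p) + \int[mu]_p (h p * v' p).
    by move=> /funext -> /funext ->.
  apply: etrans (esym e); apply: cg => p; exact: esym (tG_shift _ _ E).
have [A1 G1] := tG_rbd tphi.1 [:: tidx d]; have [A2 G2] := tG_rbd tphi.1 [::].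
have -> : \int[mu]_p (w p * tD phi [:: tidx d] p) = \int[mu]_p (w p * Av None (tG phi [:: tidx d]) p).
  by apply: Int_eq => p; rewrite (Av_tG1 tphi.1).
have -> : \int[mu]_p (h p * phi p) = \int[mu]_p (h p * Av None (tG phi [::]) p).
  by apply: Int_eq => p; rewrite (Av_tG tphi.1).
exact: (translates_average None wi hi G1 G2 tr).
Qed.

Let g p := w p - sI p.1 * It T h p.
Let gi : wL1 g. Proof. by apply: wL1D => //; apply: wL1N; exact: wL1_It. Qed.

Let gc p : ~~ (0 < p.1 < T) -> g p = 0.
Proof. by move=> np; rewrite /g -wc /cut sI0// !mul0r subrr. Qed.

Let g_product k (a0 b0 : R) (a b : 'I_d -> R) : b0 < T ->
  \int[mu]_p (g p * rho p.2 * (bump k a0 b0 p.1 * \prod_i bump k (a i) (b i) (tnth p.2 i))) = 0.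
Proof.
move=> b0T.
have [th [th' [thS dth th0 th'E]]] := compact_antiderivative T0 b0T (fun j => sm_bump j k a0 b0)
  (@bump_out R k a0 b0).
(* The factors [jap] multiply up to the weight [rho], while the time factor [th] has the bump as its
   derivative on the slab. *)
pose bb i s := jap s * bump k (a i) (b i) s.
have bbS i : Sm (bb i) by move=> j; apply: sm_mul; [exact: sm_jap|exact: sm_bump].
pose A := \sum_i (`|a i| + `|b i|).
have bb0 i s : A < `|s| -> bb i s = 0.
  move=> As; rewrite /bb bump_out ?mulr0//; apply/negP => /andP[h1 h2].
  have : `|a i| + `|b i| <= A by rewrite /A (bigD1 i)//= lerDl sumr_ge0// => j _; rewrite addr_ge0.
  have : `|s| <= `|a i| + `|b i|.
    rewrite ler_norml; have := ler_norm (- a i); have := ler_norm (b i); rewrite normrN.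
    by have := normr_ge0 (a i); have := normr_ge0 (b i); move=> *; apply/andP; split; lra.
  by lra.
have tphi : test_fun d T (ptest th bb) by exact: (ptest_test thS bbS b0T th0 bb0).
have := product_identity thS bbS b0T th0 bb0.
have [B1 D1] := tD_rbd tphi.1 [:: tidx d]; have [B2 D2] := tD_rbd tphi.1 [::].
have := @time_fubini R d T T0 h (tD (ptest th bb) [::]) (tD (ptest th bb) [:: tidx d]) B1 B2 hi hs D2 D1
  (tD_derive tphi [::]) (fun x => @tD_continuous R d T (ptest th bb) tphi [:: tidx d] x)
  (fun x => @tD_T R d T (ptest th bb) tphi [::] T x (lexx T)).
have -> : \int[mu]_p (h p * tD (ptest th bb) [::] p) = \int[mu]_p (h p * ptest th bb p).
  by apply: Int_eq => p; rewrite tD_nil.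
move=> e1 e2.
have e3 : \int[mu]_p (w p * tD (ptest th bb) [:: tidx d] p - sI p.1 * It T h p * tD (ptest th bb) [:: tidx d] p) = 0.
  by rewrite (IntB (wL1_rbd wi D1) (intg_It_phi T0 hi D1)) e1 opprK.
rewrite -[RHS]e3; apply: Int_eq => p; rewrite -mulrBl -/(g p).
have [pT|pT] := boolP (0 < p.1 < T); last by rewrite gc// !mul0r.
rewrite (ptest_dt _ tphi dth) th'E// -mulrA; congr (_ * _).
rewrite mulrCA; congr (_ * _); rewrite /rho -big_split.
by apply: eq_bigr.
Qed.

Let gr_box (a0 b0 : R) (a b : 'I_d -> R) : b0 < T ->
  \int[mu]_p (g p * rho p.2 * (bI a0 b0 p.1 * \prod_i bI (a i) (b i) (tnth p.2 i))) = 0.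
Proof.
move=> b0T.
have mgr : mfunT (fun p => g p * rho p.2) by exact: intg_measurable gi.
have mb (q : R -> R -> R -> R) : (forall a b, mfunT (q a b)) ->
    mfunT (fun p : R * d.-tuple R => q a0 b0 p.1 * \prod_i q (a i) (b i) (tnth p.2 i)).
  move=> mq; apply: measurable_funM; first exact: (measurableT_comp (mq _ _) measurable_fst).
  apply: measurable_prod => i _; apply: (measurableT_comp (mq _ _)).
  exact: (measurableT_comp (measurable_tnth i) measurable_snd).
apply: (@Int_dct0 _ _ _ mu (fun k p => g p * rho p.2 *
  (bump k a0 b0 p.1 * \prod_i bump k (a i) (b i) (tnth p.2 i))) _ (fun p => `|g p * rho p.2|)).
- move=> k; apply: measurable_funM mgr _; apply: (mb (bump k)) => a' b'.
  by apply: continuous_measurable_fun; exact: sm_cont (sm_bump 0 k a' b').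
- by apply: measurable_funM mgr _; apply: (mb bI) => a' b'; exact: measurable_bI.
- move=> p; apply: cvgM; first exact: cvg_cst.
  apply: cvgM; first exact: bump_cvg.
  elim: (index_enum _) => [|i s ih].
    by rewrite big_nil; apply: (@cvg_near_cst _ _ _ _ \oo); apply: nearW => k; rewrite big_nil.
  rewrite big_cons; under eq_cvg do rewrite big_cons.
  by apply: cvgM => //; exact: bump_cvg.
- exact: intg_norm gi.
- move=> k p; rewrite normrM ler_piMr// normrM mulr_ile1//.
    by rewrite ger0_norm ?bump_ge0 ?bump_le1.
  rewrite normr_prod; apply: prodr_ile1 => i _.
  by rewrite normr_ge0 ger0_norm ?bump_ge0 ?bump_le1.
by move=> k; exact: g_product.
Qed.

Lemma mild_ae : \int[mu]_p (`|g p| * rho p.2) = 0.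
Proof.
have mgr : mfunT (fun p => g p * rho p.2) by exact: intg_measurable gi.
have N : nullf mu (fun p => g p * rho p.2).
  apply: (nullf_step (@boxI1 R d) (@nullf_lebn R d) gi) => a0 b0 _ [a [b ->]].
  (* Test functions must vanish before time [T], so the right end of the time interval is approached
     from below; nothing is lost, since [g] vanishes outside the slab. *)
  pose c n : R := Num.min b0 (T - T / n.+1%:R).
  have cT n : c n < T by rewrite gt_min; apply/orP; right; rewrite ltrBlDr ltrDl divr_gt0.
  have mb e f : mfunT (fun p : R * d.-tuple R => bI e f p.1 * \prod_i bI (a i) (b i) (tnth p.2 i)).
    apply: measurable_funM; first exact: (measurableT_comp (measurable_bI _ _) measurable_fst).
    apply: measurable_prod => i _; apply: (measurableT_comp (measurable_bI _ _)).
    exact: (measurableT_comp (measurable_tnth i) measurable_snd).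
  apply: (@Int_dct0 _ _ _ mu (fun n p => g p * rho p.2 *
    (bI a0 (c n) p.1 * \prod_i bI (a i) (b i) (tnth p.2 i))) _ (fun p => `|g p * rho p.2|)).
  - by move=> n; exact: measurable_funM mgr (mb _ _).
  - exact: measurable_funM mgr (mb _ _).
  - move=> p; have [pT|pT] := boolP (0 < p.1 < T); last first.
      rewrite gc// !mul0r; apply: (@cvg_near_cst _ _ _ _ \oo); apply: nearW => n.
      by rewrite mul0r.
    have /andP[p0 p1] := pT.
    apply: (@cvg_near_cst _ _ _ _ \oo); near=> n.
    congr (_ * (_ * _)); rewrite /bI lt_min; congr (if _ then _ else _).
    rewrite (_ : p.1 < T - T / n.+1%:R) ?andbT//.
    rewrite ltrBrDr addrC -ltrBrDr ltr_pdivrMr// mulrC -ltr_pdivrMr ?subr_gt0//.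
    have : T / (T - p.1) < n%:R by near: n; exact: nbhs_infty_gtr.
    by move=> /lt_le_trans; apply; rewrite ler_nat.
  - exact: intg_norm gi.
  - move=> n p; rewrite normrM ler_piMr// normrM mulr_ile1// ?norm_bI_le1//.
    by rewrite normr_prod; apply: prodr_ile1 => i _; rewrite normr_ge0 norm_bI_le1.
  by move=> n; exact: gr_box.
have := nullf_norm gi N; rewrite -[X in _ -> X = 0](@Int_eq _ _ _ mu (fun p => `|g p * rho p.2|)).
  by [].
by move=> p; rewrite normrM (gtr0_norm (rho_gt0 _)).
Unshelve. all: by end_near. Qed.

Section gronwall.
Variable L : R.
Hypotheses (L0 : 0 <= L) (FL : forall j p, `|F j p| <= L * `|w p|).
Let km := @kmass R d.
Let km0 : 0 <= km. Proof. exact: kmass_ge0. Qed.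
Let C := 1 + km + d%:R * km * L.
Let C0 : 0 < C.
Proof. by rewrite /C -addrA ltr_pwDl// addr_ge0// !mulr_ge0. Qed.
Let lam := 2 * C.
Let lam0 : 0 < lam. Proof. by rewrite mulr_gt0. Qed.
(** In an integral norm the exponential weight decreases in time; clamping keeps it between
    [expR (- lam * T)] and 1. *)
Let e (t : R) := expR (- (lam * clamp T t)).

Let e_ge0 t : 0 <= e t. Proof. exact: expR_ge0. Qed.

Let e_le1 t : e t <= 1.
Proof.
rewrite /e -[leRHS]expR0 ler_expR oppr_le0 mulr_ge0 ?clamp_ge0//; exact: ltW.
Qed.

Let norm_e t : `|e t| <= 1. Proof. by rewrite ger0_norm. Qed.

Let me : mfunT e.
Proof.
apply: (measurableT_comp (@measurable_expR R)).
apply: (measurableT_comp (@oppr_measurable R setT)); apply: measurable_funM => //.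
by apply: measurable_maxr => //; exact: measurable_minr.
Qed.

Let me1 : mfunT (fun p : R * d.-tuple R => e p.1).
Proof. exact: (measurableT_comp me measurable_fst). Qed.

Let ew p := e p.1 * w p.
Let ewi : wL1 ew. Proof. exact: (wL1_bm wi me1 (fun p => norm_e p.1)). Qed.
Let eFi j : wL1 (fun p => e p.1 * F j p).
Proof. exact: (wL1_bm (Fi j) me1 (fun p => norm_e p.1)). Qed.
Let E := \int[mu]_p (`|ew p| * rho p.2).

Let eF_le j : \int[mu]_p (`|e p.1 * F j p| * rho p.2) <= L * E.
Proof.
rewrite /E -IntZ; last exact: wL1_norm ewi.
apply: Int_le; [exact: wL1_norm (eFi j)|exact: intgZ (wL1_norm ewi)|].
move=> p; rewrite mulrA ler_wpM2r ?(ltW (rho_gt0 _))// /ew !normrM mulrCA.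
by rewrite ler_wpM2l.
Qed.

Let eh_le : \int[mu]_p (`|e p.1 * h p| * rho p.2) <= C * E.
Proof.
have NE p : e p.1 * h p = Nop ew (fun j q => e q.1 * F j q) p.
  by rewrite Nop_time//; [exact: wL1_measurable|move=> j; exact: wL1_measurable].
have iC k f : wL1 f -> intg mu (fun p => `|Cv k f p| * rho p.2).
  by move=> fi; exact: wL1_norm (wL1_Cv k fi).
have i1 := wL1_norm ewi; have i2 := iC None ew ewi.
have i3 j := iC (Some j) _ (eFi j).
have i4 := intg_sum (index_enum 'I_d) i3.
apply: (@le_trans _ _ (\int[mu]_p (`|ew p| * rho p.2 + `|Cv None ew p| * rho p.2 +
    \sum_j `|Cv (Some j) (fun q => e q.1 * F j q) p| * rho p.2))).
  apply: Int_le.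
  - apply: wL1_norm; exact: (wL1_bm hi me1 (fun p => norm_e p.1)).
  - exact: intgD (intgD i1 i2) i4.
  move=> p; rewrite NE -mulr_suml -!mulrDl ler_wpM2r ?(ltW (rho_gt0 _))// /Nop.
  apply: (le_trans (ler_normD _ _)); apply: lerD; last exact: ler_norm_sum.
  by apply: (le_trans (ler_normD _ _)); rewrite normrN.
rewrite (IntD (intgD i1 i2) i4) (IntD i1 i2) (Int_sum _ i3) -/E /C !mulrDl mul1r.
apply: lerD; first by rewrite lerD2l; exact: Cv_L1.
rewrite -!mulrA mulr_natl -[X in _ *+ X]card_ord -sumr_const; apply: ler_sum => j _.
by apply: (le_trans (Cv_L1 (Some j) (eFi j))); rewrite ler_wpM2l.
Qed.

Let norm_It p : `|It T h p| <= It T (fun q => `|h q|) p.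
Proof.
have mh : mfunT (fun s => chi T p.1 s * h (s, p.2)).
  by apply: measurable_funM; [exact: measurable_chi|exact: measurable_section2 (wL1_measurable hi)].
have [i|ni] := pselect (intg lebR (fun s => chi T p.1 s * h (s, p.2))).
  have a s : `|chi T p.1 s * h (s, p.2)| = chi T p.1 s * `|h (s, p.2)|.
    by rewrite normrM ger0_norm// chi_ge0.
  apply: Int_norm_le => // [|s]; last by rewrite a.
  by apply: intg_eq (intg_norm i) => s; rewrite a.
(* On a section that is not integrable, [It T h p] has the default value 0. *)
rewrite /It (Int_nonintg mh ni) normr0; apply: Int_ge0 => s.
by rewrite mulr_ge0// chi_ge0.
Qed.

Let rbd_e : rbd 1 (fun p : R * d.-tuple R => e p.1 * rho p.2).
Proof.
split; first exact: measurable_funM me1 measurable_rho2.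
move=> p; rewrite normrM (gtr0_norm (rho_gt0 _)) ler_wpM2r ?(ltW (rho_gt0 _))//; exact: norm_e.
Qed.

(** The integral of [e^(- lam t)] from [s] to [T] is at most [e^(- lam s) / lam]; this is the $L^1$
    counterpart of the gain in [norm_It_le]. *)
Let inner s (x : d.-tuple R) : 0 < s < T ->
  \int[lebR]_t (sI t * chi T t s * (e t * rho x)) <= lam^-1 * e s * rho x.
Proof.
move=> sT; have /andP[s0 s1] := sT.
pose F0 t := - lam^-1 * expR (- lam * t).
have dF t : is_derive t (1 : R) F0 (expR (- lam * t)).
  have dl : is_derive t (1 : R) (fun t => - lam * t) (- lam).
    by have := dv_scale (- lam) (dv_id t); rewrite mulr1.
  have := dv_scale (- lam^-1) (@dv_comp _ expR (fun t => - lam * t) t _ _ (is_derive_expR _) dl).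
  by move=> D; apply: is_derive_eq D _; field; rewrite gt_eqF.
have cf : continuous (fun t : R => expR (- lam * t)).
  move=> t; apply: (@continuous_comp _ _ _ (fun t : R => - lam * t) expR).
    exact: (dv_continuous (fun t => dv_scale (- lam) (dv_id t))).
  exact: continuous_expR.
have mc : mfunT (fun t => sI t * chi T t s).
  apply: measurable_funM; first exact: measurable_sI.
  exact: (@measurable_fun_pair1 _ _ _ _ _ _ (fun ts : R * R => chi T ts.1 ts.2) s (measurable_chi2 T)).
have ftc := @Int_ftc_ends R F0 (fun t => expR (- lam * t)) (fun t => sI t * chi T t s) s T (ltW s1) dF cf mc
  (fun t h1 h2 => sI_chi sT h1 h2).
rewrite (@Int_eq _ _ _ lebR _ (fun t => rho x * (sI t * chi T t s * expR (- lam * t)))); last first.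
  move=> t; have [tT|tT] := boolP (0 < t < T); last by rewrite sI0// !mul0r mulr0.
  have /andP[a b] := tT; rewrite /e clamp_id ?(ltW a) ?(ltW b)// mulNr.
  by move: (sI t) (chi T t s) (expR _) (rho x) => *; ring.
rewrite Int_scale ?ftc; last first.
  by apply: measurable_funM => //; exact: continuous_measurable_fun.
rewrite mulrC ler_wpM2r ?(ltW (rho_gt0 _))// /F0 /e clamp_id ?(ltW s0) ?(ltW s1)// -[- (lam * s)]mulNr.
have id (l A B : R) : 0 <= l -> 0 <= A -> - l * A - (- l * B) <= l * B.
  by move=> l0 A0; have := mulr_ge0 l0 A0; lra.
by apply: id; rewrite ?invr_ge0 ?(ltW lam0)// expR_ge0.
Qed.

(** Since [g] has zero weighted norm, [w] is the time integral of [h] almost everywhere, and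
    exchanging the two times gives [E <= lam^-1 * (C * E) = E / 2]. *)
Lemma gronwall_L1 : \int[mu]_p (`|w p| * rho p.2) = 0.
Proof.
have habs : wL1 (fun q => `|h q|) by exact: wL1_norm hi.
have ig : intg mu (fun p => `|g p| * rho p.2) by exact: wL1_norm gi.
have iI := intg_It_phi T0 habs rbd_e.
have ieh : intg mu (fun p => `|e p.1 * h p| * rho p.2).
  by apply: wL1_norm; exact: (wL1_bm hi me1 (fun p => norm_e p.1)).
have E1 : E <= \int[mu]_p (`|g p| * rho p.2) +
    \int[mu]_p (sI p.1 * It T (fun q => `|h q|) p * (e p.1 * rho p.2)).
  rewrite -(IntD ig iI); apply: Int_le; [exact: wL1_norm ewi|exact: intgD ig iI|].
  move=> p; rewrite /ew normrM (ger0_norm (e_ge0 _)).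
  have wE : w p = g p + sI p.1 * It T h p by rewrite /g subrK.
  have h1 : `|w p| <= `|g p| + sI p.1 * It T (fun q => `|h q|) p.
    rewrite wE; apply: (le_trans (ler_normD _ _)); rewrite lerD2l normrM (ger0_norm (sI_ge0 _ _)).
    by rewrite ler_wpM2l ?sI_ge0.
  have r0 := rho_gt0 p.2.
  apply: (@le_trans _ _ (e p.1 * (`|g p| + sI p.1 * It T (fun q => `|h q|) p) * rho p.2)).
    by rewrite ler_wpM2r ?(ltW r0)// ler_wpM2l.
  have id (x y r : R) : x * y * r = y * (x * r) by ring.
  rewrite mulrDr mulrDl; apply: lerD; last by rewrite id.
  by rewrite ler_wpM2r ?(ltW r0)// ler_piMl.
have E2 : \int[mu]_p (sI p.1 * It T (fun q => `|h q|) p * (e p.1 * rho p.2)) <= lam^-1 * (C * E).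
  have [iP ->] := Int_It_phi T0 habs rbd_e.
  apply: (@le_trans _ _ (\int[mu]_p (lam^-1 * (`|e p.1 * h p| * rho p.2)))); last first.
    by rewrite (IntZ _ ieh) ler_wpM2l// ?invr_ge0 ?(ltW lam0).
  apply: (Int_le iP (intgZ _ ieh)).
  move=> [s x] /=; have [sT|sT] := boolP (0 < s < T); last first.
    by rewrite -(hs (s, x)) /= sI0// mul0r normr0 !mulr0 normr0 mul0r mulr0.
  apply: (@le_trans _ _ (lam^-1 * e s * rho x * `|h (s, x)|)).
    by rewrite ler_wpM2r// inner.
  by rewrite normrM (ger0_norm (e_ge0 _)) -!mulrA ler_wpM2l ?invr_ge0 ?(ltW lam0)// ler_wpM2l// mulrC.
have E0 : 0 <= E by apply: Int_ge0 => p; rewrite mulr_ge0// ltW// rho_gt0.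
have EE : E = 0.
  move: E1 E2; rewrite mild_ae add0r => E1 /(le_trans E1).
  have -> : lam^-1 * (C * E) = E / 2 by rewrite /lam; field; rewrite gt_eqF.
  by lra.
apply/eqP; rewrite eq_le; apply/andP; split; last first.
  by apply: Int_ge0 => p; rewrite mulr_ge0// ltW// rho_gt0.
(* The weight [e] is bounded below by [expR (- lam * T)], so the integral without it vanishes as
   well. *)
rewrite -[leRHS](mulr0 (expR (lam * T))) -EE /E -(IntZ _ (wL1_norm ewi)).
apply: Int_le; [exact: wL1_norm wi|exact: intgZ (wL1_norm ewi)|].
move=> p; rewrite /ew normrM (ger0_norm (e_ge0 _)).
have id (x y u r : R) : x * (y * u * r) = (x * y) * (u * r) by ring.
rewrite id ler_peMl ?mulr_ge0 ?(ltW (rho_gt0 _))// /e -expRD -[leLHS]expR0 ler_expR.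
by rewrite -mulrBr mulr_ge0 ?(ltW lam0)// subr_ge0 clamp_leT.
Qed.

End gronwall.
End uniqueness.

Lemma Int_abs_negligible (d : measure_display) (X : measurableType d) (R : realType)
    (mu : {measure set X -> \bar R}) (f : X -> R) :
  intg mu f -> \int[mu]_x `|f x| = 0 -> mu.-negligible [set x | f x <> 0].
Proof.
move=> fi f0; have mf : mfunT (EFin \o f) by apply/measurable_EFinP; exact: intg_measurable fi.
have e : (\int[mu]_x `|(EFin \o f) x|)%E = 0%E.
  by have := IntE (intg_norm fi); rewrite f0 => <-.
have [N [mN N0 sN]] := (ae_eq_integral_abs mu measurableT mf).1 e.
exists N; split => // x /= fx; apply: sN => /= h; apply: fx.
by have := h I => -[].
Qed.

(** * Conclusion: almost everywhere uniqueness and the theorem *)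

Section main.
Context {R : realType} {d : nat}.
Variables (T : R) (f : 'I_d -> d.-tuple R -> R -> R) (ui : d.-tuple R -> R).
Hypotheses (T0 : 0 < T) (fs : forall j, cc_smooth (d + 1) (ofXU d (f j)))
  (us : cc_smooth d (fun v => ui (tup d v))).
Local Notation mu := (@must R d).
Local Notation cut := (cut T).

(** The difference of two weak identities is linear in the cut differences [w] and [F]. The
    Lipschitz bound of the flux in its last argument gives [|F| <= L * |w|], the hypothesis that
    [gronwall_L1] needs to force [w] to vanish almost everywhere. *)
Lemma weak_unique (u v : R * d.-tuple R -> R) : weak_solution_nl d T f ui u ->
  weak_solution_nl d T f ui v -> (mu_st d).-negligible [set p | slab d T p /\ u p <> v p].
Proof.
move=> [uL [uF uW]] [vL [vF vW]].
pose Fu j p := f j p.2 (u p); pose Fv j p := f j p.2 (v p).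
have u1 := L2_wL1 T0 uL; have v1 := L2_wL1 T0 vL.
have Fu1 j : wL1 (cut (Fu j)) by exact: L2_wL1 (uF j).
have Fv1 j : wL1 (cut (Fv j)) by exact: L2_wL1 (vF j).
pose w := cut (fun p => u p - v p); pose F j := cut (fun p => Fu j p - Fv j p).
have wE p : w p = cut u p - cut v p by rewrite /w /cut mulrBr.
have FE j p : F j p = cut (Fu j) p - cut (Fv j) p by rewrite /F /cut mulrBr.
have wi : wL1 w by apply: intg_eq (wL1D u1 (wL1N v1)) => p; rewrite wE.
have Fi j : wL1 (F j) by apply: intg_eq (wL1D (Fu1 j) (wL1N (Fv1 j))) => p; rewrite FE.
have cc (g : R * d.-tuple R -> R) : cut (cut g) = cut g.
  by apply/funext => p; rewrite /cut mulrA sI_idem.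
have wF0 phi : test_fun d T phi -> \int[mu]_p weak_integrand phi w F p = 0.
  move=> tphi; have ii := initial_intg us tphi.
  have := uW _ tphi; rewrite /= (weak_identityE tphi u1 Fu1 ii) => -[eu].
  have := vW _ tphi; rewrite /= (weak_identityE tphi v1 Fv1 ii) => -[ev].
  have [iu _ _ _] := weak_dual tphi.1 u1 Fu1; have [iv _ _ _] := weak_dual tphi.1 v1 Fv1.
  rewrite (@Int_eq _ _ _ mu _ (fun p => weak_integrand phi (cut u) (fun j => cut (Fu j)) p -
    weak_integrand phi (cut v) (fun j => cut (Fv j)) p)).
    by rewrite (IntB iu iv); move: eu ev; lra.
  move=> p; rewrite /weak_integrand wE.
  have id (U V a S S1 S2 l k : R) : S = S1 - S2 -> (U - V) * a + S + (U - V) * l - (U - V) * k =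
     (U * a + S1 + U * l - U * k) - (V * a + S2 + V * l - V * k) by move=> ->; ring.
  by apply: id; rewrite -sumrB; apply: eq_bigr => j _; rewrite FE mulrBl.
have [L L0 LP] : exists2 L : R, 0 <= L & forall j x s s', `|f j x s' - f j x s| <= L * `|s' - s|.
  apply: (@fin_bound _ _ (fun j L => forall x s s', `|f j x s' - f j x s| <= L * `|s' - s|)).
    by move=> j A B AB h x s s'; apply: (le_trans (h x s s')); rewrite ler_wpM2r.
  by move=> j; have [B [_ _ _ Bs]] := isSk_S0 (isSk_cc (fs j) 0); exists B.
have FL j p : `|F j p| <= L * `|w p|.
  rewrite /F /w /cut !normrM mulrCA ler_wpM2l//; exact: LP.
have := gronwall_L1 T0 wi Fi (cc _) (fun j => cc _) wF0 L0 FL.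
move=> w0; have wr0 : \int[mu]_p `|w p * rho p.2| = 0.
  rewrite -[RHS]w0; apply: Int_eq => p.
  by rewrite normrM (gtr0_norm (rho_gt0 _)).
have [N [mN N0 sN]] := Int_abs_negligible wi wr0.
exists N; split => //; first by rewrite mu_stE.
move=> p [/mem_set pT up]; apply: sN => /=; rewrite slabE in pT.
rewrite /w /cut sI1// mul1r; apply/eqP; apply: mulf_neq0; last by rewrite gt_eqF// rho_gt0.
by rewrite subr_eq0; exact/eqP.
Qed.

End main.

Unset Implicit Arguments.

Theorem theorem1p1 (R : realType) (d : nat) (T : R)
  (f : 'I_d -> d.-tuple R -> R -> R) (u0 : d.-tuple R -> R) :
  (0 < d)%N -> 0 < T ->
  (forall j : 'I_d, cc_smooth (d + 1) (ofXU d (f j))) ->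
  cc_smooth d (fun v : 'rV[R]_d => u0 (tup d v)) ->
  exists u : R * d.-tuple R -> R,
    [/\ weak_solution_nl d T f u0 u,
        (forall v : R * d.-tuple R -> R, weak_solution_nl d T f u0 v ->
           (mu_st d).-negligible [set p | slab d T p /\ u p <> v p])
      & smooth_on (1 + d) [set w : 'rV[R]_(1 + d) | 0 < w ord0 (tidx d) < T]
          (ofST d u)].
Proof.
move=> _ T0 fs us; have [u [K [uK uS uC]]] := mild_solution T0 fs us.
have uW := mild_weak T0 fs us uK uS.
exists u; split => //; first by move=> v vW; exact: (weak_unique T0 fs us uW vW).
exact: smooth_on_slab.
Qed.
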